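(* Let $(\Omega,T)$ be the symbolic model of a reasonable rank-one construction with $(\Omega,T,\mu)$ weakly mixing, and fix an integer $K\ge2$. Let $(\tilde\Omega,\tilde T,\tilde\mu)$ be as defined in the context. Assume that for all distinct primes $p,q$, the continuous parts of the maximal spectral types of $\tilde T^p$ and $\tilde T^q$ (with respect to $\tilde\mu$) are mutually singular. Then for every continuous $f:\tilde\Omega\to\mathbb C$ and every $x\in\tilde\Omega$, $\frac1N\sum_{n=1}^Nf(\tilde T^nx)\boldsymbol\mu(n)\to0$, where $\boldsymbol\mu$ is the Möbius function.
   Context: Rank-one parameters: integers $p_n\ge2$, integers $s_{n,i}\ge0$, $h_1=1$, $h_{n+1}=p_nh_n+\sum_is_{n,i}$, $\sum_n\frac1{h_{n+1}}\sum_is_{n,i}<\infty$; reasonable means $\max_is_{n,i}=o(h_n)$. Symbolic model: $B_1=0$, $B_{n+1}=B_n1^{s_{n,0}}\cdots B_n1^{s_{n,p_n-1}}$; $\Omega\subset\{0,1\}^{\mathbb Z}$ the sequences all of whose finite subwords are subwords of some $B_m$; $T$ the left shift; $\mu$ the shift-invariant probability given by limiting frequencies of words in $B_n$ (the unique non-atomic invariant probability). $\tilde\Omega=\Omega\times\{0,\dots,K-1\}$, $\tilde T(\omega,i)=(\omega,i+1)$ if $i<K-1$, $\tilde T(\omega,K-1)=(T\omega,0)$, $\tilde\mu=\mu\otimes(\text{uniform measure on }\{0,\dots,K-1\})$. Spectral types are for the Koopman operator on the orthocomplement of constants in $L^2(\tilde\mu)$. *)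

(* Defs.v *)
From HB Require Import structures.
From mathcomp Require Import all_boot all_order all_algebra.
From mathcomp Require Import all_classical all_reals all_analysis.
From mathcomp Require Import complex.
Import Order.TTheory GRing.Theory Num.Theory numFieldNormedType.Exports.

Set Implicit Arguments.
Unset Strict Implicit.
Unset Printing Implicit Defensive.

Local Open Scope classical_set_scope.
Local Open Scope ring_scope.

(* The full shift {0,1}^Z ; 0 = false, 1 = true (spacer symbol).      *)
Definition X := int -> bool.

Definition cyl (w : seq bool) (m : int) : set X :=
  [set x | forall j : nat, (j < size w)%N -> x (m + j%:Z) = nth false w j].

Definition cyls : set (set X) := [set A | exists w m, A = cyl w m].

Definition XM := g_sigma_algebraType cyls.

Definition shift (x : X) : X := fun j => x (j + 1).

(* Rank-one words. [Bword p s k] is the paper's B_{k+1}:               *)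
(*   B_1 = 0,  B_{n+1} = B_n 1^{s_{n,0}} ... B_n 1^{s_{n,p_n-1}}.      *)
Fixpoint Bword (p : nat -> nat) (s : nat -> nat -> nat) (k : nat) : seq bool :=
  match k with
  | 0 => [:: false]
  | k'.+1 => flatten [seq Bword p s k' ++ nseq (s k i) true | i <- iota 0 (p k)]
  end.

(* h_n = |B_n| for n >= 1 *)
Definition height (p : nat -> nat) (s : nat -> nat -> nat) (n : nat) : nat :=
  size (Bword p s n.-1).

(* rank-one parameters (p_n >= 2 and the finite-measure summability
   condition) together with "reasonable" (max_i s_{n,i} = o(h_n)) *)
Definition reasonable_rank_one (R : realType) (p : nat -> nat)
    (s : nat -> nat -> nat) : Prop :=
  (forall n, (1 <= n)%N -> (2 <= p n)%N) /\
  (exists C : R, forall N : nat,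
      \sum_(1 <= n < N) ((\sum_(i < p n) s n i)%:R / (height p s n.+1)%:R) <= C) /\
  (forall eps : R, 0 < eps -> exists N : nat, forall n : nat,
      (N <= n)%N -> (1 <= n)%N ->
      (\max_(i < p n) s n i)%:R <= eps * (height p s n)%:R).

Definition subword (x : X) (a : int) (L : nat) : seq bool :=
  [seq x (a + j%:Z) | j <- iota 0 L].

Definition Omega (p : nat -> nat) (s : nat -> nat -> nat) : set X :=
  [set x | forall (a : int) (L : nat), exists m : nat, infix (subword x a L) (Bword p s m)].

Definition occ (w u : seq bool) : nat :=
  count (fun i => take (size w) (drop i u) == w) (iota 0 ((size u).+1 - size w)).

Definition freq (R : realType) (w u : seq bool) : R := (occ w u)%:R / (size u)%:R.

Definition is_rank_one_measure (R : realType) (p : nat -> nat)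
    (s : nat -> nat -> nat) (mu : probability XM R) : Prop :=
  mu (Omega p s) = 1%E /\
  (forall A : set XM, measurable A -> mu (shift @^-1` A) = mu A) /\
  (forall w : seq bool,
      (fun n : nat => (freq R w (Bword p s n))%:E) @ \oo --> mu (cyl w 0)).

Definition weakly_mixing (R : realType) (mu : probability XM R) : Prop :=
  forall A B : set XM, measurable A -> measurable B ->
    (fun N : nat => N%:R^-1 * \sum_(0 <= n < N)
        `| fine (mu ((iter n shift @^-1` A) `&` B)) - fine (mu A) * fine (mu B) |)
      @ \oo --> (0 : R).

Definition Xt := (X * nat)%type.

Definition Omega_t (p : nat -> nat) (s : nat -> nat -> nat) (K : nat) : set Xt :=
  [set y | Omega p s y.1 /\ (y.2 < K)%N].

Definition Ttil (K : nat) (y : Xt) : Xt :=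
  if (y.2.+1 < K)%N then (y.1, y.2.+1) else (shift y.1, 0%N).

(* integral w.r.t. mu~ = mu (x) uniform on {0..K-1} *)
Definition tint (R : realType) (mu : probability XM R) (K : nat) (h : Xt -> R) : R :=
  K%:R^-1 * \sum_(i < K) Rintegral mu setT (fun x : XM => h (x, nat_of_ord i)).

(* f = a + i b lies in L^2(mu~) and is orthogonal to constants *)
Definition in_L2_0 (R : realType) (mu : probability XM R) (K : nat) (a b : Xt -> R) : Prop :=
  (forall i : nat, (i < K)%N ->
     measurable_fun setT (fun x : XM => a (x, i)) /\
     measurable_fun setT (fun x : XM => b (x, i)) /\
     mu.-integrable setT (fun x : XM => ((a (x, i)) ^+ 2)%:E) /\
     mu.-integrable setT (fun x : XM => ((b (x, i)) ^+ 2)%:E)) /\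
  tint mu K a = 0 /\ tint mu K b = 0.

(* real and imaginary part of < U^m f, f >, U the Koopman operator of T~ *)
Definition inner_re (R : realType) (mu : probability XM R) (K m : nat) (a b : Xt -> R) : R :=
  tint mu K (fun y => a (iter m (Ttil K) y) * a y + b (iter m (Ttil K) y) * b y).
Definition inner_im (R : realType) (mu : probability XM R) (K m : nat) (a b : Xt -> R) : R :=
  tint mu K (fun y => b (iter m (Ttil K) y) * a y - a (iter m (Ttil K) y) * b y).

(* sigma (a finite measure on the circle R/Z = [0,1)) is the spectral
   measure of f = a + i b for the operator U^q :
   < U^(q n) f, f > = int exp(2 pi i n t) dsigma(t) for all n >= 0 *)
Definition is_spectral_measure (R : realType) (mu : probability XM R) (K q : nat)
    (a b : Xt -> R) (sigma : {measure set R -> \bar R}) : Prop :=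
  (sigma setT < +oo)%E /\
  sigma (~` `[0%R, 1%R[) = 0%E /\
  (forall n : nat,
     (\int[sigma]_(t in `[0%R, 1%R[) (cos (2 * pi * n%:R * t))%:E)%E
       = (inner_re mu K (q * n) a b)%:E /\
     (\int[sigma]_(t in `[0%R, 1%R[) (sin (2 * pi * n%:R * t))%:E)%E
       = (inner_im mu K (q * n) a b)%:E).

Definition is_max_spectral_type (R : realType) (mu : probability XM R) (K q : nat)
    (nu : {measure set R -> \bar R}) : Prop :=
  (exists a b, in_L2_0 mu K a b /\ is_spectral_measure mu K q a b nu) /\
  (forall a b (sigma : {measure set R -> \bar R}),
      in_L2_0 mu K a b -> is_spectral_measure mu K q a b sigma ->
      forall A : set R, measurable A -> nu A = 0%E -> sigma A = 0%E).

(* atoms of a measure; its continuous part is A |-> nu (A \ atoms nu) *)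
Definition atoms (R : realType) (nu : {measure set R -> \bar R}) : set R :=
  [set t | (0 < nu [set t])%E].

Definition cont_parts_singular (R : realType) (nu1 nu2 : {measure set R -> \bar R}) : Prop :=
  exists A : set R, measurable A /\
    nu1 (A `\` atoms nu1) = 0%E /\ nu2 ((~` A) `\` atoms nu2) = 0%E.

(* Moebius function (for n >= 1) *)
Definition mobius (n : nat) : int :=
  if all (fun q => logn q n == 1%N) (primes n) then (-1) ^+ size (primes n) else 0.

(* continuity of f on Omega~ (product topology on {0,1}^Z, discrete on
   {0,...,K-1}, subspace topology on Omega~) *)
Definition continuous_on_tower (R : realType) (P : set Xt) (f : Xt -> R[i]) : Prop :=
  forall x, P x -> forall eps : R, 0 < eps -> exists M : nat, forall y, P y ->
    y.2 = x.2 -> (forall j : int, `|j| <= M%:Z -> y.1 j = x.1 j) ->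
    `|f y - f x| < (eps%:C)%C.

(* Main.v *)
Require Import Defs.
From HB Require Import structures.
From mathcomp Require Import all_boot all_order all_algebra.
From mathcomp Require Import all_classical all_reals all_analysis.
From mathcomp Require Import complex cyclic measurable_realfun ring lra zify.
Import Order.TTheory GRing.Theory Num.Theory numFieldNormedType.Exports.

Set Implicit Arguments.
Unset Strict Implicit.
Unset Printing Implicit Defensive.
Local Open Scope classical_set_scope.
Local Open Scope ring_scope.

(** By the criterion of Katai, Bourgain, Sarnak and Ziegler, a bounded sequence [z] is orthogonal to the Moebius
    function as soon as the correlations of [z (p n)] and [z (q n)] are small for distinct primes [p] and [q].
    Let [F] be the centred indicator of a cylinder of the tower. Weak mixing makes its spectral measures for
    [T~^p] and [T~^q] atomless, so the singularity hypothesis yields a set [S] that is null for the first one and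
    conull for the second one. A trigonometric polynomial [phi] close to [1_S] in [L^2] of both measures gives two
    combinations [phi(T~^p) F] and [(1 - phi)(T~^q) F] of iterates of [F] with small norm, and moving [phi(V)] from
    one factor of a correlation sum to the other bounds that sum by the norms of these combinations along the orbit.
    A point of the rank-one system need not be generic, but because the construction is reasonable any word of it is
    a good prefix, a run of spacers and a good suffix, where "good" means that all short words occur with almost the
    right frequency. On the good parts the orbital norms are close to the [L^2] norms and the criterion applies; on
    the run of spacers, and for the means of the indicators, the sequence is periodic in [n], and the Moebius
    function has mean zero in arithmetic progressions (proved here by Selberg's elementary method). *)

(** * Dirichlet convolution and the von Mangoldt function *)

Section DirichletConvolution.

(** The rotation of [K] points is a factor of the tower, so [T~] is not weakly mixing and its
    maximal types have atoms. The indicator of a cylinder is therefore centred inside its own level,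
    which makes its integral over every level zero; what this removes is periodic in time, which is
    one reason why progressions modulo [K] are needed. Selberg's formula alone does not give mean
    zero in residue classes: the sums of [mu n / n] over each class must be bounded, which rests on
    the nonvanishing of the values [L(1, chi)]. It is phrased linearly: a certain matrix is
    injective, since a nonzero kernel would contain a character with vanishing [L]-value. No
    spectral theorem is used. Spectral measures of real functions come from positive definiteness,
    and only their cosine coefficients are compared; these determine the measures on sets invariant
    under complex conjugation, hence the recurrent symmetrisation of null sets. The hypothesis
    quantifies over measures that are maximal spectral types, so it gives nothing until one is shown
    to exist. It is realised by a uniformly convergent series of centred box functions with generic
    coefficients. *)

Definition dsum (V : nmodType) (g : nat -> V) (n : nat) : V :=
  \sum_(1 <= d < n.+1 | (d %| n)%N) g d.

Lemma sum_multiples (V : nmodType) (F : nat -> V) (d N : nat) : (0 < d)%N ->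
  \sum_(1 <= n < N.+1 | (d %| n)%N) F (n %/ d)%N
  = \sum_(1 <= e < (N %/ d).+1) F e.
Proof.
move=> d0; elim: N => [|N IH]; first by rewrite div0n !big_geq.
rewrite big_mkcond big_nat_recr //= -big_mkcond IH divnS //.
case: ifP => h; last by rewrite add0n addr0.
by rewrite h add1n [RHS]big_nat_recr.
Qed.

Lemma dsum_widen (V : nmodType) (g : nat -> V) (n N : nat) : (0 < n)%N -> (n <= N)%N ->
  dsum g n = \sum_(1 <= d < N.+1 | (d %| n)%N) g d.
Proof.
move=> n0 nN; rewrite /dsum [RHS](@big_cat_nat _ _ _ n.+1) //=.
rewrite [X in _ = _ + X]big_nat_cond [X in _ = _ + X]big1 ?addr0 // => i.
by case/andP=> /andP[h _] /(dvdn_leq n0); rewrite leqNgt h.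
Qed.

(** Both sides run over the pairs with [d * e <= N]; on the right they are grouped by their
    product. *)
Lemma sum_hyperbola (V : nmodType) (h : nat -> nat -> V) (N : nat) :
  \sum_(1 <= d < N.+1) \sum_(1 <= e < (N %/ d).+1) h d e
  = \sum_(1 <= n < N.+1) dsum (fun d => h d (n %/ d)%N) n.
Proof.
rewrite [RHS](eq_big_nat _ _ (F2 := fun n =>
  \sum_(1 <= d < N.+1) if (d %| n)%N then h d (n %/ d)%N else 0)); last first.
  by move=> n /andP[n0 nN]; rewrite (dsum_widen _ n0 nN) big_mkcond.
rewrite exchange_big_nat /=; apply: eq_big_nat => d /andP[d0 _].
by rewrite -big_mkcond /= sum_multiples.
Qed.

Lemma sum_hyperbola_swap (V : nmodType) (h : nat -> nat -> V) (N : nat) :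
  \sum_(1 <= d < N.+1) \sum_(1 <= e < (N %/ d).+1) h d e
  = \sum_(1 <= e < N.+1) \sum_(1 <= d < (N %/ e).+1) h d e.
Proof.
have aux (F : nat -> V) d : (0 < d)%N ->
  \sum_(1 <= e < (N %/ d).+1) F e = \sum_(1 <= e < N.+1 | (d * e <= N)%N) F e.
  move=> d0; rewrite [RHS](@big_cat_nat _ _ _ (N %/ d).+1) //=; last by rewrite ltnS leq_div.
  rewrite [X in _ = _ + X]big_nat_cond [X in _ = _ + X]big1 ?addr0 => [|i].
    rewrite [RHS]big_nat_cond big_nat_cond; apply: eq_bigl => i; rewrite andbT.
    by case: andP => //= -[_]; rewrite ltnS leq_divRL // mulnC => ->.
  by rewrite mulnC -leq_divRL // => /andP[/andP[h1 _]]; rewrite leqNgt h1.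
rewrite (eq_big_nat _ _ (F2 := fun d => \sum_(1 <= e < N.+1 | (d * e <= N)%N) h d e)); last first.
  by move=> d /andP[d0 _]; rewrite aux.
under eq_bigr do rewrite big_mkcond.
rewrite exchange_big_nat /=; apply: eq_big_nat => e /andP[e0 _].
by rewrite -big_mkcond /= (aux (h^~ e)) //; apply: eq_bigl => d; rewrite mulnC.
Qed.

(** The divisors of [p ^ a.+1 * m] that do not divide [p ^ a * m] are the products [p ^ a.+1 * e]
    with [e] dividing [m]. *)
Lemma dsum_pfactor (V : nmodType) (g : nat -> V) (p a m : nat) :
  prime p -> ~~ (p %| m)%N ->
  dsum g (p ^ a.+1 * m) = dsum g (p ^ a * m) + dsum (fun e => g (p ^ a.+1 * e)%N) m.
Proof.
move=> pp pm; have p0 := prime_gt0 pp.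
have m0 : (0 < m)%N by case: m pm => //; rewrite dvdn0.
set n := (p ^ a.+1 * m)%N; set D := (p ^ a.+1)%N.
have D0 : (0 < D)%N by rewrite expn_gt0 p0.
have n0 : (0 < n)%N by rewrite muln_gt0 D0.
have ln : (p ^ a * m <= n)%N by rewrite leq_mul2r leq_exp2l ?prime_gt1 // leqnSn orbT.
have l0 : (0 < p ^ a * m)%N by rewrite muln_gt0 expn_gt0 p0.
rewrite (dsum_widen _ l0 ln) {1}/dsum (bigID (fun d => d %| p ^ a * m)%N) /=; congr (_ + _).
  apply: eq_bigl => d; apply/andP/idP => [[] //|h]; split=> //.
  by apply: dvdn_trans h _; rewrite /n expnS -mulnA dvdn_mull.
pose F e := if (e %| m)%N then g (D * e)%N else 0.
transitivity (\sum_(1 <= d < n.+1 | (D %| d)%N) F (d %/ D)%N).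
  rewrite big_nat_cond [RHS]big_nat_cond big_mkcond [RHS]big_mkcond.
  apply: eq_bigr => d _; case: (1 <= d < n.+1)%N/andP => //= -[d0 _].
  have [Dd|nDd] := boolP (D %| d)%N.
    case/dvdnP: Dd d0 => e -> ; rewrite muln_gt0 => /andP[e0 _].
    rewrite mulnK // /n mulnC dvdn_pmul2l // /F; case: ifP => /= [/andP[-> _]//|em].
    case: ifP => // em'; move: em; rewrite em' /= => /negbFE.
    rewrite /D expnSr -mulnA dvdn_pmul2l ?expn_gt0 ?p0 // => h.
    by case/negP: pm; apply: dvdn_trans h; rewrite dvdn_mulr.
  case: ifP => // /andP[dn]; case/negP.
  have cop : coprime (p ^ a.+1) m by rewrite coprimeXl // prime_coprime.
  have d0' := d0.
  pose k := logn p d.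
  have [//|] := leqP a.+1 k.
    move=> ak; case/negP: nDd; rewrite /D pfactor_dvdn //.
  rewrite ltnS => ka.
  case: (pfactor_coprime pp d0) => d' cpd dE.
  rewrite dE mulnC; apply: dvdn_mul; first by rewrite dvdn_exp2l.
  have : (d' %| n)%N by apply: dvdn_trans dn; rewrite dE dvdn_mulr.
  by rewrite /n Gauss_dvdr // coprime_sym coprimeXl.
rewrite sum_multiples // /n mulKn // /F /dsum [RHS]big_mkcond.
by [].
Qed.

Lemma dsum_le0 (V : nmodType) (g : nat -> V) : dsum g 1 = g 1%N.
Proof. by rewrite /dsum big_mkcond big_nat1. Qed.

Variable R : realType.
Implicit Types f g h : nat -> R.

Definition psum f N : R := \sum_(1 <= n < N.+1) f n.

Lemma psum0 f : psum f 0 = 0. Proof. by rewrite /psum big_geq. Qed.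
Lemma psumS f N : psum f N.+1 = psum f N + f N.+1.
Proof. by rewrite /psum big_nat_recr. Qed.

(** Identities between convolutions are proved on summatory functions, where they become
    rearrangements of sums over lattice points. *)
Lemma psum_inj f g : (forall N, psum f N = psum g N) -> forall n, (0 < n)%N -> f n = g n.
Proof. by move=> h [//|n] _; have := h n.+1; rewrite !psumS h => /addrI. Qed.

Lemma eq_psum f g N : (forall n, (0 < n)%N -> f n = g n) -> psum f N = psum g N.
Proof. by move=> h; apply: eq_big_nat => n /andP[n0 _]; apply: h. Qed.

Definition dconv f g (n : nat) : R := dsum (fun d => f d * g (n %/ d)%N) n.

Lemma eq_dconv f g f' g' n : (0 < n)%N -> (forall n, (0 < n)%N -> f n = f' n) ->
  (forall n, (0 < n)%N -> g n = g' n) -> dconv f g n = dconv f' g' n.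
Proof.
move=> n0 hf hg; rewrite /dconv /dsum big_nat_cond [RHS]big_nat_cond; apply: eq_bigr => d.
move=> /andP[/andP[d0 dn] ddn]; rewrite hf // hg // divn_gt0 //; exact: dvdn_leq.
Qed.

Lemma psum_dconv_weight f g (G : nat -> R) N :
  \sum_(1 <= d < N.+1) f d * \sum_(1 <= e < (N %/ d).+1) g e * G (N %/ (d * e))%N
  = \sum_(1 <= n < N.+1) dconv f g n * G (N %/ n)%N.
Proof.
under eq_bigr do rewrite big_distrr /=.
rewrite sum_hyperbola; apply: eq_big_nat => n /andP[n0 _].
rewrite /dconv /dsum big_distrl /=; apply: eq_bigr => d dn.
by rewrite mulrA [(d * _)%N]mulnC divnK.
Qed.

Lemma psum_dconv f g N :
  psum (dconv f g) N = \sum_(1 <= d < N.+1) f d * psum g (N %/ d)%N.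
Proof.
have := psum_dconv_weight f g (fun=> 1) N.
rewrite -[in X in _ = X -> _]big_distrl /= mulr1 /psum => <-; apply: eq_bigr => d _.
by rewrite -big_distrl /= mulr1.
Qed.

Lemma dconvC f g n : (0 < n)%N -> dconv f g n = dconv g f n.
Proof.
move: n; apply: psum_inj => N; rewrite !psum_dconv /psum.
under eq_bigr do rewrite big_distrr /=.
rewrite sum_hyperbola_swap; apply: eq_bigr => e _.
by rewrite big_distrr /=; apply: eq_bigr => d _; rewrite mulrC.
Qed.

Lemma dconvA f g h n : (0 < n)%N -> dconv f (dconv g h) n = dconv (dconv f g) h n.
Proof.
move: n; apply: psum_inj => N; rewrite !psum_dconv.
rewrite -psum_dconv_weight; apply: eq_bigr => d _.
by rewrite psum_dconv; congr (_ * _); apply: eq_bigr => e _; rewrite divnMA.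
Qed.

Lemma dconvDr f g h n : dconv h (fun n => f n + g n) n = dconv h f n + dconv h g n.
Proof. by rewrite /dconv /dsum -big_split; apply: eq_bigr => d _; rewrite mulrDr. Qed.

Lemma dconvNr f g n : dconv f (fun n => - g n) n = - dconv f g n.
Proof. by rewrite /dconv /dsum -sumrN; apply: eq_bigr => d _; rewrite mulrN. Qed.

Lemma dconvNl f g n : dconv (fun n => - f n) g n = - dconv f g n.
Proof. by rewrite /dconv /dsum -sumrN; apply: eq_bigr => d _; rewrite mulNr. Qed.

Definition dunit (n : nat) : R := (n == 1%N)%:R.

Lemma dconv1l f n : (0 < n)%N -> dconv dunit f n = f n.
Proof.
move=> n0; rewrite /dconv /dsum big_mkcond big_ltn //= dvd1n /dunit eqxx mul1r divn1.
rewrite big_nat_cond big1 ?addr0 // => i /andP[/andP[h _] _]; case: ifP => // _.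
by rewrite gtn_eqF // mul0r.
Qed.

Definition lnn (n : nat) : R := ln n%:R.

Lemma lnnM m n : (0 < m)%N -> (0 < n)%N -> lnn (m * n) = lnn m + lnn n.
Proof. by move=> m0 n0; rewrite /lnn natrM lnM // posrE ltr0n. Qed.

(** Multiplication by the logarithm is a derivation for the convolution, because
    [ln n = ln d + ln (n / d)]. *)
Lemma dconv_lnn f g n : (0 < n)%N ->
  lnn n * dconv f g n = dconv (fun n => lnn n * f n) g n + dconv f (fun n => lnn n * g n) n.
Proof.
move=> n0; rewrite /dconv /dsum big_distrr /= -big_split /= big_nat_cond [RHS]big_nat_cond.
apply: eq_bigr => d /andP[/andP[d0 _] dn].
have q0 : (0 < n %/ d)%N by rewrite divn_gt0 //; exact: dvdn_leq.
have -> : lnn n = lnn d + lnn (n %/ d)%N by rewrite -lnnM // mulnC divnK.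
ring.
Qed.

End DirichletConvolution.

Section MoebiusMangoldt.
Variable R : realType.
Implicit Types f g : nat -> R.

Lemma mobius1 : mobius 1 = 1. Proof. by []. Qed.

Lemma mobius_sqfree_pM (p d : nat) : prime p -> ~~ (p %| d)%N -> mobius (p * d) = - mobius d.
Proof.
move=> pp pd; have d0 : (0 < d)%N by case: d pd => //; rewrite dvdn0.
have p0 := prime_gt0 pp.
have prE : perm_eq (primes (p * d)) (p :: primes d).
  apply: uniq_perm; rewrite ?primes_uniq //=.
    by rewrite mem_primes pp d0 /= pd primes_uniq.
  by move=> q; rewrite primesM // primes_prime // inE in_cons.
rewrite /mobius (perm_all _ prE) (perm_size prE) /= lognM // logn_prime // eqxx.
rewrite (lognE p d) pp d0 /= (negbTE pd) addn0 eqxx /=.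
rewrite (eq_in_all (a2 := fun q => logn q d == 1%N)); last first.
  move=> q; rewrite mem_primes => /and3P[qp _ qd]; rewrite lognM // logn_prime //.
  by case: (q =P p) qd pd => [->|_ _ _]; rewrite ?add0n // => ->.
by case: ifP => _; rewrite ?oppr0 // exprS mulN1r.
Qed.

Lemma mobius_sqr_dvd (p d : nat) : prime p -> (0 < d)%N -> (p %| d)%N -> mobius (p * d) = 0.
Proof.
move=> pp d0 pd; have p0 := prime_gt0 pp.
rewrite /mobius; case: allP => // /(_ p); rewrite mem_primes pp muln_gt0 p0 d0 dvdn_mulr //.
rewrite lognM // logn_prime // eqxx => /(_ isT).
by rewrite (lognE p d) pp d0 pd.
Qed.

Definition mu (n : nat) : R := (mobius n)%:~R.

Lemma norm_mu n : `|mu n| <= 1.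
Proof.
rewrite /mu /mobius; case: ifP => _; last by rewrite normr0.
by rewrite rmorphXn /= normrX mulrN1z normrN normr1 expr1n.
Qed.

Lemma pfactor_decomp n : (1 < n)%N ->
  exists p a m, [/\ prime p, ~~ (p %| m)%N & n = (p ^ a.+1 * m)%N].
Proof.
move=> n1; have pp := pdiv_prime n1; set p := pdiv n in pp.
have n0 : (0 < n)%N by exact: ltnW.
have [m cm nE] := pfactor_coprime pp n0.
exists p, (logn p n).-1, m; split => //; first by rewrite -prime_coprime.
by rewrite prednK ?[LHS]nE 1?mulnC // logn_gt0 mem_primes pp n0 pdiv_dvd.
Qed.

Lemma eq_dsum (V : nmodType) (f g : nat -> V) n : (0 < n)%N ->
  (forall d, (0 < d)%N -> (d %| n)%N -> f d = g d) -> dsum f n = dsum g n.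
Proof.
move=> n0 h; rewrite /dsum big_nat_cond [RHS]big_nat_cond; apply: eq_bigr => d.
by move=> /andP[/andP[d0 _] dn]; apply: h.
Qed.

(** Only the divisors [d] and [p * d] with [d] dividing [m] survive, and they carry opposite signs.
    The case [g = 1] gives the inversion formula, a logarithmic [g] the sign of the von Mangoldt
    function. *)
Lemma dsum_mu_pfactor (g : nat -> R) (p a m : nat) : prime p -> ~~ (p %| m)%N ->
  dsum (fun d => mu d * g d) (p ^ a.+1 * m) = dsum (fun d => mu d * (g d - g (p * d)%N)) m.
Proof.
move=> pp pm; have m0 : (0 < m)%N by case: m pm => //; rewrite dvdn0.
elim: a => [|a IH]; rewrite dsum_pfactor //.
  rewrite expn0 mul1n /dsum -big_split /=; rewrite big_nat_cond [RHS]big_nat_cond.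
  apply: eq_bigr => d /andP[/andP[d0 _] dm].
  have pd : ~~ (p %| d)%N by apply: contra pm => /dvdn_trans; apply.
  by rewrite expn1 {2}/mu mobius_sqfree_pM // rmorphN /= -/(mu d); ring.
rewrite IH [X in _ + X](@eq_dsum _ _ (fun=> 0)) //; last first.
  move=> d d0 dm; rewrite /mu expnS -mulnA mobius_sqr_dvd ?mul0r //.
    by rewrite muln_gt0 expn_gt0 prime_gt0.
  by rewrite expnS -mulnA dvdn_mulr.
by rewrite [X in _ + X]big1 ?addr0.
Qed.

Lemma dconv_mu1 n : (0 < n)%N -> dconv mu (fun=> 1) n = dunit R n.
Proof.
move=> n0; have [n1|] := ltnP 1 n; last first.
  by case: n n0 => [|[|]] // _ _; rewrite /dconv dsum_le0 /dunit /mu mobius1 mulr1.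
have [p [a [m [pp pm nE]]]] := pfactor_decomp n1.
rewrite /dconv nE (dsum_mu_pfactor (fun=> 1)) // /dunit -nE gtn_eqF //.
by rewrite /dsum big1 // => i _; rewrite subrr mulr0.
Qed.

Lemma dconv1_mu n : (0 < n)%N -> dconv (fun=> 1) mu n = dunit R n.
Proof. by move=> n0; rewrite dconvC // dconv_mu1. Qed.

(** The von Mangoldt function, as the Moebius inverse of the logarithm; its prime factors enter only
    in the proof that it is nonnegative. *)
Definition mangoldt : nat -> R := dconv mu (@lnn R).

Lemma lnn1 : lnn R 1 = 0. Proof. by rewrite /lnn ln1. Qed.

Lemma lnn_ge0 n : 0 <= lnn R n.
Proof.
case: n => [|n]; first by rewrite /lnn ln0.
by rewrite /lnn ln_ge0 // ler1n.
Qed.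

(** Pairing the divisors [d] and [p * d] leaves [ln p] times the sum of [mu] over the divisors of
    [m], which is [0] or [1]. *)
Lemma mangoldt_ge0 n : 0 <= mangoldt n.
Proof.
case: n => [|n]; first by rewrite /mangoldt /dconv /dsum big_geq.
have [n1|] := ltnP 1 n.+1; last first.
  by case: n => // _; rewrite /mangoldt /dconv dsum_le0 /= lnn1 mulr0.
have [p [a [m [pp pm nE]]]] := pfactor_decomp n1.
have m0 : (0 < m)%N by case: m pm {nE} => //; rewrite dvdn0.
have -> : mangoldt n.+1 = dsum (fun d => mu d * (lnn R n.+1 - lnn R d)) n.+1.
  apply: eq_dsum => // d d0 dn; congr (_ * _).
  have q0 : (0 < n.+1 %/ d)%N by rewrite divn_gt0 //; exact: dvdn_leq.
  by apply/eqP; rewrite -subr_eq opprK -lnnM // divnK.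
rewrite [in X in dsum _ X]nE (dsum_mu_pfactor (fun d => lnn R n.+1 - lnn R d)) //.
rewrite (@eq_dsum _ _ (fun d => mu d * 1 * lnn R p)) //; last first.
  move=> d d0 dm; rewrite (lnnM _ (prime_gt0 pp) d0). ring.
rewrite /dsum -big_distrl /= mulr_ge0 ?lnn_ge0 //.
by have := @dconv_mu1 m m0; rewrite /dconv /dsum => ->; rewrite /dunit ler0n.
Qed.

Lemma dconv1_mangoldt n : (0 < n)%N -> dconv (fun=> 1) mangoldt n = lnn R n.
Proof.
move=> n0; rewrite dconvA // (@eq_dconv _ _ _ (dunit R) (@lnn R)) ?dconv1l //.
exact: dconv1_mu.
Qed.

Lemma lnn_dunit n : lnn R n * dunit R n = 0.
Proof. by rewrite /dunit; case: eqP => [->|]; rewrite ?lnn1 ?mul0r ?mulr0. Qed.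

Lemma lnn_mu n : (0 < n)%N -> lnn R n * mu n = - dconv mu mangoldt n.
Proof.
move=> n0.
have key k : (0 < k)%N -> dconv (@lnn R) mu k = - dconv (fun=> 1) (fun n => lnn R n * mu n) k.
  move=> k0; have := dconv_lnn (fun=> 1) mu k0.
  rewrite dconv1_mu // lnn_dunit => /eqP; rewrite eq_sym addr_eq0 => /eqP.
  move=> <-; apply: eq_dconv => // j _; ring.
rewrite -(@dconv1l R (fun n => lnn R n * mu n)) // (@eq_dconv _ _ _ (dconv mu (fun=> 1)) (fun n => lnn R n * mu n)) //; last first.
  by move=> j j0; rewrite dconv_mu1.
rewrite -dconvA // (@eq_dconv _ _ _ mu (fun n => - mangoldt n)) ?dconvNr //.
move=> j j0; rewrite /mangoldt dconvC // [dconv mu _ _]dconvC // key // opprK.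
by rewrite dconvC.
Qed.

Definition selberg (n : nat) : R := lnn R n * mangoldt n + dconv mangoldt mangoldt n.

(** The signed companion of [selberg]: [ln ^ 2 * mu] is the convolution of [mu] with it, while
    [selberg] dominates it. Thus the asymptotics of [selberg] bound sums of [mu]. *)
Definition selberg' (n : nat) : R := dconv mangoldt mangoldt n - lnn R n * mangoldt n.

Lemma dconv_mangoldt_ge0 n : 0 <= dconv mangoldt mangoldt n.
Proof. by rewrite /dconv /dsum sumr_ge0 // => i _; rewrite mulr_ge0 ?mangoldt_ge0. Qed.

Lemma norm_selberg' n : `|selberg' n| <= selberg n.
Proof.
rewrite /selberg' /selberg; have h1 := dconv_mangoldt_ge0 n.
have h2 : 0 <= lnn R n * mangoldt n by rewrite mulr_ge0 ?lnn_ge0 ?mangoldt_ge0.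
by rewrite ler_norml; apply/andP; split; lra.
Qed.

(** The derivation rule applied to [ln = 1] convolved with [mangoldt] shows that [ln ^ 2] is [1]
    convolved with [selberg]; then invert. *)
Lemma selbergE n : (0 < n)%N -> selberg n = dconv mu (fun n => lnn R n ^+ 2) n.
Proof.
move=> n0.
have key k : (0 < k)%N -> lnn R k ^+ 2 = dconv (fun=> 1) selberg k.
  move=> k0; rewrite expr2 -{2}dconv1_mangoldt // dconv_lnn // /selberg dconvDr addrC.
  congr (_ + _); rewrite dconvA //; apply: eq_dconv => // j j0.
  by rewrite mulr1 dconv1_mangoldt.
rewrite -[LHS]dconv1l // (@eq_dconv _ _ _ (dconv mu (fun=> 1)) selberg) //; last first.
  by move=> j j0; rewrite dconv_mu1.
by rewrite -dconvA //; apply: eq_dconv => // j j0; rewrite key.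
Qed.

Lemma lnn2_mu n : (0 < n)%N -> lnn R n ^+ 2 * mu n = dconv mu selberg' n.
Proof.
move=> n0; rewrite expr2 -mulrA lnn_mu // mulrN dconv_lnn //.
rewrite (@eq_dconv _ (fun n => lnn R n * mu n) _ (fun n => - dconv mu mangoldt n) mangoldt) //; last first.
  by move=> j j0; rewrite lnn_mu.
rewrite dconvNl -dconvA // /selberg' dconvDr dconvNr opprD opprK //.
Qed.

End MoebiusMangoldt.

(** * Elementary estimates for logarithmic and harmonic sums *)

Section ElementaryBounds.
Variable R : realType.
Implicit Types f g c w : nat -> R.
Local Notation lnn := (lnn R).
Local Notation mu := (mu R).
Local Notation mangoldt := (mangoldt R).

Lemma ln_le_subr1 (x : R) : 0 < x -> ln x <= x - 1.
Proof. by move=> x0; have := @le_ln1Dx R (x - 1); rewrite [1 + _]addrC subrK; apply; lra. Qed.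

Lemma ln_ge_1subV (x : R) : 0 < x -> 1 - x^-1 <= ln x.
Proof.
move=> x0; have := @ln_le_subr1 x^-1; rewrite invr_gt0 => /(_ x0).
rewrite lnV ?posrE //; lra.
Qed.

Lemma lnn_incr_le n : (0 < n)%N -> lnn n.+1 - lnn n <= n%:R^-1.
Proof.
move=> n0; have n0' : 0 < n%:R :> R by rewrite ltr0n.
rewrite /lnn -ln_div ?posrE ?ltr0n //.
apply: le_trans (ln_le_subr1 _) _; first by rewrite divr_gt0 ?ltr0n.
by rewrite -(natr1 n) mulrDl divff ?gt_eqF // mul1r addrAC subrr add0r.
Qed.

Lemma lnn_incr_ge n : (0 < n)%N -> n.+1%:R^-1 <= lnn n.+1 - lnn n.
Proof.
move=> n0; have n0' : 0 < n%:R :> R by rewrite ltr0n.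
rewrite /lnn -ln_div ?posrE ?ltr0n //.
apply: le_trans (ln_ge_1subV _); last by rewrite divr_gt0 ?ltr0n.
rewrite invf_div -[X in X / _](addrK 1) natr1 mulrBl divff ?pnatr_eq0 // mul1r.
by rewrite opprB addrC subrK.
Qed.

Lemma lnn_le m n : (0 < m)%N -> (m <= n)%N -> lnn m <= lnn n.
Proof.
by move=> m0 mn; rewrite /lnn ler_ln ?posrE ?ltr0n ?ler_nat // (leq_trans m0).
Qed.

Lemma psum_lnn_ge m : (0 < m)%N -> m%:R * lnn m - m%:R <= psum lnn m.
Proof.
elim: m => // -[_ _|m IH _].
  by rewrite /psum big_nat1 lnn1; lra.
rewrite psumS; have := IH isT; have := @lnn_incr_le m.+1 isT.
set a := lnn m.+1; set b := lnn m.+2 => h1 h2.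
have x0 : 0 < m.+1%:R :> R by rewrite ltr0n.
rewrite -[m.+2%:R]natr1; move: h1; rewrite -(ler_pM2l x0) divff ?gt_eqF //.
nra.
Qed.

Lemma psum_lnn_le m : (0 < m)%N -> psum lnn m <= m%:R * lnn m - m%:R + 1 + lnn m.
Proof.
elim: m => // -[_ _|m IH _].
  by rewrite /psum big_nat1 lnn1; lra.
rewrite psumS; have := IH isT; have := @lnn_incr_ge m.+1 isT.
set a := lnn m.+1; set b := lnn m.+2 => h1 h2.
have x0 : 0 < m.+2%:R :> R by rewrite ltr0n.
move: h1; rewrite -(ler_pM2l x0) divff ?gt_eqF //.
rewrite -[m.+2%:R]natr1 in x0 *; nra.
Qed.

Lemma divn_natr_le (N d : nat) : (0 < d)%N -> (N %/ d)%:R <= N%:R / d%:R :> R.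
Proof. by move=> d0; rewrite ler_pdivlMr ?ltr0n // -natrM ler_nat leq_divM. Qed.

Lemma divn_natr_gt (N d : nat) : (0 < d)%N -> N%:R / d%:R < (N %/ d)%:R + 1 :> R.
Proof. by move=> d0; rewrite ltr_pdivrMr ?ltr0n // natr1 -natrM ltr_nat ltn_ceil. Qed.

(** The intervals of centre [u n] and radius [v n] are nested; the limit is the supremum of their
    left endpoints. *)
Lemma telescoping_limit (u v : nat -> R) : (forall n, 0 <= v n) ->
  (forall n, `|u n.+1 - u n| <= v n - v n.+1) ->
  exists l, forall n, `|u n - l| <= v n.
Proof.
move=> v0 huv.
have incr m n : (m <= n)%N -> u m - v m <= u n - v n /\ u n + v n <= u m + v m.
  elim: n => [|n IH]; first by rewrite leqn0 => /eqP ->.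
  rewrite leq_eqVlt => /orP[/eqP -> //|]; rewrite ltnS => /IH [h1 h2].
  have := huv n; rewrite ler_norml => /andP[h3 h4]; split; lra.
pose A := range (fun n => u n - v n).
have ub m : ubound A (u m + v m).
  move=> _ [n _ <-]; have [mn|nm] := leqP m n.
    by have [_ h] := incr _ _ mn; have := v0 n; lra.
  by have [h _] := incr _ _ (ltnW nm); have := v0 m; lra.
have Ane : A !=set0 by exists (u 0%N - v 0%N), 0%N.
exists (sup A) => n; rewrite ler_norml.
have h1 : u n - v n <= sup A by apply: ub_le_sup; [exists (u 0%N + v 0%N); exact: ub | exists n].
have h2 : sup A <= u n + v n by apply: ge_sup => //; exact: ub.
apply/andP; split; lra.
Qed.

Lemma sum_by_parts c w N :
  \sum_(1 <= n < N.+1) c n * w n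
  = psum c N * w N.+1 + \sum_(1 <= n < N.+1) psum c n * (w n - w n.+1).
Proof.
elim: N => [|N IH]; first by rewrite psum0 !big_geq // mul0r add0r.
by rewrite big_nat_recr //= IH [in RHS]big_nat_recr //= psumS; ring.
Qed.

Lemma telescope_nat w N : \sum_(1 <= n < N.+1) (w n - w n.+1) = w 1%N - w N.+1.
Proof.
elim: N => [|N IH]; first by rewrite big_geq // subrr.
by rewrite big_nat_recr //= IH; ring.
Qed.

Lemma invrS_diff n : (0 < n)%N -> n%:R^-1 - n.+1%:R^-1 = (n%:R * n.+1%:R)^-1 :> R.
Proof.
move=> n0; have n0' : n%:R != 0 :> R by rewrite pnatr_eq0 -lt0n.
have n1' : n.+1%:R != 0 :> R by rewrite pnatr_eq0.
rewrite -natr1 in n1' *; field.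
by rewrite n0' n1'.
Qed.

Lemma sum_harmonic_cvg c (C : R) : (forall N, `|psum c N| <= C) ->
  exists l, forall N, `|\sum_(1 <= n < N.+1) c n / n%:R - l| <= 2 * C / N.+1%:R.
Proof.
move=> hC.
pose u N := \sum_(1 <= n < N.+1) psum c n * (n%:R^-1 - n.+1%:R^-1).
have C0 : 0 <= C by apply: le_trans (hC 0%N).
have [||l hl] := @telescoping_limit u (fun N => C / N.+1%:R).
- by move=> n; rewrite divr_ge0.
- move=> n; rewrite /u big_nat_recr //= addrAC subrr add0r normrM -mulrBr.
  have d0 : 0 <= n.+1%:R^-1 - n.+2%:R^-1 :> R by rewrite invrS_diff // invr_ge0 mulr_ge0.
  by rewrite (ger0_norm d0) ler_wpM2r.
exists l => N; rewrite (sum_by_parts c (fun n => n%:R^-1)) -/(u N) -addrA.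
apply: le_trans (ler_normD _ _) _.
rewrite normrM normfV normr_nat; have := hl N; have := hC N.
have : 0 < N.+1%:R^-1 :> R by rewrite invr_gt0 ltr0n.
set x := N.+1%:R^-1 => x0 h1 h2; rewrite -mulrA.
have : `|psum c N| * x <= C * x by rewrite ler_wpM2r // ltW.
lra.
Qed.

Definition harm N : R := \sum_(1 <= n < N.+1) n%:R^-1.

Lemma harmS N : harm N.+1 = harm N + N.+1%:R^-1.
Proof. by rewrite /harm big_nat_recr. Qed.

Lemma harm_euler : exists g : R, forall N, (0 < N)%N -> `|harm N - lnn N - g| <= N%:R^-1.
Proof.
have [||g hg] := @telescoping_limit (fun N => harm N.+1 - lnn N.+1) (fun N => N.+1%:R^-1).
- by move=> n; rewrite invr_ge0.
- move=> n; rewrite [harm n.+2]harmS.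
  have h1 := @lnn_incr_le n.+1 isT; have h2 := @lnn_incr_ge n.+1 isT.
  move: h1 h2; set a := n.+1%:R^-1; set b := n.+2%:R^-1 => h1 h2.
  rewrite ler_norml; apply/andP; split; lra.
by exists g => -[//|N _]; exact: hg.
Qed.

Lemma harm_le N : harm N <= 1 + lnn N.
Proof.
case: N => [|N]; first by rewrite /harm big_geq // addr_ge0 ?lnn_ge0.
elim: N => [|N IH]; first by rewrite /harm big_nat1 invr1 lnn1 addr0.
rewrite harmS; have := @lnn_incr_ge N.+1 isT; set a := N.+2%:R^-1; lra.
Qed.

(** The integer part [x] of [y = N / d] satisfies [y <= 2 * x], so an error [O(1 / x)] in Euler's
    formula stays bounded after multiplication by [y]. *)
Lemma harm_euler_real : exists2 g : R, 0 <= g & forall N d, (0 < d)%N -> (d <= N)%N ->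
  `|N%:R / d%:R * harm (N %/ d) - N%:R / d%:R * (ln (N%:R / d%:R) + g)| <= 4.
Proof.
have [g hg] := harm_euler; exists g.
  have := hg 1%N isT; rewrite /harm big_nat1 lnn1 invr1 ler_norml => /andP[]; lra.
move=> N d d0 dN.
have m0 : (0 < N %/ d)%N by rewrite divn_gt0.
have := hg _ m0; have := divn_natr_le N d0; have := divn_natr_gt N d0.
set y : R := N%:R / d%:R; set m := (N %/ d)%N; rewrite /lnn.
have mr : 1 <= m%:R :> R by rewrite ler1n.
set x : R := m%:R in mr * => h1 h2 h3.
have y0 : 0 < y by lra.
rewrite -mulrBr normrM (gtr0_norm y0).
have l1 : 0 <= ln y - ln x by rewrite subr_ge0 ler_ln ?posrE //; lra.
have l2 : ln y - ln x <= x^-1.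
  rewrite -ln_div ?posrE; try lra.
  apply: le_trans (ln_le_subr1 _) _; first by rewrite divr_gt0 //; lra.
  rewrite -[X in _ - X](@divff _ x) ?gt_eqF //; last by lra.
  by rewrite -mulrBl -[leRHS]mul1r ler_wpM2r ?invr_ge0 //; lra.
have l3 : `|harm m - (ln y + g)| <= 2 * x^-1.
  move: h3; rewrite !ler_norml => /andP[h3 h4]; apply/andP; split; lra.
have : y <= 2 * x by lra.
have x0 : 0 < x by lra.
move=> yx; apply: (@le_trans _ _ (2 * x * (2 * x^-1))).
  by apply: ler_pM => //; lra.
rewrite mulrACA divff ?gt_eqF //; lra.
Qed.

Lemma sum_inv_sqrt N : \sum_(1 <= d < N.+1) (Num.sqrt d%:R)^-1 <= 2 * Num.sqrt N%:R :> R.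
Proof.
elim: N => [|N IH]; first by rewrite big_geq // sqrtr0 mulr0.
rewrite big_nat_recr //=; apply: le_trans (lerD IH (lexx _)) _.
have h0 : 0 <= Num.sqrt N%:R :> R by rewrite sqrtr_ge0.
have h1 : 0 < Num.sqrt N.+1%:R :> R by rewrite sqrtr_gt0 ltr0n.
have e0 : Num.sqrt N%:R ^+ 2 = N%:R :> R by rewrite sqr_sqrtr.
have e1 : Num.sqrt N.+1%:R ^+ 2 = N%:R + 1 :> R by rewrite sqr_sqrtr // natr1.
move: h0 h1 e0 e1; set a := Num.sqrt N%:R; set b := Num.sqrt _ => h0 h1 e0 e1.
rewrite -(ler_pM2r h1) mulrDl mulVf ?gt_eqF //.
have := sqr_ge0 (a - b); nra.
Qed.

Lemma ln_sqr_le_sqrt (y : R) : 1 <= y -> (1 + ln y) ^+ 2 <= 16 * Num.sqrt y.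
Proof.
move=> y1; set t := Num.sqrt (Num.sqrt y).
have t2 : t ^+ 2 = Num.sqrt y by rewrite sqr_sqrtr ?sqrtr_ge0.
have t4 : t ^+ 4 = y by rewrite (exprM t 2 2) t2 sqr_sqrtr; lra.
have t0 : 0 < t by rewrite !sqrtr_gt0; lra.
have h : ln y <= 4 * (t - 1).
  by rewrite -t4 lnXn // -[X in X <= _]mulr_natl ler_pM2l // ln_le_subr1.
have h0 : 0 <= ln y by rewrite ln_ge0.
rewrite -t2; have -> : 16 * t ^+ 2 = (4 * t) ^+ 2 by ring.
rewrite ler_sqr ?nnegrE; lra.
Qed.

Lemma ln_div_ge0 (N d : nat) : (0 < d)%N -> (d <= N)%N -> 0 <= ln (N%:R / d%:R : R).
Proof. by move=> d0 dN; rewrite ln_ge0 // ler_pdivlMr ?ltr0n // mul1r ler_nat. Qed.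

(** The square of the logarithm is dominated by a square root, and the inverse square roots up to
    [N] add up to at most [2 * sqrt N]. This is why errors that are logarithmic in [N / d] total
    only [O(N)]. *)
Lemma sum_ln_div_sqr N :
  \sum_(1 <= d < N.+1) (1 + ln (N%:R / d%:R)) ^+ 2 <= 32 * N%:R :> R.
Proof.
apply: (@le_trans _ _ (\sum_(1 <= d < N.+1) (16 * Num.sqrt N%:R) * (Num.sqrt d%:R)^-1)).
  rewrite big_nat [leRHS]big_nat; apply: ler_sum => d /andP[d0 dN].
  apply: le_trans (ln_sqr_le_sqrt _) _.
    by rewrite ler_pdivlMr ?ltr0n // mul1r ler_nat.
  by rewrite -mulrA sqrtrM ?ler0n // sqrtrV ?ler0n.
rewrite -big_distrr /=.
have := sum_inv_sqrt N; have e : Num.sqrt N%:R ^+ 2 = N%:R :> R by rewrite sqr_sqrtr.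
have := sqrtr_ge0 (N%:R : R); move: e; set a := Num.sqrt _ => e a0 h.
have : 16 * a * (\sum_(1 <= d < N.+1) (Num.sqrt d%:R)^-1) <= 16 * a * (2 * a).
  by rewrite ler_wpM2l // mulr_ge0.
nra.
Qed.

Lemma sum_ln_div N : \sum_(1 <= d < N.+1) (1 + ln (N%:R / d%:R)) <= 32 * N%:R :> R.
Proof.
apply: le_trans (sum_ln_div_sqr N).
rewrite big_nat [leRHS]big_nat; apply: ler_sum => d /andP[d0 dN].
have := ln_div_ge0 d0 dN; nra.
Qed.

End ElementaryBounds.

(** * Selberg's formula in residue classes *)

Section ResidueClasses.
Variable R : realType.
Variable K : nat.
Hypothesis K1 : (1 < K)%N.
Implicit Types (f g c w : nat -> R) (b : 'Z_K).
Local Notation lnn := (lnn R).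
Local Notation mu := (mu R).
Local Notation mangoldt := (mangoldt R).

Definition cls b (n : nat) : R := ((n%:R : 'Z_K) == b)%:R.
(** The principal character modulo [K]. *)
Definition chi0 (n : nat) : R := (coprime K n)%:R.

Lemma natr_unit n : ((n%:R : 'Z_K) \is a GRing.unit) = coprime K n.
Proof. exact: unitZpE. Qed.

Lemma chi0_sum n : chi0 n = \sum_(b : 'Z_K | b \is a GRing.unit) cls b n.
Proof.
rewrite /chi0 -natr_unit /cls; have [u|u] := boolP ((n%:R : 'Z_K) \is a GRing.unit); last first.
  by rewrite big1 // => b bu; case: eqP => // e; rewrite -e (negbTE u) in bu.
rewrite (bigD1 (n%:R : 'Z_K)) //= eqxx big1 ?addr0 // => b /andP[_ /negbTE nb].
by rewrite eq_sym nb.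
Qed.

Lemma chi0M m n : chi0 (m * n) = chi0 m * chi0 n.
Proof. by rewrite /chi0 coprimeMr; case: coprime; case: coprime; rewrite ?mulr1 ?mulr0. Qed.

Lemma chi01 : chi0 1 = 1. Proof. by rewrite /chi0 coprimen1. Qed.

Lemma chi0_ge0 n : 0 <= chi0 n. Proof. by rewrite /chi0 ler0n. Qed.
Lemma chi0_le1 n : chi0 n <= 1. Proof. by rewrite /chi0 lern1 leq_b1. Qed.

Lemma cls_ge0 b n : 0 <= cls b n. Proof. by rewrite /cls ler0n. Qed.
Lemma cls_le1 b n : cls b n <= 1. Proof. by rewrite /cls lern1 leq_b1. Qed.

Lemma dconv_twist (chi : nat -> R) f g n : (forall m n, chi (m * n)%N = chi m * chi n) ->
  (0 < n)%N -> dconv (fun n => chi n * f n) (fun n => chi n * g n) n = chi n * dconv f g n.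
Proof.
move=> chiM n0; rewrite /dconv /dsum big_distrr /= big_nat_cond [RHS]big_nat_cond.
apply: eq_bigr => d /andP[_ dn]; rewrite -[in chi n](divnK dn) chiM; ring.
Qed.

Lemma count_cls b N : `|psum (cls b) N - N%:R / K%:R| <= 1.
Proof.
have K0 : (0 < K)%N by exact: ltnW.
have bK : (b < K)%N by have := ltn_ord b; rewrite [X in (_ < X)%N]Zp_cast.
have clsE n : cls b n = (K %| n + (K - b))%:R.
  rewrite /cls; congr (nat_of_bool _)%:R; apply/eqP/idP => [<-|h].
    rewrite val_Zp_nat //; have -> : (n + (K - n %% K) = n %/ K * K + K)%N.
      by rewrite {1}(divn_eq n K) -addnA subnKC // ltnW // ltn_pmod.
    by rewrite dvdn_add ?dvdnn ?dvdn_mull.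
  apply/val_inj; rewrite /= val_Zp_nat //.
  have : (n + (K - b) + b) = b %[mod K] by rewrite -modnDml (eqP h) add0n.
  by rewrite -addnA subnK ?(ltnW bK) // modnDr (modn_small bK).
have -> : psum (cls b) N = ((N + (K - b)) %/ K)%:R - ((K - b) %/ K)%:R.
  elim: N => [|N IH]; first by rewrite psum0 add0n subrr.
  by rewrite psumS IH clsE addSn divnS // natrD; ring.
have h1 := divn_natr_le R (N + (K - b)) K0; have h2 := divn_natr_gt R (N + (K - b)) K0.
have h3 := divn_natr_le R (K - b) K0; have h4 := divn_natr_gt R (K - b) K0.
have e : (N + (K - b))%:R / K%:R = N%:R / K%:R + (K - b)%:R / K%:R :> R by rewrite natrD mulrDl.
by rewrite ler_norml; apply/andP; split; lra.
Qed.

Definition phiK : R := (#|[pred b : 'Z_K | b \is a GRing.unit]|)%:R.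

Lemma phiK_gt0 : 0 < phiK.
Proof. by rewrite /phiK ltr0n; apply/card_gt0P; exists 1; rewrite inE unitr1. Qed.

Definition kapK : R := phiK / K%:R.

Lemma kapK_gt0 : 0 < kapK.
Proof. by rewrite divr_gt0 ?phiK_gt0 // ltr0n ltnW. Qed.

Lemma psum_chi0_sum f N : \sum_(1 <= n < N.+1) chi0 n * f n =
  \sum_(b : 'Z_K | b \is a GRing.unit) \sum_(1 <= n < N.+1) cls b n * f n.
Proof.
rewrite exchange_big /=; apply: eq_bigr => n _; by rewrite chi0_sum big_distrl.
Qed.

Lemma sum_unit_const (x : R) : \sum_(b : 'Z_K | b \is a GRing.unit) x = phiK * x.
Proof. by rewrite /phiK mulr_natl -sumr_const; apply: eq_bigl => b. Qed.

Lemma count_chi0 N : `|psum (fun n => chi0 n - kapK) N| <= phiK.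
Proof.
have -> : psum (fun n => chi0 n - kapK) N =
   \sum_(b : 'Z_K | b \is a GRing.unit) (psum (cls b) N - N%:R / K%:R).
  rewrite /psum big_split /= sumrN [in LHS]big_const_nat iter_addr_0 subSS subn0.
  rewrite big_split /= sumrN sum_unit_const.
  congr (_ - _); last by rewrite /kapK -mulr_natl; ring.
  by rewrite exchange_big /=; apply: eq_bigr => n _; exact: chi0_sum.
apply: le_trans (ler_norm_sum _ _ _) _; rewrite -[leRHS]mulr1 -sum_unit_const.
by apply: ler_sum => b _; exact: count_cls.
Qed.

Lemma psum_sub_bound c w (C : R) N : (forall N, `|psum c N| <= C) -> (forall n, 0 <= w n) ->
  (forall n, (0 < n)%N -> w n <= w n.+1) ->
  `|\sum_(1 <= n < N.+1) c n * w n| <= 2 * C * w N.+1.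
Proof.
move=> hC w0 wi; rewrite sum_by_parts; apply: le_trans (ler_normD _ _) _.
have h1 : `|psum c N * w N.+1| <= C * w N.+1.
  by rewrite normrM (ger0_norm (w0 _)) ler_wpM2r.
have h2 : `|\sum_(1 <= n < N.+1) psum c n * (w n - w n.+1)| <= C * (w N.+1 - w 1%N).
  apply: le_trans (ler_norm_sum _ _ _) _.
  have -> : w N.+1 - w 1%N = - (w 1%N - w N.+1) by ring.
  rewrite -(telescope_nat w) -sumrN mulr_sumr big_nat [leRHS]big_nat.
  apply: ler_sum => n /andP[n0 _]; rewrite normrM opprB distrC (@ger0_norm _ (_ - _)) ?subr_ge0 ?wi //.
  by rewrite ler_wpM2r // subr_ge0 wi.
have C0 : 0 <= C by apply: le_trans (hC 0%N).
have := mulr_ge0 C0 (w0 1%N); move: h1 h2; nra.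
Qed.

(** Halving, as for the central binomial coefficient: with [h = M %/ 2], the quantity
    [M %/ d - 2 * (h %/ d)] is nonnegative, and at least [1] when [h < d <= M]. *)
Lemma chebyshev N : psum mangoldt N <= 10 * N%:R.
Proof.
have E M : psum lnn M = \sum_(1 <= d < M.+1) mangoldt d * (M %/ d)%:R.
  transitivity (psum (dconv mangoldt (fun=> 1)) M).
    by apply: eq_psum => n n0; rewrite dconvC // dconv1_mangoldt.
  rewrite psum_dconv; apply: eq_bigr => d _; congr (_ * _).
  by rewrite /psum big_const_nat iter_addr_0 subSS subn0.
elim/ltn_ind: N => N IH.
case: N IH => [|[|N]] IH; first by rewrite psum0 mulr0.
  by rewrite /psum big_nat1 /mangoldt /dconv dsum_le0 divn1 lnn1 mulr0; lra.
set M := N.+2; set h := (M %/ 2)%N.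
have hM : (h <= M)%N by exact: leq_div.
have h0 : (0 < h)%N by rewrite divn_gt0.
have step : psum mangoldt M - psum mangoldt h <= psum lnn M - 2 * psum lnn h.
  rewrite !E.
  have ext : \sum_(1 <= d < h.+1) mangoldt d * (h %/ d)%:R = \sum_(1 <= d < M.+1) mangoldt d * (h %/ d)%:R.
    rewrite [RHS](@big_cat_nat _ _ _ h.+1) //= [X in _ + X]big_nat [X in _ + X]big1 ?addr0 // => d.
    by case/andP=> hd _; rewrite divn_small ?mulr0.
  have ext2 : psum mangoldt h = \sum_(1 <= d < M.+1) mangoldt d * (d <= h)%N%:R.
    rewrite [RHS](@big_cat_nat _ _ _ h.+1) //= [X in _ + X]big_nat [X in _ + X]big1 ?addr0; last first.
      by move=> d /andP[hd _]; rewrite leqNgt hd mulr0.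
    by apply: eq_big_nat => d /andP[_ hd]; rewrite -ltnS hd mulr1.
  rewrite ext ext2 mulr_sumr /psum -!sumrB big_nat [leRHS]big_nat.
  apply: ler_sum => d /andP[d0 dM].
  rewrite -{1}[mangoldt d]mulr1 -mulrBr mulrCA -mulrBr ler_wpM2l ?mangoldt_ge0 //.
  suff : (1 + 2 * (h %/ d) <= M %/ d + (d <= h))%N.
    by rewrite -(ler_nat R) [X in X <= _]natrD [X in _ <= X]natrD natrM; lra.
  have : (2 * (h %/ d) <= M %/ d)%N.
    by rewrite leq_divRL // -mulnA (leq_trans (leq_mul (leqnn 2) (leq_divM h d))) // mulnC leq_divM.
  have [dh|dh] := leqP d h; first by rewrite addn1 add1n ltnS.
  by rewrite (divn_small dh) muln0 !addn0 divn_gt0.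
have hh : M%:R <= 2 * h%:R + 1 :> R.
  by rewrite -natrM natr1 ler_nat /h; lia.
have hh2 : 2 * h%:R <= M%:R :> R by rewrite -natrM ler_nat mulnC leq_divM.
have up := @psum_lnn_le R M isT; have lo := @psum_lnn_ge R h h0.
have lnM : lnn M - lnn h <= 2.
  have hr : 1 <= h%:R :> R by rewrite ler1n.
  rewrite /lnn -ln_div ?posrE ?ltr0n //; apply: le_trans (ln_le_subr1 _) _.
    by rewrite divr_gt0 ?ltr0n.
  rewrite lerBlDr ler_pdivrMr ?ltr0n //; lra.
have lM : lnn M <= M%:R - 1 by apply: ln_le_subr1; rewrite ltr0n.
have IHh := IH h (@ltn_Pdiv M 2 isT isT).
have lh := lnn_ge0 R h; have lM0 := lnn_ge0 R M.
have q : M%:R * lnn M - 2 * (h%:R * lnn h) <= M%:R - 1 + 2 * M%:R.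
  have -> : M%:R * lnn M - 2 * (h%:R * lnn h) = (M%:R - 2 * h%:R) * lnn M + 2 * h%:R * (lnn M - lnn h) by ring.
  apply: lerD.
    apply: le_trans lM; rewrite -[leRHS]mul1r ler_wpM2r //; lra.
  have : 2 * h%:R * (lnn M - lnn h) <= 2 * h%:R * 2 by rewrite ler_wpM2l // mulr_ge0.
  lra.
lra.
Qed.

Definition mangoldt0 n := chi0 n * mangoldt n.

Lemma mangoldt0_ge0 n : 0 <= mangoldt0 n.
Proof. by rewrite mulr_ge0 ?chi0_ge0 ?mangoldt_ge0. Qed.

Lemma mangoldt0_le n : mangoldt0 n <= mangoldt n.
Proof. by rewrite -[leRHS]mul1r ler_wpM2r ?mangoldt_ge0 ?chi0_le1. Qed.

Lemma chebyshev0 N : psum mangoldt0 N <= 10 * N%:R.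
Proof. apply: le_trans (chebyshev N); apply: ler_sum => n _; exact: mangoldt0_le. Qed.

Lemma psum_mangoldt0_ge0 N : 0 <= psum mangoldt0 N.
Proof. by rewrite /psum sumr_ge0 // => i _; rewrite mangoldt0_ge0. Qed.

Lemma dconv_chi0_mangoldt0 n : (0 < n)%N -> dconv chi0 mangoldt0 n = chi0 n * lnn n.
Proof.
move=> n0; rewrite -dconv1_mangoldt // -dconv_twist //; last exact: chi0M.
by apply: eq_dconv => // k _; rewrite mulr1.
Qed.

Lemma psum_chi0_lnn N : psum (fun n => chi0 n * lnn n) N =
  \sum_(1 <= d < N.+1) mangoldt0 d * psum chi0 (N %/ d).
Proof.
rewrite -psum_dconv; apply: eq_psum => n n0; rewrite dconvC //; exact/esym/dconv_chi0_mangoldt0.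
Qed.

Lemma psum_chi0_lnn_close N :
  `|psum (fun n => chi0 n * lnn n) N - kapK * psum lnn N| <= 2 * phiK * lnn N.+1.
Proof.
have -> : psum (fun n => chi0 n * lnn n) N - kapK * psum lnn N =
  \sum_(1 <= n < N.+1) (chi0 n - kapK) * lnn n.
  by rewrite /psum mulr_sumr -sumrB; apply: eq_bigr => n _; rewrite mulrBl.
apply: (psum_sub_bound (c := fun n => chi0 n - kapK)).
- exact: count_chi0.
- exact: lnn_ge0.
- by move=> n n0; exact: lnn_le.
Qed.

Lemma psum_chi0_close N : `|psum chi0 N - kapK * N%:R| <= phiK.
Proof.
apply: le_trans (count_chi0 N); rewrite /psum big_split /= sumrN big_const_nat iter_addr_0.
by rewrite subSS subn0 mulr_natr.
Qed.

Lemma lnnS_le N : (0 < N)%N -> lnn N.+1 <= 1 + lnn N.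
Proof.
move=> N0; have := @lnn_incr_le R N N0.
have : N%:R^-1 <= 1 :> R by rewrite invf_le1 ?ltr0n // ler1n.
lra.
Qed.

(** The sum of [chi0 n * ln n] is evaluated twice: directly, as [kapK * N * ln N + O(N)], and
    through [mangoldt0], as [kapK * N] times the sum in question plus [O(N)] by Chebyshev's
    bound. *)
Lemma mertens0 : exists C : R, forall N, (0 < N)%N ->
  `|\sum_(1 <= n < N.+1) mangoldt0 n / n%:R - lnn N| <= C.
Proof.
have k0 := kapK_gt0; have p0 := phiK_gt0.
exists ((3 + 10 * (phiK + kapK) / kapK) + 2 * phiK / kapK) => N N0.
set S := \sum_(_ <= _ < _) _.
have NR : 1 <= N%:R :> R by rewrite ler1n.
have e1 : `|psum (fun n => chi0 n * lnn n) N - kapK * N%:R * S| <= (phiK + kapK) * (10 * N%:R).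
  rewrite psum_chi0_lnn /S mulr_sumr -sumrB; apply: le_trans (ler_norm_sum _ _ _) _.
  apply: (@le_trans _ _ (\sum_(1 <= d < N.+1) (phiK + kapK) * mangoldt0 d)); last first.
    rewrite -mulr_sumr ler_wpM2l ?chebyshev0 //; lra.
  rewrite big_nat [leRHS]big_nat; apply: ler_sum => d /andP[d0 _].
  have -> : mangoldt0 d * psum chi0 (N %/ d) - kapK * N%:R * (mangoldt0 d / d%:R) =
     mangoldt0 d * (psum chi0 (N %/ d) - kapK * (N%:R / d%:R)) by ring.
  rewrite normrM (ger0_norm (mangoldt0_ge0 _)) mulrC ler_wpM2r ?mangoldt0_ge0 //.
  have := psum_chi0_close (N %/ d); have := divn_natr_le R N d0; have := divn_natr_gt R N d0.
  set y := N%:R / d%:R; set m := (N %/ d)%:R => h1 h2; rewrite !ler_norml => /andP[h3 h4].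
  apply/andP; split; nra.
have e2 := psum_chi0_lnn_close N; have e3 := @psum_lnn_ge R N N0; have e4 := @psum_lnn_le R N N0.
have lN : lnn N <= N%:R - 1 by apply: ln_le_subr1; lra.
have e5 := lnnS_le N0; have lN0 := lnn_ge0 R N.
have kN : 0 < kapK * N%:R by apply: mulr_gt0 => //; lra.
rewrite -(ler_pM2l kN) -{1}[kapK * _](gtr0_norm kN) -normrM.
have -> : kapK * N%:R * (3 + 10 * (phiK + kapK) / kapK + 2 * phiK / kapK) =
  3 * kapK * N%:R + 10 * (phiK + kapK) * N%:R + 2 * phiK * N%:R.
  by field; rewrite gt_eqF.
have e6 : 2 * phiK * lnn N.+1 <= 2 * phiK * N%:R by rewrite ler_wpM2l //; lra.
have e7 : `|kapK * psum lnn N - kapK * (N%:R * lnn N)| <= kapK * (3 * N%:R).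
  by rewrite -mulrBr normrM (gtr0_norm k0) ler_pM2l // ler_norml; apply/andP; split; lra.
move: e1 e2 e6 e7; set A := psum _ N; set B := psum lnn N.
rewrite !ler_norml => /andP[a1 a2] /andP[b1 b2] c /andP[d1 d2].
apply/andP; split; lra.
Qed.

End ResidueClasses.

Lemma chi0E (R : realType) K n : chi0 R K n = (coprime K n)%:R. Proof. by []. Qed.

Lemma mangoldt0E (R : realType) K n : mangoldt0 R K n = chi0 R K n * mangoldt R n. Proof. by []. Qed.

Lemma selbergDef (R : realType) n :
  selberg R n = lnn R n * mangoldt R n + dconv (mangoldt R) (mangoldt R) n.
Proof. by []. Qed.

Lemma clsE (R : realType) K (b : 'Z_K) n : cls R b n = ((n%:R : 'Z_K) == b)%:R. Proof. by []. Qed.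

Section SelbergFormula.
Variable R : realType.
Variable K : nat.
Hypothesis K1 : (1 < K)%N.
Local Notation lnn := (lnn R).
Local Notation mu := (mu R).
Local Notation mangoldt := (mangoldt R).
Local Notation chi0 := (chi0 R K).
Local Notation kapK := (kapK R K).
Local Notation phiK := (phiK R K).
Local Notation mangoldt0 := (mangoldt0 R K).
Local Notation selberg := (selberg R).
Local Notation cls := (@cls R K).

Lemma sum_mangoldt0_ln N : (0 < N)%N ->
  `|lnn N * psum mangoldt0 N - psum (fun n => lnn n * mangoldt0 n) N| <= 10 * N%:R.
Proof.
move=> N0.
have -> : lnn N * psum mangoldt0 N - psum (fun n => lnn n * mangoldt0 n) N =
   \sum_(1 <= n < N.+1) mangoldt0 n * (lnn N - lnn n).
  by rewrite /psum mulr_sumr -sumrB; apply: eq_bigr => n _; ring.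
rewrite ger0_norm; last first.
  rewrite big_nat sumr_ge0 // => n /andP[n0 nN].
  by rewrite mulr_ge0 ?mangoldt0_ge0 // subr_ge0 lnn_le.
rewrite (sum_by_parts mangoldt0 (fun n => lnn N - lnn n)).
have h1 : psum mangoldt0 N * (lnn N - lnn N.+1) <= 0.
  by rewrite mulr_ge0_le0 ?psum_mangoldt0_ge0 // subr_le0 lnn_le.
rewrite -[leRHS]add0r; apply: lerD => //.
apply: (@le_trans _ _ (\sum_(1 <= n < N.+1) 10)); last first.
  by rewrite big_const_nat iter_addr_0 subSS subn0 mulr_natr.
rewrite big_nat [leRHS]big_nat; apply: ler_sum => n /andP[n0 _].
have -> : lnn N - lnn n - (lnn N - lnn n.+1) = lnn n.+1 - lnn n by ring.
have nR : 0 < n%:R :> R by rewrite ltr0n.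
apply: (@le_trans _ _ (10 * n%:R * n%:R^-1)).
  apply: ler_pM; rewrite ?psum_mangoldt0_ge0 ?subr_ge0 ?lnn_le ?lnn_incr_le //.
  exact: chebyshev0.
by rewrite -mulrA divff ?mulr1 // gt_eqF.
Qed.

(** Split [ln (N / d)] as [(ln N - ln n) + ln (n / d)]: the first part meets the inversion formula,
    the second one gives [mangoldt]. *)
Lemma dsum_mu_ln_div (N n : nat) : (0 < N)%N -> (0 < n)%N ->
  dsum (fun d => mu d * ln (N%:R / d%:R)) n = lnn N * dunit R n + mangoldt n.
Proof.
move=> N0 n0.
rewrite (@eq_dsum _ _ (fun d => (lnn N - lnn n) * (mu d * 1) + mu d * lnn (n %/ d)%N)) //; last first.
  move=> d d0 dn; have q0 : (0 < n %/ d)%N by rewrite divn_gt0 //; exact: dvdn_leq.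
  have -> : lnn n = lnn d + lnn (n %/ d)%N by rewrite -lnnM // mulnC divnK.
  rewrite ln_div ?posrE ?ltr0n // /lnn; ring.
have hd := @dconv_mu1 R n n0; rewrite /dconv /dsum in hd.
rewrite /dsum big_split /= -mulr_sumr hd; congr (_ + _); rewrite mulrBl /dunit; case: eqP => [->|]; last by rewrite !mulr0 subr0.
by rewrite lnn1 mul0r subr0.
Qed.

(* By the Tatuzawa-Iseki identity. *)
Lemma selberg_coprime : exists C : R, forall N, (0 < N)%N ->
  `|psum (fun n => chi0 n * selberg n) N - 2 * N%:R * lnn N| <= C * N%:R.
Proof.
have k0 := kapK_gt0 R K1; have p0 := phiK_gt0 R K.
have [l hl] := sum_harmonic_cvg (count_chi0 R K1).
have [ge ge0 hge] := @harm_euler_real R.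
have [Cm hCm] := mertens0 R K1.
pose g := l + kapK * ge.
(* Chosen so that [c * psum chi0] cancels the linear terms of the other two sums in [inner], namely
   [- kapK * x] from Stirling's formula and [- g * y] from the harmonic sum. *)
pose c := 1 + g / kapK.
have Cm0 : 0 <= Cm by have := hCm 1%N isT; apply: le_trans.
pose psi0 := psum mangoldt0.
pose C1 := 8 * kapK + 6 * phiK + `|g| + phiK * `|c|.
have C10 : 0 <= C1 by rewrite /C1 !addr_ge0 ?mulr_ge0 //; lra.
exists (32 * C1 + 10 + Cm + `|c| + 10 * `|c|) => N N0.
pose phi n := psi0 (N %/ n)%N - N%:R / n%:R + c.
pose L d := ln (N%:R / d%:R : R).
(* Evaluated twice: regrouped by [n = d * m] it contains Selberg's sum, while the inner sums over
   [m] are only logarithmic in [N / d], so that [A = O(N)]. *)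
pose A := \sum_(1 <= d < N.+1) chi0 d * (mu d * L d) *
   \sum_(1 <= m < (N %/ d).+1) chi0 m * phi (d * m)%N.
have AE : A = lnn N * phi 1%N + \sum_(1 <= n < N.+1) mangoldt0 n * phi n.
  transitivity (\sum_(1 <= n < N.+1) chi0 n * phi n * (lnn N * dunit R n + mangoldt n)).
    rewrite /A; under eq_bigr do rewrite mulr_sumr.
    rewrite sum_hyperbola; apply: eq_big_nat => n /andP[n0 _].
    rewrite -dsum_mu_ln_div // /dsum mulr_sumr; apply: eq_bigr => d dn.
    by rewrite [(d * _)%N]mulnC divnK // -[in chi0 n](divnK dn) chi0M -/(L d); ring.
  rewrite (eq_bigr (fun n => chi0 n * phi n * lnn N * dunit R n + mangoldt0 n * phi n)); last first.
    by move=> n _; rewrite mangoldt0E; ring.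
  rewrite big_split /=; congr (_ + _).
  rewrite big_ltn // /dunit eqxx chi01 mul1r mulr1 mulrC big_nat big1 ?addr0 // => n.
  by case/andP=> n1 _; rewrite gtn_eqF // mulr0.
have inner d : (0 < d)%N -> (d <= N)%N ->
   `|\sum_(1 <= m < (N %/ d).+1) chi0 m * phi (d * m)%N| <= C1 * (1 + L d).
  move=> d0 dN; set M := (N %/ d)%N.
  have M0 : (0 < M)%N by rewrite divn_gt0.
  have -> : \sum_(1 <= m < M.+1) chi0 m * phi (d * m)%N =
    psum (fun n => chi0 n * lnn n) M - N%:R / d%:R * (\sum_(1 <= m < M.+1) chi0 m / m%:R)
      + c * psum chi0 M.
    rewrite psum_chi0_lnn -psum_dconv -(@eq_psum _ (dconv chi0 mangoldt0)); last by move=> n n0; rewrite dconvC.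
    rewrite psum_dconv mulr_sumr /psum [c * _]mulr_sumr -sumrB -big_split /=.
    apply: eq_big_nat => m /andP[m0 _]; rewrite /phi /psi0 /psum divnMA -/M natrM invfM; ring.
  have b1 := psum_chi0_lnn_close R K1 M.
  have b2 := @psum_lnn_ge R M M0; have b3 := @psum_lnn_le R M M0.
  have b4 := hge N d d0 dN; have b5 := hl M; have b6 := psum_chi0_close R K1 M.
  have b7 := lnnS_le R M0; have b8 := divn_natr_le R N d0; have b9 := divn_natr_gt R N d0.
  have Ld0 : 0 <= L d by exact: ln_div_ge0.
  have MR : 1 <= M%:R :> R by rewrite ler1n.
  have y0 : 0 < N%:R / d%:R :> R by rewrite divr_gt0 ?ltr0n.
  have lM : lnn M <= L d by rewrite /lnn /L ler_ln ?posrE // ltr0n.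
  have ly : L d - lnn M <= (M%:R)^-1.
    rewrite /L /lnn -ln_div ?posrE ?ltr0n //.
    apply: le_trans (ln_le_subr1 _) _; first by rewrite divr_gt0 // ltr0n.
    rewrite lerBlDr ler_pdivrMr ?ltr0n // mulrDl mulVf ?gt_eqF ?ltr0n // mul1r; clear -b9; lra.
  have hE : \sum_(1 <= m < M.+1) chi0 m / m%:R =
     \sum_(1 <= n < M.+1) (chi0 n - kapK) / n%:R + kapK * harm R M.
    by rewrite /harm mulr_sumr -big_split /=; apply: eq_bigr => m _; ring.
  move: b4 b5; rewrite -/M hE.
  set H := harm R M; set T := \sum_(1 <= n < M.+1) _.
  set y : R := N%:R / d%:R in b8 b9 y0 *; set x : R := M%:R in b2 b3 b6 b8 b9 ly MR *.
  rewrite -/(L d) => b4 b5.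
  have b5' : `|y * (T - l)| <= 2 * phiK.
    rewrite normrM (gtr0_norm y0).
    have x1 : M.+1%:R = x + 1 :> R by rewrite natr1.
    rewrite x1 in b5; apply: (@le_trans _ _ ((x + 1) * (2 * phiK / (x + 1)))).
      by apply: ler_pM => //; clear -b9 y0; lra.
    by rewrite mulrCA divff ?mulr1 // gt_eqF //; clear -MR; lra.
  have ly' : x * (L d - lnn M) <= 1.
    by have := ler_wpM2l (ltW (lt_le_trans ltr01 MR)) ly; rewrite divff // gt_eqF //; clear -MR; lra.
  have e1 : kapK * (psum lnn M) - y * (T + kapK * H) + c * (kapK * x) =
     kapK * (psum lnn M - x * lnn M + x) - y * (T - l) - kapK * (y * H - y * (L d + ge))
      - kapK * (y - x) * L d - kapK * (x * (L d - lnn M)) - g * (y - x).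
    have -> : c * (kapK * x) = kapK * x + g * x by rewrite /c; field; rewrite gt_eqF.
    by rewrite /g; ring.
  have z0 : 0 <= y - x by clear -b8; lra.
  have z1 : y - x <= 1 by clear -b9; lra.
  have e2 : `|kapK * (psum lnn M - x * lnn M + x)| <= kapK * (1 + L d).
    rewrite normrM (gtr0_norm k0) ler_pM2l //.
    clear -b2 b3 lM Ld0; rewrite ler_norml; apply/andP; split; lra.
  have e3 : `|kapK * (y * H - y * (L d + ge))| <= kapK * 4.
    by rewrite normrM (gtr0_norm k0) ler_pM2l.
  have e4 : `|kapK * (y - x) * L d| <= kapK * L d.
    rewrite ger0_norm; last by rewrite !mulr_ge0 // ltW.
    by rewrite -mulrA ler_pM2l // -[leRHS]mul1r ler_wpM2r.
  have e5 : `|kapK * (x * (L d - lnn M))| <= kapK.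
    have xl : 0 <= x * (L d - lnn M) by rewrite mulr_ge0 ?subr_ge0 // (le_trans ler01 MR).
    by rewrite (ger0_norm (mulr_ge0 (ltW k0) xl)); have := ler_wpM2l (ltW k0) ly'; rewrite mulr1.
  have e6 : `|g * (y - x)| <= `|g|.
    by rewrite normrM (ger0_norm z0) -[leRHS]mulr1 ler_wpM2l.
  have e7 : `|psum (fun n => chi0 n * lnn n) M - kapK * psum lnn M| <= 2 * phiK * (1 + L d).
    by apply: le_trans b1 _; rewrite ler_wpM2l //; clear -p0 b7 lM; lra.
  have e8 : `|c * (psum chi0 M - kapK * x)| <= `|c| * phiK by rewrite normrM ler_wpM2l.
  have q1 : 0 <= `|g| * L d by rewrite mulr_ge0.
  have q2 : 0 <= `|c| * phiK * L d by rewrite !mulr_ge0 // ltW.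
  have q3 : 0 <= kapK * L d by rewrite mulr_ge0 // ltW.
  have q4 : 0 <= phiK * L d by rewrite mulr_ge0 // ltW.
  move: e1 e2 e3 e4 e5 e6 e7 e8 b5'.
  set a1 := psum (fun n => chi0 n * lnn n) M; set a2 := psum chi0 M; set a3 := psum lnn M.
  set t2 := kapK * (a3 - _ + _); set t3 := kapK * (y * H - _); set t4 := kapK * (y - x) * L d.
  set t5 := kapK * (x * _); set t6 := g * (y - x); set t8 := c * (a2 - _); set t9 := y * (T - l).
  move=> e1 /ler_normlP[e2 e2'] /ler_normlP[e3 e3'] /ler_normlP[e4 e4'] /ler_normlP[e5 e5']
    /ler_normlP[e6 e6'] /ler_normlP[e7 e7'] /ler_normlP[e8 e8'] /ler_normlP[e9 e9'].
  have -> : a1 - y * (T + kapK * H) + c * a2 = (a1 - kapK * a3) + (t2 - t9 - t3 - t4 - t5 - t6) + t8.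
    by rewrite -e1 /t8; ring.
  rewrite /C1; clear -e2 e2' e3 e3' e4 e4' e5 e5' e6 e6' e7 e7' e8 e8' e9 e9' q1 q2 q3 q4 k0 p0.
  apply/ler_normlP; split; lra.
have Abound : `|A| <= 32 * C1 * N%:R.
  apply: le_trans (ler_norm_sum _ _ _) _.
  apply: (@le_trans _ _ (\sum_(1 <= d < N.+1) C1 * (1 + ln (N%:R / d%:R)) ^+ 2)); last first.
    by rewrite -mulr_sumr -mulrA mulrCA ler_wpM2l // sum_ln_div_sqr.
  rewrite big_nat [leRHS]big_nat; apply: ler_sum => d /andP[d0]; rewrite ltnS => dN.
  have Ld0 : 0 <= L d by exact: ln_div_ge0.
  have h1 : `|chi0 d * (mu d * L d)| <= L d.
    rewrite 2!normrM (ger0_norm Ld0) (ger0_norm (chi0_ge0 _ _ _)) mulrA -[leRHS]mul1r ler_wpM2r //.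
    by rewrite -[leRHS]mulr1 ler_pM ?chi0_ge0 ?chi0_le1 ?norm_mu.
  rewrite normrM; apply: le_trans (ler_pM _ _ h1 (inner d d0 dN)) _ => //.
  rewrite -/(L d) mulrCA ler_wpM2l // expr2 ler_wpM2r //; clear -Ld0; lra.
have lN : lnn N <= N%:R - 1 by apply: ln_le_subr1; rewrite ltr0n.
have lN0 := lnn_ge0 R N.
have SE : psum (fun n => chi0 n * selberg n) N = psum (fun n => lnn n * mangoldt0 n) N +
    \sum_(1 <= n < N.+1) mangoldt0 n * psi0 (N %/ n)%N.
  rewrite -psum_dconv /psum -big_split /=; apply: eq_big_nat => n /andP[n0 _].
  rewrite selbergDef dconv_twist //; last exact: chi0M.
  by rewrite mangoldt0E; ring.
have PE : \sum_(1 <= n < N.+1) mangoldt0 n * phi n = \sum_(1 <= n < N.+1) mangoldt0 n * psi0 (N %/ n)%N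
   - N%:R * (\sum_(1 <= n < N.+1) mangoldt0 n / n%:R) + c * psi0 N.
  rewrite /psi0 {2}/psum !mulr_sumr -sumrB -big_split /=; apply: eq_bigr => n _; rewrite /phi /psi0; ring.
rewrite PE /phi divn1 divr1 in AE.
have f1 := sum_mangoldt0_ln N0; have f2 := hCm N N0.
have f3 : `|N%:R * (\sum_(1 <= n < N.+1) mangoldt0 n / n%:R - lnn N)| <= N%:R * Cm.
  by rewrite normrM normr_nat ler_wpM2l.
have f4 : `|c * lnn N| <= `|c| * N%:R.
  rewrite normrM (ger0_norm lN0) ler_wpM2l //; clear -lN; lra.
have f5 : `|c * psi0 N| <= `|c| * (10 * N%:R).
  by rewrite normrM (ger0_norm (psum_mangoldt0_ge0 _ _ _)) ler_wpM2l // chebyshev0.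
rewrite SE; move: AE Abound f1 f3 f4 f5; rewrite -/psi0.
set s1 := \sum_(1 <= n < N.+1) mangoldt0 n * _; set s2 := \sum_(1 <= n < N.+1) mangoldt0 n / _.
set s3 := psum _ N; set u := psi0 N.
move=> AE /ler_normlP[a1 a1'] /ler_normlP[a2 a2'] /ler_normlP[a3 a3'] /ler_normlP[a4 a4'] /ler_normlP[a5 a5'].
apply/ler_normlP; split; lra.
Qed.

Lemma lnn_sqr_le m n : (0 < m)%N -> (m <= n)%N -> lnn m ^+ 2 <= lnn n ^+ 2.
Proof.
move=> m0 mn; rewrite ler_sqr ?nnegrE ?lnn_ge0 //; exact: lnn_le.
Qed.

Lemma psum_cls_selberg (b : 'Z_K) N : b \is a GRing.unit ->
  psum (fun n => cls b n * selberg n) N =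
  \sum_(1 <= d < N.+1) chi0 d * mu d * \sum_(1 <= m < (N %/ d).+1) cls (b / d%:R) m * lnn m ^+ 2.
Proof.
move=> bu.
transitivity (\sum_(1 <= d < N.+1) \sum_(1 <= m < (N %/ d).+1) mu d * (cls b (d * m) * lnn m ^+ 2)).
  rewrite sum_hyperbola; apply: eq_big_nat => n /andP[n0 _].
  rewrite selbergE // /dconv /dsum mulr_sumr; apply: eq_bigr => d dn.
  by rewrite [(d * _)%N]mulnC divnK // mulrCA.
apply: eq_bigr => d _; rewrite mulr_sumr; apply: eq_bigr => m _.
have -> : cls b (d * m) = chi0 d * cls (b / d%:R) m; last by ring.
rewrite clsE [cls (b / _) _]clsE chi0E -natr_unit // natrM.
have [u|u] := boolP ((d%:R : 'Z_K) \is a GRing.unit).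
  rewrite mul1r; congr (nat_of_bool _)%:R; apply/eqP/eqP => [<-|->].
    by rewrite [d%:R * _]mulrC mulrK.
  by rewrite mulrC divrK.
rewrite mul0r; case: eqP => // e; move: bu; rewrite -e unitrM (negbTE u) //.
Qed.

(* Residue classes interlace, so changing the class moves the inner sums of a monotone function by O(log^2) only. *)
Lemma selberg_class_close (b b' : 'Z_K) N : b \is a GRing.unit -> b' \is a GRing.unit ->
  `|psum (fun n => cls b n * selberg n) N - psum (fun n => cls b' n * selberg n) N| <= 256 * N%:R.
Proof.
move=> bu bu'; rewrite !psum_cls_selberg // -sumrB.
apply: le_trans (ler_norm_sum _ _ _) _.
apply: (@le_trans _ _ (\sum_(1 <= d < N.+1) 8 * (1 + ln (N%:R / d%:R)) ^+ 2)); last first.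
  by rewrite -mulr_sumr; have := sum_ln_div_sqr R N; lra.
rewrite big_nat [leRHS]big_nat; apply: ler_sum => d /andP[d0]; rewrite ltnS => dN.
rewrite -mulrBr normrM -[leRHS]mul1r ler_pM //.
  rewrite normrM (ger0_norm (chi0_ge0 _ _ _)) -[leRHS]mulr1.
  by rewrite ler_pM ?chi0_ge0 ?chi0_le1 ?norm_mu.
set M := (N %/ d)%N; have M0 : (0 < M)%N by rewrite divn_gt0.
rewrite -sumrB.
under eq_bigr do rewrite -mulrBl.
have hb : forall n, `|psum (fun n => cls (b / d%:R) n - cls (b' / d%:R) n) n| <= 2.
  move=> n; rewrite /psum sumrB.
  have /ler_normlP[h1 h1'] := count_cls R K1 (b / d%:R) n.
  have /ler_normlP[h2 h2'] := count_cls R K1 (b' / d%:R) n.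
  move: h1 h1' h2 h2'; rewrite /psum => *; apply/ler_normlP; split; lra.
apply: le_trans (psum_sub_bound (w := fun n => lnn n ^+ 2) M hb _ _) _.
- by move=> n; rewrite sqr_ge0.
- by move=> n n0; rewrite lnn_sqr_le.
have -> : 2 * 2 * lnn M.+1 ^+ 2 = 4 * lnn M.+1 ^+ 2 :> R by ring.
have h0 := lnnS_le R M0; have h1 := lnn_ge0 R M; have h1' := lnn_ge0 R M.+1.
have h2 : lnn M <= ln (N%:R / d%:R : R).
  rewrite /lnn ler_ln ?posrE ?divr_gt0 ?ltr0n //; first exact: divn_natr_le.
    exact: leq_trans dN.
have : lnn M.+1 ^+ 2 <= (1 + ln (N%:R / d%:R)) ^+ 2 by rewrite ler_sqr ?nnegrE; lra.
have := sqr_ge0 (1 + ln (N%:R / d%:R) : R); lra.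
Qed.

(** The [phiK] invertible classes add up to the sum of [selberg_coprime] and differ pairwise by
    [O(N)], so each carries an equal share of the main term. *)
Lemma selberg_class : exists C : R, forall (b : 'Z_K) N, b \is a GRing.unit -> (0 < N)%N ->
  `|psum (fun n => cls b n * selberg n) N - 2 / phiK * N%:R * lnn N| <= C * N%:R.
Proof.
have [C hC] := selberg_coprime; have p0 := phiK_gt0 R K.
exists (C / phiK + 256) => b N bu N0.
have := hC N N0; rewrite /psum psum_chi0_sum // -/(psum _ _) => h.
set S := psum _ N.
have h2 : `|\sum_(b : 'Z_K | b \is a GRing.unit) \sum_(1 <= n < N.+1) cls b n * selberg n - phiK * S|
   <= phiK * (256 * N%:R).
  rewrite -!sum_unit_const -sumrB; apply: le_trans (ler_norm_sum _ _ _) _.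
  by apply: ler_sum => b' bu'; exact: selberg_class_close.
rewrite -(ler_pM2l p0) -{1}(gtr0_norm p0) -normrM.
have -> : phiK * (S - 2 / phiK * N%:R * lnn N) = phiK * S - 2 * N%:R * lnn N.
  by field; rewrite gt_eqF.
have -> : phiK * ((C / phiK + 256) * N%:R) = C * N%:R + phiK * (256 * N%:R).
  by field; rewrite gt_eqF.
move: h h2; set t := \sum_(b | _) _; move=> /ler_normlP[a1 a1'] /ler_normlP[a2 a2'].
apply/ler_normlP; split; lra.
Qed.

End SelbergFormula.

(** * Selberg's inequality for Moebius sums in residue classes *)

Section MoebiusResidueClass.
Variable R : realType.
Variable K : nat.
Hypothesis K1 : (1 < K)%N.
Local Notation lnn := (lnn R).
Local Notation mu := (mu R).
Local Notation phiK := (phiK R K).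
Local Notation selberg := (selberg R).
Local Notation cls := (@cls R K).
Implicit Types (b a : 'Z_K) (F f : nat -> R).

Lemma cls_mul b (d m : nat) : b \is a GRing.unit ->
  cls b (d * m) = chi0 R K d * cls (b / d%:R) m.
Proof.
move=> bu; rewrite clsE [cls (b / _) _]clsE chi0E -natr_unit // natrM.
have [u|u] := boolP ((d%:R : 'Z_K) \is a GRing.unit).
  rewrite mul1r; congr (nat_of_bool _)%:R; apply/eqP/eqP => [<-|->].
    by rewrite [d%:R * _]mulrC mulrK.
  by rewrite mulrC divrK.
rewrite mul0r; case: eqP => // e; move: bu; rewrite -e unitrM (negbTE u) //.
Qed.

Definition Mcls b : nat -> R := psum (fun n => cls b n * mu n).

Lemma norm_cls_mu b n : `|cls b n * mu n| <= 1.
Proof.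
rewrite normrM (ger0_norm (cls_ge0 _ _ _)) -[leRHS]mulr1.
by rewrite ler_pM ?cls_ge0 ?cls_le1 ?norm_mu.
Qed.

Lemma Mcls_incr b n : `|Mcls b n.+1 - Mcls b n| <= 1.
Proof. by rewrite /Mcls psumS addrC addKr norm_cls_mu. Qed.

Lemma norm_Mcls b n : `|Mcls b n| <= n%:R.
Proof.
elim: n => [|n IH]; first by rewrite /Mcls psum0 normr0.
rewrite -(subrK (Mcls b n) (Mcls b n.+1)) -natr1 addrC.
by apply: le_trans (ler_normD _ _) _; rewrite lerD // Mcls_incr.
Qed.

Lemma psum_incr F n : F 0%N = 0 -> F n = psum (fun k => F k - F k.-1) n.
Proof.
move=> F0; elim: n => [|n IH]; first by rewrite psum0.
by rewrite psumS -IH /= addrC subrK.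
Qed.

Lemma sum_floor_swap (e : nat -> R) F N : F 0%N = 0 ->
  \sum_(1 <= d < N.+1) e d * F (N %/ d)%N =
  \sum_(1 <= k < N.+1) (F k - F k.-1) * psum e (N %/ k).
Proof.
move=> F0; under eq_bigr do rewrite (psum_incr _ F0) /psum mulr_sumr.
rewrite sum_hyperbola_swap; apply: eq_bigr => k _.
by rewrite mulr_sumr; apply: eq_bigr => d _; rewrite mulrC.
Qed.

(** Decomposing [F] into its increments turns the sum into partial sums of [e] at [N %/ k], whose
    bounds add up to a harmonic sum. It replaces coefficients by their mean when [e] is the
    difference. *)
Lemma sum_floor_bound (e : nat -> R) F (C : R) N : 0 <= C -> (forall D, `|psum e D| <= C * D%:R) ->
  F 0%N = 0 -> (forall n, `|F n.+1 - F n| <= 1) ->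
  `|\sum_(1 <= d < N.+1) e d * F (N %/ d)%N| <= C * N%:R * (1 + lnn N).
Proof.
move=> C0 he F0 hF; rewrite sum_floor_swap //; apply: le_trans (ler_norm_sum _ _ _) _.
apply: (@le_trans _ _ (C * N%:R * harm R N)); last first.
  by rewrite ler_wpM2l ?harm_le // mulr_ge0.
rewrite /harm mulr_sumr big_nat [leRHS]big_nat; apply: ler_sum => k /andP[k0 _].
rewrite normrM -[leRHS]mul1r ler_pM //; first by case: k k0.
apply: le_trans (he _) _; rewrite -mulrA ler_wpM2l //; exact: divn_natr_le.
Qed.

Lemma sum_unit_div a F : a \is a GRing.unit -> forall G : 'Z_K -> R,
  \sum_(b : 'Z_K | b \is a GRing.unit) G (a / b) = \sum_(b : 'Z_K | b \is a GRing.unit) G b.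
Proof.
move=> au G; rewrite [RHS](reindex_onto (fun b => a / b) (fun b => a / b)) /=; last first.
  by move=> b bu; rewrite invrM ?unitrV // invrK mulrCA divrr // mulr1.
apply: eq_bigl => b; rewrite unitrM au unitrV /=.
have [bu|//] := boolP (b \is a GRing.unit).
by rewrite invrM ?unitrV // invrK mulrCA divrr // mulr1 eqxx.
Qed.

(** Replacing [ln N ^ 2] by [ln n ^ 2] under the sum costs [O(N * ln N)]. Then [ln ^ 2 * mu] is [mu]
    convolved with [selberg'], which is dominated by [selberg], and the latter may be replaced in
    each class by its mean [2 / phiK * ln d]. *)
Lemma Mcls_selberg : exists C : R, forall a N, a \is a GRing.unit -> (0 < N)%N ->
  `|Mcls a N| * lnn N ^+ 2 <=
   2 / phiK * \sum_(b : 'Z_K | b \is a GRing.unit) \sum_(1 <= d < N.+1) lnn d * `|Mcls b (N %/ d)|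
   + C * N%:R * (1 + lnn N).
Proof.
have [C0 hC0] := selberg_class R K1; have p0 := phiK_gt0 R K.
have C00 : 0 <= C0.
  by have h := hC0 1 1%N (unitr1 _) isT; apply: le_trans (normr_ge0 _) (le_trans h _); rewrite mulr1.
pose C1 := C0 + 4 / phiK.
have C10 : 0 <= C1 by rewrite /C1 addr_ge0 // divr_ge0 // ltW.
exists (64 + phiK * C1) => a N au N0.
have lN0 := lnn_ge0 R N.
have s1 : `|Mcls a N * lnn N ^+ 2 - psum (fun n => cls a n * (lnn n ^+ 2 * mu n)) N|
   <= 64 * N%:R * (1 + lnn N).
  rewrite /Mcls /psum mulr_suml -sumrB; apply: le_trans (ler_norm_sum _ _ _) _.
  apply: (@le_trans _ _ (\sum_(1 <= d < N.+1) 2 * lnn N * (1 + ln (N%:R / d%:R)))).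
    rewrite big_nat [leRHS]big_nat; apply: ler_sum => n /andP[n0]; rewrite ltnS => nN.
    have -> : cls a n * mu n * lnn N ^+ 2 - cls a n * (lnn n ^+ 2 * mu n) =
      (cls a n * mu n) * ((lnn N - lnn n) * (lnn N + lnn n)) by ring.
    have l1 : 0 <= lnn N - lnn n by rewrite subr_ge0 lnn_le.
    have l2 := lnn_ge0 R n.
    have l3 : ln (N%:R / n%:R) = lnn N - lnn n by rewrite ln_div ?posrE ?ltr0n.
    rewrite normrM (@ger0_norm _ (_ * (_ + _))); last by rewrite mulr_ge0 // addr_ge0.
    apply: (@le_trans _ _ ((lnn N - lnn n) * (lnn N + lnn n))).
      by rewrite -[leRHS]mul1r ler_wpM2r ?norm_cls_mu // mulr_ge0 // addr_ge0.
    rewrite l3; nra.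
  rewrite -mulr_sumr; have := sum_ln_div R N => h.
  apply: (@le_trans _ _ (2 * lnn N * (32 * N%:R))); first by rewrite ler_wpM2l // mulr_ge0.
  have : 0 <= N%:R :> R by []. nra.
have s2 : `|psum (fun n => cls a n * (lnn n ^+ 2 * mu n)) N| <=
   \sum_(b : 'Z_K | b \is a GRing.unit) \sum_(1 <= d < N.+1) cls b d * selberg d * `|Mcls (a / b) (N %/ d)|.
  have -> : psum (fun n => cls a n * (lnn n ^+ 2 * mu n)) N =
     \sum_(1 <= d < N.+1) chi0 R K d * selberg' R d * Mcls (a / d%:R) (N %/ d).
    transitivity (\sum_(1 <= d < N.+1) \sum_(1 <= m < (N %/ d).+1) selberg' R d * (cls a (d * m) * mu m)).
      rewrite sum_hyperbola; apply: eq_big_nat => n /andP[n0 _].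
      rewrite lnn2_mu // dconvC // /dconv /dsum mulr_sumr; apply: eq_bigr => d dn.
      by rewrite [(d * _)%N]mulnC divnK // mulrCA.
    apply: eq_bigr => d _; rewrite /Mcls /psum mulr_sumr; apply: eq_bigr => m _.
    rewrite cls_mul //; ring.
  apply: le_trans (ler_norm_sum _ _ _) _.
  rewrite exchange_big /=; apply: ler_sum => d _.
  rewrite 2!normrM (ger0_norm (chi0_ge0 _ _ _)) chi0_sum // 2!mulr_suml; apply: ler_sum => b bu.
  rewrite [X in X <= _](_ : _ = cls b d * (`|selberg' R d| * `|Mcls (a / b) (N %/ d)|)); last first.
    by rewrite -mulrA clsE; case: eqP => [->|]; rewrite ?mul0r.
  by rewrite -mulrA ler_wpM2l ?cls_ge0 // ler_wpM2r // norm_selberg'.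
have s3 b : b \is a GRing.unit ->
   `|\sum_(1 <= d < N.+1) (cls b d * selberg d - 2 / phiK * lnn d) * `|Mcls (a / b) (N %/ d)| |
     <= C1 * N%:R * (1 + lnn N).
  move=> bu; apply: (sum_floor_bound (F := fun n => `|Mcls (a / b) n|)) => //.
  - move=> D; case: D => [|D]; first by rewrite psum0 normr0 mulr0.
    have h := hC0 b D.+1 bu isT.
    have h1 := @psum_lnn_ge R D.+1 isT; have h2 := @psum_lnn_le R D.+1 isT.
    have h3 : lnn D.+1 <= D.+1%:R - 1 by apply: ln_le_subr1; rewrite ltr0n.
    have -> : psum (fun d => cls b d * selberg d - 2 / phiK * lnn d) D.+1 =
      (psum (fun n => cls b n * selberg n) D.+1 - 2 / phiK * D.+1%:R * lnn D.+1)
       - 2 / phiK * (psum lnn D.+1 - D.+1%:R * lnn D.+1).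
      rewrite {1}/psum sumrB -mulr_sumr -/(psum _ _) -/(psum _ _); ring.
    apply: le_trans (ler_normB _ _) _; rewrite /C1 [(C0 + _) * _]mulrDl lerD //.
    have q0 : 0 < 2 / phiK by rewrite divr_gt0.
    rewrite normrM (gtr0_norm q0) (_ : 4 / phiK * _ = 2 / phiK * (2 * D.+1%:R)); last by ring.
    rewrite ler_pM2l // ler_norml; apply/andP; split; lra.
  - by rewrite /Mcls psum0 normr0.
  - by move=> n; apply: le_trans (ler_dist_dist _ _) (Mcls_incr _ _).
apply: (@le_trans _ _ (`|Mcls a N * lnn N ^+ 2|)); first by rewrite normrM (ger0_norm (sqr_ge0 _)).
have s4 : \sum_(b : 'Z_K | b \is a GRing.unit) \sum_(1 <= d < N.+1) cls b d * selberg d * `|Mcls (a / b) (N %/ d)|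
   <= \sum_(b : 'Z_K | b \is a GRing.unit) (2 / phiK * (\sum_(1 <= d < N.+1) lnn d * `|Mcls (a / b) (N %/ d)|)
     + C1 * N%:R * (1 + lnn N)).
  apply: ler_sum => b bu; have := s3 b bu.
  rewrite (eq_bigr (fun d => cls b d * selberg d * `|Mcls (a / b) (N %/ d)| -
    2 / phiK * (lnn d * `|Mcls (a / b) (N %/ d)|))) => [|d _]; last by ring.
  by rewrite sumrB -mulr_sumr => /ler_normlP[_]; rewrite lerBlDl.
move: s4; rewrite big_split /= sum_unit_const -mulr_sumr.
rewrite (sum_unit_div (fun=> 0) au (fun b => \sum_(1 <= d < N.+1) lnn d * `|Mcls b (N %/ d)|)) => s4.
have := ler_normD (Mcls a N * lnn N ^+ 2 - psum (fun n => cls a n * (lnn n ^+ 2 * mu n)) N)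
  (psum (fun n => cls a n * (lnn n ^+ 2 * mu n)) N); rewrite subrK => s5.
apply: le_trans s5 _; apply: le_trans (lerD s1 (le_trans s2 s4)) _.
lra.
Qed.

(** Summation by parts is done twice: first the increments of [F] multiply partial sums of the
    logarithm, which Stirling's formula makes smooth; then the differences return to the smooth
    factor, so that only the values of [F] remain. *)
Lemma sum_ln_floor F N : (0 < N)%N -> F 0%N = 0 -> (forall n, 0 <= F n) ->
  (forall n, `|F n.+1 - F n| <= 1) ->
  \sum_(1 <= d < N.+1) lnn d * F (N %/ d)%N <=
  N%:R * \sum_(1 <= k < N.+1) F k / (k%:R * k.+1%:R) * ln (N%:R / k%:R) + 64 * N%:R.
Proof.
move=> N0 F0 Fp hF; rewrite sum_floor_swap //.
have NR : 0 < N%:R :> R by rewrite ltr0n.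
(* Stirling's approximation of [psum lnn (N %/ k)]. *)
pose g k : R := N%:R / k%:R * (ln (N%:R / k%:R) - 1).
have s1 : \sum_(1 <= k < N.+1) (F k - F k.-1) * psum lnn (N %/ k) <=
   \sum_(1 <= k < N.+1) (F k - F k.-1) * g k + 64 * N%:R.
  rewrite -lerBlDl -sumrB.
  apply: (@le_trans _ _ (\sum_(1 <= k < N.+1) 2 * (1 + ln (N%:R / k%:R)))); last first.
    rewrite -mulr_sumr; have := sum_ln_div R N; lra.
  rewrite big_nat [leRHS]big_nat; apply: ler_sum => k /andP[k0]; rewrite ltnS => kN.
  rewrite -mulrBr; apply: le_trans (ler_norm _) _; rewrite normrM -[leRHS]mul1r.
  apply: ler_pM => //; first by case: k k0 {kN}.
  set M := (N %/ k)%N; have M0 : (0 < M)%N by rewrite divn_gt0.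
  have b2 := @psum_lnn_ge R M M0; have b3 := @psum_lnn_le R M M0.
  have b8 := divn_natr_le R N k0; have b9 := divn_natr_gt R N k0.
  have L0 := ln_div_ge0 R k0 kN; have MR : 1 <= M%:R :> R by rewrite ler1n.
  have y0 : 0 < N%:R / k%:R :> R by rewrite divr_gt0 ?ltr0n.
  have lM : lnn M <= ln (N%:R / k%:R) by rewrite /lnn ler_ln ?posrE // ltr0n.
  have ly : ln (N%:R / k%:R) - lnn M <= (M%:R)^-1.
    rewrite /lnn -ln_div ?posrE ?ltr0n //.
    apply: le_trans (ln_le_subr1 _) _; first by rewrite divr_gt0 // ltr0n.
    rewrite lerBlDr ler_pdivrMr ?ltr0n // mulrDl mulVf ?gt_eqF ?ltr0n // mul1r; clear -b9; lra.
  rewrite /g; set y : R := N%:R / k%:R in b8 b9 L0 y0 lM ly *.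
  set x : R := M%:R in b2 b3 b8 b9 MR ly *; set L := ln y in L0 lM ly *.
  have ly' : x * (L - lnn M) <= 1.
    by have := ler_wpM2l (ltW (lt_le_trans ltr01 MR)) ly; rewrite divff // gt_eqF //; clear -MR; lra.
  have lx : 0 <= x * (L - lnn M) by rewrite mulr_ge0 ?subr_ge0 // (le_trans ler01 MR).
  have z0 : 0 <= y - x by clear -b8; lra.
  have z1 : y - x <= 1 by clear -b9; lra.
  have zL : (y - x) * L <= L by rewrite -[leRHS]mul1r ler_wpM2r.
  have zL0 : 0 <= (y - x) * L by rewrite mulr_ge0.
  clear b8 b9 ly y0; rewrite ler_norml; apply/andP; split; lra.
have s2 : \sum_(1 <= k < N.+1) (F k - F k.-1) * g k <=
  N%:R * \sum_(1 <= k < N.+1) F k / (k%:R * k.+1%:R) * ln (N%:R / k%:R).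
  rewrite (sum_by_parts (fun k => F k - F k.-1) g) -psum_incr // -[leRHS]add0r.
  apply: lerD.
    rewrite mulr_ge0_le0 // /g mulr_ge0_le0 // subr_le0 (@le_trans _ _ 0) // ln_le0 //.
    by rewrite ler_pdivrMr ?ltr0n // mul1r ler_nat.
  rewrite mulr_sumr big_nat [leRHS]big_nat; apply: ler_sum => k /andP[k0]; rewrite ltnS => kN.
  rewrite -psum_incr // [leRHS](_ : _ = F k * (N%:R * (ln (N%:R / k%:R) / (k%:R * k.+1%:R)))); last by ring.
  rewrite ler_wpM2l //.
  have kR : 0 < k%:R :> R by rewrite ltr0n.
  have dl := @lnn_incr_le R k k0.
  have -> : g k = N%:R * (k%:R^-1 * (lnn N - lnn k - 1)) by rewrite /g ln_div ?posrE // /lnn; ring.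
  have -> : g k.+1 = N%:R * (k.+1%:R^-1 * (lnn N - lnn k.+1 - 1)).
    by rewrite /g ln_div ?posrE ?ltr0n // /lnn; ring.
  rewrite ln_div ?posrE // -/(lnn N) -/(lnn k) -mulrBr ler_pM2l // -invrS_diff // .
  have : k.+1%:R^-1 * (lnn k.+1 - lnn k) <= k.+1%:R^-1 * k%:R^-1 by rewrite ler_wpM2l.
  have -> : k.+1%:R^-1 * k%:R^-1 = k%:R^-1 - k.+1%:R^-1 :> R by rewrite invrS_diff // invfM mulrC.
  by clear; set u := k%:R^-1; set v := k.+1%:R^-1; lra.
exact: le_trans s1 (lerD s2 (lexx _)).
Qed.

Lemma sum_ln_div_by_parts (w : nat -> R) N : (0 < N)%N -> (forall k, 0 <= w k) ->
  \sum_(1 <= k < N.+1) w k * ln (N%:R / k%:R) <= \sum_(1 <= k < N.+1) psum w k / k%:R.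
Proof.
move=> N0 w0.
have Wp k : 0 <= psum w k by apply: sumr_ge0.
rewrite (eq_big_nat _ _ (F2 := fun k => w k * (lnn N - lnn k))); last first.
  by move=> k /andP[k0 _]; rewrite ln_div ?posrE ?ltr0n.
rewrite (sum_by_parts w (fun k => lnn N - lnn k)) -[leRHS]add0r; apply: lerD.
  by rewrite mulr_ge0_le0 // subr_le0 lnn_le.
rewrite big_nat [leRHS]big_nat; apply: ler_sum => k /andP[k0 _].
rewrite ler_wpM2l //; have := @lnn_incr_le R k k0; lra.
Qed.

Lemma sum_lnn_div N : (0 < N)%N ->
  \sum_(1 <= j < N.+1) lnn j / j%:R <= lnn N ^+ 2 / 2 + 1 - N%:R^-1.
Proof.
elim: N => // -[_ _|N IH _]; first by rewrite big_nat1 lnn1 invr1; lra.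
rewrite big_nat_recr //=; apply: le_trans (lerD (IH isT) (lexx _)) _.
have h1 := @lnn_incr_le R N.+1 isT; have h2 := @lnn_incr_ge R N.+1 isT.
have h3 := @invrS_diff R N.+1 isT; have h4 := lnn_ge0 R N.+2.
have j0 : 1 <= N.+1%:R :> R by rewrite ler1n.
move: h1 h2 h3 h4; rewrite -[N.+2%:R]natr1; set a := lnn N.+1; set b := lnn N.+2.
set j : R := N.+1%:R in j0 *; set u := j^-1; set v := (j + 1)^-1 => h1 h2 h3 h4.
have u0 : 0 < u by rewrite invr_gt0; lra.
have v0 : 0 < v by rewrite invr_gt0; lra.
have uv : u <= 2 * v by rewrite /u /v ler_pdivlMr ?ler_pdivrMl; [lra|lra|lra].
have h5 : u - v = u * v by rewrite h3 invfM.
have h6 : b * v <= b * (b - a) by rewrite ler_wpM2l.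
have h7 : (b - a) ^+ 2 <= u * u by rewrite expr2 ler_pM //; lra.
have h8 : u * u <= u * (2 * v) by rewrite ler_wpM2l // ltW.
clear h1 h2 h3; nra.
Qed.

Definition Wcls b : nat -> R := psum (fun k => `|Mcls b k| / (k%:R * k.+1%:R)).

(** If [|Mcls b k| <= c * k] for all [b] and [k], then [Wcls b j] is at most about [c * ln j] and
    the right side is about [c * N * ln N ^ 2]: the inequality returns exactly [c]. Any proportional
    saving in [Wcls] therefore improves the constant. *)
Lemma Mcls_average : exists C : R, forall a N, a \is a GRing.unit -> (0 < N)%N ->
  `|Mcls a N| * lnn N ^+ 2 <=
   N%:R * (2 / phiK * \sum_(b : 'Z_K | b \is a GRing.unit) \sum_(1 <= j < N.+1) Wcls b j / j%:R
   + C * (1 + lnn N)).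
Proof.
have [C hC] := Mcls_selberg; have p0 := phiK_gt0 R K.
exists (C + 128) => a N au N0; apply: le_trans (hC a N au N0) _.
have NR : 0 <= N%:R :> R by [].
have lN := lnn_ge0 R N.
have s : \sum_(b : 'Z_K | b \is a GRing.unit) \sum_(1 <= d < N.+1) lnn d * `|Mcls b (N %/ d)| <=
   \sum_(b : 'Z_K | b \is a GRing.unit) (N%:R * (\sum_(1 <= j < N.+1) Wcls b j / j%:R) + 64 * N%:R).
  apply: ler_sum => b bu; apply: le_trans (sum_ln_floor (F := fun n => `|Mcls b n|) N0 _ _ _) _ => //.
  - by rewrite /Mcls psum0 normr0.
  - by move=> n; apply: le_trans (ler_dist_dist _ _) (Mcls_incr _ _).
  rewrite lerD2r ler_wpM2l //; apply: (sum_ln_div_by_parts (w := fun k => `|Mcls b k| / (k%:R * k.+1%:R))) => //.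
move: s; rewrite big_split /= sum_unit_const -mulr_sumr; set S := \sum_(b | _) _; set T := \sum_(b | _) _ => s.
have s' : 2 / phiK * S <= 2 / phiK * (N%:R * T + phiK * (64 * N%:R)).
  by rewrite ler_wpM2l // divr_ge0 // ltW.
have e : 2 / phiK * (N%:R * T + phiK * (64 * N%:R)) = N%:R * (2 / phiK * T) + 128 * N%:R.
  by field; rewrite gt_eqF.
rewrite e in s'; have : 0 <= N%:R * lnn N by rewrite mulr_ge0.
lra.
Qed.

End MoebiusResidueClass.

(** * Savings forced by cancellation in a slowly varying sequence *)

Section Windows.
Variable R : realType.
Local Notation lnn := (lnn R).

Lemma sum_inv_window_le (u v : nat) : (0 < u)%N -> (u <= v)%N ->
  \sum_(u <= k < v) k.+1%:R^-1 <= lnn v - lnn u.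
Proof.
move=> u0; elim: v => [|v IH]; first by rewrite leqn0 => /eqP uE; rewrite uE in u0.
rewrite leq_eqVlt => /orP[/eqP <-|]; first by rewrite big_geq // subrr.
rewrite ltnS => uv; rewrite big_nat_recr //=.
have := IH uv; have := @lnn_incr_ge R v (leq_trans u0 uv).
by set x := v.+1%:R^-1; lra.
Qed.

Lemma sum_inv_window_ge (u m : nat) : (0 < u)%N ->
  m%:R / (u + m)%:R <= \sum_(u <= k < u + m) (k.+1%:R^-1 : R).
Proof.
move=> u0; rewrite [leLHS](_ : _ = \sum_(u <= k < u + m) (u + m)%:R^-1); last first.
  by rewrite big_const_nat iter_addr_0 addKn mulr_natl.
rewrite big_nat [leRHS]big_nat; apply: ler_sum => k /andP[_ k1].
by rewrite lef_pV2 ?posrE ?ltr0n ?ler_nat // (leq_trans u0) // leq_addr.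
Qed.

Variable f : nat -> R.
Hypothesis f_incr : forall n, `|f n.+1 - f n| <= 1.
Variable B : R.
Hypothesis fB : forall N, `|psum (fun k => f k / (k%:R * k.+1%:R)) N| <= B.
Let w k := `|f k| / (k%:R * k.+1%:R).

Lemma f_lip k m : `|f (k + m)%N - f k| <= m%:R.
Proof.
elim: m => [|m IH]; first by rewrite addn0 subrr normr0.
rewrite addnS -(subrK (f (k + m)%N) (f (k + m).+1)) -addrA.
by apply: le_trans (ler_normD _ _) _; rewrite -natr1 [leRHS]addrC lerD.
Qed.

(** A step of size at most [1] cannot jump over the interval [[-1, 1]]. *)
Lemma constant_sign (u v : nat) : (forall k, (u <= k < v)%N -> 1 < `|f k|) ->
  (forall k, (u <= k < v)%N -> 0 < f k) \/ (forall k, (u <= k < v)%N -> f k < 0).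
Proof.
move=> h; case: (leqP v u) => [vu|uv].
  by left => k /andP[h1 h2]; move: (leq_ltn_trans h1 h2); rewrite ltnNge vu.
have [fu|fu] := ltrP 0 (f u); [left|right].
  move=> k; elim: k => [|k IH] /andP[h1 h2]; first by move: h1; rewrite leqn0 => /eqP <-.
  move: h1; rewrite leq_eqVlt => /orP[/eqP <- //|]; rewrite ltnS => uk.
  have h3 : (u <= k < v)%N by rewrite uk ltnW.
  have fk := IH h3; have := h _ h3; rewrite (gtr0_norm fk).
  have := f_incr k; rewrite ler_norml => /andP[a b]; lra.
move=> k; elim: k => [|k IH] /andP[h1 h2].
  move: h1; rewrite leqn0 => /eqP uE; subst u; rewrite lt_neqAle fu andbT.
  by apply/eqP => e; have := h 0%N; rewrite e normr0 leqnn h2 => /(_ isT); rewrite ltr10.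
move: h1; rewrite leq_eqVlt => /orP[/eqP uE|].
  subst u; rewrite lt_neqAle fu andbT.
  by apply/eqP => e; have := h k.+1; rewrite e normr0 leqnn h2 => /(_ isT); rewrite ltr10.
rewrite ltnS => uk; have h3 : (u <= k < v)%N by rewrite uk ltnW.
have fk := IH h3; have := h _ h3; rewrite (ltr0_norm fk).
have := f_incr k; rewrite ler_norml => /andP[a b]; lra.
Qed.

Lemma psum_window (g : nat -> R) (u v : nat) : (0 < u)%N -> (u <= v)%N ->
  \sum_(u <= k < v) g k = psum g v.-1 - psum g u.-1.
Proof.
move=> u0 uv; rewrite /psum !prednK ?(leq_trans u0) //.
by rewrite [X in _ = X - _](@big_cat_nat _ _ _ u) //= [X in _ = X - _]addrC addrK.
Qed.

(** With a constant sign, the sum of the absolute values is the absolute value of a difference of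
    two partial sums, each bounded by [B]. *)
Lemma window_signed (u v : nat) : (0 < u)%N -> (u <= v)%N ->
  (forall k, (u <= k < v)%N -> 1 < `|f k|) -> \sum_(u <= k < v) w k <= 2 * B.
Proof.
move=> u0 uv h.
have b : `|\sum_(u <= k < v) f k / (k%:R * k.+1%:R)| <= 2 * B.
  rewrite psum_window //; apply: le_trans (ler_normB _ _) _.
  have := fB v.-1; have := fB u.-1; lra.
have [hp|hn] := constant_sign h.
  rewrite (eq_big_nat _ _ (F2 := fun k => f k / (k%:R * k.+1%:R))).
    by apply: le_trans b; apply: ler_norm.
  by move=> k /hp fk; rewrite /w gtr0_norm.
rewrite (eq_big_nat _ _ (F2 := fun k => - (f k / (k%:R * k.+1%:R)))).
  by rewrite sumrN; apply: le_trans b; rewrite -normrN ler_norm.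
by move=> k /hn fk; rewrite /w ltr0_norm // mulNr.
Qed.

Variable c : R.
Hypotheses (c0 : 0 < c) (c1 : c <= 1).

Lemma w_le k : (0 < k)%N -> `|f k| <= c * k%:R -> w k <= c / k.+1%:R.
Proof.
move=> k0 h; have kR : 0 < k%:R :> R by rewrite ltr0n.
rewrite /w invfM mulrA ler_wpM2r // ler_pdivrMr //.
Qed.

(** After a point [k0] with [|f k0| <= 1], the sequence needs about [c * k0 / 4] steps before it can
    exceed [c / 2 * k]. On this stretch half of the trivial bound is saved, which amounts to a fixed
    multiple of [c ^ 2]. *)
Lemma window_zero (u v k0 : nat) : (0 < u)%N -> (forall k, (u <= k)%N -> `|f k| <= c * k%:R) ->
  (u <= k0)%N -> (2 * k0 <= v)%N -> `|f k0| <= 1 -> 8 <= c * u%:R ->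
  \sum_(u <= k < v) w k <= c * (lnn v - lnn u) - c ^+ 2 / 64.
Proof.
move=> u0 fc uk kv fk cu.
have k00 : (0 < k0)%N by exact: leq_trans uk.
have kR : 1 <= k0%:R :> R by rewrite ler1n.
have ck : 8 <= c * k0%:R by apply: le_trans cu _; rewrite ler_wpM2l ?ler_nat // ltW.
pose m := Num.trunc (c * k0%:R / 4).
have m1 : m%:R <= c * k0%:R / 4 by rewrite Num.Theory.truncn_le // divr_ge0 // mulr_ge0 // ltW.
have m2 : c * k0%:R / 4 < m%:R + 1 by rewrite natr1; exact: truncnS_gt.
have mk : (m <= k0)%N.
  have : c * k0%:R <= 1 * k0%:R by rewrite ler_wpM2r.
  by rewrite -(ler_nat R); lra.
have uv : (u <= k0 + m)%N by rewrite (leq_trans uk) // leq_addr.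
have kmv : (k0 + m <= v)%N by apply: leq_trans kv; rewrite mul2n -addnn leq_add2l.
have part (a b : nat) : (u <= a)%N -> (a <= b)%N -> \sum_(a <= k < b) w k <= c * (lnn b - lnn a).
  move=> ua ab; have a0 := leq_trans u0 ua.
  apply: (@le_trans _ _ (\sum_(a <= k < b) c * k.+1%:R^-1)).
    rewrite big_nat [leRHS]big_nat; apply: ler_sum => k /andP[ak _].
    by apply: w_le; [exact: leq_trans ak | apply: fc; exact: leq_trans ak].
  by rewrite -mulr_sumr ler_pM2l // sum_inv_window_le.
have mid : \sum_(k0 <= k < k0 + m) w k <= c * (lnn (k0 + m) - lnn k0) - c / 2 * (m%:R / (k0 + m)%:R).
  have := sum_inv_window_le k00 (leq_addr m k0); have := sum_inv_window_ge m k00.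
  set S := \sum_(_ <= k < _) _ => h1 h2.
  apply: (@le_trans _ _ (c / 2 * S)); last by nra.
  rewrite /S mulr_sumr big_nat [leRHS]big_nat; apply: ler_sum => k /andP[kk kk2].
  have k1 : (0 < k)%N by exact: leq_trans kk.
  have kR1 : 0 < k%:R :> R by rewrite ltr0n.
  rewrite /w invfM mulrA ler_wpM2r // ler_pdivrMr //.
  have := f_lip k0 (k - k0); rewrite subnKC // => h3.
  have h4 : `|f k| <= 1 + (k - k0)%:R.
    by rewrite -(subrK (f k0) (f k)) addrC; apply: le_trans (ler_normD _ _) _; rewrite lerD.
  have h5 : (k - k0)%:R <= m%:R :> R by rewrite ler_nat leq_subLR ltnW.
  have h6 : k0%:R <= k%:R :> R by rewrite ler_nat.
  have : c * k0%:R <= c * k%:R by rewrite ler_pM2l.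
  lra.
rewrite (@big_cat_nat _ _ _ k0 u v) //=; last by apply: leq_trans kv; rewrite leq_pmull.
rewrite (@big_cat_nat _ _ _ (k0 + m) k0 v) //= ?leq_addr //.
have p1 := part u k0 (leqnn u) uk; have p2 := part _ _ uv kmv.
have sv : c ^+ 2 / 64 <= c / 2 * (m%:R / (k0 + m)%:R).
  have d0 : 0 < (k0 + m)%:R :> R by rewrite ltr0n ltn_addr.
  rewrite mulrA ler_pdivlMr // natrD.
  have mkR : m%:R <= k0%:R :> R by rewrite ler_nat.
  have m3 : c * k0%:R / 8 <= m%:R by lra.
  have q : c * (c * k0%:R) <= c * (8 * m%:R) by rewrite ler_pM2l //; lra.
  have q2 : c ^+ 2 * m%:R <= c ^+ 2 * k0%:R by rewrite ler_wpM2l ?sqr_ge0.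
  have q3 : 0 <= c * m%:R by rewrite mulr_ge0 // ltW.
  rewrite expr2 in q2 *; lra.
lra.
Qed.

(** Either [f] has a small value in [[u, r * u[], and the last factor [2] leaves room for the
    stretch of [window_zero], or it has constant sign there and the bounded sum [2 * B] beats
    [c * ln r]. *)
Lemma window_saving (r u : nat) : (0 < r)%N -> (0 < u)%N ->
  (forall k, (u <= k)%N -> `|f k| <= c * k%:R) -> 8 <= c * u%:R -> 2 * B + 1 <= c * lnn r ->
  \sum_(u <= k < 2 * r * u) w k <= c * lnn (2 * r) - c ^+ 2 / 64.
Proof.
move=> r0 u0 fc cu hr.
have uru : (u <= r * u)%N by rewrite leq_pmull.
have lE : lnn (2 * r * u) - lnn u = lnn (2 * r) by rewrite lnnM ?muln_gt0 // addrK.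
case: (pselect (exists2 k0, (u <= k0 < r * u)%N & `|f k0| <= 1)) => [[k0 /andP[h1 h2] fk]|no].
  rewrite -lE; apply: (window_zero (k0 := k0)) => //.
  by rewrite -mulnA leq_mul2l (ltnW h2) orbT.
have big k : (u <= k < r * u)%N -> 1 < `|f k|.
  by move=> hk; rewrite ltNge; apply/negP => fk; apply: no; exists k.
have s1 := window_signed u0 uru big.
rewrite (@big_cat_nat _ _ _ (r * u)) //=; last by rewrite -mulnA leq_pmull.
have s2 : \sum_(r * u <= k < 2 * r * u) w k <= c * lnn 2.
  apply: (@le_trans _ _ (\sum_(r * u <= k < 2 * r * u) c * k.+1%:R^-1)).
    rewrite big_nat [leRHS]big_nat; apply: ler_sum => k /andP[ak _].
    have uk := leq_trans uru ak.
    by apply: w_le; [exact: leq_trans uk | apply: fc].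
  rewrite -mulr_sumr ler_pM2l //; apply: le_trans (sum_inv_window_le _ _) _.
  - by rewrite muln_gt0 r0.
  - by rewrite -mulnA leq_pmull.
  by rewrite -mulnA lnnM // ?muln_gt0 ?r0 // addrK.
rewrite lnnM //; have : c ^+ 2 <= 1 by rewrite expr_le1 // ltW.
lra.
Qed.

(** The half-line is cut into windows of ratio [2 * r]. Each has logarithmic length [ln (2 * r)] and
    saves [c ^ 2 / 64], so the slope in [ln j] decreases by the quotient. *)
Lemma weighted_sum_bound (r N0 : nat) : (0 < r)%N ->
  (forall k, (N0 <= k)%N -> `|f k| <= c * k%:R) -> 2 * B + 1 <= c * lnn r ->
  exists C, forall j, (0 < j)%N ->
    psum w j <= (c - c ^+ 2 / (64 * lnn (2 * r))) * lnn j + C.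
Proof.
move=> r0 fc hr.
have B0 : 0 <= B by apply: le_trans (fB 0%N).
have lr : 1 <= lnn r.
  have : 1 * lnn r >= c * lnn r by rewrite ler_wpM2r ?lnn_ge0.
  lra.
have l2r : lnn r <= lnn (2 * r) by rewrite lnn_le // leq_pmull.
pose q := (2 * r)%N; pose l := lnn q; rewrite -/q -/l.
have l1 : 1 <= l by rewrite /l /q; lra.
pose u0 := maxn N0 (Num.trunc (8 / c)).+1.
have u00 : (0 < u0)%N by rewrite leq_max orbT.
have cu : 8 <= c * u0%:R.
  rewrite mulrC -ler_pdivrMr // ltW //; apply: lt_le_trans (truncnS_gt _) _.
  by rewrite ler_nat leq_max leqnn orbT.
have w0 k : 0 <= w k by rewrite divr_ge0.
have win i : \sum_(1 <= k < q ^ i * u0) w k <= psum w u0 + i%:R * (c * l - c ^+ 2 / 64).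
  elim: i => [|i IH].
    rewrite expn0 mul1n mul0r addr0 /psum [leRHS]big_nat_recr //= lerDl //.
  have ge1 : (u0 <= q ^ i * u0)%N by rewrite leq_pmull // expn_gt0 muln_gt0 r0.
  rewrite (@big_cat_nat _ _ _ (q ^ i * u0)) //=; last 2 first.
  - by apply: leq_trans ge1.
  - by rewrite expnS -mulnA leq_pmull // muln_gt0 r0.
  have s : \sum_(q ^ i * u0 <= k < q ^ i.+1 * u0) w k <= c * l - c ^+ 2 / 64.
    rewrite expnS -mulnA; apply: window_saving => //.
    - by apply: leq_trans ge1.
    - by move=> k hk; apply: fc; rewrite (leq_trans _ hk) // (leq_trans _ ge1) // leq_maxl.
    - by apply: le_trans cu _; rewrite ler_pM2l // ler_nat.
  rewrite -natr1; lra.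
pose c' := c - c ^+ 2 / (64 * l).
have c'E : c' * l = c * l - c ^+ 2 / 64 by rewrite /c'; field; rewrite gt_eqF; lra.
have c'0 : 0 <= c'.
  rewrite subr_ge0 ler_pdivrMr; last by lra.
  rewrite expr2; apply: ler_wpM2l; first exact: ltW.
  by apply: le_trans c1 (le_trans l1 _); rewrite ler_peMl // ?ler1n // (le_trans ler01 l1).
exists (psum w u0 + c' * l) => j j0.
pose i := trunc_log q j.
have q1 : (1 < q)%N by rewrite /q (leq_trans (_ : 1 < 2)%N) // leq_pmulr.
have ji : (j < q ^ i.+1)%N by exact: trunc_log_ltn.
have ij : (q ^ i <= j)%N by exact: trunc_logP.
apply: (@le_trans _ _ (\sum_(1 <= k < q ^ i.+1 * u0) w k)).
  have jj : (j.+1 <= q ^ i.+1 * u0)%N by apply: leq_trans ji _; rewrite leq_pmulr.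
  by rewrite [leRHS](@big_cat_nat _ _ _ j.+1) //= lerDl sumr_ge0.
apply: le_trans (win i.+1) _; rewrite -c'E.
have il : i%:R * l <= lnn j.
  have -> : i%:R * l = lnn (q ^ i).
    by rewrite /l /lnn natrX lnXn ?ltr0n ?mulr_natl // (ltnW q1).
  by rewrite lnn_le // expn_gt0 (ltnW q1).
rewrite -natr1 mulrDl mul1r.
have : c' * (i%:R * l) <= c' * lnn j by rewrite ler_wpM2l.
rewrite -/c'; lra.
Qed.

End Windows.

(** * From bounded weighted sums to mean zero in invertible classes *)

Section MoebiusResidueClassMean.
Variable R : realType.
Variable K : nat.
Hypothesis K1 : (1 < K)%N.
Local Notation lnn := (lnn R).
Local Notation phiK := (phiK R K).
Local Notation Mcls := (@Mcls R K).
Variable B : R.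
Hypothesis MB : forall (b : 'Z_K) N, b \is a GRing.unit ->
  `|psum (fun k => Mcls b k / (k%:R * k.+1%:R)) N| <= B.

Definition Mcls_eventually (c : R) := exists N0, forall (b : 'Z_K) N, b \is a GRing.unit ->
  (N0 <= N)%N -> `|Mcls b N| <= c * N%:R.

Lemma Mcls_eventually_le c c' : c <= c' -> Mcls_eventually c -> Mcls_eventually c'.
Proof.
move=> cc [N0 h]; exists N0 => b N bu hN; apply: le_trans (h b N bu hN) _.
by rewrite ler_wpM2r.
Qed.

Lemma exists_lnn_ge (x : R) : exists2 r, (0 < r)%N & forall n, (r <= n)%N -> x <= lnn n.
Proof.
exists (Num.trunc (expR x)).+1 => // n hn.
have h : expR x <= n%:R.
  by apply: le_trans (ltW (truncnS_gt _)) _; rewrite ler_nat.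
by rewrite /lnn -[leLHS]expRK ler_ln ?posrE ?expR_gt0 // (lt_le_trans (expR_gt0 _) h).
Qed.

(** Of the saving [2 * eta] in the leading coefficient, one [eta] is kept and the other pays for all
    terms of lower order once [X] is large. *)
Lemma contraction_arith (c eta X D C C' S : R) : c <= 1 -> 0 < eta -> 0 <= C -> 1 <= X ->
  D = `|C'| + 2 * C + 2 -> 2 * D <= eta * X ->
  S <= 2 * ((c - 2 * eta) * (X ^+ 2 / 2 + 1) + C * (1 + X)) ->
  S + C' * (1 + X) <= (c - eta) * X ^+ 2.
Proof.
move=> c1 eta0 C0 X1 DE XD hS.
have s3 : C' * (1 + X) <= `|C'| * (1 + X) by rewrite ler_wpM2r ?ler_norm //; lra.
have D0 : 0 <= D by rewrite DE; have := normr_ge0 C'; lra.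
have s4 : D * (1 + X) <= eta * X ^+ 2.
  apply: (@le_trans _ _ (D * (2 * X))); first by rewrite ler_wpM2l //; lra.
  by rewrite mulrA [D * 2]mulrC expr2 mulrA ler_wpM2r //; lra.
rewrite DE in s4; move: (X ^+ 2) s4 hS => X2 s4 hS.
have := normr_ge0 C'; move: (`|C'|) s3 s4 => C'' s3 s4 s5.
clear XD DE D0; lra.
Qed.

(** The step [eta] is uniform for [c] in [[c0, 1]], so that finitely many applications bring the
    constant from [1] down to [c0]. *)
Lemma Mcls_contraction (c0 : R) : 0 < c0 -> exists2 eta, 0 < eta &
  forall c, c0 <= c -> c <= 1 -> Mcls_eventually c -> Mcls_eventually (c - eta).
Proof.
move=> c00; have p0 := phiK_gt0 R K.
have B0 : 0 <= B by apply: le_trans (MB 0%N (unitr1 _)).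
have [r r0 hr] := exists_lnn_ge ((2 * B + 1) / c0).
pose l := lnn (2 * r).
have l0 : 0 < l.
  apply: lt_le_trans (hr _ _); first by rewrite divr_gt0 //; lra.
  by rewrite leq_pmull.
exists (c0 ^+ 2 / (128 * l)).
  by rewrite divr_gt0 ?exprn_gt0 // mulr_gt0.
set eta := _ / _ => c cc0 c1 [N0 hN0].
have c_gt0 : 0 < c by exact: lt_le_trans cc0.
have etac : 2 * eta <= c ^+ 2 / (64 * l).
  have -> : 2 * eta = c0 ^+ 2 / (64 * l) by rewrite /eta; field; rewrite gt_eqF.
  rewrite ler_wpM2r ?invr_ge0 ?mulr_ge0 ?(ltW l0) // ler_sqr ?nnegrE // ltW //.
have hr' : 2 * B + 1 <= c * lnn r.
  have h := hr r (leqnn r); rewrite ler_pdivrMr // [leRHS]mulrC in h; apply: le_trans h _.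
  by rewrite ler_wpM2r ?lnn_ge0.
have hC (b : 'Z_K) : exists C, b \is a GRing.unit -> forall j, (0 < j)%N ->
    Wcls R b j <= (c - 2 * eta) * lnn j + C.
  case: (boolP (b \is a GRing.unit)) => [bu|_]; last by exists 0.
  have [C hC] := weighted_sum_bound (Mcls_incr R b) (fun N => MB N bu) c_gt0 c1 r0
    (fun k => hN0 b k bu) hr'.
  exists C => _ j j0; apply: le_trans (hC j j0) _.
  by rewrite lerD2r ler_wpM2r ?lnn_ge0 // lerD2l lerN2.
have [Cf hCf] := boolp.choice hC.
pose C := \sum_b `|Cf b|.
have hCb b : Cf b <= C.
  by rewrite /C (bigD1 b) //=; apply: le_trans (ler_norm _) _; rewrite lerDl sumr_ge0.
have C0 : 0 <= C by apply: sumr_ge0.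
have [C' hC'] := Mcls_average R K1.
pose D := `|C'| + 2 * C + 2.
have D0 : 0 < D by rewrite /D; have := normr_ge0 C'; clear -C0; lra.
have eta0 : 0 < eta by rewrite divr_gt0 ?exprn_gt0 // mulr_gt0.
have [N1 N10 hN1] := exists_lnn_ge (1 + 2 * D / eta).
exists N1 => a N au hN.
have N_gt0 : (0 < N)%N by exact: leq_trans hN.
have lN := hN1 N hN; set X := lnn N in lN.
have X1 : 1 <= X.
  apply: le_trans lN; rewrite lerDl; apply: divr_ge0; last exact: ltW.
  by apply: mulr_ge0 => //; exact: ltW.
have XD : 2 * D <= eta * X.
  have : 2 * D / eta <= X by clear -lN; lra.
  by rewrite ler_pdivrMr // [leRHS]mulrC.
have c'0 : 0 <= c - 2 * eta.
  have cl : c ^+ 2 / (64 * l) <= c.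
    have hl : c * lnn r <= l.
      apply: (@le_trans _ _ (1 * lnn r)); first by rewrite ler_wpM2r ?lnn_ge0.
      by rewrite mul1r lnn_le // leq_pmull.
    rewrite ler_pdivrMr ?mulr_gt0 // expr2 ler_wpM2l ?(ltW c_gt0) //; clear -hl hr' B0 l0 c1; lra.
  clear -cl etac; lra.
have s1 (b : 'Z_K) : b \is a GRing.unit -> \sum_(1 <= j < N.+1) Wcls R b j / j%:R <=
    (c - 2 * eta) * (X ^+ 2 / 2 + 1) + C * (1 + X).
  move=> bu; apply: (@le_trans _ _ (\sum_(1 <= j < N.+1) ((c - 2 * eta) * (lnn j / j%:R) + C * j%:R^-1))).
    rewrite big_nat [leRHS]big_nat; apply: ler_sum => j /andP[j0 _].
    rewrite mulrA -mulrDl ler_wpM2r //; apply: le_trans (hCf b bu j j0) _.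
    by rewrite lerD2l.
  rewrite big_split /= -!mulr_sumr lerD //.
    rewrite ler_wpM2l //; apply: le_trans (sum_lnn_div R N_gt0) _.
    by rewrite lerBlDr lerDl.
  by rewrite ler_wpM2l //; exact: harm_le.
have h := hC' a N au N_gt0; rewrite -/X in h.
have NR : 0 <= N%:R :> R by [].
have s2 : 2 / phiK * \sum_(b : 'Z_K | b \is a GRing.unit) \sum_(1 <= j < N.+1) Wcls R b j / j%:R
  <= 2 * ((c - 2 * eta) * (X ^+ 2 / 2 + 1) + C * (1 + X)).
  rewrite -[leRHS](_ : 2 / phiK * (phiK * ((c - 2 * eta) * (X ^+ 2 / 2 + 1) + C * (1 + X))) = _); last first.
    by field; rewrite gt_eqF.
  rewrite ler_wpM2l ?divr_ge0 ?(ltW p0) // -sum_unit_const; exact: ler_sum.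
have X0 : 0 < X ^+ 2 by rewrite exprn_gt0 // (lt_le_trans ltr01 X1).
rewrite -(ler_pM2r X0); apply: le_trans h _.
rewrite [leRHS](_ : _ = N%:R * ((c - eta) * X ^+ 2)); last by ring.
apply: ler_wpM2l => //.
exact: (contraction_arith c1 eta0 C0 X1 (erefl _) XD s2).
Qed.

Lemma Mcls_little_o (eps : R) : 0 < eps -> Mcls_eventually eps.
Proof.
move=> e0; have [eta eta0 h] := Mcls_contraction e0.
have key n : Mcls_eventually (Num.max eps (1 - n%:R * eta)).
  elim: n => [|n IH].
    rewrite mul0r subr0; apply: (@Mcls_eventually_le 1); first by rewrite le_max lexx orbT.
    by exists 0%N => b N _ _; rewrite mul1r norm_Mcls.
  have [le|lt] := leP (1 - n%:R * eta) eps.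
    apply: Mcls_eventually_le IH; rewrite (max_idPl le) le_max lexx //.
  move: IH; rewrite (max_idPr (ltW lt)) => IH.
  apply: Mcls_eventually_le (h _ (ltW lt) _ IH).
    by rewrite -natr1 mulrDl mul1r le_max opprD addrA lexx orbT.
  by rewrite lerBlDr lerDl mulr_ge0 // ltW.
apply: Mcls_eventually_le (key (Num.trunc (1 / eta)).+1).
rewrite ge_max lexx /=; have : 1 <= (Num.trunc (1 / eta)).+1%:R * eta.
  by rewrite -ler_pdivrMr // ltW // truncnS_gt.
lra.
Qed.

End MoebiusResidueClassMean.

(** * Nonvanishing of characters *)

Section CharacterNonvanishing.
Variable R : realType.
Let eq_ler (x y : R) : x = y -> x <= y. Proof. by move=> ->. Qed.
Variable K : nat.
Hypothesis K1 : (1 < K)%N.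
Local Notation lnn := (lnn R).
Local Notation mu := (mu R).
Local Notation mangoldt := (mangoldt R).
Local Notation chi0 := (chi0 R K).

(* A complex Dirichlet character is handled through its real and imaginary parts (al, be). *)
Definition is_character (al be : nat -> R) :=
  [/\ forall m n, al (m * n)%N = al m * al n - be m * be n,
      forall m n, be (m * n)%N = al m * be n + be m * al n,
      forall n, al n ^+ 2 + be n ^+ 2 = chi0 n,
      al 1%N = 1 & be 1%N = 0].

Lemma norm_le1_of_sqr (x y : R) n : x ^+ 2 + y ^+ 2 = chi0 n -> `|x| <= 1.
Proof.
move=> h; rewrite -[leRHS]normr1 -ler_sqr ?nnegrE // normr1 expr1n -normrX ger0_norm ?sqr_ge0 //.
have := chi0_le1 R K n; have := sqr_ge0 y; lra.
Qed.

Lemma char_re_le1 al be n : is_character al be -> `|al n| <= 1.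
Proof. by case=> _ _ h _ _; exact: norm_le1_of_sqr (h n). Qed.

Lemma char_im_le1 al be n : is_character al be -> `|be n| <= 1.
Proof. by case=> _ _ h _ _; apply: (@norm_le1_of_sqr _ (al n) n); rewrite addrC. Qed.

Lemma char_sqr al be : is_character al be ->
  is_character (fun n => al n ^+ 2 - be n ^+ 2) (fun n => 2 * al n * be n).
Proof.
case=> aM bM nrm a1 b1; split=> [m n|m n|n||].
- rewrite aM bM; ring.
- rewrite aM bM; ring.
- have -> : (al n ^+ 2 - be n ^+ 2) ^+ 2 + (2 * al n * be n) ^+ 2 = (al n ^+ 2 + be n ^+ 2) ^+ 2 by ring.
  by rewrite nrm chi0E; case: coprime; rewrite ?expr1n ?expr0n.
- by rewrite a1 b1 expr1n expr0n subr0.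
- by rewrite b1 mulr0.
Qed.

Lemma sum_twist_floor (al be w g : nat -> R) N : is_character al be ->
  \sum_(1 <= n < N.+1) al n / n%:R * dsum (fun d => w d * g (n %/ d)%N) n =
  \sum_(1 <= d < N.+1) w d / d%:R *
     (al d * (\sum_(1 <= m < (N %/ d).+1) al m / m%:R * g m) -
      be d * (\sum_(1 <= m < (N %/ d).+1) be m / m%:R * g m)).
Proof.
case=> aM bM _ _ _.
transitivity (\sum_(1 <= d < N.+1) \sum_(1 <= m < (N %/ d).+1)
   (w d * (al (d * m)%N / (d * m)%:R * g m))).
  rewrite sum_hyperbola; apply: eq_big_nat => n /andP[n0 _].
  rewrite /dsum mulr_sumr; apply: eq_bigr => d dn.
  by rewrite [(d * _)%N]mulnC divnK //; ring.
apply: eq_bigr => d _; rewrite 2!mulr_sumr -sumrB mulr_sumr; apply: eq_bigr => m _.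
rewrite aM natrM invfM; ring.
Qed.

Lemma inv_floorS_le N d : (0 < N)%N -> (0 < d)%N -> (N %/ d).+1%:R^-1 <= d%:R / N%:R :> R.
Proof.
move=> N0 d0; rewrite -invf_div lef_pV2 ?posrE ?divr_gt0 ?ltr0n //.
by rewrite -natr1 ltW // divn_natr_gt.
Qed.

Lemma char_tail (al be : nat -> R) (C : R) N d : is_character al be -> 0 <= C ->
  (forall N, `|\sum_(1 <= n < N.+1) al n / n%:R| <= C / N.+1%:R) ->
  (forall N, `|\sum_(1 <= n < N.+1) be n / n%:R| <= C / N.+1%:R) ->
  (0 < N)%N -> (0 < d)%N ->
  `|al d * (\sum_(1 <= m < (N %/ d).+1) al m / m%:R) -
     be d * (\sum_(1 <= m < (N %/ d).+1) be m / m%:R)| <= 2 * C * (d%:R / N%:R).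
Proof.
move=> ch C0 ha hb N0 d0; have hi := inv_floorS_le N0 d0.
apply: le_trans (ler_normB _ _) _; rewrite !normrM.
have s1 : C / (N %/ d).+1%:R <= C * (d%:R / N%:R) by rewrite ler_wpM2l.
have h1 := ler_pM (normr_ge0 _) (normr_ge0 _) (char_re_le1 d ch) (le_trans (ha _) s1).
have h2 := ler_pM (normr_ge0 _) (normr_ge0 _) (char_im_le1 d ch) (le_trans (hb _) s1).
have := lerD h1 h2; rewrite !mul1r; lra.
Qed.

(** The two hypotheses say that [L(1, chi) = 0]. The weights [mu d * ln (N / d)] produce [ln N] plus
    the sum of [chi * mangoldt / n], and the vanishing makes every inner sum a tail of size
    [O(d / N)]. *)
Lemma char_zero_mangoldt (al be : nat -> R) (C : R) : is_character al be ->
  (forall N, `|\sum_(1 <= n < N.+1) al n / n%:R| <= C / N.+1%:R) ->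
  (forall N, `|\sum_(1 <= n < N.+1) be n / n%:R| <= C / N.+1%:R) ->
  forall N, (0 < N)%N ->
  `|lnn N + \sum_(1 <= n < N.+1) al n * mangoldt n / n%:R| <= 64 * C.
Proof.
move=> ch ha hb N N0.
have C0 : 0 <= C by have := ha 0%N; rewrite divr1; apply: le_trans.
have NR : 0 < N%:R :> R by rewrite ltr0n.
have -> : lnn N + \sum_(1 <= n < N.+1) al n * mangoldt n / n%:R =
  \sum_(1 <= n < N.+1) al n / n%:R * dsum (fun d => mu d * ln (N%:R / d%:R) * 1) n.
  rewrite [RHS](eq_big_nat _ _ (F2 := fun n => al n / n%:R * (lnn N * dunit R n) + al n * mangoldt n / n%:R)); last first.
    move=> n /andP[n0 _]; under [X in _ * X]eq_bigr do rewrite mulr1.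
    rewrite -/(dsum (fun d => mu d * ln (N%:R / d%:R)) n) dsum_mu_ln_div //; ring.
  rewrite big_split /=; congr (_ + _).
  rewrite big_ltn // /dunit eqxx big_nat big1 ?addr0.
    by case: ch => _ _ _ -> _; rewrite divr1 mul1r mulr1.
  by move=> n /andP[n1 _]; rewrite gtn_eqF // !mulr0.
rewrite (@sum_twist_floor al be (fun d => mu d * ln (N%:R / d%:R)) (fun=> 1)) //.
apply: le_trans (ler_norm_sum _ _ _) _.
apply: (@le_trans _ _ (\sum_(1 <= d < N.+1) 2 * C / N%:R * (1 + ln (N%:R / d%:R)))); last first.
  rewrite -mulr_sumr; apply: (@le_trans _ _ (2 * C / N%:R * (32 * N%:R))).
    by rewrite ler_wpM2l ?sum_ln_div // divr_ge0 ?mulr_ge0.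
  by apply: eq_ler; field; rewrite gt_eqF.
rewrite big_nat [leRHS]big_nat; apply: ler_sum => d /andP[d0]; rewrite ltnS => dN.
have dR : 0 < d%:R :> R by rewrite ltr0n.
under [X in _ * X - _]eq_bigr do rewrite mulr1.
under [X in _ - _ * X]eq_bigr do rewrite mulr1.
have h := char_tail ch C0 ha hb N0 d0.
have L0 := ln_div_ge0 R d0 dN.
rewrite normrM; apply: (@le_trans _ _ (ln (N%:R / d%:R) / d%:R * (2 * C * (d%:R / N%:R)))).
  apply: ler_pM => //; rewrite 2!normrM normfV normr_nat (ger0_norm L0).
  apply: ler_wpM2r; first by rewrite invr_ge0 ltW.
  by rewrite -[leRHS]mul1r ler_wpM2r ?norm_mu.
have -> : ln (N%:R / d%:R) / d%:R * (2 * C * (d%:R / N%:R)) = 2 * C / N%:R * ln (N%:R / d%:R).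
  by field; rewrite !gt_eqF.
rewrite ler_wpM2l ?divr_ge0 ?mulr_ge0 ?(ltW NR) //; lra.
Qed.

Lemma sum_bounded_lnn_div (c : nat -> R) (C : R) N : (forall N, `|psum c N| <= C) ->
  `|\sum_(1 <= n < N.+1) c n * (lnn n / n%:R)| <= 4 * C.
Proof.
move=> hC; have C0 : 0 <= C by apply: le_trans (hC 0%N).
rewrite (sum_by_parts c (fun n => lnn n / n%:R)); apply: le_trans (ler_normD _ _) _.
pose v n := (3 + lnn n) / n%:R.
have s1 : `|psum c N * (lnn N.+1 / N.+1%:R)| <= C.
  rewrite normrM -[leRHS]mulr1 ler_pM // ger0_norm ?divr_ge0 ?lnn_ge0 //.
  rewrite ler_pdivrMr ?ltr0n // mul1r; have := @ln_le_subr1 R N.+1%:R; rewrite ltr0n => /(_ isT).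
  rewrite /lnn; lra.
have s2 : `|\sum_(1 <= n < N.+1) psum c n * (lnn n / n%:R - lnn n.+1 / n.+1%:R)| <= C * 3.
  apply: le_trans (ler_norm_sum _ _ _) _.
  apply: (@le_trans _ _ (\sum_(1 <= n < N.+1) C * (v n - v n.+1))); last first.
    rewrite -mulr_sumr telescope_nat ler_wpM2l // /v lnn1 addr0 divr1 lerBlDr lerDl.
    by rewrite divr_ge0 // addr_ge0 // lnn_ge0.
  rewrite big_nat [leRHS]big_nat; apply: ler_sum => n /andP[n0 _].
  rewrite normrM ler_pM //.
  have h1 := @lnn_incr_le R n n0; have h2 := @lnn_incr_ge R n n0; have h3 := @invrS_diff R n n0.
  have h4 := lnn_ge0 R n; have nR : 1 <= n%:R :> R by rewrite ler1n.
  move: h1 h2 h3; rewrite /v -[n.+1%:R]natr1; set a := lnn n in h4 *; set b := lnn n.+1.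
  set u := n%:R^-1; set t := (n%:R + 1)^-1 => h1 h2 h3.
  have u0 : 0 < u by rewrite invr_gt0; lra.
  have t0 : 0 < t by rewrite invr_gt0; lra.
  have u1 : u <= 1 by rewrite invf_le1; lra.
  rewrite invfM -/u -/t in h3.
  have q1 : (b - a) * t <= u * t by rewrite ler_wpM2r // ltW.
  have q2 : 0 <= (b - a) * t by rewrite mulr_ge0 // ?ltW //; lra.
  have q3 : 0 <= a * (u - t) by rewrite mulr_ge0 // h3 mulr_ge0 // ltW.
  clear - q1 q2 q3 h3 u0 t0; rewrite ler_norml; apply/andP; split; nra.
lra.
Qed.

(** The pair [(u, v)] is [(al, be)] or [(be, - al)]: these give the real and imaginary parts of the
    product of [L(1, chi)] with the sum of [chi * mangoldt / n]. Both come from expanding the sum of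
    [chi n * ln n / n] by [ln = 1] convolved with [mangoldt]. *)
Lemma char_mangoldt_bounded (al be u v : nat -> R) (C D lu lv : R) : is_character al be ->
  (forall d m, u (d * m)%N = al d * u m - be d * v m) ->
  (forall N, `|psum u N| <= D) ->
  (forall N, `|\sum_(1 <= n < N.+1) u n / n%:R - lu| <= C / N.+1%:R) ->
  (forall N, `|\sum_(1 <= n < N.+1) v n / n%:R - lv| <= C / N.+1%:R) ->
  forall N, (0 < N)%N ->
  `|lu * (\sum_(1 <= n < N.+1) al n * mangoldt n / n%:R) -
    lv * (\sum_(1 <= n < N.+1) be n * mangoldt n / n%:R)| <= 4 * D + 20 * C.
Proof.
move=> ch uM du hu hv N N0.
have C0 : 0 <= C by have := hu 0%N; rewrite divr1; apply: le_trans.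
have NR : 0 < N%:R :> R by rewrite ltr0n.
pose A M := \sum_(1 <= m < M.+1) u m / m%:R.
pose B M := \sum_(1 <= m < M.+1) v m / m%:R.
have tail d : (0 < d)%N -> `|A (N %/ d)%N - lu| <= C * (d%:R / N%:R) /\ `|B (N %/ d)%N - lv| <= C * (d%:R / N%:R).
  move=> d0; have hi := inv_floorS_le N0 d0.
  by split; [apply: le_trans (hu _) _|apply: le_trans (hv _) _]; rewrite ler_wpM2l.
have chebN : \sum_(1 <= d < N.+1) mangoldt d * (2 * C / N%:R) <= 20 * C.
  rewrite -mulr_suml; apply: (@le_trans _ _ (10 * N%:R * (2 * C / N%:R))).
    by apply: ler_wpM2r; [rewrite divr_ge0 ?mulr_ge0|exact: chebyshev].
  by apply: eq_ler; field; rewrite gt_eqF.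
have i1 : \sum_(1 <= n < N.+1) u n * (lnn n / n%:R) =
    \sum_(1 <= d < N.+1) mangoldt d / d%:R * (al d * A (N %/ d)%N - be d * B (N %/ d)%N).
  transitivity (\sum_(1 <= d < N.+1) \sum_(1 <= m < (N %/ d).+1)
     (mangoldt d * (u (d * m)%N / (d * m)%:R))).
    rewrite sum_hyperbola; apply: eq_big_nat => n /andP[n0 _].
    rewrite mulrCA -dconv1_mangoldt // dconvC // /dconv /dsum mulr_suml; apply: eq_bigr => d dn.
    by rewrite [(d * _)%N]mulnC divnK // mulr1.
  apply: eq_bigr => d _; rewrite /A /B 2!mulr_sumr -sumrB mulr_sumr; apply: eq_bigr => m _.
  rewrite uM natrM invfM; ring.
have -> : lu * (\sum_(1 <= n < N.+1) al n * mangoldt n / n%:R) -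
    lv * (\sum_(1 <= n < N.+1) be n * mangoldt n / n%:R) = \sum_(1 <= n < N.+1) u n * (lnn n / n%:R) -
     \sum_(1 <= d < N.+1) mangoldt d / d%:R * (al d * (A (N %/ d)%N - lu) - be d * (B (N %/ d)%N - lv)).
  rewrite i1 -sumrB 2!mulr_sumr -sumrB; apply: eq_bigr => d _; ring.
apply: le_trans (ler_normB _ _) _; rewrite lerD ?sum_bounded_lnn_div //.
apply: le_trans (ler_norm_sum _ _ _) _; apply: le_trans chebN.
rewrite big_nat [leRHS]big_nat; apply: ler_sum => d /andP[d0 _].
have dR : 0 < d%:R :> R by rewrite ltr0n.
have [t1 t2] := tail d d0.
have h1 := ler_pM (normr_ge0 _) (normr_ge0 _) (char_re_le1 d ch) t1.
have h2 := ler_pM (normr_ge0 _) (normr_ge0 _) (char_im_le1 d ch) t2.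
rewrite normrM (ger0_norm (divr_ge0 (mangoldt_ge0 _ _) (ltW dR))) -[_ / _ * _]mulrA.
apply: ler_wpM2l; first exact: mangoldt_ge0.
rewrite ler_pdivrMl //; apply: le_trans (ler_normB _ _) _; rewrite !normrM.
apply: le_trans (lerD h1 h2) _; apply: eq_ler; field; rewrite gt_eqF //.
Qed.

Lemma char_nonzero_mangoldt (al be : nat -> R) (C D l1 l2 : R) : is_character al be ->
  (forall N, `|psum al N| <= D) -> (forall N, `|psum be N| <= D) ->
  (forall N, `|\sum_(1 <= n < N.+1) al n / n%:R - l1| <= C / N.+1%:R) ->
  (forall N, `|\sum_(1 <= n < N.+1) be n / n%:R - l2| <= C / N.+1%:R) ->
  0 < l1 ^+ 2 + l2 ^+ 2 ->
  exists C', forall N, (0 < N)%N -> \sum_(1 <= n < N.+1) al n * mangoldt n / n%:R <= C'.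
Proof.
move=> ch da db ha hb l0; case: (ch) => aM bM nrm a1 b1.
pose E := 4 * D + 20 * C.
exists ((`|l1| * E + `|l2| * E) / (l1 ^+ 2 + l2 ^+ 2)) => N N0.
have e1 := char_mangoldt_bounded ch aM da ha hb N0.
have bM' d m : be (d * m)%N = al d * be m - be d * - al m by rewrite bM; ring.
have hna N' : `|\sum_(1 <= n < N'.+1) - al n / n%:R - - l1| <= C / N'.+1%:R.
  under eq_bigr do rewrite mulNr; by rewrite sumrN -opprB normrN opprK addrC ha.
have e2 := char_mangoldt_bounded ch bM' db hb hna N0.
move: e1 e2; rewrite -/E; set X := \sum_(_ <= _ < _) _; set Y := \sum_(_ <= _ < _) _ => e1 e2.
rewrite ler_pdivlMr //.
have h1 : l1 * (l1 * X - l2 * Y) <= `|l1| * E.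
  by apply: le_trans (ler_norm _) _; rewrite normrM ler_wpM2l.
have h2 : l2 * (l2 * X - - l1 * Y) <= `|l2| * E.
  by apply: le_trans (ler_norm _) _; rewrite normrM ler_wpM2l.
by apply: le_trans (lerD h1 h2); apply: eq_ler; ring.
Qed.

(* The inequality 3 + 4 cos t + cos 2t >= 0. *)
Lemma character_nonvanishing_complex (al be : nat -> R) (C D l1 l2 : R) : is_character al be ->
  (forall N, `|\sum_(1 <= n < N.+1) al n / n%:R| <= C / N.+1%:R) ->
  (forall N, `|\sum_(1 <= n < N.+1) be n / n%:R| <= C / N.+1%:R) ->
  (forall N, `|psum (fun n => al n ^+ 2 - be n ^+ 2) N| <= D) ->
  (forall N, `|psum (fun n => 2 * al n * be n) N| <= D) ->
  (forall N, `|\sum_(1 <= n < N.+1) (al n ^+ 2 - be n ^+ 2) / n%:R - l1| <= C / N.+1%:R) ->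
  (forall N, `|\sum_(1 <= n < N.+1) (2 * al n * be n) / n%:R - l2| <= C / N.+1%:R) -> False.
Proof.
move=> ch ha hb da db ha2 hb2.
have ch2 := char_sqr ch.
have [C1 hC1] : exists C', forall N, (0 < N)%N ->
    \sum_(1 <= n < N.+1) (al n ^+ 2 - be n ^+ 2) * mangoldt n / n%:R <= C'.
  (* The square of the character may itself have a vanishing [L]-value; its sum is then close to
     [- ln N], which is bounded above as well. *)
  have [l0|l0] := eqVneq (l1 ^+ 2 + l2 ^+ 2) 0; last first.
    apply: (char_nonzero_mangoldt ch2 da db ha2 hb2).
    by rewrite lt_neqAle eq_sym l0 addr_ge0 // sqr_ge0.
  have /eqP := l0; rewrite paddr_eq0 ?sqr_ge0 // !sqrf_eq0 => /andP[/eqP l10 /eqP l20].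
  exists (64 * C) => N N0.
  have hz := @char_zero_mangoldt (fun n => al n ^+ 2 - be n ^+ 2) (fun n => 2 * al n * be n) C ch2.
  have /ler_normlP[_] : `|lnn N + \sum_(1 <= n < N.+1) (al n ^+ 2 - be n ^+ 2) * mangoldt n / n%:R| <= 64 * C.
    by apply: hz => // N'; [have := ha2 N'; rewrite l10 subr0 | have := hb2 N'; rewrite l20 subr0].
  have := lnn_ge0 R N; lra.
have [C2 hC2] := mertens0 R K1.
have [N N0 hN] := exists_lnn_ge (3 * C2 + 4 * (64 * C) + C1 + 1).
have := hN N (leqnn N); have := hC2 N N0; have := hC1 N N0.
have := @char_zero_mangoldt al be C ch ha hb N N0.
have : 0 <= \sum_(1 <= n < N.+1) (3 * (mangoldt0 R K n / n%:R) + 4 * (al n * mangoldt n / n%:R) +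
    (al n ^+ 2 - be n ^+ 2) * mangoldt n / n%:R).
  apply: sumr_ge0 => n _; case: ch => _ _ nrm _ _.
  have -> : 3 * (mangoldt0 R K n / n%:R) + 4 * (al n * mangoldt n / n%:R) +
    (al n ^+ 2 - be n ^+ 2) * mangoldt n / n%:R =
    (3 * (al n ^+ 2 + be n ^+ 2) + 4 * al n + (al n ^+ 2 - be n ^+ 2)) * (mangoldt n / n%:R).
    by rewrite mangoldt0E nrm; ring.
  have := nrm n; rewrite chi0E; case: coprime => /= e.
    rewrite mulr_ge0 ?divr_ge0 ?mangoldt_ge0 // e.
    have -> : 3 * 1%:R + 4 * al n + (al n ^+ 2 - be n ^+ 2) = 2 * (1 + al n) ^+ 2 + ((al n ^+ 2 + be n ^+ 2) * -1 + 1) :> R by ring.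
    by rewrite e mulrN1 addNr addr0 mulr_ge0 // sqr_ge0.
  have /eqP := e; rewrite paddr_eq0 ?sqr_ge0 // !sqrf_eq0 => /andP[/eqP -> /eqP ->].
  by rewrite expr0n /= !mulr0 subrr !addr0 !mulr0 mul0r.
rewrite !big_split /= -!mulr_sumr.
set s1 := \sum_(_ <= _ < _) _; set s2 := \sum_(_ <= _ < _) _; set s3 := \sum_(_ <= _ < _) _.
move=> p /ler_normlP[a1 a1'] a2 /ler_normlP[a3 a3'] a4; lra.
Qed.

End CharacterNonvanishing.

Section RealCharacterNonvanishing.
Variable R : realType.
Variable K : nat.
Variable al : nat -> R.
Hypothesis alM : forall m n, al (m * n)%N = al m * al n.
Hypothesis al_sqr : forall n, al n ^+ 2 = chi0 R K n.
Hypothesis al1 : al 1%N = 1.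

Lemma al_values n : [\/ al n = 0, al n = 1 | al n = -1].
Proof.
have := al_sqr n; rewrite chi0E; case: coprime => /= /eqP.
  by rewrite sqrf_eq1 => /orP[/eqP ->|/eqP ->]; [apply: Or32|apply: Or33].
by rewrite sqrf_eq0 => /eqP ->; apply: Or31.
Qed.

Lemma al_norm n : `|al n| <= 1.
Proof. by case: (al_values n) => ->; rewrite ?normr0 ?normrN ?normr1. Qed.

Lemma alX p k : al (p ^ k) = al p ^+ k.
Proof. by elim: k => [|k IH]; rewrite ?expn0 ?expr0 // expnS alM IH exprS. Qed.

Lemma dsum_al_pfactor p a m : prime p -> ~~ (p %| m)%N ->
  dsum al (p ^ a * m) = (\sum_(i < a.+1) al p ^+ i) * dsum al m.
Proof.
move=> pp pm; elim: a => [|a IH].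
  by rewrite expn0 mul1n big_ord_recl big_ord0 expr0 addr0 mul1r.
rewrite dsum_pfactor // IH [in RHS]big_ord_recr /= [RHS]mulrDl; congr (_ + _).
by rewrite /dsum mulr_sumr; apply: eq_bigr => d _; rewrite alM alX.
Qed.

(** These are the local factors of the divisor sum of a real character; the even exponents are those
    occurring in perfect squares. *)
Lemma geometric_sign (x : R) a : [\/ x = 0, x = 1 | x = -1] ->
  0 <= \sum_(i < a.+1) x ^+ i /\ (~~ odd a -> 1 <= \sum_(i < a.+1) x ^+ i).
Proof.
case=> ->.
- suff -> : \sum_(i < a.+1) (0 : R) ^+ i = 1 by [].
  by rewrite big_ord_recl expr0 big1 ?addr0 // => i _; rewrite expr0n.
- have -> : \sum_(i < a.+1) (1 : R) ^+ i = a.+1%:R.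
    by under eq_bigr do rewrite expr1n; rewrite sumr_const card_ord.
  by split=> [|_]; rewrite ?ler0n // ler1n.
have -> : \sum_(i < a.+1) (-1 : R) ^+ i = (~~ odd a)%:R.
  elim: a => [|a IH]; first by rewrite big_ord_recl big_ord0 expr0 addr0.
  rewrite big_ord_recr /= IH -signr_odd /=.
  by case: (odd a) => /=; rewrite ?expr0 ?expr1 ?add0r ?subrr.
by split=> [|->]; rewrite ?ler0n.
Qed.

Lemma dsum_al_ge0 n : (0 < n)%N -> 0 <= dsum al n.
Proof.
elim/ltn_ind: n => n IH n0; have [n1|n1] := ltnP 1 n; last first.
  by case: n n0 n1 {IH} => [|[|]] // _ _; rewrite dsum_le0 al1.
have [p [a [m [pp pm nE]]]] := pfactor_decomp n1.
have m0 : (0 < m)%N by case: m pm {nE} => //; rewrite dvdn0.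
rewrite nE dsum_al_pfactor // mulr_ge0 ?(geometric_sign _ (al_values p)).1 // IH //.
by rewrite nE ltn_Pmull // -{1}(exp1n a.+1) ltn_exp2r // prime_gt1.
Qed.

Lemma dsum_al_square k : (0 < k)%N -> 1 <= dsum al (k ^ 2).
Proof.
elim/ltn_ind: k => n IH n0; have [n1|n1] := ltnP 1 n; last first.
  by case: n n0 n1 {IH} => [|[|]] // _ _; rewrite exp1n dsum_le0 al1.
have [p [a [m [pp pm nE]]]] := pfactor_decomp n1.
have m0 : (0 < m)%N by case: m pm {nE} => //; rewrite dvdn0.
rewrite nE expnMn -expnM dsum_al_pfactor //; last by rewrite Euclid_dvdX // negb_and pm.
rewrite -[X in X <= _]mul1r ler_pM // ?IH //.
  by apply: (geometric_sign _ (al_values p)).2; rewrite oddM andbF.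
by rewrite nE ltn_Pmull // -{1}(exp1n a.+1) ltn_exp2r // prime_gt1.
Qed.

Lemma sum_squares_le (g : nat -> R) q : (forall n, 0 <= g n) ->
  \sum_(1 <= k < q.+1) g (k ^ 2)%N <= psum g (q ^ 2).
Proof.
move=> g0; elim: q => [|q IH]; first by rewrite psum0 big_geq.
rewrite big_nat_recr //= /psum.
have qq : (q ^ 2 < q.+1 ^ 2)%N by rewrite ltn_sqr.
have p0 : (0 < q.+1 ^ 2)%N by rewrite expn_gt0.
rewrite [leRHS]big_nat_recr //= lerD //; apply: le_trans IH _.
rewrite [leRHS](@big_cat_nat _ _ _ (q ^ 2).+1) //= lerDl sumr_ge0 //.
Qed.

(** The linear weight improves the error from the [O(1)] of a sharp cut-off to [d / N], which can be
    summed over all [d] up to [N ^ (2/3)]. *)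
Lemma sum_linear_weight (N d : nat) : (0 < d)%N -> (d <= N)%N ->
  `|\sum_(1 <= m < (N %/ d).+1) (1 - (d * m)%:R / N%:R) - (N%:R / d%:R / 2 - 1 / 2)|
  <= d%:R / N%:R :> R.
Proof.
move=> d0 dN; have N0 : (0 < N)%N by exact: leq_trans dN.
have NR : 0 < N%:R :> R by rewrite ltr0n.
have dR : 0 < d%:R :> R by rewrite ltr0n.
have cE M : \sum_(1 <= m < M.+1) (1 - (d * m)%:R / N%:R) = M%:R - M%:R * (M%:R + 1) / 2 * (d%:R / N%:R) :> R.
  elim: M => [|M IH]; first by rewrite big_geq // !mul0r subr0.
  rewrite big_nat_recr //= IH natrM -[M.+1%:R]natr1; field; rewrite gt_eqF //.
rewrite cE; have := divn_natr_le R N d0; have := divn_natr_gt R N d0.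
set M := (N %/ d)%:R; have -> : d%:R / N%:R = (N%:R / d%:R)^-1 :> R by rewrite invf_div.
set Y := N%:R / d%:R => h1 h2.
have Y0 : 0 < Y by rewrite divr_gt0.
have -> : M - M * (M + 1) / 2 * Y^-1 - (Y / 2 - 1 / 2) = (Y - M) * (1 - (Y - M)) / 2 * Y^-1.
  by field; rewrite gt_eqF.
have z0 : 0 <= Y - M by lra.
have z1 : 0 <= 1 - (Y - M) by lra.
rewrite normrM (gtr0_norm (_ : 0 < Y^-1)) ?invr_gt0 // -[leRHS]mul1r ler_wpM2r ?invr_ge0 ?(ltW Y0) //.
rewrite ger0_norm ?divr_ge0 ?mulr_ge0 //; move: (Y - M) z0 z1 => f z0 z1; nra.
Qed.

Variables C D : R.
Hypothesis al_psum : forall N, `|psum al N| <= D.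
Hypothesis al_zero : forall N, `|\sum_(1 <= n < N.+1) al n / n%:R| <= C / N.+1%:R.

(** The long divisors of the hyperbola method: up to [B] the vanishing [L]-value is used, beyond [B]
    only the bounded partial sums. *)
Let c B n := if (B < n)%N then al n else 0.

Lemma psum_cut B N : `|psum (c B) N| <= 2 * D.
Proof.
have D0 : 0 <= D by apply: le_trans (al_psum 0%N).
have [h|h] := leqP N B.
  rewrite /psum big_nat big1 ?normr0 ?mulr_ge0 // => n /andP[_ hn].
  by rewrite /c ltnNge (leq_trans _ h).
have -> : psum (c B) N = psum al N - psum al B.
  rewrite /psum [X in _ = X - _](@big_cat_nat _ _ _ B.+1) //=; last by rewrite ltnS ltnW.
  rewrite [X in _ = X - _]addrC addrK (@big_cat_nat _ _ _ B.+1) //=; last by rewrite ltnS ltnW.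
  rewrite big_nat big1 ?add0r; last by move=> n /andP[_ hn]; rewrite /c ltnNge -ltnS hn.
  by apply: eq_big_nat => n /andP[hn _]; rewrite /c hn.
by apply: le_trans (ler_normB _ _) _; have := al_psum N; have := al_psum B; lra.
Qed.

(* Counting sum_{d | n} al d with the weight 1 - n/N: the squares alone contribute
   sqrt N, while the hyperbola method bounds the total by N^{1/3} when the L-value vanishes. *)
Lemma real_character_nonvanishing : False.
Proof.
have D0 : 0 <= D by apply: le_trans (al_psum 0%N).
have C0 : 0 <= C by have := al_zero 0%N; rewrite divr1; apply: le_trans.
pose E := (C / 2 + 1 + 12 * D) * 4 + D.
have E0 : 0 <= E by rewrite /E !(addr_ge0, mulr_ge0, divr_ge0).
pose u := (Num.trunc E).+1; have Eu : E < u%:R by exact: truncnS_gt.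
have u0 : (0 < u)%N by [].
(* Here [B] is [N ^ (2/3)] and [q] is half of [sqrt N], so the squares up to [q ^ 2] have weight at
   least [1 / 2] and contribute [2 * u ^ 3], against an upper bound [E * u ^ 2]. *)
pose t := (4 * u ^ 2)%N; pose B := (t ^ 2)%N; pose N := (t ^ 3)%N; pose q := (4 * u ^ 3)%N.
have t0 : (0 < t)%N by rewrite muln_gt0 expn_gt0.
have N0 : (0 < N)%N by rewrite expn_gt0 t0.
have B0 : (0 < B)%N by rewrite expn_gt0 t0.
have NE : N = (t * B)%N by rewrite /N /B expnS.
have BN : (B <= N)%N by rewrite NE leq_pmull.
have NR : 0 < N%:R :> R by rewrite ltr0n.
have BR : 0 < B%:R :> R by rewrite ltr0n.
have tR : 0 < t%:R :> R by rewrite ltr0n.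
have NRE : N%:R = t%:R * B%:R :> R by rewrite NE natrM.
have q2 : (4 * q ^ 2 = N)%N by rewrite /q /N /t; ring.
pose F := \sum_(1 <= n < N.+1) dsum al n * (1 - n%:R / N%:R).
have lower : 2 * u%:R ^+ 3 <= F.
  pose g n := if (n <= N)%N && (0 < n)%N then dsum al n * (1 - n%:R / N%:R) else 0.
  have g0 n : 0 <= g n.
    rewrite /g; case: ifP => // /andP[nN n0]; rewrite mulr_ge0 ?dsum_al_ge0 //.
    by rewrite subr_ge0 ler_pdivrMr // mul1r ler_nat.
  have qN : (q ^ 2 <= N)%N by rewrite -q2 leq_pmull.
  have -> : F = psum g N.
    by apply: eq_big_nat => n /andP[n0]; rewrite ltnS => nN; rewrite /g nN n0.
  apply: (@le_trans _ _ (psum g (q ^ 2))); last first.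
    by rewrite /psum [leRHS](@big_cat_nat _ _ _ (q ^ 2).+1) //= lerDl sumr_ge0.
  apply: le_trans (sum_squares_le q g0).
  apply: (@le_trans _ _ (\sum_(1 <= k < q.+1) (1 / 2))).
    rewrite big_const_nat iter_addr_0 subSS subn0 -[X in _ <= X]mulr_natl /q natrM natrX; lra.
  rewrite big_nat [leRHS]big_nat; apply: ler_sum => k /andP[k0]; rewrite ltnS => kq.
  have kq2 : (4 * k ^ 2 <= N)%N by rewrite -q2 leq_mul2l leq_sqr kq orbT.
  have kN : (k ^ 2 <= N)%N by apply: leq_trans kq2; rewrite leq_pmull.
  rewrite /g kN expn_gt0 k0 /= -[leLHS]mul1r ler_pM ?dsum_al_square //.
  have : (k ^ 2)%:R / N%:R <= 1 / 4 :> R.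
    have := kq2; rewrite -(ler_nat R) natrM ler_pdivrMr //; lra.
  lra.
have upper : F <= (C / 2 + 1 + 12 * D) * t%:R + D.
  have FE : F = \sum_(1 <= d < N.+1) \sum_(1 <= m < (N %/ d).+1) al d * (1 - (d * m)%:R / N%:R).
    rewrite sum_hyperbola; apply: eq_big_nat => n /andP[n0 _].
    by rewrite /dsum mulr_suml; apply: eq_bigr => d dn; rewrite [(d * _)%N]mulnC divnK.
  pose h d := \sum_(1 <= m < (N %/ d).+1) (1 - (d * m)%:R / N%:R) : R.
  have -> : F = \sum_(1 <= d < B.+1) al d * h d + \sum_(1 <= d < N.+1) \sum_(1 <= m < (N %/ d).+1) c B d * (1 - (d * m)%:R / N%:R).
    rewrite FE (@big_cat_nat _ _ _ B.+1) //= [X in _ = _ + X](@big_cat_nat _ _ _ B.+1) //=.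
    rewrite [X in _ = _ + (X + _)]big_nat [X in _ = _ + (X + _)]big1 ?add0r; last first.
      by move=> d /andP[_ hd]; rewrite big1 // => m _; rewrite /c ltnNge -ltnS hd mul0r.
    congr (_ + _); first by apply: eq_bigr => d _; rewrite mulr_sumr.
    by apply: eq_big_nat => d /andP[hd _]; rewrite /c hd.
  have p1 : `|\sum_(1 <= d < B.+1) al d * h d| <= (C / 2 + 1) * t%:R + D.
    have -> : \sum_(1 <= d < B.+1) al d * h d = N%:R / 2 * (\sum_(1 <= d < B.+1) al d / d%:R)
       - psum al B / 2 + \sum_(1 <= d < B.+1) al d * (h d - (N%:R / d%:R / 2 - 1 / 2)).
      rewrite /psum mulr_sumr mulr_suml -sumrB -big_split /=; apply: eq_bigr => d _; ring.
    have r1 : `|N%:R / 2 * (\sum_(1 <= d < B.+1) al d / d%:R)| <= C / 2 * t%:R.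
      rewrite normrM ger0_norm ?divr_ge0 //.
      apply: (@le_trans _ _ (N%:R / 2 * (C / B%:R))).
        rewrite ler_wpM2l ?divr_ge0 //; apply: le_trans (al_zero B) _.
        by rewrite ler_wpM2l // lef_pV2 ?posrE ?ltr0n // ler_nat.
      rewrite NRE [leLHS](_ : _ = C / 2 * t%:R) //; field; rewrite gt_eqF //.
    have r2 : `|psum al B / 2| <= D.
      rewrite normrM [`|2^-1|]ger0_norm ?invr_ge0 //; have := al_psum B; have := normr_ge0 (psum al B); lra.
    have r3 : `|\sum_(1 <= d < B.+1) al d * (h d - (N%:R / d%:R / 2 - 1 / 2))| <= t%:R.
      apply: le_trans (ler_norm_sum _ _ _) _.
      apply: (@le_trans _ _ (\sum_(1 <= d < B.+1) B%:R / N%:R)).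
        rewrite big_nat [leRHS]big_nat; apply: ler_sum => d /andP[d0]; rewrite ltnS => dB.
        rewrite normrM -[leRHS]mul1r ler_pM ?al_norm //.
        apply: le_trans (sum_linear_weight d0 (leq_trans dB BN)) _.
        by rewrite ler_wpM2r ?invr_ge0 ?(ltW NR) // ler_nat.
      rewrite big_const_nat iter_addr_0 subSS subn0 -[X in X <= _]mulr_natl NRE.
      have BE : B%:R = t%:R ^+ 2 :> R by rewrite natrX.
      rewrite BE [leLHS](_ : _ = t%:R) //; field; rewrite gt_eqF //.
    move: r1 r2 r3 => /ler_normlP[a1 a1'] /ler_normlP[a2 a2'] /ler_normlP[a3 a3'].
    apply/ler_normlP; split; lra.
  have p2 : `|\sum_(1 <= d < N.+1) \sum_(1 <= m < (N %/ d).+1) c B d * (1 - (d * m)%:R / N%:R)|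
     <= 12 * D * t%:R.
    rewrite sum_hyperbola_swap (@big_cat_nat _ _ _ t.+1) //=; last first.
      by rewrite ltnS NE leq_pmulr.
    rewrite [X in _ + X]big_nat [X in _ + X]big1 ?addr0; last first.
      move=> m /andP[tm _]; rewrite big_nat big1 // => d /andP[d0]; rewrite ltnS => dm.
      rewrite /c ifN ?mul0r // -leqNgt; apply: leq_trans dm _.
      by rewrite -(mulKn B t0) -NE leq_div2l // ltnW.
    apply: le_trans (ler_norm_sum _ _ _) _.
    apply: (@le_trans _ _ (\sum_(1 <= m < t.+1) 12 * D)); last first.
      by rewrite big_const_nat iter_addr_0 subSS subn0 mulr_natr.
    rewrite big_nat [leRHS]big_nat; apply: ler_sum => m /andP[m0]; rewrite ltnS => mt.
    set L := (N %/ m)%N.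
    pose w d := 1 - (d * m)%:R / N%:R : R.
    rewrite (sum_by_parts (c B) w).
    have wd n : w n - w n.+1 = m%:R / N%:R by rewrite /w !natrM -[n.+1%:R]natr1; ring.
    have mR : 0 <= m%:R / N%:R :> R by rewrite divr_ge0.
    have LmN : L.+1%:R * m%:R <= N%:R + m%:R :> R.
      by rewrite -natrM -natrD ler_nat mulSn addnC leq_add2r leq_divM.
    have mN : m%:R <= N%:R :> R by rewrite ler_nat (leq_trans mt) // NE leq_pmulr.
    have wL : `|w L.+1| <= 1.
      rewrite /w natrM ler_norml; apply/andP; split; last by rewrite lerBlDr lerDl divr_ge0 ?mulr_ge0.
      have : L.+1%:R * m%:R / N%:R <= 2 :> R by rewrite ler_pdivrMr //; lra.
      lra.
    have w1 : w 1%N <= 1 by rewrite /w lerBlDr lerDl divr_ge0.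
    apply: le_trans (ler_normD _ _) _.
    have r1 : `|psum (c B) L * w L.+1| <= 2 * D * 1 by rewrite normrM ler_pM // psum_cut.
    have r2 : `|\sum_(1 <= n < L.+1) psum (c B) n * (w n - w n.+1)| <= 2 * D * (w 1%N - w L.+1).
      apply: le_trans (ler_norm_sum _ _ _) _; rewrite -(telescope_nat w) mulr_sumr.
      apply: ler_sum => n _; rewrite normrM wd (ger0_norm mR).
      by apply: ler_wpM2r => //; exact: psum_cut.
    have r3 : 2 * D * (w 1%N - w L.+1) <= 2 * D * 2.
      apply: ler_wpM2l; first by rewrite mulr_ge0.
      by move: wL; rewrite ler_norml => /andP[]; lra.
    lra.
  move: p1 p2 => /ler_normlP[_ a1] /ler_normlP[_ a2]; lra.
have : 2 * u%:R ^+ 3 <= E * u%:R ^+ 2.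
  apply: le_trans lower (le_trans upper _).
  rewrite /E /t natrM natrX; have : 1 <= u%:R ^+ 2 :> R by rewrite exprn_ege1 // ler1n.
  move=> h; have : D * 1 <= D * u%:R ^+ 2 by rewrite ler_wpM2l.
  lra.
have u2 : 0 < u%:R ^+ 2 :> R by rewrite exprn_gt0 // ltr0n.
rewrite exprS mulrA ler_pM2r //; have : 0 < u%:R :> R by rewrite ltr0n.
lra.
Qed.

End RealCharacterNonvanishing.

Section GroupCharacters.
Variable R : realType.
Variable n : nat.
Local Notation C := R[i].

(** In the coordinates of a basis of the left kernel of [L], the operators become commuting square
    matrices over an algebraically closed field. *)
Lemma common_eigenvector_in (I : finType) (p : nat) (L : 'M[C]_(n, p)) (P : I -> 'M[C]_n) :
  (forall i j, P i *m P j = P j *m P i) ->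
  (forall i (v : 'rV_n), v *m L = 0 -> v *m P i *m L = 0) -> ~~ row_free L ->
  exists2 u : 'rV[C]_n, u != 0 & u *m L = 0 /\ forall i, exists a, u *m P i = a *: u.
Proof.
move=> comm stab nL; set W := row_base (kermx L).
have WL : W *m L = 0 by apply/sub_kermxP; rewrite eq_row_base.
have WP i : (W *m P i <= W)%MS.
  rewrite eq_row_base; apply/sub_kermxP/row_matrixP => k.
  rewrite -mulmxA row_mul mulmxA stab ?row0 // -row_mul WL row0 //.
have Wf : row_free W by exact: row_base_free.
have [A AW] : exists A : (I -> 'M[C]_(\rank (kermx L))), (forall i, A i *m W = W *m P i).
  by exists (fun i => W *m P i *m pinvmx W) => i; rewrite mulmxKpV.
have AAW k m : A k *m A m *m W = W *m (P k *m P m).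
  by rewrite -mulmxA (AW m) mulmxA (AW k) -mulmxA.
have r0 : (0 < \rank (kermx L))%N by rewrite lt0n mxrank_eq0 kermx_eq0.
have [|v v0 /allP hv] := @common_eigenvector C _ [seq A i | i : I] r0.
  move=> A1 A2 /fintype.imageP[i _ ->] /fintype.imageP[j _ ->]; apply: (row_free_inj Wf).
  by change (A i *m A j *m W = A j *m A i *m W); rewrite 2!AAW comm.
exists (v *m W).
  by apply: contra v0 => /eqP e; apply/eqP; apply: (row_free_inj Wf); rewrite /= e mul0mx.
split=> [|i]; first by rewrite -mulmxA WL mulmx0.
have /sub_rVP[a ha] := hv _ (fintype.image_f A (isT : i \in I)).
by exists a; rewrite -mulmxA -AW mulmxA ha -scalemxAl.
Qed.

End GroupCharacters.

(** * Logarithmic means of the Moebius function and values of L-series at 1 *)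

Section MoebiusLogMean.
Variable R : realType.
Variable K : nat.
Hypothesis K1 : (1 < K)%N.
Local Notation mu := (mu R).
Local Notation chi0 := (chi0 R K).
Local Notation phiK := (phiK R K).
Local Notation kapK := (kapK R K).
Local Notation cls := (@cls R K).
Local Notation N' := (Zp_trunc K).+2.
Local Notation "x ^u" := (x \is a GRing.unit) (at level 2, only parsing).

Definition Rcls (b : 'Z_K) N : R := \sum_(1 <= n < N.+1) cls b n * mu n / n%:R.

Lemma psum_weights_bound (w : 'Z_K -> R) N : (forall b, `|w b| <= 1) ->
  \sum_(b : 'Z_K | b \is a GRing.unit) w b = 0 ->
  `|psum (fun n => \sum_(b : 'Z_K | b \is a GRing.unit) w b * cls b n) N| <= phiK.
Proof.
move=> w1 w0; rewrite /psum exchange_big /=.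
have -> : \sum_(b : 'Z_K | b \is a GRing.unit) \sum_(1 <= n < N.+1) w b * cls b n =
  \sum_(b : 'Z_K | b \is a GRing.unit) w b * (psum (cls b) N - N%:R / K%:R).
  transitivity (\sum_(b : 'Z_K | b \is a GRing.unit) (w b * psum (cls b) N) - (\sum_(b : 'Z_K | b \is a GRing.unit) w b) * (N%:R / K%:R)).
    by rewrite w0 mul0r subr0; apply: eq_bigr => b _; rewrite mulr_sumr.
  by rewrite mulr_suml -sumrB; apply: eq_bigr => b _; rewrite mulrBr.
apply: le_trans (ler_norm_sum _ _ _) _; rewrite -[leRHS]mulr1 -sum_unit_const.
by apply: ler_sum => b _; rewrite normrM -[leRHS]mul1r ler_pM // count_cls.
Qed.

(** The harmonic series of a single class diverges, hence the comparison with class [1]. For a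
    nontrivial character [psi] the values sum to zero over the units, so that the sum of
    [l b * psi b] is [L(1, psi)]. *)
Lemma class_harmonic_limits : exists l : 'Z_K -> R, forall b N,
  `|\sum_(1 <= n < N.+1) (cls b n - cls 1 n) / n%:R - l b| <= 4 / N.+1%:R.
Proof.
suff hc b : exists x, forall N, `|\sum_(1 <= n < N.+1) (cls b n - cls 1 n) / n%:R - x| <= 4 / N.+1%:R.
  by have [x hx] := boolp.choice hc; exists x.
have hb : forall n, `|psum (fun n => cls b n - cls 1 n) n| <= 2.
  move=> n; rewrite /psum sumrB.
  have /ler_normlP[h1 h1'] := count_cls R K1 b n.
  have /ler_normlP[h2 h2'] := count_cls R K1 1 n.
  move: h1 h1' h2 h2'; rewrite /psum => *; apply/ler_normlP; split; lra.
have [x hx] := sum_harmonic_cvg hb.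
exists x => N; apply: le_trans (hx N) _.
by rewrite -natrM.
Qed.

Lemma norm_chi0_mu d : `|chi0 d * mu d| <= 1.
Proof.
rewrite normrM (ger0_norm (chi0_ge0 _ _ _)) -[leRHS]mulr1.
by rewrite ler_pM ?chi0_ge0 ?chi0_le1 ?norm_mu.
Qed.

(** Inversion gives that the sum of [chi0 d * mu d * psum chi0 (M %/ d)] is [1]; replacing the count
    by [kapK * M / d] costs [O(1)] for each [d]. *)
Lemma sum_Rcls_bounded : exists C, forall N, `|\sum_(b : 'Z_K | b \is a GRing.unit) Rcls b N| <= C.
Proof.
have k0 := kapK_gt0 R K1; have p0 := phiK_gt0 R K.
exists ((phiK + kapK + 1) / kapK) => -[|N].
  rewrite big1 ?normr0 ?divr_ge0 ?(ltW k0) //; first lra.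
  by move=> b _; rewrite /Rcls big_geq.
set M := N.+1; have M0 : 0 < M%:R :> R by rewrite ltr0n.
have -> : \sum_(b : 'Z_K | b \is a GRing.unit) Rcls b M = \sum_(1 <= d < M.+1) chi0 d * mu d / d%:R.
  rewrite /Rcls exchange_big /=; apply: eq_bigr => d _.
  by rewrite chi0_sum // !mulr_suml.
have e1 : \sum_(1 <= d < M.+1) chi0 d * mu d * psum chi0 (M %/ d) = 1.
  rewrite -psum_dconv (eq_psum (g := dunit R)) => [|n n0].
    rewrite /psum big_ltn // /dunit eqxx big_nat big1 ?addr0 // => n /andP[n1 _].
    by rewrite gtn_eqF.
  transitivity (chi0 n * dconv mu (fun=> 1) n).
    rewrite -dconv_twist //; last exact: chi0M.
    by apply: eq_dconv => // k _; rewrite mulr1.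
  rewrite dconv_mu1 // /dunit; case: eqP => [->|]; last by rewrite mulr0.
  by rewrite chi01 mulr1.
set S := \sum_(_ <= _ < _) _.
have e2 : `|kapK * M%:R * S - 1| <= (phiK + kapK) * M%:R.
  rewrite -[X in _ - X]e1 /S mulr_sumr -sumrB; apply: le_trans (ler_norm_sum _ _ _) _.
  apply: (@le_trans _ _ (\sum_(1 <= d < M.+1) (phiK + kapK))); last first.
    by rewrite big_const_nat iter_addr_0 subSS subn0 mulr_natr.
  rewrite big_nat [leRHS]big_nat; apply: ler_sum => d /andP[d0 _].
  have -> : kapK * M%:R * (chi0 d * mu d / d%:R) - chi0 d * mu d * psum chi0 (M %/ d) =
    chi0 d * mu d * (kapK * (M%:R / d%:R) - psum chi0 (M %/ d)) by ring.
  rewrite normrM -[leRHS]mul1r ler_pM ?norm_chi0_mu //.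
  have := psum_chi0_close R K1 (M %/ d); have := divn_natr_le R M d0; have := divn_natr_gt R M d0.
  set y := M%:R / d%:R; set m := (M %/ d)%:R => h1 h2 /ler_normlP[h3 h4].
  apply/ler_normlP; split; nra.
rewrite ler_pdivlMr // -(ler_pM2r M0).
have -> : `|S| * kapK * M%:R = `|kapK * M%:R * S|.
  by rewrite 2!normrM (gtr0_norm k0) (gtr0_norm M0); ring.
have : 1 <= M%:R :> R by rewrite ler1n.
move: e2 => /ler_normlP[a1 a2] a3; apply/ler_normlP; split; lra.
Qed.

(** Convolving the harmonic sums of the class of [a] with [mu] leaves at most the term [n = 1]. The
    inner sums are [l (a / d)] plus a part [T] that does not depend on [a], with errors adding up to
    [4]; subtracting the case [a = 1] eliminates [T]. *)
Lemma Rcls_relation (l : 'Z_K -> R) :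
  (forall b N, `|\sum_(1 <= n < N.+1) (cls b n - cls 1 n) / n%:R - l b| <= 4 / N.+1%:R) ->
  forall a N, a \is a GRing.unit ->
  `|\sum_(b : 'Z_K | b \is a GRing.unit) (l (a / b) - l (1 / b)) * Rcls b N| <= 10.
Proof.
move=> hl; pose T N := \sum_(1 <= d < N.+1) chi0 d * mu d / d%:R * (\sum_(1 <= m < (N %/ d).+1) cls 1 m / m%:R).
have key a N : a \is a GRing.unit -> (0 < N)%N ->
    `|\sum_(b : 'Z_K | b \is a GRing.unit) l (a / b) * Rcls b N + T N| <= 5.
  move=> au N0; have NR : 0 < N%:R :> R by rewrite ltr0n.
  have e0 : `|\sum_(1 <= d < N.+1) chi0 d * mu d / d%:R * (\sum_(1 <= m < (N %/ d).+1) cls (a / d%:R) m / m%:R)| <= 1.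
    have -> : \sum_(1 <= d < N.+1) chi0 d * mu d / d%:R * (\sum_(1 <= m < (N %/ d).+1) cls (a / d%:R) m / m%:R) =
      \sum_(1 <= n < N.+1) cls a n / n%:R * dunit R n.
      transitivity (\sum_(1 <= d < N.+1) \sum_(1 <= m < (N %/ d).+1) (mu d * (cls a (d * m)%N / (d * m)%:R))).
        apply: eq_bigr => d _; rewrite mulr_sumr; apply: eq_bigr => m _.
        by rewrite cls_mul // natrM invfM; ring.
      rewrite sum_hyperbola; apply: eq_big_nat => n /andP[n0 _].
      rewrite -dconv_mu1 // /dconv /dsum mulr_sumr; apply: eq_bigr => d dn.
      by rewrite [(d * _)%N]mulnC divnK // mulr1 mulrC.
    rewrite big_ltn // /dunit eqxx big_nat big1 ?addr0; last first.
      by move=> n /andP[n1 _]; rewrite gtn_eqF // mulr0.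
    by rewrite divr1 mulr1 ger0_norm ?cls_ge0 ?cls_le1.
  have e1 : \sum_(b : 'Z_K | b \is a GRing.unit) l (a / b) * Rcls b N =
     \sum_(1 <= d < N.+1) chi0 d * mu d / d%:R * l (a / d%:R).
    rewrite /Rcls; under eq_bigr do rewrite mulr_sumr.
    rewrite exchange_big /=; apply: eq_bigr => d _.
    rewrite chi0_sum // !mulr_suml; apply: eq_bigr => b _.
    by rewrite clsE; case: eqP => [->|_]; rewrite ?mul0r ?mulr0 //; ring.
  have e2 : `|\sum_(1 <= d < N.+1) chi0 d * mu d / d%:R * (\sum_(1 <= m < (N %/ d).+1) cls (a / d%:R) m / m%:R)
     - (\sum_(b : 'Z_K | b \is a GRing.unit) l (a / b) * Rcls b N + T N)| <= 4.
    rewrite e1 /T -big_split -sumrB /=; apply: le_trans (ler_norm_sum _ _ _) _.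
    apply: (@le_trans _ _ (\sum_(1 <= d < N.+1) 4 / N%:R)); last first.
      rewrite big_const_nat iter_addr_0 subSS subn0 -[X in X <= _]mulr_natr divfK // gt_eqF //.
    rewrite big_nat [leRHS]big_nat; apply: ler_sum => d /andP[d0 _].
    have dR : 0 < d%:R :> R by rewrite ltr0n.
    rewrite -mulrDr -mulrBr.
    have -> : \sum_(1 <= m < (N %/ d).+1) cls (a / d%:R) m / m%:R - (l (a / d%:R) + \sum_(1 <= m < (N %/ d).+1) cls 1 m / m%:R) =
      \sum_(1 <= m < (N %/ d).+1) (cls (a / d%:R) m - cls 1 m) / m%:R - l (a / d%:R).
      rewrite opprD addrCA addrC [in RHS]addrC; under [in RHS]eq_bigr do rewrite mulrBl.
      by rewrite sumrB; ring.
    have h := hl (a / d%:R) (N %/ d)%N.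
    have hi := @inv_floorS_le R N d N0 d0.
    have h2 : 4 / (N %/ d).+1%:R <= 4 * (d%:R / N%:R) :> R by rewrite ler_wpM2l.
    rewrite normrM; apply: (@le_trans _ _ (d%:R^-1 * (4 * (d%:R / N%:R)))).
      apply: ler_pM => //; last exact: le_trans h h2.
      rewrite normrM normfV normr_nat -[leRHS]mul1r.
      by apply: ler_wpM2r; [rewrite invr_ge0 ltW | exact: norm_chi0_mu].
    by rewrite le_eqVlt; apply/orP; left; apply/eqP; field; rewrite !gt_eqF.
  move: e0 e2 => /ler_normlP[a1 a1'] /ler_normlP[a2 a2']; apply/ler_normlP; split; lra.
move=> a [|N] au.
  by rewrite big1 ?normr0 // => b _; rewrite /Rcls big_geq ?mulr0.
have h1 := key a N.+1 au isT; have h2 := key 1 N.+1 (unitr1 _) isT.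
under eq_bigr do rewrite mulrBl; rewrite sumrB.
move: h1 h2 => /ler_normlP[a1 a1'] /ler_normlP[a2 a2']; apply/ler_normlP; split; lra.
Qed.

Lemma unit_expn_totient (c : 'Z_K) : c \is a GRing.unit -> c ^+ totient K = 1.
Proof.
rewrite -[c]natr_Zp natr_unit // => cop.
rewrite -natrX; apply/val_inj; rewrite /= !val_Zp_nat //.
by rewrite Euler_exp_totient 1?coprime_sym // modn_small.
Qed.

Definition normsq (z : R[i]) : R := complex.Re z ^+ 2 + complex.Im z ^+ 2.

Lemma normsqM z w : normsq (z * w) = normsq z * normsq w.
Proof. by case: z => a b; case: w => c d; rewrite /normsq /=; ring. Qed.

Lemma normsq_unity z m : (0 < m)%N -> z ^+ m = 1 -> normsq z = 1.
Proof.
move=> m0 zm; have nX k : normsq (z ^+ k) = normsq z ^+ k.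
  elim: k => [|k IH]; first by rewrite !expr0 /normsq /= expr1n expr0n addr0.
  by rewrite !exprS normsqM IH.
have := nX m; rewrite zm {1}/normsq /= expr1n expr0n addr0 => /esym/eqP.
have n0 : 0 <= normsq z by rewrite addr_ge0 ?sqr_ge0.
by rewrite pexpr_eq1 // => /eqP.
Qed.

Variable l : 'Z_K -> R.
Hypothesis hl : forall b N,
  `|\sum_(1 <= n < N.+1) (cls b n - cls 1 n) / n%:R - l b| <= 4 / N.+1%:R.

Lemma harmonic_weights_close (w : 'Z_K -> R) N : (forall b, `|w b| <= 1) ->
  \sum_(b : 'Z_K | b \is a GRing.unit) w b = 0 ->
  \sum_(b : 'Z_K | b \is a GRing.unit) l b * w b = 0 ->
  `|\sum_(1 <= n < N.+1) (\sum_(b : 'Z_K | b \is a GRing.unit) w b * cls b n) / n%:R|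
    <= 4 * phiK / N.+1%:R.
Proof.
move=> w1 w0 lw0.
have -> : \sum_(1 <= n < N.+1) (\sum_(b : 'Z_K | b \is a GRing.unit) w b * cls b n) / n%:R =
  \sum_(b : 'Z_K | b \is a GRing.unit) w b * (\sum_(1 <= n < N.+1) (cls b n - cls 1 n) / n%:R - l b).
  transitivity (\sum_(b : 'Z_K | b \is a GRing.unit) w b * (\sum_(1 <= n < N.+1) cls b n / n%:R)
     - (\sum_(b : 'Z_K | b \is a GRing.unit) w b) * (\sum_(1 <= n < N.+1) cls 1 n / n%:R)
     - \sum_(b : 'Z_K | b \is a GRing.unit) l b * w b).
    rewrite w0 lw0 mul0r !subr0; under eq_bigr do rewrite mulr_suml.
    rewrite exchange_big /=; apply: eq_bigr => b _; rewrite mulr_sumr; apply: eq_bigr => n _; ring.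
  rewrite mulr_suml -!sumrB; apply: eq_bigr => b _.
  under [in RHS]eq_bigr do rewrite mulrBl; rewrite sumrB; ring.
apply: le_trans (ler_norm_sum _ _ _) _.
rewrite -mulrA mulrCA -sum_unit_const; apply: ler_sum => b _.
by rewrite normrM -[leRHS]mul1r ler_pM // mulrC.
Qed.

(** Since the sum of [l b * psi b] is [L(1, psi)], this is the nonvanishing theorem, split according
    to whether [psi] is real. *)
Lemma no_degenerate_character (psi : 'Z_K -> R[i]) :
  (forall a b, a \is a GRing.unit -> b \is a GRing.unit -> psi (a * b) = psi a * psi b) ->
  psi 1 = 1 -> (exists2 a, a \is a GRing.unit & psi a != 1) ->
  \sum_(b : 'Z_K | b \is a GRing.unit) (l b)%:C%C * psi b = 0 -> False.
Proof.
move=> psiM psi1 nontriv lpsi.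
have p0 := phiK_gt0 R K.
have psiX a k : a \is a GRing.unit -> psi (a ^+ k) = psi a ^+ k.
  move=> au; elim: k => [|k IH]; first by rewrite !expr0.
  by rewrite !exprS psiM ?unitrX // IH.
have psi_norm a : a \is a GRing.unit -> normsq (psi a) = 1.
  move=> au; apply: (@normsq_unity _ (totient K)); first by rewrite totient_gt0 ltnW.
  by rewrite -psiX // unit_expn_totient.
have orth (f : 'Z_K -> R[i]) : (forall a b, a \is a GRing.unit -> b \is a GRing.unit -> f (a * b) = f a * f b) ->
    (exists2 a, a \is a GRing.unit & f a != 1) -> \sum_(b : 'Z_K | b \is a GRing.unit) f b = 0.
  move=> fM [a au fa].
  have : f a * \sum_(b : 'Z_K | b \is a GRing.unit) f b = \sum_(b : 'Z_K | b \is a GRing.unit) f b.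
    rewrite mulr_sumr [RHS](reindex_onto (fun b => a * b) (fun b => a^-1 * b)) /=; last first.
      by move=> b _; rewrite mulrA divrr // mul1r.
    apply: eq_big => [b|b bu]; last by rewrite fM.
    by rewrite unitrM au /= mulrA mulVr // mul1r eqxx andbT.
  move/eqP; rewrite -subr_eq0 -{2}[\sum_(b | _) _]mul1r -mulrBl mulf_eq0 subr_eq0 (negbTE fa) /=.
  by move/eqP.
pose re (f : 'Z_K -> R[i]) n := \sum_(b : 'Z_K | b \is a GRing.unit) complex.Re (f b) * cls b n.
pose im (f : 'Z_K -> R[i]) n := \sum_(b : 'Z_K | b \is a GRing.unit) complex.Im (f b) * cls b n.
have reE f n : re f n = if coprime K n then complex.Re (f n%:R) else 0.
  rewrite /re -natr_unit //; case: ifP => u.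
    rewrite (bigD1 (n%:R : 'Z_K)) //= clsE eqxx mulr1 big1 ?addr0 // => b /andP[_ /negbTE nb].
    by rewrite clsE eq_sym nb mulr0.
  by rewrite big1 // => b bu; rewrite clsE; case: eqP => [e|]; rewrite ?mulr0 // -e u in bu *.
have imE f n : im f n = if coprime K n then complex.Im (f n%:R) else 0.
  rewrite /im -natr_unit //; case: ifP => u.
    rewrite (bigD1 (n%:R : 'Z_K)) //= clsE eqxx mulr1 big1 ?addr0 // => b /andP[_ /negbTE nb].
    by rewrite clsE eq_sym nb mulr0.
  by rewrite big1 // => b bu; rewrite clsE; case: eqP => [e|]; rewrite ?mulr0 // -e u in bu *.
have ReIm0 (f : 'Z_K -> R[i]) : \sum_(b : 'Z_K | b \is a GRing.unit) f b = 0 ->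
   \sum_(b : 'Z_K | b \is a GRing.unit) complex.Re (f b) = 0 /\
   \sum_(b : 'Z_K | b \is a GRing.unit) complex.Im (f b) = 0.
  have reD : {morph (@complex.Re R) : x y / x + y >-> (x + y : R)} by case=> ? ? [].
  have imD : {morph (@complex.Im R) : x y / x + y >-> (x + y : R)} by case=> ? ? [].
  by move=> h; rewrite -(big_morph _ reD (erefl : complex.Re (0 : R[i]) = 0))
    -(big_morph _ imD (erefl : complex.Im (0 : R[i]) = 0)) h.
have re_le (f : 'Z_K -> R[i]) b : normsq (f b) = 1 -> `|complex.Re (f b)| <= 1.
  move=> h; rewrite -[leRHS]normr1 -ler_sqr ?nnegrE // normr1 expr1n -normrX ger0_norm ?sqr_ge0 //.
  by rewrite -h lerDl sqr_ge0.
have im_le (f : 'Z_K -> R[i]) b : normsq (f b) = 1 -> `|complex.Im (f b)| <= 1.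
  move=> h; rewrite -[leRHS]normr1 -ler_sqr ?nnegrE // normr1 expr1n -normrX ger0_norm ?sqr_ge0 //.
  by rewrite -h lerDr sqr_ge0.
(* The value [1] at non-units makes the modulus [1] everywhere, as required of weights; the sums see
   only the units. *)
pose psi' a := if a \is a GRing.unit then psi a else 1.
have psi'u a : a \is a GRing.unit -> psi' a = psi a by rewrite /psi' => ->.
have psi'n a : normsq (psi' a) = 1.
  by rewrite /psi'; case: ifP => [/psi_norm //|_]; rewrite /normsq /= expr1n expr0n addr0.
have psi's : \sum_(b : 'Z_K | b \is a GRing.unit) psi' b = 0.
  by rewrite (eq_bigr psi) //; exact: orth.
have [rs is_] := ReIm0 _ psi's.
have [rl il] : \sum_(b : 'Z_K | b \is a GRing.unit) l b * complex.Re (psi' b) = 0 /\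
   \sum_(b : 'Z_K | b \is a GRing.unit) l b * complex.Im (psi' b) = 0.
  have [h1 h2] := ReIm0 _ lpsi.
  split; [rewrite -[RHS]h1|rewrite -[RHS]h2]; apply: eq_bigr => b bu; rewrite psi'u //.
    by case: (psi b) => x y /=; rewrite mul0r subr0.
  by case: (psi b) => x y /=; rewrite mul0r addr0.
have ha := fun N => harmonic_weights_close N (fun b => re_le psi' b (psi'n b)) rs rl.
have hb := fun N => harmonic_weights_close N (fun b => im_le psi' b (psi'n b)) is_ il.
have da := fun N => psum_weights_bound N (fun b => re_le psi' b (psi'n b)) rs.
have db := fun N => psum_weights_bound N (fun b => im_le psi' b (psi'n b)) is_.
have ch : is_character K (re psi') (im psi').
  have u1 : coprime K 1 by rewrite coprimen1.
  split=> [m n|m n|n||].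
  - rewrite !reE !imE coprimeMr; case: (boolP (coprime K m)) => um; case: (boolP (coprime K n)) => un /=; rewrite ?mulr0 ?mul0r ?subr0 //.
    rewrite !psi'u ?natr_unit ?coprimeMr ?um ?un // natrM psiM ?natr_unit //.
    by case: (psi _) => a b; case: (psi _) => c d.
  - rewrite !reE !imE coprimeMr; case: (boolP (coprime K m)) => um; case: (boolP (coprime K n)) => un /=; rewrite ?mulr0 ?mul0r ?addr0 //.
    rewrite !psi'u ?natr_unit ?coprimeMr ?um ?un // natrM psiM ?natr_unit //.
    by case: (psi _) => a b; case: (psi _) => c d /=; ring.
  - rewrite reE imE chi0E; case: coprime; last by rewrite expr0n addr0.
    exact: psi'n.
  - by rewrite reE u1 psi'u ?unitr1 // psi1.
  - by rewrite imE u1 psi'u ?unitr1 // psi1.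
have chM : forall m n, re psi' (m * n)%N = re psi' m * re psi' n - im psi' m * im psi' n by case: ch.
have nrm : forall n, re psi' n ^+ 2 + im psi' n ^+ 2 = chi0 n by case: ch.
pose sq b := psi' b ^+ 2.
have sqn b : normsq (sq b) = 1 by rewrite /sq expr2 normsqM psi'n mulr1.
have sqRe n : re sq n = re psi' n ^+ 2 - im psi' n ^+ 2.
  rewrite !reE imE; case: coprime; last by rewrite expr0n subrr.
  by rewrite /sq; case: (psi' _) => a b /=; rewrite !expr2.
have sqIm n : im sq n = 2 * re psi' n * im psi' n.
  rewrite !imE reE; case: coprime; last by rewrite !mulr0.
  by rewrite /sq; case: (psi' _) => a b /=; ring.
(* If the square is nontrivial, its harmonic series converges and the trigonometric inequality
   applies; otherwise the imaginary part vanishes and the character is real. *)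
case: (pselect (exists2 a, a \is a GRing.unit & sq a != 1)) => [nt|tr].
  have sqM a b : a \is a GRing.unit -> b \is a GRing.unit -> sq (a * b) = sq a * sq b.
    by move=> au bu; rewrite /sq !psi'u ?unitrM ?au // psiM // exprMn.
  have [rs2 is2] := ReIm0 _ (orth _ sqM nt).
  have da2 := fun N => psum_weights_bound N (fun b => re_le sq b (sqn b)) rs2.
  have db2 := fun N => psum_weights_bound N (fun b => im_le sq b (sqn b)) is2.
  have [l1 hl1] := sum_harmonic_cvg da2; have [l2 hl2] := sum_harmonic_cvg db2.
  apply: (@character_nonvanishing_complex R K K1 (re psi') (im psi') (4 * phiK) phiK l1 l2) => // N.
  - by apply: le_trans (da2 N); rewrite /psum; under eq_bigr do rewrite -sqRe.
  - by apply: le_trans (db2 N); rewrite /psum; under eq_bigr do rewrite -sqIm.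
  - under eq_bigr do rewrite -sqRe; apply: le_trans (hl1 N) _.
    by rewrite ler_wpM2r ?invr_ge0 // ler_wpM2r ?(ltW p0) // ler_nat.
  - under eq_bigr do rewrite -sqIm; apply: le_trans (hl2 N) _.
    by rewrite ler_wpM2r ?invr_ge0 // ler_wpM2r ?(ltW p0) // ler_nat.
have im0 n : im psi' n = 0.
  have h : re sq n = chi0 n.
    rewrite reE chi0E; case: (boolP (coprime K n)) => // un.
    have [->//|ne] := eqVneq (sq n%:R) 1.
    by case: tr; exists n%:R => //; rewrite natr_unit.
  have /eqP : im psi' n ^+ 2 = 0 by have := nrm n; rewrite -h sqRe; lra.
  by rewrite sqrf_eq0 => /eqP.
apply: (@real_character_nonvanishing R K (re psi') _ _ _ (4 * phiK) phiK) => // [m n|n|].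
- by rewrite chM !im0 mulr0 subr0.
- by rewrite -nrm im0 expr0n addr0.
- by case: ch.
Qed.

End MoebiusLogMean.

(** * The Moebius function in arithmetic progressions *)

Section MoebiusArithmeticProgression.
Variable R : realType.
Variable K : nat.
Hypothesis K1 : (1 < K)%N.
Local Notation phiK := (phiK R K).
Local Notation cls := (@cls R K).
Local Notation Rcls := (@Rcls R K).
Local Notation n := (Zp_trunc K).+2.

(** The columns are the linear forms known to be bounded on the vector of the [Rcls b N]: those of
    [Rcls_relation] for the units [a], and the total sum in the last column. The coordinate forms at
    non-units confine the left kernel to the units. *)
Definition harmonic_kernel (l : 'Z_K -> R) : 'M[R]_(n, n + 1) :=
  row_mx (\matrix_(b, a) (if (a : 'Z_K) \is a GRing.unit then
     if (b : 'Z_K) \is a GRing.unit then l (a / b) - l (1 / b) else 0 else (b == a)%:R))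
   (\col_b ((b : 'Z_K) \is a GRing.unit)%:R).

Definition shift_mx (g : 'Z_K) : 'M[R[i]]_n := \matrix_(b, a) ((b : 'Z_K) == a * g)%:R.

Lemma mul_shift_mx (u : 'rV[R[i]]_n) g a : (u *m shift_mx g) 0 a = u 0 (a * g : 'Z_K).
Proof.
rewrite mxE (bigD1 (a * g : 'Z_K)) //= mxE eqxx mulr1 big1 ?addr0 // => b nb.
by rewrite mxE (negbTE nb) mulr0.
Qed.

Lemma harmonic_kernelP (l : 'Z_K -> R) (u : 'rV[R[i]]_n) :
  u *m map_mx (real_complex R) (harmonic_kernel l) = 0 <->
  [/\ forall a : 'Z_K, a \is a GRing.unit ->
        \sum_(b : 'Z_K | b \is a GRing.unit) ((l (a / b) - l (1 / b))%:C)%C * u 0 b = 0,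
      forall a : 'Z_K, a \isn't a GRing.unit -> u 0 a = 0 &
      \sum_(b : 'Z_K | b \is a GRing.unit) u 0 b = 0].
Proof.
have E1 (a : 'Z_K) : (u *m map_mx (real_complex R) (harmonic_kernel l)) 0 (lshift 1 a) =
   if a \is a GRing.unit then \sum_(b : 'Z_K | b \is a GRing.unit) ((l (a / b) - l (1 / b))%:C)%C * u 0 b
   else u 0 a.
  rewrite mxE; case: ifP => au.
    rewrite [RHS]big_mkcond; apply: eq_bigr => b _; rewrite mxE row_mxEl mxE au.
    by case: ifP => bu; rewrite ?rmorph0 ?mulr0 // mulrC.
  rewrite (bigD1 a) //= mxE row_mxEl mxE au eqxx rmorph1 mulr1 big1 ?addr0 // => b nb.
  by rewrite mxE row_mxEl mxE au (negbTE nb) rmorph0 mulr0.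
have E2 : (u *m map_mx (real_complex R) (harmonic_kernel l)) 0 (rshift n 0) =
   \sum_(b : 'Z_K | b \is a GRing.unit) u 0 b.
  rewrite mxE [RHS]big_mkcond; apply: eq_bigr => b _; rewrite mxE row_mxEr mxE.
  by case: ifP => bu; rewrite ?rmorph0 ?mulr0 // rmorph1 mulr1.
split=> [h|[h1 h2 h3]].
  split=> [a au|a au|].
  - by have := E1 a; rewrite au h mxE => <-.
  - by have := E1 a; rewrite (negbTE au) h mxE => <-.
  - by rewrite -E2 h mxE.
apply/rowP => j; rewrite [RHS]mxE; case: (split_ordP j) => k ->.
  by rewrite E1; case: ifP => ku; [exact: h1 | apply: h2; rewrite ku].
by rewrite (ord1 k) E2.
Qed.

(** The left kernel is invariant under the commuting translations by units. If it were nonzero, a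
    common eigenvector in it would be a multiple of a character, and the kernel relations would make
    an [L]-value vanish. *)
Lemma harmonic_kernel_free (l : 'Z_K -> R) :
  (forall b N, `|\sum_(1 <= n < N.+1) (cls b n - cls 1 n) / n%:R - l b| <= 4 / N.+1%:R) ->
  row_free (harmonic_kernel l).
Proof.
move=> hl; rewrite -(row_free_map (real_complex R)); apply/negPn/negP => nf.
(* Non-units are sent to the identity so that the family is indexed by the whole finite type. *)
pose P (g : 'Z_K) := shift_mx (if g \is a GRing.unit then g else 1).
have [||u u0 [uL uP]] := common_eigenvector_in (P := P) _ _ nf.
- move=> i j; apply/row_matrixP => k; rewrite !rowE !mulmxA; apply/rowP => a.
  by rewrite !mul_shift_mx mulrAC.
- move=> g v; rewrite /P; set h := if _ then _ else _.
  have hu : h \is a GRing.unit by rewrite /h; case: ifP => // _; exact: unitr1.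
  move/harmonic_kernelP => [h1 h2 h3]; apply/harmonic_kernelP.
  have reidx (F : 'Z_K -> R[i]) : \sum_(b : 'Z_K | b \is a GRing.unit) F (b * h) =
      \sum_(b : 'Z_K | b \is a GRing.unit) F b.
    rewrite [RHS](reindex_onto (fun b => b * h) (fun b => b / h)) /=; last by move=> b _; rewrite divrK.
    by apply: eq_bigl => b; rewrite unitrM hu andbT mulrK // eqxx andbT.
  split=> [a au|a au|].
  + pose F x b := ((l (x * h / b))%:C)%C * v 0 b.
    have F0 x : x \is a GRing.unit -> \sum_(b : 'Z_K | b \is a GRing.unit) (F x b - F 1 b) = 0.
      move=> xu; have e1 := h1 (x * h); have e2 := h1 h hu; rewrite unitrM xu hu in e1.
      transitivity (\sum_(b : 'Z_K | b \is a GRing.unit) ((l (x * h / b) - l (1 / b))%:C)%C * v 0 b -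
         \sum_(b : 'Z_K | b \is a GRing.unit) ((l (h / b) - l (1 / b))%:C)%C * v 0 b).
        by rewrite -sumrB; apply: eq_bigr => b bu; rewrite /F mul1r !rmorphB /=; ring.
      by rewrite (e1 isT) e2 subrr.
    rewrite -[RHS](F0 a au) -[RHS]reidx; apply: eq_bigr => b bu.
    have bE x : x * h / (b * h) = x / b by rewrite invrM // mulrA mulrK.
    by rewrite mul_shift_mx /F !bE rmorphB /= mulrBl.
  + by rewrite mul_shift_mx h2 // unitrM hu andbT.
  + by rewrite -[RHS]h3 -[RHS]reidx; apply: eq_bigr => b _; rewrite mul_shift_mx.
move/harmonic_kernelP: uL => [h1 h2 h3].
have eig (g : 'Z_K) : g \is a GRing.unit -> exists c, forall a : 'Z_K, u 0 (a * g : 'Z_K) = c * u 0 a.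
  move=> gu; have [c hc] := uP g; exists c => a.
  by have /rowP/(_ a) := hc; rewrite /P gu mul_shift_mx mxE.
pose U (a : 'Z_K) := u 0 a.
have U1 : U 1 != 0.
  apply/negP => /eqP U10; case/negP: u0; apply/eqP/rowP => a; rewrite [RHS]mxE.
  have [au|au] := boolP ((a : 'Z_K) \is a GRing.unit); last exact: h2.
  by have [c hc] := eig a au; have := hc 1; rewrite mul1r -/(U 1) U10 mulr0.
have eigU (g a : 'Z_K) : g \is a GRing.unit -> U (a * g) = U g / U 1 * U a.
  move=> gu; have [c hc] := eig g gu; rewrite /U hc; congr (_ * _).
  by have := hc 1; rewrite mul1r -/(U 1) -/(U g) => ->; rewrite mulfK.
(* The inverse appears because the relations pair [l (a / b)] with [U b]: after the substitution
   [c = a / b], the function [l] is tested against [U c^-1]. *)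
pose psi (a : 'Z_K) := U a^-1 / U 1.
apply: (@no_degenerate_character R K K1 l hl psi).
- move=> a b au bu; rewrite /psi invrM // eigU ?unitrV //; field.
  exact: U1.
- by rewrite /psi invr1 divff.
- apply: contrapT => no.
  have all1 (a : 'Z_K) : a \is a GRing.unit -> U a = U 1.
    move=> au; apply/eqP; rewrite -subr_eq0; apply: contrapT => /negP ne.
    apply: no; exists a^-1; rewrite ?unitrV // /psi invrK; apply: contra ne => /eqP e.
    by rewrite -[U a](mulfVK U1) e mul1r subrr.
  have := h3; rewrite (eq_bigr (fun=> U 1)) ?sumr_const; last by move=> b bu; exact: all1.
  move/eqP; rewrite mulrn_eq0 (negbTE U1) orbF => /eqP; apply/eqP; rewrite -lt0n.
  by apply/card_gt0P; exists 1; rewrite unitr1.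
pose S := \sum_(c : 'Z_K | c \is a GRing.unit) (l c)%:C%C * U c^-1.
pose kap := \sum_(b : 'Z_K | b \is a GRing.unit) (l (1 / b))%:C%C * U b.
have Sa (a : 'Z_K) : a \is a GRing.unit -> U a / U 1 * S = kap.
  move=> au; have := h1 a au; under eq_bigr do rewrite rmorphB mulrBl; rewrite sumrB => /eqP.
  rewrite subr_eq0 => /eqP; rewrite -/kap => <-.
  rewrite [RHS](reindex_onto (fun b : 'Z_K => a / b) (fun b => a / b)) /=; last first.
    by move=> b bu; rewrite invrM ?unitrV // invrK mulrCA divrr // mulr1.
  rewrite /S mulr_sumr; apply: eq_big => [b|b bu].
    rewrite unitrM au unitrV /=; have [bu|//] := boolP (b \is a GRing.unit).
    by rewrite invrM ?unitrV // invrK mulrCA divrr // mulr1 eqxx.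
  have -> : a / (a / b) = b by rewrite invrM ?unitrV // invrK mulrCA divrr // mulr1.
  rewrite -/(U _) [a / b]mulrC eigU //; ring.
(* All the numbers [U a / U 1 * S] equal [kap], hence [S], and they add up to zero because the
   values of [U] do. *)
suff S0 : S = 0.
  rewrite /psi; under eq_bigr do rewrite mulrA; by rewrite -mulr_suml -/S S0 mul0r.
have Sk : S = kap by rewrite -(Sa 1 (unitr1 _)) divff // mul1r.
have : \sum_(a : 'Z_K | a \is a GRing.unit) U a / U 1 * S = 0.
  by rewrite -2!mulr_suml h3 !mul0r.
rewrite (eq_bigr (fun=> S)) ?sumr_const; last by move=> a au; rewrite Sa.
move/eqP; rewrite mulrn_eq0 => /orP[|/eqP //].
have : (0 < #|[pred a : 'Z_K | a \is a GRing.unit]|)%N by apply/card_gt0P; exists 1; rewrite inE unitr1.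
by rewrite lt0n => /negbTE; rewrite (eq_card (B := GRing.unit)) // => ->.
Qed.

(** An injective matrix has a right inverse, through which the bounded relations bound each
    coordinate; the inverse does not depend on [N]. *)
Lemma Rcls_bounded : exists C, forall b N, b \is a GRing.unit -> `|Rcls b N| <= C.
Proof.
have [l hl] := class_harmonic_limits R K1.
have [C0 hC0] := sum_Rcls_bounded R K1.
have free := harmonic_kernel_free hl.
pose Q := pinvmx (harmonic_kernel l).
pose C := Num.max 10 C0.
have C_ge0 : 0 <= C by rewrite le_max ler0n.
exists (C * \sum_i \sum_j `|Q i j|) => b N bu.
pose r : 'rV[R]_n := \row_b (if (b : 'Z_K) \is a GRing.unit then Rcls b N else 0).
have rb : Rcls b N = (r *m harmonic_kernel l *m Q) 0 b.
  by rewrite -mulmxA mulmxVp // mulmx1 mxE bu.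
have bnd j : `|(r *m harmonic_kernel l) 0 j| <= C.
  case: (split_ordP j) => k ->.
    rewrite mxE; have [ku|ku] := boolP ((k : 'Z_K) \is a GRing.unit).
      apply: (@le_trans _ _ 10); last by rewrite le_max lexx.
      apply: le_trans (Rcls_relation K1 hl N ku); rewrite [X in _ <= `|X|]big_mkcond /=.
      rewrite le_eqVlt; apply/orP; left; apply/eqP; congr `|_|; apply: eq_bigr => c _.
      by rewrite row_mxEl !mxE ku; case: ifP => cu; rewrite ?mul0r // mulrC.
    rewrite big1 ?normr0 // => c _; rewrite row_mxEl !mxE (negbTE ku).
    by case: eqP => [->|]; rewrite ?mulr0 // (negbTE ku) mul0r.
  apply: (@le_trans _ _ C0); last by rewrite le_max lexx orbT.
  apply: le_trans (hC0 N); rewrite [X in _ <= `|X|]big_mkcond /= mxE.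
  rewrite le_eqVlt; apply/orP; left; apply/eqP; congr `|_|; apply: eq_bigr => c _.
  by rewrite row_mxEr !mxE; case: ifP => cu; rewrite ?mul0r // mulr1.
rewrite rb mxE; apply: le_trans (ler_norm_sum _ _ _) _.
rewrite mulr_sumr; apply: ler_sum => i _; rewrite normrM ler_pM //.
by rewrite (bigD1 b) //= lerDl sumr_ge0.
Qed.

(** Summation by parts identifies the sum of [Mcls b k / (k * (k + 1))] with
    [Rcls b N - Mcls b N / (N + 1)], whence the bound [C + 1] required for the contraction. *)
Lemma Mcls_mean (eps : R) : 0 < eps -> exists N0, forall (b : 'Z_K) N, b \is a GRing.unit ->
  (N0 <= N)%N -> `|Mcls R b N| <= eps * N%:R.
Proof.
move=> e0; have [C hC] := Rcls_bounded.
apply: (@Mcls_little_o R K K1 (C + 1)) => // b N bu.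
have -> : psum (fun k => Mcls R b k / (k%:R * k.+1%:R)) N = Rcls b N - Mcls R b N / N.+1%:R.
  elim: N => [|N IH]; first by rewrite /Rcls /Mcls !psum0 big_geq // mul0r subr0.
  have MS : Mcls R b N.+1 = Mcls R b N + cls b N.+1 * mu R N.+1 by rewrite /Mcls psumS.
  rewrite psumS IH MS {2}/Rcls big_nat_recr //= -/(Rcls b N) -[N.+2%:R]natr1.
  have := ler0n R N; rewrite -natr1; move: (N%:R : R) => x x0; field.
  by rewrite !lt0r_neq0 // ?ltr_wpDl // addr_ge0.
apply: le_trans (ler_normB _ _) _; rewrite lerD ?hC // normrM normfV [`|_%:R|]ger0_norm //.
by rewrite ler_pdivrMr ?ltr0n // mul1r (le_trans (norm_Mcls _ _ _)) // ler_nat.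
Qed.

End MoebiusArithmeticProgression.

Lemma mobiusM m n : (0 < m)%N -> (0 < n)%N ->
  mobius (m * n) = if coprime m n then mobius m * mobius n else 0.
Proof.
move=> m0 n0; case: ifP => [cop|/negbT ncop]; last first.
  have g1 : (1 < gcdn m n)%N.
    by rewrite ltn_neqAle eq_sym ncop gcdn_gt0 m0.
  have pp := pdiv_prime g1; set p := pdiv _ in pp.
  have pg : (p %| gcdn m n)%N by exact: pdiv_dvd.
  have /andP[pm pn] : (p %| m)%N && (p %| n)%N by rewrite -dvdn_gcd.
  rewrite /mobius; case: allP => // /(_ p).
  rewrite mem_primes pp muln_gt0 m0 n0 dvdn_mulr // lognM // => /(_ isT).
  by rewrite (lognE p m) (lognE p n) pp m0 n0 pm pn addnS.
have dis q : q \in primes m -> q \in primes n -> False.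
  rewrite !mem_primes => /and3P[qp _ qm] /and3P[_ _ qn].
  have : (q %| gcdn m n)%N by rewrite dvdn_gcd qm.
  by rewrite (eqP cop) dvdn1 => /eqP q1; rewrite q1 in qp.
have prE : perm_eq (primes (m * n)) (primes m ++ primes n).
  apply: uniq_perm; rewrite ?primes_uniq // ?cat_uniq ?primes_uniq ?andbT //=.
    by apply/hasPn => q qn; apply/negP => qm; exact: (dis q).
  by move=> q; rewrite primesM // mem_cat.
have E1 : all (fun q => logn q (m * n) == 1%N) (primes m) = all (fun q => logn q m == 1%N) (primes m).
  apply: eq_in_all => q qm; rewrite lognM // [logn q n]logn_coprime ?addn0 //.
  move: (qm); rewrite mem_primes => /and3P[qp _ _]; rewrite prime_coprime //.
  by apply/negP => qn; apply: (dis q) => //; rewrite mem_primes qp n0.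
have E2 : all (fun q => logn q (m * n) == 1%N) (primes n) = all (fun q => logn q n == 1%N) (primes n).
  apply: eq_in_all => q qn; rewrite lognM // [logn q m]logn_coprime ?add0n //.
  move: (qn); rewrite mem_primes => /and3P[qp _ _]; rewrite prime_coprime //.
  by apply/negP => qm; apply: (dis q) => //; rewrite mem_primes qp m0.
rewrite /mobius (perm_all _ prE) (perm_size prE) all_cat E1 E2 size_cat exprD.
by case: ifP => [/andP[-> ->] //|/negbT]; rewrite negb_and => /orP[]/negbTE ->; rewrite ?mul0r ?mulr0.
Qed.

(* Residues [a] not prime to [K]: with [d = gcd(a, K)] and [n = d n'], only [n'] prime to [K] contribute. *)
Lemma mobius_progression (R : realType) (K : nat) (a : nat) (eps : R) : (1 < K)%N -> 0 < eps ->
  exists N0, forall N, (N0 <= N)%N ->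
    `|\sum_(1 <= n < N.+1 | n == a %[mod K]) (mobius n)%:~R| <= eps * N%:R.
Proof.
move=> K1 e0; have K0 : (0 < K)%N by exact: ltnW.
pose d := gcdn a K; have d0 : (0 < d)%N by rewrite gcdn_gt0 K0 orbT.
pose ph := (\sum_(b : 'Z_K | b \is a GRing.unit) 1 : R) + 1.
have ph0 : 0 < ph by rewrite ltr_wpDl // sumr_ge0.
have [N0 hN0] := Mcls_mean K1 (divr_gt0 e0 ph0).
exists (N0 * d)%N => N NN0.
have dK : (d %| K)%N := dvdn_gcdr a K.
have da : (d %| a)%N := dvdn_gcdl a K.
pose ok (m : nat) := (d * m == a %[mod K]) && coprime d m.
(* A prime [p] dividing both [K / d] and [m] would make [p * d] a common divisor of [a] and [K]. *)
have okK m : ok m -> coprime K m.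
  move=> /andP[e c]; rewrite -(divnK dK) coprimeMl c andbT.
  apply: contraT => nc; have g1 : (1 < gcdn (K %/ d) m)%N.
    by rewrite ltn_neqAle eq_sym nc gcdn_gt0 divn_gt0 // dvdn_leq.
  have pp := pdiv_prime g1; set p := pdiv _ in pp.
  have /andP[pK pm] : (p %| K %/ d)%N && (p %| m)%N by rewrite -dvdn_gcd pdiv_dvd.
  have pdK : (p * d %| K)%N by rewrite -(divnK dK) dvdn_mul.
  have pda : (p * d %| a)%N.
    have : (d * m == a %[mod p * d]) by rewrite -(modn_dvdm _ pdK) (eqP e) modn_dvdm.
    by rewrite /dvdn => /eqP <-; rewrite -/(dvdn _ _) mulnC dvdn_mul.
  have : (p * d %| d)%N by rewrite {2}/d dvdn_gcd pda pdK.
  by move=> /(dvdn_leq d0); rewrite leqNgt ltn_Pmull // prime_gt1.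
have okP (m m' : nat) : (m%:R : 'Z_K) = m'%:R -> ok m -> ok m'.
  move=> e /andP[h1 h2].
  have em : m = m' %[mod K] by have := congr1 (fun x : 'Z_K => x : nat) e; rewrite !val_Zp_nat.
  rewrite /ok -modnMmr -em modnMmr h1 /=.
  have : gcdn d m = gcdn d m'.
    by rewrite -[gcdn d m]gcdn_modr -[gcdn d m']gcdn_modr -(modn_dvdm m dK) em modn_dvdm.
  by rewrite /coprime => <-.
have E : \sum_(1 <= n < N.+1 | n == a %[mod K]) (mobius n)%:~R =
    (mobius d)%:~R * \sum_(b : 'Z_K | ok (b : nat)) Mcls R b (N %/ d) :> R.
  transitivity (\sum_(1 <= n < N.+1 | (d %| n)%N)
     (fun m => if ok m then (mobius d)%:~R * (mobius m)%:~R else 0 : R) (n %/ d)%N).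
    rewrite big_mkcond [RHS]big_mkcond; apply: eq_big_nat => n /andP[n0 _].
    have [dn|dn] := boolP (d %| n)%N; last first.
      case: ifP => // /eqP e; case/negP: dn.
      by rewrite /dvdn -(modn_dvdm n dK) e modn_dvdm //.
    have q0 : (0 < n %/ d)%N by rewrite divn_gt0 // dvdn_leq.
    have nE : n = (d * (n %/ d))%N by rewrite mulnC divnK.
    rewrite /ok -nE; case: eqP => //= _; rewrite {1}nE mobiusM //.
    by case: ifP => _; rewrite ?rmorphM // rmorph0.
  rewrite (sum_multiples (fun m => if ok m then (mobius d)%:~R * (mobius m)%:~R else 0 : R) N d0) mulr_sumr.
  under [RHS]eq_bigr do rewrite /Mcls /psum mulr_sumr.
  rewrite exchange_big /=; apply: eq_bigr => m _; case: ifP => okm.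
    have okm' : ok (m%:R : 'Z_K) by apply: okP okm; rewrite natr_Zp.
    rewrite (bigD1 (m%:R : 'Z_K)) //= clsE eqxx mul1r big1 ?addr0 // => b /andP[_ /negbTE nb].
    by rewrite clsE eq_sym nb mul0r mulr0.
  rewrite big1 // => b okb; rewrite clsE; case: eqP => [e|_]; rewrite ?mul0r ?mulr0 //.
  by move: okm; rewrite (@okP b m) // natr_Zp e.
rewrite E normrM; apply: (@le_trans _ _ (\sum_(b : 'Z_K | b \is a GRing.unit) (eps / ph * (N %/ d)%:R))).
  rewrite -[leRHS]mul1r ler_pM //; first exact: (norm_mu R d).
  apply: le_trans (ler_norm_sum _ _ _) _.
  rewrite big_mkcond [leRHS]big_mkcond; apply: ler_sum => b _.
  case: ifP => [okb|_]; last first.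
    case: ifP => // _; by rewrite mulr_ge0 // divr_ge0 // ltW.
  have bu : b \is a GRing.unit by rewrite -[b]natr_Zp natr_unit // okK.
  by rewrite bu hN0 // leq_divRL.
have -> : \sum_(b : 'Z_K | b \is a GRing.unit) (eps / ph * (N %/ d)%:R) = eps * ((ph - 1) / ph) * (N %/ d)%:R.
  rewrite -(eq_bigr _ (fun _ _ => mul1r _)) -mulr_suml /ph addrK; ring.
rewrite -mulrA; apply: ler_wpM2l; first exact: ltW.
have ph1 : 0 <= ph - 1 by rewrite /ph addrK sumr_ge0.
rewrite -[leRHS]mul1r; apply: ler_pM; rewrite ?ler_nat ?leq_div //.
- by rewrite divr_ge0 // ltW.
- by rewrite ler_pdivrMr // mul1r gerBl.
Qed.

(** * Orthogonality criterion of Katai, Bourgain, Sarnak and Ziegler *)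

Lemma ler_norm_sum1 (R : realType) (F : nat -> R) n : (forall m, `|F m| <= 1) ->
  `|\sum_(1 <= m < n.+1) F m| <= n%:R.
Proof.
move=> F1; apply: le_trans (ler_norm_sum _ _ _) _.
rewrite -[n in leRHS]/(n.+1.-1) -subn1 -sumr_const_nat; exact: ler_sum.
Qed.

Section PrimeReciprocals.
Variable R : realType.
Local Notation lnn := (@lnn R).
Local Notation recip N := (\sum_(1 <= p < N.+1 | prime p) p%:R^-1 : R).

Lemma geometric_half_le (x : R) n : 0 <= x -> x <= 2^-1 ->
  \sum_(1 <= k < n.+1) x ^+ k <= 2 * x.
Proof.
move=> x0 x1; suff : \sum_(1 <= k < n.+1) x ^+ k <= 2 * x - 2 * x * x ^+ n.
  by move/le_trans; apply; rewrite gerBl !mulr_ge0 // exprn_ge0.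
elim: n => [|n IH]; first by rewrite big_geq // expr0 mulr1 subrr.
rewrite big_nat_recr //=; have : x * x ^+ n.+1 <= 2^-1 * x ^+ n.+1 by rewrite ler_wpM2r // exprn_ge0.
rewrite exprS in IH *; move: IH; move: (x ^+ n) => y; move: (\sum_(_ <= _ < _) _) => S; nra.
Qed.

Lemma sum_logn_le p N : prime p -> \sum_(1 <= n < N.+1) (logn p n)%:R <= 2 * N%:R / p%:R :> R.
Proof.
move=> pp; have p0 : 0 < p%:R :> R by rewrite ltr0n prime_gt0.
have -> : \sum_(1 <= n < N.+1) (logn p n)%:R = (logn p N`!)%:R :> R.
  elim: N => [|N IH]; first by rewrite big_geq // logn1.
  by rewrite big_nat_recr //= IH factS lognM ?fact_gt0 // natrD addrC.
rewrite logn_fact // natr_sum; apply: (@le_trans _ _ (N%:R * \sum_(1 <= k < N.+1) (p%:R^-1) ^+ k)).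
  rewrite mulr_sumr; apply: ler_sum => k _; rewrite exprVn -natrX divn_natr_le //.
  by rewrite expn_gt0 prime_gt0.
rewrite [2 * _]mulrC -mulrA ler_wpM2l // geometric_half_le ?invr_ge0 ?ler0n //.
by rewrite lef_pV2 ?posrE ?ltr0n ?prime_gt0 // ler_nat prime_gt1.
Qed.

Lemma lnn_prime_sum n N : (0 < n)%N -> (n <= N)%N ->
  lnn n = \sum_(1 <= p < N.+1 | prime p) (logn p n)%:R * lnn p.
Proof.
move=> n0 nN; have nE := widen_partn predT nN; rewrite partnT // in nE.
have {}nE : n = (\prod_(0 <= p < N.+1 | prime p) p ^ logn p n)%N.
  rewrite {1}nE [RHS]big_mkcond; apply: eq_bigr => p _.
  by rewrite lognE; case: (prime p).
rewrite [in LHS]nE big_ltn_cond //=.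
elim: (index_iota 1 N.+1) => [|p s IH]; first by rewrite !big_nil lnn1.
rewrite !big_cons; case: ifP => // pp.
have S0 : (0 < \prod_(j <- s | prime j) j ^ logn j n)%N.
  by apply: prodn_cond_gt0 => q qp; rewrite expn_gt0 prime_gt0.
have P0 : (0 < p ^ logn p n)%N by rewrite expn_gt0 prime_gt0.
rewrite lnnM //.
by rewrite IH /lnn natrX lnXn ?ltr0n ?prime_gt0 // mulr_natl.
Qed.

(** Factoring [M!] gives [ln M - 1 <= 2 * sum of ln p / p]. If the primes beyond [y] had reciprocals
    summing to less than [1 / 8], they would account for at most [ln M / 4] of it, and the others
    are bounded in terms of [y]. *)
Lemma prime_recip_step y : exists N, 8^-1 <= \sum_(y.+1 <= p < N.+1 | prime p) p%:R^-1 :> R.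
Proof.
have [N N0 hN] := exists_lnn_ge (4 * (1 + 2 * y%:R ^+ 2) + 2 : R).
have lN := hN _ (leqnn N); exists (maxn N y); rewrite leNgt; apply/negP => small.
pose M := maxn N y; have NM : (N <= M)%N by exact: leq_maxl.
have M0 : (0 < M)%N by exact: leq_trans NM.
have lM : 4 * (1 + 2 * y%:R ^+ 2) + 2 <= lnn M := hN _ NM.
have y_ge0 : 0 <= y%:R :> R by exact: ler0n.
have l0 : 0 <= lnn M by exact: lnn_ge0.
have B : lnn M - 1 <= 2 * \sum_(1 <= p < M.+1 | prime p) lnn p / p%:R.
  have M0R : 0 < M%:R :> R by rewrite ltr0n.
  rewrite -(ler_pM2l M0R) mulrBr mulr1; apply: le_trans (psum_lnn_ge R M0) _.
  have -> : psum lnn M = \sum_(1 <= n < M.+1) \sum_(1 <= p < M.+1 | prime p) (logn p n)%:R * lnn p.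
    by apply: eq_big_nat => n /andP[n0 nM]; rewrite -lnn_prime_sum.
  rewrite exchange_big /= mulrA mulr_sumr; apply: ler_sum => p pp; rewrite -mulr_suml.
  rewrite mulrCA mulrC; apply: ler_wpM2l; first exact: lnn_ge0.
  by apply: le_trans (sum_logn_le _ pp) _; rewrite [2 * _]mulrC.
have yM : (y.+1 <= M.+1)%N by rewrite ltnS leq_maxr.
rewrite (@big_cat_nat _ _ _ y.+1) //= in B.
have B1 : \sum_(1 <= p < y.+1 | prime p) lnn p / p%:R <= y%:R ^+ 2.
  apply: (@le_trans _ _ (\sum_(1 <= p < y.+1) y%:R)); last first.
    by rewrite sumr_const_nat subn1 /= expr2 mulr_natr.
  rewrite big_mkcond !big_nat; apply: ler_sum => p /andP[p0 py]; case: ifP => _ //.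
  have p0R : 0 < p%:R :> R by rewrite ltr0n.
  apply: (@le_trans _ _ 1); last by rewrite ler1n (leq_trans p0) // -ltnS.
  rewrite ler_pdivrMr // mul1r; have := ln_le_subr1 p0R; rewrite -/(lnn p); lra.
have B2 : \sum_(y.+1 <= p < M.+1 | prime p) lnn p / p%:R <= lnn M * 8^-1.
  apply: (@le_trans _ _ (lnn M * \sum_(y.+1 <= p < M.+1 | prime p) p%:R^-1)); last first.
    by rewrite ler_wpM2l // ltW.
  rewrite mulr_sumr big_nat_cond [leRHS]big_nat_cond; apply: ler_sum => p /andP[/andP[_ pM] pp].
  by rewrite ler_wpM2r ?invr_ge0 // lnn_le // prime_gt0.
nra.
Qed.

Lemma prime_recip_unbounded (A : R) : exists N, A <= recip N.
Proof.
have key k : exists N, k%:R * 8^-1 <= recip N.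
  elim: k => [|k [y IH]]; first by exists 0%N; rewrite big_geq // mul0r.
  have [N hN] := prime_recip_step y; exists (maxn N y).
  rewrite (@big_cat_nat _ _ _ y.+1) ?ltnS ?leq_maxr //= -natr1 mulrDl mul1r lerD //.
  apply: le_trans hN _; have [Ny|yN] := leqP N y; last by rewrite lexx.
  by rewrite [leLHS]big_geq // big_geq.
have [N hN] := key (Num.trunc (8 * A)).+1; exists N; apply: le_trans hN.
by rewrite ler_pdivlMr // mulrC; apply/ltW/truncnS_gt.
Qed.

End PrimeReciprocals.

Lemma ler_norm_sqr_scaled (R : realType) (t a : R) : 0 < t -> `|a| <= t / 2 + a ^+ 2 / (2 * t).
Proof.
move=> t0; rewrite -real_normK ?num_real //; move: `|a| => b.
rewrite -subr_ge0; have -> : t / 2 + b ^+ 2 / (2 * t) - b = (b - t) ^+ 2 / (2 * t).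
  field; lra.
by rewrite divr_ge0 ?sqr_ge0 // mulr_ge0 // ltW.
Qed.

(* Both the Turan-Kubilius inequality and the Cauchy-Schwarz step are used in the form [|a| <= t/2 + a^2/(2t)]. *)
Section PrimeDilates.
Variables (R : realType) (y : nat).
Local Notation s := [seq p <- index_iota 1 y.+1 | prime p].
Local Notation mu := (@mu R).
Variables (z : nat -> R) (N : nat) (delta : R).
Hypothesis z1 : forall n, `|z n| <= 1.
Hypothesis delta0 : 0 <= delta.
Hypothesis corr : forall p q, p \in s -> q \in s -> p != q ->
  `|\sum_(1 <= m < (N %/ maxn p q).+1) z (p * m) * z (q * m)| <= delta * N%:R.

Let L : R := \sum_(p <- s) p%:R^-1.
Let om n : R := \sum_(p <- s) (p %| n)%:R.

Let L0 : 0 <= L. Proof. by apply: sumr_ge0 => p _; rewrite invr_ge0. Qed.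
Let s_prime p : p \in s -> prime p. Proof. by rewrite mem_filter => /andP[]. Qed.
Let s_pos p : p \in s -> (0 < p)%N. Proof. by move/s_prime/prime_gt0. Qed.
Let s_size : (size s)%:R <= y%:R :> R.
Proof. by rewrite ler_nat size_filter (leq_trans (count_size _ _)) // size_iota subn1. Qed.

Lemma count_dvdn d : (0 < d)%N -> \sum_(1 <= n < N.+1) (d %| n)%:R = (N %/ d)%:R :> R.
Proof.
move=> d0; have := sum_multiples (fun=> 1 : R) N d0; rewrite sumr_const_nat subn1 /= => <-.
by rewrite [RHS]big_mkcond; apply: eq_bigr => n _; case: ifP.
Qed.

(** Divisibilities by distinct primes are nearly independent: [p * q] has at most [N / (p * q)]
    multiples, so beyond [N * L ^ 2] only the diagonal and the rounding of the first moment
    contribute. *)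
Lemma turan_kubilius : \sum_(1 <= n < N.+1) (L - om n) ^+ 2 <= N%:R * L + 2 * L * y%:R.
Proof.
have E1 : N%:R * L - y%:R <= \sum_(1 <= n < N.+1) om n.
  rewrite exchange_big /=; apply: (@le_trans _ _ (\sum_(p <- s) (N%:R / p%:R - 1))).
    by rewrite sumrB -mulr_sumr -/L lerB // big_const_seq count_predT iter_addr_0 s_size.
  rewrite big_seq [leRHS]big_seq; apply: ler_sum => p ps; rewrite count_dvdn ?s_pos //.
  by have := divn_natr_gt R N (s_pos ps); lra.
have E2 : \sum_(1 <= n < N.+1) om n ^+ 2 <= N%:R * L ^+ 2 + N%:R * L.
  under eq_bigr do rewrite expr2 mulr_suml.
  rewrite exchange_big /= expr2 mulrA mulr_sumr -[N%:R * L in leRHS]/(N%:R * _) mulr_sumr -[leRHS]big_split /=.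
  rewrite big_seq [leRHS]big_seq; apply: ler_sum => p ps; have p0 := s_pos ps.
  under eq_bigr do rewrite mulr_sumr; rewrite exchange_big /=.
  rewrite (bigD1_seq p) ?filter_uniq ?iota_uniq //= addrC lerD //; last first.
    under eq_bigr do rewrite -natrM mulnb andbb; by rewrite count_dvdn // divn_natr_le.
  rewrite mulr_suml [leRHS](bigID (fun q => q != p)) /=; apply: ler_wpDr.
    by apply: sumr_ge0 => q _; rewrite !divr_ge0.
  rewrite big_seq_cond [leRHS]big_seq_cond; apply: ler_sum => q /andP[qs qp].
  have q0 := s_pos qs.
  have cpq : coprime p q by rewrite prime_coprime ?s_prime // dvdn_prime2 ?s_prime // eq_sym.
  under eq_bigr do rewrite -natrM mulnb -Gauss_dvd //.
  rewrite count_dvdn ?muln_gt0 ?p0 // -[leRHS]mulrA -invfM -natrM mulnC divn_natr_le //.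
  by rewrite muln_gt0 q0.
have -> : \sum_(1 <= n < N.+1) (L - om n) ^+ 2 =
   N%:R * L ^+ 2 - 2 * L * (\sum_(1 <= n < N.+1) om n) + \sum_(1 <= n < N.+1) om n ^+ 2.
  under eq_bigr do rewrite sqrrB; rewrite big_split sumrB /= sumr_const_nat subn1 /= mulr_natl.
  by congr (_ - _ + _); rewrite mulr_sumr; apply: eq_bigr => n _; rewrite -mulr_natl mulrA.
have : 2 * L * (N%:R * L - y%:R) <= 2 * L * (\sum_(1 <= n < N.+1) om n) by rewrite ler_wpM2l // mulr_ge0.
move: E2; rewrite expr2; nra.
Qed.

Lemma sum_prime_sqr : \sum_(p <- s) (p%:R ^+ 2)^-1 <= 1 :> R.
Proof.
rewrite big_filter; case: y => [|m]; first by rewrite big_geq.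
suff : \sum_(1 <= p < m.+2 | prime p) (p%:R ^+ 2)^-1 <= 1 - m.+1%:R^-1 :> R.
  by move/le_trans; apply; rewrite gerBl.
elim: m => [|m IH]; first by rewrite big_mkcond big_nat1 /= invr1 subrr.
rewrite big_mkcond big_nat_recr //= -big_mkcond /=.
apply: (@le_trans _ _ (1 - m.+1%:R^-1 + (m.+2%:R ^+ 2)^-1)).
  by rewrite lerD //; case: ifP => // _; rewrite invr_ge0 exprn_ge0.
have : (m.+2%:R ^+ 2)^-1 <= (m.+1%:R * m.+2%:R)^-1 :> R.
  by rewrite lef_pV2 ?posrE ?exprn_gt0 ?mulr_gt0 ?ltr0n // expr2 ler_wpM2r // ler_nat.
rewrite -(invrS_diff R (ltn0Sn m)); set a := m.+1%:R^-1; set b := m.+2%:R^-1; set c := (_ ^+ 2)^-1; lra.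
Qed.

Lemma sum_abs_deviation (t : R) : 0 < t ->
  \sum_(1 <= n < N.+1) `|L - om n| <= N%:R * (t / 2) + (N%:R * L + 2 * L * y%:R) / (2 * t).
Proof.
move=> t0; apply: (@le_trans _ _ (\sum_(1 <= n < N.+1) (t / 2 + (L - om n) ^+ 2 / (2 * t)))).
  by apply: ler_sum => n _; exact: ler_norm_sqr_scaled.
rewrite big_split /= sumr_const_nat subn1 /= -[_ *+ N]mulr_natl lerD // -mulr_suml ler_wpM2r //.
  by rewrite invr_ge0 mulr_ge0 // ltW.
exact: turan_kubilius.
Qed.

Let dil m : R := \sum_(p <- s) (p * m <= N)%:R * z (p * m).

Lemma sum_dilates (F : nat -> R) p : (0 < p)%N ->
  \sum_(1 <= m < (N %/ p).+1) F m = \sum_(1 <= m < N.+1) (p * m <= N)%:R * F m.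
Proof.
move=> p0; have le : (N %/ p <= N)%N by exact: leq_div.
rewrite [RHS](@big_cat_nat _ _ _ (N %/ p).+1) //= [X in _ = _ + X]big_nat [X in _ = _ + X]big1 ?addr0.
  by apply: eq_big_nat => m /andP[_ mN]; rewrite mulnC -leq_divRL // -ltnS mN mul1r.
by move=> m /andP[mN _]; rewrite mulnC -leq_divRL // leqNgt mN mul0r.
Qed.

Lemma sum_dil_sqr : \sum_(1 <= m < N.+1) dil m ^+ 2 <= N%:R * L + y%:R ^+ 2 * (delta * N%:R).
Proof.
have -> : \sum_(1 <= m < N.+1) dil m ^+ 2 =
    \sum_(p <- s) \sum_(q <- s) \sum_(1 <= m < (N %/ maxn p q).+1) z (p * m) * z (q * m).
  under eq_bigr do rewrite expr2 mulr_suml.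
  rewrite exchange_big /=; rewrite big_seq [RHS]big_seq; apply: eq_bigr => p ps.
  under eq_bigr do rewrite mulr_sumr; rewrite exchange_big /= big_seq [RHS]big_seq.
  apply: eq_bigr => q qs; rewrite sum_dilates ?leq_max ?s_pos //; apply: eq_bigr => m _.
  have -> : (maxn p q * m <= N)%N = (p * m <= N)%N && (q * m <= N)%N by rewrite maxnMl geq_max.
  by rewrite -mulnb natrM; ring.
apply: (@le_trans _ _ (\sum_(p <- s) (N%:R / p%:R + \sum_(q <- s) delta * N%:R))).
  rewrite big_seq [leRHS]big_seq; apply: ler_sum => p ps.
  rewrite (bigD1_seq p) ?filter_uniq ?iota_uniq //= maxnn lerD //.
    apply: le_trans (divn_natr_le R N (s_pos ps)); apply: le_trans (ler_norm _) _.
    by apply: ler_norm_sum1 => m; rewrite normrM mulr_ile1.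
  rewrite [leRHS](bigD1_seq p) ?filter_uniq ?iota_uniq //=; apply: ler_wpDl; first by rewrite mulr_ge0.
  rewrite big_seq_cond [leRHS]big_seq_cond; apply: ler_sum => q /andP[qs qp].
  by apply: le_trans (ler_norm _) _; rewrite corr // eq_sym.
rewrite big_split /= -mulr_sumr -/L lerD // !big_const_seq !count_predT !iter_addr_0.
rewrite -mulrnA -[_ *+ _]mulr_natl natrM expr2; apply: ler_wpM2r; first by rewrite mulr_ge0.
by apply: ler_pM => //; exact: ler0n.
Qed.

Let S := \sum_(1 <= n < N.+1) z n * mu n.

(** Since [mu (p * m) = - mu m] when [p] does not divide [m], the sum becomes one of dilates. The
    terms with [p] dividing [m] number at most [N / p ^ 2] for each [p], and total at most [N]. *)
Lemma sum_weighted_omega :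
  `|\sum_(1 <= n < N.+1) z n * mu n * om n| <= N%:R + \sum_(1 <= m < N.+1) `|dil m|.
Proof.
have E1 p : p \in s -> \sum_(1 <= n < N.+1) z n * mu n * (p %| n)%:R =
   - \sum_(1 <= m < (N %/ p).+1) z (p * m) * mu m +
     \sum_(1 <= m < (N %/ p).+1) z (p * m) * mu m * (p %| m)%:R.
  move=> ps; have p0 := s_pos ps; have pp := s_prime ps.
  transitivity (\sum_(1 <= n < N.+1 | (p %| n)%N) (fun m => z (p * m) * mu (p * m)) (n %/ p)%N).
    rewrite [RHS]big_mkcond; apply: eq_bigr => n _; case: ifP => [pn|_]; rewrite ?mulr0 //.
    by rewrite mulr1 [(p * _)%N]mulnC divnK.
  rewrite (sum_multiples (fun m => z (p * m) * mu (p * m)) N p0) -sumrN -big_split /=.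
  apply: eq_big_nat => m /andP[m0 _]; case: (boolP (p %| m)%N) => [pm|pm].
    by rewrite {1}/mu mobius_sqr_dvd // mulr0 mulr1 addNr.
  by rewrite mulr0 addr0 {1}/mu mobius_sqfree_pM // rmorphN mulrN.
have -> : \sum_(1 <= n < N.+1) z n * mu n * om n =
   - \sum_(1 <= m < N.+1) dil m * mu m +
   \sum_(p <- s) \sum_(1 <= m < (N %/ p).+1) z (p * m) * mu m * (p %| m)%:R.
  under eq_bigr do rewrite mulr_sumr; rewrite exchange_big /=.
  rewrite big_seq (eq_bigr _ E1) -big_seq big_split /= sumrN; congr (- _ + _).
  under [RHS]eq_bigr do rewrite mulr_suml; rewrite [RHS]exchange_big /= big_seq [RHS]big_seq.
  apply: eq_bigr => p ps; rewrite sum_dilates ?s_pos //.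
  by apply: eq_bigr => m _; rewrite mulrA.
rewrite addrC; apply: le_trans (ler_normD _ _) _; rewrite normrN lerD //.
  apply: le_trans (ler_norm_sum _ _ _) _.
  apply: (@le_trans _ _ (\sum_(p <- s) N%:R * (p%:R ^+ 2)^-1)); last first.
    by rewrite -mulr_sumr -[leRHS]mulr1 ler_wpM2l // sum_prime_sqr.
  rewrite big_seq [leRHS]big_seq; apply: ler_sum => p ps; have p0 := s_pos ps.
  apply: le_trans (ler_norm_sum _ _ _) _.
  apply: (@le_trans _ _ (\sum_(1 <= m < (N %/ p).+1 | (p %| m)%N) (fun=> 1) (m %/ p)%N)).
    rewrite [leRHS]big_mkcond; apply: ler_sum => m _.
    case: ifP => _; rewrite ?mulr0 ?normr0 // mulr1 normrM mulr_ile1 //; exact: norm_mu.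
  rewrite (sum_multiples (fun=> 1 : R) _ p0) sumr_const_nat subn1 /=.
  apply: le_trans (divn_natr_le R _ p0) _; rewrite expr2 invfM mulrA ler_wpM2r ?invr_ge0 //.
  exact: divn_natr_le.
apply: le_trans (ler_norm_sum _ _ _) _; apply: ler_sum => m _.
by rewrite normrM ler_piMr //; exact: norm_mu.
Qed.

Lemma prime_dilates_bound (t : R) : 0 < t ->
  L * `|S| <= N%:R * t + (2 * N%:R * L + 2 * L * y%:R + y%:R ^+ 2 * (delta * N%:R)) / (2 * t) + N%:R.
Proof.
move=> t0; have -> : L * `|S| = `|L * S| by rewrite normrM (ger0_norm L0).
have -> : L * S = \sum_(1 <= n < N.+1) z n * mu n * (L - om n) + \sum_(1 <= n < N.+1) z n * mu n * om n.
  by rewrite -big_split /= /S mulr_sumr; apply: eq_bigr => n _; ring.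
apply: le_trans (ler_normD _ _) _.
have h1 : `|\sum_(1 <= n < N.+1) z n * mu n * (L - om n)| <= \sum_(1 <= n < N.+1) `|L - om n|.
  apply: le_trans (ler_norm_sum _ _ _) _; apply: ler_sum => n _.
  by rewrite normrM ler_piMl // normrM mulr_ile1 //; exact: norm_mu.
have h2 := sum_abs_deviation t0.
have h3 : \sum_(1 <= m < N.+1) `|dil m| <= N%:R * (t / 2) + (N%:R * L + y%:R ^+ 2 * (delta * N%:R)) / (2 * t).
  apply: (@le_trans _ _ (\sum_(1 <= m < N.+1) (t / 2 + dil m ^+ 2 / (2 * t)))).
    by apply: ler_sum => n _; exact: ler_norm_sqr_scaled.
  rewrite big_split /= sumr_const_nat subn1 /= -[_ *+ N]mulr_natl lerD // -mulr_suml ler_wpM2r ?sum_dil_sqr //.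
  by rewrite invr_ge0 mulr_ge0 // ltW.
have h4 := sum_weighted_omega.
move: h1 h2 h3 h4; set A := \sum_(1 <= n < N.+1) `|L - om n|; set B := \sum_(1 <= n < N.+1) `|dil n|.
set C := `|_|; set D := `|_| => h1 h2 h3 h4.
apply: (@le_trans _ _ (A + (N%:R + B))); first exact: lerD.
apply: (@le_trans _ _ (N%:R * (t / 2) + (N%:R * L + 2 * L * y%:R) / (2 * t) + (N%:R +
   (N%:R * (t / 2) + (N%:R * L + y%:R ^+ 2 * (delta * N%:R)) / (2 * t))))).
  by rewrite lerD // lerD.
by rewrite le_eqVlt; apply/orP; left; apply/eqP; field; rewrite gt_eqF.
Qed.

End PrimeDilates.

Lemma katai_bourgain_sarnak_ziegler (R : realType) (eps : R) : 0 < eps ->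
  exists (y : nat) (delta : R) (N0 : nat), 0 < delta /\ forall (N : nat) (z : nat -> R),
   (N0 <= N)%N -> (forall n, `|z n| <= 1) ->
   (forall p q, prime p -> prime q -> (p <= y)%N -> (q <= y)%N -> p != q ->
     `|\sum_(1 <= m < (N %/ maxn p q).+1) z (p * m) * z (q * m)| <= delta * N%:R) ->
   `|\sum_(1 <= n < N.+1) z n * mu R n| <= eps * N%:R.
Proof.
move=> e0; have [y hy] := prime_recip_unbounded (64 / eps ^+ 2 + 4 / eps).
pose L : R := \sum_(p <- [seq p <- index_iota 1 y.+1 | prime p]) p%:R^-1.
have LE : 64 / eps ^+ 2 + 4 / eps <= L by rewrite /L big_filter.
have e64 : 0 < 64 / eps ^+ 2 by rewrite divr_gt0 // exprn_gt0.
have e4 : 0 < 4 / eps by rewrite divr_gt0.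
have L0 : 0 < L by lra.
have hL1 : 64 <= L * eps ^+ 2 by rewrite -ler_pdivrMr ?exprn_gt0 //; lra.
have hL2 : 4 <= L * eps by rewrite -ler_pdivrMr //; lra.
(* With this value the at most [y ^ 2] off-diagonal correlations weigh no more than the diagonal
   [N * L]. The parameter of [prime_dilates_bound] will be [eps * L / 4], proportional to the
   target. *)
pose delta : R := L / (y%:R + 1) ^+ 2.
have y1 : 0 < y%:R + 1 :> R by rewrite ltr_wpDl.
exists y, delta, y; split; first by rewrite divr_gt0 // exprn_gt0.
move=> N z yN z1 hc.
have t0 : 0 < eps * L / 4 by rewrite divr_gt0 // mulr_gt0.
have d0 : 0 <= delta by rewrite divr_ge0 ?exprn_ge0 // ltW.
have := @prime_dilates_bound R y z N delta z1 d0 _ _ t0; rewrite -/L => hb.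
rewrite -(ler_pM2l L0); apply: le_trans (hb _) _.
  move=> p q; rewrite !mem_filter !mem_index_iota => /and3P[pp _ py] /and3P[qp _ qy] pq.
  exact: hc.
have yNR : y%:R <= N%:R :> R by rewrite ler_nat.
have dy : y%:R ^+ 2 * (delta * N%:R) <= L * N%:R.
  rewrite mulrA ler_wpM2r // /delta mulrA ler_pdivrMr ?exprn_gt0 // mulrC ler_wpM2l //; first exact: ltW.
  by rewrite ler_sqr ?nnegrE // ?lerDl // ltW.
have Ly : L * y%:R <= L * N%:R by rewrite ler_pM2l.
have h : (2 * N%:R * L + 2 * L * y%:R + y%:R ^+ 2 * (delta * N%:R)) / (2 * (eps * L / 4)) <= N%:R * (10 / eps).
  rewrite ler_pdivrMr ?mulr_gt0 //.
  have -> : N%:R * (10 / eps) * (2 * (eps * L / 4)) = 5 * (N%:R * L) by field; rewrite gt_eqF.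
  nra.
have h2 : 10 / eps <= L * eps / 4 by rewrite ler_pdivrMr //; rewrite expr2 in hL1; nra.
have : N%:R * (10 / eps) <= N%:R * (L * eps / 4) by rewrite ler_wpM2l.
have : N%:R * 4 <= N%:R * (L * eps) by rewrite ler_wpM2l.
have : 0 <= N%:R :> R by [].
lra.
Qed.

(** * Approximation by cosine polynomials on the circle *)

Section SquareDistance.
Context {d : measure_display} {T : measurableType d} {R : realType}.
Variable mu : {measure set T -> \bar R}.
Implicit Types f g h : T -> R.

Definition sqd f g : \bar R := (\int[mu]_x ((f x - g x) ^+ 2)%:E)%E.

Lemma measurable_sqd f g : measurable_fun setT f -> measurable_fun setT g ->
  measurable_fun setT (EFin \o (fun x => (f x - g x) ^+ 2 : R)).
Proof. by move=> mf mg; apply/measurable_EFinP; apply: measurable_funX; exact: measurable_funB. Qed.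

Lemma sqd_ge0 f g : (0 <= sqd f g)%E.
Proof. by apply: integral_ge0 => x _; rewrite lee_fin sqr_ge0. Qed.

Lemma sqdC f g : sqd f g = sqd g f.
Proof. by apply: eq_integral => x _; rewrite -sqrrN opprB. Qed.

Lemma sqd_comb (a b : R) f g f1 g1 f2 g2 : 0 <= a -> 0 <= b ->
  measurable_fun setT f -> measurable_fun setT g -> measurable_fun setT f1 ->
  measurable_fun setT g1 -> measurable_fun setT f2 -> measurable_fun setT g2 ->
  (forall x, (f x - g x) ^+ 2 <= a * (f1 x - g1 x) ^+ 2 + b * (f2 x - g2 x) ^+ 2) ->
  (sqd f g <= a%:E * sqd f1 g1 + b%:E * sqd f2 g2)%E.
Proof.
move=> a0 b0 mf mg mf1 mg1 mf2 mg2 h; have m1 := measurable_sqd mf1 mg1; have m2 := measurable_sqd mf2 mg2.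
rewrite /sqd -!ge0_integralZl_EFin //; try by move=> x _; rewrite lee_fin sqr_ge0.
rewrite -ge0_integralD //; first last.
- by apply: measurable_funeM.
- by move=> x _; rewrite -EFinM lee_fin mulr_ge0 ?sqr_ge0.
- by apply: measurable_funeM.
- by move=> x _; rewrite -EFinM lee_fin mulr_ge0 ?sqr_ge0.
apply: ge0_le_integral => //.
- by move=> x _; rewrite lee_fin sqr_ge0.
- exact: measurable_sqd.
- by apply: emeasurable_funD; apply: measurable_funeM.
- by move=> x _; rewrite -!EFinM -EFinD lee_fin.
Qed.

Lemma sqd_triangle f g h : measurable_fun setT f -> measurable_fun setT g -> measurable_fun setT h ->
  (sqd f h <= 2%:E * sqd f g + 2%:E * sqd g h)%E.
Proof.
move=> mf mg mh; apply: sqd_comb => // x.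
have := sqr_ge0 ((f x - g x) - (g x - h x)); rewrite !expr2; nra.
Qed.

Lemma sqdZ (c : R) f g : measurable_fun setT f -> measurable_fun setT g ->
  sqd (fun x => c * f x) (fun x => c * g x) = ((c ^+ 2)%:E * sqd f g)%E.
Proof.
move=> mf mg; rewrite /sqd -ge0_integralZl_EFin ?sqr_ge0 //; last 2 first.
- by move=> x _; rewrite lee_fin sqr_ge0.
- exact: measurable_sqd.
by apply: eq_integral => x _; rewrite -EFinM -mulrBr exprMn.
Qed.

Lemma sqd_dominated (f_ : nat -> T -> R) f (g : T -> R) (e : R) :
  (forall n, measurable_fun setT (f_ n)) -> measurable_fun setT f ->
  (forall x, f_ n x @[n --> \oo] --> f x) ->
  mu.-integrable setT (EFin \o g) -> (forall n x, (f x - f_ n x) ^+ 2 <= g x) -> 0 < e ->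
  exists n, (sqd f (f_ n) <= e%:E)%E.
Proof.
move=> mf_ mf cf ig fg e0.
have h : sqd f (f_ n) @[n --> \oo] --> (\int[mu]_x (cst 0 x : \bar R))%E.
  apply: (@dominated_cvg _ _ _ mu setT measurableT (fun n => EFin \o (fun x => (f x - f_ n x) ^+ 2 : R)) (cst 0%E) (EFin \o g)) => //.
  - by move=> n; exact: measurable_sqd.
  - move=> x _; apply: cvg_EFin; first by exact: nearW.
    have -> : fine \o (fun n => (EFin \o (fun x => (f x - f_ n x) ^+ 2 : R)) x) = (fun n => (f x - f_ n x) * (f x - f_ n x)).
      by apply/funext => n /=; rewrite expr2.
    have c0 : f x - f_ n x @[n --> \oo] --> 0.
      by rewrite -(subrr (f x)); apply: cvgB; [exact: cvg_cst|exact: cf].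
    by rewrite -(mulr0 0); apply: cvgM.
  - by move=> n x _ /=; rewrite lee_fin ger0_norm ?sqr_ge0.
rewrite integral_cst // mul0e in h.
have /fine_cvgP[fin /cvgrPdist_le /(_ e e0) le] := h.
near \oo => n; exists n.
have fn : sqd f (f_ n) \is a fin_num by near: n.
have ln : `|0 - fine (sqd f (f_ n))| <= e by near: n.
by rewrite -(fineK fn) lee_fin (le_trans (ler_norm _)) // -[fine _]opprK normrN -sub0r.
Unshelve. all: by end_near.
Qed.

Section Approximation.
Variable V : set (T -> R).
Hypothesis V_meas : forall f, V f -> measurable_fun setT f.
Hypothesis V_add : forall f g, V f -> V g -> V (fun x => f x + g x).
Hypothesis V_scale : forall c f, V f -> V (fun x => c * f x).
Hypothesis V1 : V (fun=> 1).

Definition approximable f := forall e : R, 0 < e -> exists2 h, V h & (sqd f h <= e%:E)%E.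

Lemma approximable_V f : V f -> approximable f.
Proof.
move=> Vf e e0; exists f => //; rewrite /sqd; under eq_integral do rewrite subrr expr0n /=.
by rewrite integral0 lee_fin ltW.
Qed.

Lemma approximableD f g : measurable_fun setT f -> measurable_fun setT g ->
  approximable f -> approximable g -> approximable (fun x => f x + g x).
Proof.
move=> mf mg hf hg e e0; have e4 : 0 < e / 4 by rewrite divr_gt0.
have [h1 V1h k1] := hf _ e4; have [h2 V2h k2] := hg _ e4.
exists (fun x => h1 x + h2 x); first exact: V_add.
have m1 := V_meas V1h; have m2 := V_meas V2h.
apply: (@le_trans _ _ (2%:E * sqd f h1 + 2%:E * sqd g h2)%E).
  apply: sqd_comb => //; [exact: measurable_funD|exact: measurable_funD|move=> x].
  have := sqr_ge0 ((f x - h1 x) - (g x - h2 x)); rewrite !expr2; nra.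
have -> : e = 2 * (e / 4) + 2 * (e / 4) by field.
by rewrite (EFinD (2 * _)) !(EFinM 2) leeD // lee_wpmul2l // lee_fin.
Qed.

Lemma approximable_close f : measurable_fun setT f ->
  (forall e : R, 0 < e -> exists g, [/\ measurable_fun setT g, approximable g & (sqd f g <= e%:E)%E]) ->
  approximable f.
Proof.
move=> mf hf e e0; have e4 : 0 < e / 4 by rewrite divr_gt0.
have [g [mg ag fg]] := hf _ e4; have [h Vh gh] := ag _ e4.
exists h => //; apply: le_trans (sqd_triangle mf mg (V_meas Vh)) _.
have -> : e = 2 * (e / 4) + 2 * (e / 4) by field.
by rewrite (EFinD (2 * _)) !(EFinM 2) leeD // lee_wpmul2l // lee_fin.
Qed.

Lemma approximableZ c f : measurable_fun setT f -> approximable f -> approximable (fun x => c * f x).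
Proof.
move=> mf hf e e0; have c0 : 0 < c ^+ 2 + 1 by rewrite ltr_wpDl ?sqr_ge0.
have [h Vh fh] := hf _ (divr_gt0 e0 c0); exists (fun x => c * h x); first exact: V_scale.
rewrite sqdZ //; last exact: V_meas.
apply: (@le_trans _ _ ((c ^+ 2)%:E * (e / (c ^+ 2 + 1))%:E)%E); first by rewrite lee_wpmul2l // lee_fin sqr_ge0.
by rewrite -EFinM lee_fin mulrCA -[leRHS]mulr1 ler_pM2l // ler_pdivrMr // mul1r lerDl ler01.
Qed.

Lemma approximable_sum (I : Type) (s : seq I) (f : I -> T -> R) :
  (forall i, measurable_fun setT (f i)) -> (forall i, approximable (f i)) ->
  approximable (fun x => \sum_(i <- s) f i x).
Proof.
move=> mf hf; elim: s => [|i s IH].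
  have -> : (fun x => \sum_(i <- [::]) f i x) = (fun x => 0 * 1 : R).
    by apply/funext => x; rewrite big_nil mul0r.
  by apply: approximableZ; [exact: measurable_cst|exact: approximable_V].
have -> : (fun x => \sum_(j <- i :: s) f j x) = (fun x => f i x + \sum_(j <- s) f j x).
  by apply/funext => x; rewrite big_cons.
by apply: approximableD => //; exact: measurable_sum.
Qed.

Hypothesis mu_fin : (mu setT < +oo)%E.

Lemma integrable_cst_fin (c : R) : mu.-integrable setT (EFin \o cst c).
Proof.
apply: measurable_bounded_integrable => //; exists `|c|; split; first exact: num_real.
by move=> M cM x _ /=; rewrite ltW.
Qed.

(** The sets with approximable indicator form a Dynkin class; disjoint unions are handled by
    dominated convergence of the partial sums of indicators. *)
Lemma approximable_indic (G : set (set T)) : @measurable _ T = <<s G >> -> setI_closed G ->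
  (forall A, G A -> approximable (\1_A)) -> forall A, measurable A -> approximable (\1_A : T -> R).
Proof.
move=> GE GI GA A mA; rewrite GE in mA.
apply: (@dynkin_induction _ T G (fun A => approximable (\1_A : T -> R)) GE GI) mA => //.
- by rewrite indicT; exact: approximable_V.
- move=> S mS hS; rewrite indicC.
  have -> : (fun x => (x \notin S)%:R) = (fun x => 1 + (-1) * \1_S x) :> (T -> R).
    by apply/funext => x; rewrite indicE; case: (x \in S); rewrite ?mulr1 ?mulr0 ?subrr ?addr0.
  apply: approximableD => //; [|exact: approximable_V|].
    by apply: measurable_funM; [exact: measurable_cst|exact: measurable_indic].
  by apply: approximableZ => //; exact: measurable_indic.
- move=> F mF tF hF; have mU : measurable (\bigcup_k F k) by exact: bigcup_measurable.
  apply: approximable_close => [|e e0]; first exact: measurable_indic.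
  pose S n := (fun x => \sum_(k <- iota 0 n) \1_(F k) x) : T -> R.
  have mS n : measurable_fun setT (S n) by apply: measurable_sum => k; exact: measurable_indic.
  have SE x n : (S n x)%:E = (\sum_(0 <= k < n) (\1_(F k) x)%:E)%E.
    by rewrite /S /index_iota subn0 sumEFin.
  have SU x n : 0 <= S n x <= \1_(\bigcup_k F k) x.
    rewrite sumr_ge0 //= -lee_fin SE indic_bigcup //; apply: nneseries_lim_ge => k _.
    by rewrite lee_fin.
  have U1 x : \1_(\bigcup_k F k) x <= 1 :> R by rewrite indicE lern1 leq_b1.
  have [n hn] : exists n, (sqd (\1_(\bigcup_k F k)) (S n) <= e%:E)%E.
    apply: (@sqd_dominated S _ (cst 1)) => //.
    - move=> x; have : (S n x)%:E @[n --> \oo] --> (\1_(\bigcup_k F k) x : R)%:E.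
        rewrite indic_bigcup //; under eq_fun do rewrite SE; apply: is_cvg_nneseries => n _ _.
        by rewrite lee_fin.
      by move/fine_cvgP => [_]; apply: cvg_trans.
    - exact: integrable_cst_fin.
    - move=> n x; have /andP[h1 h2] := SU x n; have := U1 x => h3 /=.
      rewrite expr_le1 // ?subr_ge0 //; lra.
  exists (S n); split => //; apply: approximable_sum => k //; exact: measurable_indic.
Qed.

End Approximation.
End SquareDistance.

(** * Polynomials in the cosine *)

Section CosinePolynomials.
Variable R : realType.

Definition cos2pi_ (t : R) : R := cos (2 * pi * t).
Local Notation ck := cos2pi_.
Definition cosn (n : nat) (t : R) : R := cos (2 * pi * n%:R * t).

Lemma ck_bound t : -1 <= ck t <= 1.
Proof. by rewrite cos_geN1 cos_le1. Qed.

Lemma measurable_cosn n : measurable_fun setT (cosn n).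
Proof.
apply: continuous_measurable_fun => x; rewrite /cosn.
apply: (@continuous_comp _ _ _ (fun t => 2 * pi * n%:R * t) (@cos R)); last exact: continuous_cos.
by apply: cvgM; [exact: cvg_cst|exact: cvg_id].
Qed.

Lemma ckE : ck = cosn 1. Proof. by apply/funext => t; rewrite /cosn mulr1. Qed.

Lemma measurable_ck : measurable_fun setT ck.
Proof. rewrite ckE; exact: measurable_cosn. Qed.

Lemma measurable_poly (p : {poly R}) : measurable_fun setT (fun x : R => p.[x]).
Proof.
apply: continuous_measurable_fun => x; exact: continuous_horner.
Qed.

Lemma cosnD m n t : 2 * (cosn m t * cosn n t) = cosn (m + n) t + cosn (maxn m n - minn m n) t.
Proof.
wlog mn : m n / (n <= m)%N.
  move=> H; have [nm|mn] := boolP (n <= m)%N; first exact: H.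
  by rewrite maxnC minnC addnC [cosn m t * _]mulrC; apply: H; rewrite ltnW // ltnNge.
rewrite (maxn_idPl mn) (minn_idPr mn) /cosn natrD natrB //.
have -> : 2 * pi * (m%:R + n%:R) * t = 2 * pi * m%:R * t + 2 * pi * n%:R * t by ring.
have -> : 2 * pi * (m%:R - n%:R) * t = 2 * pi * m%:R * t - 2 * pi * n%:R * t by ring.
rewrite cosD cosB; ring.
Qed.

Definition even_trig (phi : R -> R) := exists (k : nat) (al : nat -> R),
  forall t, phi t = \sum_(n < k) al n * cosn n t.

Lemma even_trig_cosn c n : even_trig (fun t => c * cosn n t).
Proof.
exists n.+1, (fun m => (m == n)%:R * c) => t; rewrite big_ord_recr /= eqxx mul1r big1 ?add0r // => m _.
by rewrite ltn_eqF // !mul0r.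
Qed.

Lemma even_trigD f g : even_trig f -> even_trig g -> even_trig (fun t => f t + g t).
Proof.
move=> [k [a hf]] [l [b hg]]; exists (k + l)%N.
exists (fun n => (n < k)%:R * a n + (n < l)%:R * b n) => t.
have ext m (c : nat -> R) : (m <= k + l)%N ->
    \sum_(n < m) c n * cosn n t = \sum_(n < k + l) (n < m)%:R * c n * cosn n t.
  move=> mk; rewrite (big_ord_widen _ (fun n => c n * cosn n t) mk) big_mkcond /=.
  by apply: eq_bigr => n _; case: ifP => _; rewrite ?mul1r ?mul0r.
rewrite hf hg (ext k) ?leq_addr // (ext l) ?leq_addl // -big_split /=.
by apply: eq_bigr => n _; rewrite mulrDl.
Qed.

Lemma even_trig_sum (I : Type) (s : seq I) (f : I -> R -> R) :
  (forall i, even_trig (f i)) -> even_trig (fun t => \sum_(i <- s) f i t).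
Proof.
move=> hf; elim: s => [|i s IH].
  by exists 0%N, (fun=> 0) => t; rewrite big_nil big_ord0.
have [k [a h]] := even_trigD (hf i) IH; exists k, a => t; rewrite big_cons; exact: h.
Qed.

(** By the product formula, multiplication by the cosine moves each frequency by one in both
    directions; a frequency [0] is reflected to [1]. *)
Lemma even_trig_poly (p : {poly R}) : even_trig (fun t => p.[ck t]).
Proof.
elim/poly_ind: p => [|p c [k [a hp]]].
  by exists 0%N, (fun=> 0) => t; rewrite horner0 big_ord0.
have [l [b h]] := @even_trigD (fun t => \sum_(n <- iota 0 k) (a n / 2 * cosn (n + 1) t +
   a n / 2 * cosn (maxn n 1 - minn n 1) t)) _ (even_trig_sum (iota 0 k)
   (fun n => even_trigD (even_trig_cosn (a n / 2) (n + 1)) (even_trig_cosn (a n / 2) (maxn n 1 - minn n 1))))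
   (even_trig_cosn c 0).
exists l, b => t; rewrite -h hornerMXaddC hp mulr_suml.
have -> : cosn 0 t = 1 by rewrite /cosn mulr0 mul0r cos0.
rewrite mulr1 -(big_mkord xpredT (fun n => a n * cosn n t * ck t)) /index_iota subn0; congr (_ + _).
by apply: eq_bigr => n _; rewrite -mulrDr -cosnD -ckE; field.
Qed.

Lemma mul_exprn_bound (w : R) n : 0 <= w -> w < 1 -> n%:R * w ^+ n <= (1 - w)^-1.
Proof.
move=> w0 w1; have w1' : 0 < 1 - w by rewrite subr_gt0.
have h : n%:R * w ^+ n <= \sum_(k < n) w ^+ k.
  rewrite -[n in n%:R]card_ord -sumr_const mulr_suml; apply: ler_sum => k _.
  by rewrite mul1r; apply: ler_wiXn2l (ltnW (ltn_ord k)) => //; exact: ltW.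
apply: le_trans h _; rewrite -[leRHS]div1r ler_pdivlMr //.
have := subrX1 w n; rewrite -opprB -[w - 1]opprB mulNr => /oppr_inj e.
by rewrite mulrC -e lerBlDr lerDl exprn_ge0.
Qed.

(* [(1-u)^m <= 1/(1+mu)], and Bernoulli's inequality from below. *)
Lemma threshold_cvg (x : R) : 0 <= x -> x <= 1 ->
  (1 - x ^+ n) ^+ (n * 2 ^ n) @[n --> \oo] --> ((x < 2^-1)%R%:R : R).
Proof.
move=> x0 x1.
have xn n : 0 <= x ^+ n <= 1 by rewrite exprn_ge0 // exprn_ile1.
have bern (u : R) m : 0 <= u <= 1 -> 1 - m%:R * u <= (1 - u) ^+ m.
  move=> /andP[u0 u1]; elim: m => [|m IH]; first by rewrite expr0 mul0r subr0.
  rewrite exprS -natr1; have : (1 - u) * (1 - m%:R * u) <= (1 - u) * (1 - u) ^+ m.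
    by rewrite ler_wpM2l // subr_ge0.
  apply: le_trans; have : 0 <= m%:R * u * u by rewrite !mulr_ge0.
  nra.
case: ltP => xh /=.
  pose w := Num.sqrt (2 * x); have w2 : w * w = 2 * x by rewrite -expr2 sqr_sqrtr // mulr_ge0.
  have w0 : 0 <= w by exact: sqrtr_ge0.
  have w1 : w < 1 by rewrite -(ltr_sqr (x := w)) ?nnegrE // expr1n expr2 w2; lra.
  have cv : (1 - (1 - w)^-1 * w ^+ n) @[n --> \oo] --> (1 : R).
    have c0 : (1 - w)^-1 * w ^+ n @[n --> \oo] --> ((1 - w)^-1 * 0 : R).
      by apply: cvgM; [exact: cvg_cst|apply: cvg_expr; rewrite ger0_norm].
    rewrite mulr0 in c0; have := cvgB (cvg_cst (1 : R)) c0; rewrite subr0; exact.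
  apply: (squeeze_cvgr _ cv (cvg_cst (1 : R))); near=> n; apply/andP; split; last first.
    by rewrite exprn_ile1 // ?subr_ge0 ?gerBl; have /andP[] := xn n.
  apply: le_trans (bern _ _ (xn n)); rewrite lerD2l lerN2 natrM natrX.
  have -> : n%:R * 2 ^+ n * x ^+ n = n%:R * w ^+ n * w ^+ n.
    by rewrite -mulrA -exprMn -w2 exprMn mulrA.
  by rewrite ler_wpM2r ?exprn_ge0 // mul_exprn_bound.
apply: (squeeze_cvgr _ (cvg_cst (0 : R)) (@cvg_harmonic R)); near=> n.
have /andP[p0 p1] := xn n.
rewrite exprn_ge0 ?subr_ge0 //= /harmonic.
have h1 : n.+1%:R <= (1 + x ^+ n) ^+ (n * 2 ^ n).
  have b (u : R) m : 0 <= u -> 1 + m%:R * u <= (1 + u) ^+ m.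
    move=> u0; elim: m => [|m IH]; first by rewrite expr0 mul0r addr0.
    rewrite exprS -natr1; have : (1 + u) * (1 + m%:R * u) <= (1 + u) * (1 + u) ^+ m.
      by rewrite ler_wpM2l // addr_ge0.
    apply: le_trans; have : 0 <= m%:R * u * u by rewrite !mulr_ge0.
    nra.
  apply: le_trans (b _ _ p0); rewrite -natr1 addrC lerD2l natrM natrX -mulrA -exprMn.
  rewrite -[leLHS]mulr1 ler_wpM2l // exprn_ege1 //.
  by rewrite -(ler_pM2l (x := 2)) // mulfV // in xh.
rewrite -[leRHS]div1r ler_pdivlMr ?ltr0n //.
apply: (@le_trans _ _ ((1 - x ^+ n) ^+ (n * 2 ^ n) * (1 + x ^+ n) ^+ (n * 2 ^ n))).
  by rewrite ler_wpM2l // exprn_ge0 // subr_ge0.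
rewrite -exprMn exprn_ile1 //; have : 0 <= x ^+ n * x ^+ n by rewrite mulr_ge0.
all: nra.
Unshelve. all: by end_near.
Qed.

(** An affine change of variable sends the threshold [c] to [1 / 2] and the range of the cosine into
    [[0, 1]]; for [c] outside []-1, 1]] constants suffice. *)
Lemma poly_threshold (c : R) : exists P : nat -> {poly R}, forall t,
  (forall n, 0 <= (P n).[ck t] <= 1) /\ ((P n).[ck t] @[n --> \oo] --> ((ck t < c)%R%:R : R)).
Proof.
have [c1|c1] := ltP 1 c.
  exists (fun=> 1) => t; have /andP[_ k1] := ck_bound t.
  by rewrite hornerC; split=> [n|]; rewrite ?hornerC ?ler01 ?lexx // (le_lt_trans k1 c1); exact: cvg_cst.
have [c2|c2] := leP c (-1).
  exists (fun=> 0) => t; have /andP[k1 _] := ck_bound t.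
  by rewrite hornerC; split=> [n|]; rewrite ?hornerC ?ler01 ?lexx // ltNge (le_trans c2 k1); exact: cvg_cst.
pose x t := 2^-1 + (ck t - c) / 4.
exists (fun n => (1 - (4^-1 *: 'X + (2^-1 - c / 4)%:P) ^+ n) ^+ (n * 2 ^ n)) => t.
have E n : ((1 - (4^-1 *: 'X + (2^-1 - c / 4)%:P) ^+ n) ^+ (n * 2 ^ n)).[ck t] = (1 - x t ^+ n) ^+ (n * 2 ^ n).
  rewrite horner_exp hornerD hornerN hornerC horner_exp !hornerE; congr ((_ - _ ^+ _) ^+ _).
  by rewrite /= /x; field.
have /andP[k1 k2] := ck_bound t.
have x0 : 0 <= x t by rewrite /x; lra.
have x1 : x t <= 1 by rewrite /x; lra.
split=> [n|]; first rewrite E.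
  have /andP[p0 p1] : 0 <= x t ^+ n <= 1 by rewrite exprn_ge0 // exprn_ile1.
  by rewrite exprn_ge0 ?subr_ge0 //= exprn_ile1 // ?subr_ge0 // gerBl.
under eq_fun do rewrite E; have -> : (ck t < c) = (x t < 2^-1).
  by rewrite /x gtrDl pmulr_llt0 ?subr_lt0 // invr_gt0.
exact: threshold_cvg.
Qed.

End CosinePolynomials.

Definition pushm d d' (T1 : measurableType d) (T2 : measurableType d') (R : realType)
  (m : {measure set T1 -> \bar R}) (f : T1 -> T2) (mf : measurable_fun setT f) : {measure set T2 -> \bar R} :=
  measure_function_pushforward__canonical__measure_function_Measure m mf.

(** * Measures on the circle and conjugation-symmetric sets *)

Section CircleMeasures.
Variable R : realType.
Local Notation ck := (@cos2pi_ R).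
Local Notation cosn := (@cosn R).
Definition circle : set R := `[0%R, 1%R[%classic.

Lemma measurable_circle : measurable circle. Proof. exact: measurable_itv. Qed.
Hint Resolve measurable_circle : core.

Definition on_circle (sigma : {measure set R -> \bar R}) := (sigma setT < +oo)%E /\ sigma (~` circle) = 0%E.

Lemma bounded_integrable (sigma : {measure set R -> \bar R}) (f : R -> R) (M : R) : (sigma setT < +oo)%E ->
  measurable_fun setT f -> (forall x, `|f x| <= M) -> sigma.-integrable setT (EFin \o f).
Proof.
move=> fin mf fM; apply: measurable_bounded_integrable => //.
exists M; split; first exact: num_real.
by move=> N MN x _ /=; rewrite (le_trans (fM x)) // ltW.
Qed.

Lemma integrable_cosn sigma n : on_circle sigma -> sigma.-integrable setT (EFin \o cosn n).
Proof.
by case=> fin _; apply: (@bounded_integrable _ _ 1) => //; [exact: measurable_cosn|move=> x; exact: cos_max].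
Qed.

Lemma integral_circle sigma (f : R -> \bar R) : on_circle sigma -> sigma.-integrable setT f ->
  (\int[sigma]_(t in circle) f t = \int[sigma]_t f t)%E.
Proof.
move=> [_ c0] fi; rewrite (@negligible_integral _ _ _ sigma setT (~` circle)) //.
- by rewrite setTD setCK.
- exact: measurableC.
Qed.

Lemma integral_even_trig sigma (al : nat -> R) k : on_circle sigma ->
  (\int[sigma]_t (\sum_(n < k) al n * cosn n t)%:E = \sum_(n < k) ((al n)%:E * \int[sigma]_t (cosn n t)%:E))%E.
Proof.
move=> hs; rewrite (eq_integral (fun t => \sum_(n < k) ((al n)%:E * (cosn n t)%:E))%E); last by move=> t _; rewrite -sumEFin.
rewrite integral_sum //; last by move=> n; apply: integrableZl => //; exact: integrable_cosn.
apply: eq_bigr => n _; rewrite integralZl //; exact: integrable_cosn.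
Qed.

(** Invariance under complex conjugation of the circle; the point [0] is its own mirror image and is
    not constrained. *)
Definition symmetric (S : set R) := forall t : R, 0 < t -> t < 1 -> S t -> S (1 - t).

Lemma ck_sym t : ck (1 - t) = ck t.
Proof.
rewrite /cos2pi_; have -> : 2 * pi * (1 - t) = - (2 * pi * t) + pi *+ 2 by rewrite mulr2n; ring.
by rewrite cosD2pi cosN.
Qed.

(** The set [B] is the image of the half circle under the cosine, written as a preimage under the
    arc cosine to be measurable. That function is used on the open interval only, so the endpoints
    [1] and [-1] are added by hand. *)
Lemma symmetric_preimage (S : set R) : measurable S -> symmetric S ->
  exists2 B : set R, measurable B & forall t : R, 0 <= t -> t < 1 -> S t <-> B (ck t).
Proof.
move=> mS sS; pose g (y : R) := acos y / (2 * pi).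
have pi0 : 0 < pi :> R := pi_gt0 R.
have mg : measurable_fun `](-1 : R), 1[%classic g.
  apply: open_continuous_measurable_fun; first exact: interval_open.
  move=> y; rewrite inE /= in_itv /= => y1; apply: cvgM; last exact: cvg_cst.
  exact: continuous_acos.
pose B := (`](-1 : R), 1[%classic `&` g @^-1` S) `|` ([set y | y = 1 /\ S 0] `|` [set y | y = -1 /\ S (2^-1)]).
have m1 (c : R) (P : Prop) : measurable [set y | y = c /\ P].
  case: (pselect P) => p; last by rewrite (_ : [set _ | _] = set0) // -subset0 => y [].
  rewrite (_ : [set _ | _] = [set c]); first exact: measurable_set1.
  by apply/seteqP; split=> [y []//|y -> ].
exists B; first by apply: measurableU; [exact: mg|exact: measurableU].
have h2 : g (-1) = 2^-1 by rewrite /g acosN1 invfM mulrCA mulfV ?mulr1 // lt0r_neq0.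
have half (t : R) : 0 < t -> t <= 2^-1 -> S t <-> B (ck t).
  move=> t0 t1.
  have tp : 2 * pi * t <= pi.
    have -> : 2 * pi * t = pi * (2 * t) by ring.
    by rewrite -[leRHS]mulr1 ler_pM2l //; lra.
  have gt : g (ck t) = t.
    rewrite /g /cos2pi_ cosK; first by rewrite mulrAC mulfV ?mul1r // lt0r_neq0 // mulr_gt0.
    by rewrite in_itv /= tp andbT !mulr_ge0 // ltW.
  have lt1 : ck t < 1.
    rewrite -cos0 /cos2pi_ ltr_cos ?in_itv /=.
    - by rewrite !mulr_gt0.
    - by rewrite lexx ltW.
    - by rewrite tp andbT !mulr_ge0 // ltW.
  split=> [St|].
    have [e|ne] := eqVneq (ck t) (-1).
      by right; right; split => //; rewrite -h2 -e gt.
    left; split; last by rewrite /= gt.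
    by rewrite /= in_itv /= lt1 lt_neqAle eq_sym ne andbT; have /andP[] := ck_bound t.
  case=> [[_ /=]|[[/= e]|[/= e]]]; first by rewrite gt.
    by rewrite e ltxx in lt1.
  by rewrite -h2 -e gt.
move=> t t0 t1; have [->|tn0] := eqVneq t 0.
  have k0 : ck 0 = 1 by rewrite /cos2pi_ mulr0 cos0.
  split=> [S0|]; first by right; left; rewrite k0.
  rewrite k0; case=> [[/=]|[[]//|[/= e]]]; first by rewrite in_itv /= ltxx andbF.
  lra.
have {tn0}t0 : 0 < t by rewrite lt_neqAle eq_sym tn0.
have [th|th] := leP t 2^-1; first exact: half.
rewrite -ck_sym -half; [|lra|lra].
split=> [/sS|]; first exact.
by move=> /sS h; rewrite -[t](subKr 1); apply: h; lra.
Qed.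

Lemma circle_null_setI sigma A : on_circle sigma -> measurable A -> sigma A = sigma (A `&` circle).
Proof.
move=> [_ c0] mA.
have z : sigma (A `\` circle) = 0%E.
  apply/eqP; rewrite eq_le measure_ge0 andbT -c0; apply: le_measure; rewrite ?inE.
  - exact: measurableD.
  - exact: measurableC.
  - by move=> t [].
have mI : measurable (A `&` circle) by exact: measurableI.
have mD : measurable (A `\` circle) by exact: measurableD.
have -> : sigma A = (sigma (A `&` circle) + sigma (A `\` circle))%E.
  by rewrite -measureU ?setUIDK //; apply/seteqP; split => // t [[_ ?] [_ ?]].
by rewrite z adde0.
Qed.

Lemma measure_preimage_ck sigma (S B : set R) : on_circle sigma -> measurable S -> measurable B ->
  (forall t : R, 0 <= t -> t < 1 -> S t <-> B (ck t)) -> sigma S = sigma (ck @^-1` B).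
Proof.
move=> hs mS mB h; have mP : measurable (ck @^-1` B).
  by rewrite -[_ @^-1` _]setTI; exact: measurable_ck.
rewrite (circle_null_setI hs mS) (circle_null_setI hs mP); congr (sigma _).
apply/seteqP; split => t [Ht ct]; split => //; move: (ct); rewrite /circle /= in_itv /= => /andP[t0 t1];
  exact/(h t t0 t1).
Qed.

(** Symmetric sets being preimages under the cosine, it suffices to compare the image measures on
    half-lines. There the threshold polynomials express both sides by cosine coefficients. *)
Lemma circle_measure_unique (s1 s2 : {measure set R -> \bar R}) (S : set R) : on_circle s1 -> on_circle s2 ->
  (forall n, \int[s1]_t (cosn n t)%:E = \int[s2]_t (cosn n t)%:E)%E ->
  measurable S -> symmetric S -> s1 S = s2 S.
Proof.
move=> h1 h2 e mS sS; have [B mB SB] := symmetric_preimage mS sS.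
rewrite (measure_preimage_ck h1 mS mB SB) (measure_preimage_ck h2 mS mB SB).
pose g (k : nat) : set R := `]-oo, k%:R[%classic.
suff : forall A : set R, measurable A -> pushm s1 (@measurable_ck R) A = pushm s2 (@measurable_ck R) A by apply.
move=> B0 mB0.
refine (@measure_unique _ R _ (@RGenInftyO.G R) g (RGenInftyO.measurableE R) _ _ _ (pushm s1 (@measurable_ck R)) (pushm s2 (@measurable_ck R)) _ _ B0 mB0) => //.
- move=> A C [x ->] [y ->]; exists (Num.min x y); apply/seteqP; split => t /=; rewrite !in_itv /= lt_min.
    by move=> [-> ->].
  by move=> /andP[-> ->].
- by move=> k; exists k%:R.
- apply/seteqP; split => // t _; exists (Num.trunc `|t|).+1 => //=; rewrite /g /= in_itv /=.
  by rewrite (le_lt_trans (ler_norm t)) // truncnS_gt.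
- move=> A [c ->]; rewrite /pushm /= /pushforward.
  have [P hP] := poly_threshold c.
  have lim (s : {measure set R -> \bar R}) : on_circle s ->
     (\int[s]_t ((P n).[ck t])%:E)%E @[n --> \oo] --> s (ck @^-1` `]-oo, c[%classic).
    move=> hs; have mP : measurable (ck @^-1` `]-oo, c[%classic).
      by rewrite -[_ @^-1` _]setTI; exact: measurable_ck.
    have -> : s (ck @^-1` `]-oo, c[%classic) = (\int[s]_t (\1_(ck @^-1` `]-oo, c[%classic) t)%:E)%E.
      by rewrite integral_indic // setIT.
    apply: (@dominated_cvg _ _ _ s setT measurableT (fun n => EFin \o (fun t => (P n).[ck t])) _ (EFin \o cst 1)) => //.
    - move=> n; apply/measurable_EFinP; apply: measurableT_comp; [exact: measurable_poly|exact: measurable_ck].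
    - move=> t _; apply: cvg_EFin; first exact: nearW.
      have -> : \1_(ck @^-1` `]-oo, c[) t = (ck t < c)%R%:R :> R.
        by rewrite indicE; congr (nat_of_bool _)%:R; apply/idP/idP; rewrite inE /= in_itv.
      exact: (hP t).2.
    - by apply: (@bounded_integrable _ _ 1 hs.1) => // x; rewrite normr1.
    - by move=> n t _ /=; have /andP[p0 p1] := (hP t).1 n; rewrite lee_fin ger0_norm.
  have := lim s1 h1; have := lim s2 h2.
  have -> : (fun n => \int[s2]_t ((P n).[ck t])%:E)%E = (fun n => \int[s1]_t ((P n).[ck t])%:E)%E.
    apply/funext => n; have [k [al hk]] := even_trig_poly (P n).
    under eq_integral do rewrite hk; under [RHS]eq_integral do rewrite hk.
    rewrite !integral_even_trig //; apply: eq_bigr => i _; by rewrite e.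
  by move=> l2 l1; apply: (cvg_unique _ l1 l2) => //.
- move=> k; rewrite /pushm /= /pushforward; apply: le_lt_trans h1.1; apply: le_measure; rewrite ?inE //.
  by rewrite -[_ @^-1` _]setTI; apply: measurable_ck => //; exact: measurable_itv.
Qed.

Lemma sqd_pushm (sigma : {measure set R -> \bar R}) (f g : R -> R) : measurable_fun setT f -> measurable_fun setT g ->
  sqd (pushm sigma (@measurable_ck R)) f g = sqd sigma (f \o ck) (g \o ck).
Proof.
move=> mf mg; rewrite /sqd /pushm /= ge0_integral_pushforward ?preimage_setT //.
- exact: measurable_ck.
- exact: measurable_sqd.
- by move=> y _; rewrite lee_fin sqr_ge0.
Qed.

Lemma circle_approximation (sigma : {measure set R -> \bar R}) (S : set R) (e : R) : on_circle sigma ->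
  measurable S -> symmetric S -> 0 < e -> exists p : {poly R}, (sqd sigma \1_S (fun t => p.[ck t]) <= e%:E)%E.
Proof.
move=> hs mS sS e0; have [B mB SB] := symmetric_preimage mS sS.
pose V := [set f : R -> R | exists p : {poly R}, f = (fun x => p.[x])].
pose tau := pushm sigma (@measurable_ck R).
have tfin : (tau setT < +oo)%E by rewrite /tau /pushm /= /pushforward preimage_setT; exact: hs.1.
have [||||||h [p ->] hp] := @approximable_indic _ R R tau V _ _ _ _ tfin (@RGenInftyO.G R) (RGenInftyO.measurableE R) _ _ B mB e e0.
- by move=> f [p ->]; exact: measurable_poly.
- by move=> f g [p ->] [q ->]; exists (p + q); apply/funext => x; rewrite hornerD.
- by move=> c f [p ->]; exists (c *: p); apply/funext => x; rewrite hornerZ.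
- by exists 1; apply/funext => x; rewrite hornerC.
- move=> A C [x ->] [y ->]; exists (Num.min x y); apply/seteqP; split => t /=; rewrite !in_itv /= lt_min.
    by move=> [-> ->].
  by move=> /andP[-> ->].
- move=> A [c ->] d d0; have [P hP] := poly_threshold c.
  have mA : measurable (`]-oo, c[%classic : set R) by exact: measurable_itv.
  have [n hn] : exists n, (sqd sigma (\1_(`]-oo, c[%classic) \o ck) (fun t => (P n).[ck t]) <= d%:E)%E.
    apply: (@sqd_dominated _ _ _ sigma (fun n t => (P n).[ck t]) (\1_(`]-oo, c[%classic) \o ck) (cst 1)) => //.
    - by move=> n; apply: (measurableT_comp (measurable_poly _) (@measurable_ck R)).
    - by apply: measurableT_comp; [exact: measurable_indic|exact: measurable_ck].
    - move=> t; rewrite /= indicE; have -> : (ck t \in `]-oo, c[%classic) = (ck t < c).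
        by apply/idP/idP; rewrite inE /= in_itv.
      exact: (hP t).2.
    - by apply: (@bounded_integrable _ _ 1 hs.1) => // x; rewrite normr1.
    - move=> n t /=; have /andP[p0 p1] := (hP t).1 n.
      rewrite indicE; have : 0 <= (ck t \in `]-oo, c[%classic)%:R :> R by exact: ler0n.
      have : (ck t \in `]-oo, c[%classic)%:R <= 1 :> R by rewrite lern1 leq_b1.
      move: (_%:R) => u q1 q0.
      rewrite -[_ ^+ 2]real_normK ?num_real // expr_le1 // ler_norml; lra.
  exists (fun x => (P n).[x]); first by exists (P n).
  by rewrite sqd_pushm //; exact: measurable_poly.
exists p; have mp := measurable_poly p.
rewrite sqd_pushm // in hp.
apply: le_trans hp; have mP : measurable_fun setT (fun t => p.[ck t]).
  exact: (measurableT_comp mp (@measurable_ck R)).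
have mcirc : measurable (~` circle) by exact: measurableC.
have mBk : measurable_fun setT (\1_B \o ck : R -> R).
  by apply: measurableT_comp; [exact: measurable_indic|exact: measurable_ck].
have mSk : measurable_fun setT (\1_S : R -> R) by exact: measurable_indic.
have red (f g : R -> R) : measurable_fun setT f -> measurable_fun setT g ->
    sqd sigma f g = (\int[sigma]_(t in circle) ((f t - g t) ^+ 2)%:E)%E.
  move=> mf mg; rewrite /sqd (@ge0_negligible_integral _ _ _ sigma setT (~` circle)) //.
  - by rewrite setTD setCK.
  - exact: measurable_sqd.
  - by move=> t _; rewrite lee_fin sqr_ge0.
  - exact: hs.2.
rewrite !red // le_eqVlt; apply/orP; left; apply/eqP; apply: eq_integral => t; rewrite inE => ct.
move: (ct); rewrite /circle /= in_itv /= => /andP[t0 t1].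
have -> : \1_S t = \1_B (ck t) :> R; last by [].
rewrite !indicE; congr (nat_of_bool _)%:R; apply/idP/idP; rewrite !inE => hB; exact/(SB t t0 t1).
Qed.

(** Approximation with respect to the sum of the two measures gives one polynomial that serves
    both. *)
Lemma circle_approximation2 (s1 s2 : {measure set R -> \bar R}) (S : set R) (e : R) :
  on_circle s1 -> on_circle s2 -> measurable S -> symmetric S -> 0 < e ->
  exists k (al : nat -> R), let phi t := \sum_(n < k) al n * cosn n t in
    (sqd s1 \1_S phi <= e%:E)%E /\ (sqd s2 \1_S phi <= e%:E)%E.
Proof.
move=> h1 h2 mS sS e0.
have hs : on_circle (measure_add s1 s2).
  have E A : (measure_add s1 s2 : {measure set R -> \bar R}) A = (s1 A + s2 A)%E by exact: measure_addE.
  rewrite /on_circle !E h1.2 h2.2 adde0; split => //.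
  by apply: lte_add_pinfty; [exact: h1.1|exact: h2.1].
have [p hp] := circle_approximation hs mS sS e0.
have [k [al hk]] := even_trig_poly p; exists k, al => /=.
have -> : (fun t => \sum_(n < k) al n * cosn n t) = (fun t => p.[ck t]).
  by apply/funext => t; rewrite hk.
move: hp; rewrite /sqd ge0_integral_measure_add //; last 2 first.
- by move=> t _; rewrite lee_fin sqr_ge0.
- apply: measurable_sqd; first exact: measurable_indic.
  exact: (measurableT_comp (measurable_poly p) (@measurable_ck R)).
by move=> hp; split; apply: le_trans hp; [apply: leeDl|apply: leeDr]; exact: sqd_ge0.
Qed.

End CircleMeasures.

(** * Herglotz' theorem *)

Section CosineSums.
Variable R : realType.
Local Notation cosn := (@cosn R).

Lemma sin2piD_nat (x : R) k : sin (x + 2 * pi * k%:R) = sin x.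
Proof.
have -> : x + 2 * pi * k%:R = x + pi *+ 2 *+ k by rewrite -[pi *+ 2 *+ k]mulr_natr -[pi *+ 2]mulr_natl.
exact: (periodicn (@sinD2pi R)).
Qed.

Lemma sum_cosn_grid M k : (0 < k)%N -> (k < M)%N -> \sum_(j < M) cosn k (j%:R / M%:R) = 0.
Proof.
move=> k0 kM; have M0 : (0 < M)%N by exact: leq_trans kM.
have M0R : 0 < M%:R :> R by rewrite ltr0n.
pose h : R := pi * k%:R / M%:R.
have pi0 : 0 < pi :> R := pi_gt0 R.
have sh : sin h != 0.
  rewrite gt_eqF // sin_gt0_pi // /h; apply/andP; split.
    by rewrite divr_gt0 // mulr_gt0 // ltr0n.
  by rewrite ltr_pdivrMr // ltr_pM2l // ltr_nat.
suff tel m : 2 * sin h * \sum_(j < m) cosn k (j%:R / M%:R) = sin ((2 * m%:R - 1) * h) + sin h.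
  have := tel M; have -> : (2 * M%:R - 1) * h = - h + 2 * pi * k%:R by rewrite /h; field; rewrite gt_eqF.
  rewrite sin2piD_nat sinN addNr => /eqP; rewrite mulf_eq0 mulf_eq0 (negbTE sh) pnatr_eq0 /=.
  by move/eqP.
elim: m => [|m IH]; first by rewrite big_ord0 mulr0 mulr0 sub0r mulN1r sinN addNr.
rewrite big_ord_recr /= mulrDr IH.
have -> : cosn k (m%:R / M%:R) = cos (2 * m%:R * h).
  by rewrite /cosn /h; congr cos; field; rewrite gt_eqF.
have -> : (2 * m%:R - 1) * h = 2 * m%:R * h - h by ring.
have -> : (2 * m.+1%:R - 1) * h = 2 * m%:R * h + h by rewrite -natr1; ring.
rewrite sinB sinD; ring.
Qed.

Definition dist (a b : nat) : nat := (a - b + (b - a))%N.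

Lemma distE a b : dist a b = (maxn a b - minn a b)%N.
Proof. by rewrite /dist; lia. Qed.

Lemma cosn_dist a b t : cosn (dist a b) t = cosn a t * cosn b t + sin (2 * pi * a%:R * t) * sin (2 * pi * b%:R * t).
Proof.
rewrite -cosB /cosn; have [ab|/ltnW ab] := leqP a b.
  rewrite /dist (eqP ab) add0n natrB // -cosN; congr cos; ring.
by rewrite /dist (eqP ab) addn0 natrB //; congr cos; ring.
Qed.

Lemma sum_cosn_pair M d m : (d + m < M)%N ->
  \sum_(j < M) 2 * (cosn d (j%:R / M%:R) * cosn m (j%:R / M%:R)) =
  M%:R * ((d + m == 0)%N%:R + (d == m)%:R).
Proof.
move=> dm; have S0 k : (k < M)%N -> \sum_(j < M) cosn k (j%:R / M%:R) = M%:R * (k == 0)%N%:R.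
  case: k => [|k] kM; last by rewrite sum_cosn_grid // mulr0.
  rewrite eqxx mulr1 (eq_bigr (fun=> 1)) ?sumr_const ?card_ord // => j _.
  by rewrite /cosn mulr0 mul0r cos0.
under eq_bigr do rewrite cosnD; rewrite big_split /= !S0 //; last by lia.
by rewrite -mulrDr; congr (_ * (_ + (nat_of_bool _)%:R)); lia.
Qed.

End CosineSums.

Section FejerWeights.
Variables (R : realType) (r : nat -> R).
Hypothesis r_pos : forall N (c : nat -> R), 0 <= \sum_(a < N) \sum_(b < N) c a * c b * r (dist a b).
Local Notation cosn := (@cosn R).
Variable N : nat.
Hypothesis N0 : (0 < N)%N.
Local Notation M := (2 * N)%N.

(** The Fejer mean of the trigonometric series with coefficients [r], sampled on a grid. With
    [2 * N] points, the frequencies up to [N] are not confused with those of the mean, which are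
    below [N]. *)
Definition fejer_weight (j : nat) : R :=
  (M * N)%:R^-1 * \sum_(a < N) \sum_(b < N) r (dist a b) * cosn (dist a b) (j%:R / M%:R).

Lemma fejer_weight_ge0 j : 0 <= fejer_weight j.
Proof.
rewrite mulr_ge0 ?invr_ge0 //; set t := _ / _.
have -> : \sum_(a < N) \sum_(b < N) r (dist a b) * cosn (dist a b) t =
   \sum_(a < N) \sum_(b < N) cosn a t * cosn b t * r (dist a b) +
   \sum_(a < N) \sum_(b < N) sin (2 * pi * a%:R * t) * sin (2 * pi * b%:R * t) * r (dist a b).
  rewrite -big_split; apply: eq_bigr => a _; rewrite -big_split; apply: eq_bigr => b _ /=.
  by rewrite cosn_dist; ring.
by apply: addr_ge0; [exact: (r_pos N (fun a => cosn a t))|exact: (r_pos N (fun a => sin (2 * pi * a%:R * t)))].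
Qed.

Lemma count_dist m : (0 < m)%N -> (m <= N)%N ->
  \sum_(a < N) \sum_(b < N) (dist a b == m)%:R = 2 * (N - m)%:R :> R.
Proof.
move=> m0 mN.
have E (a : 'I_N) : \sum_(b < N) (dist a b == m)%:R = (a + m < N)%N%:R + (m <= a)%N%:R :> R.
  transitivity (\sum_(b < N) ((b == a + m :> nat)%N%:R + ((m <= a)%N && (b == a - m :> nat)%N)%:R : R)).
    apply: eq_bigr => b _; rewrite -natrD; congr (_%:R); rewrite /dist.
    case: eqP => e1; case: eqP => e2; case: leqP => e3; case: eqP => e4 /=; lia.
  rewrite big_split /=; congr (_ + _).
    have [h|h] := ltnP (a + m) N.
      rewrite (bigD1 (Ordinal h)) //= eqxx big1 ?addr0 // => b nb.
      by case: eqP => // e; case/negP: nb; apply/eqP/val_inj.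
    by rewrite big1 // => b _; case: eqP => // e; have := ltn_ord b; lia.
  have [h|h] := leqP m a; last by rewrite big1.
  have h2 : (a - m < N)%N by have := ltn_ord a; lia.
  rewrite (bigD1 (Ordinal h2)) //= eqxx big1 ?addr0 // => b nb.
  by case: eqP => // e; case/negP: nb; apply/eqP/val_inj.
rewrite (eq_bigr _ (fun a _ => E a)) big_split /= -!natr_sum.
have -> : (\sum_(a < N) (a + m < N))%N = (N - m)%N.
  rewrite -(big_mkord xpredT (fun a => (a + m < N)%N : nat)) (@big_cat_nat _ _ _ (N - m)) ?leq_subr //=.
  rewrite (eq_big_nat _ _ (F2 := fun=> 1%N)) => [|i hi]; last by lia.
  rewrite sum_nat_const_nat subn0 muln1 [X in (_ + X)%N]big_nat big1 ?addn0 // => i hi; lia.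
have -> : (\sum_(a < N) (m <= a))%N = (N - m)%N.
  rewrite -(big_mkord xpredT (fun a => (m <= a)%N : nat)) (@big_cat_nat _ _ _ m) //=.
  rewrite [X in (X + _)%N]big_nat big1 => [|i hi]; last by lia.
  rewrite (eq_big_nat _ _ (F2 := fun=> 1%N)) => [|i hi]; last by lia.
  by rewrite sum_nat_const_nat muln1.
ring.
Qed.

Lemma fejer_weight_cosn m : (m <= N)%N ->
  \sum_(j < M) fejer_weight j * cosn m (j%:R / M%:R) = (N - m)%:R / N%:R * r m.
Proof.
move=> mN; have N0R : 0 < N%:R :> R by rewrite ltr0n.
have -> : \sum_(j < M) fejer_weight j * cosn m (j%:R / M%:R) =
   (2 * (M * N)%:R)^-1 * \sum_(a < N) \sum_(b < N) r (dist a b) *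
      \sum_(j < M) 2 * (cosn (dist a b) (j%:R / M%:R) * cosn m (j%:R / M%:R)).
  rewrite mulr_sumr; under [RHS]eq_bigr do (rewrite mulr_sumr; under eq_bigr do rewrite !mulr_sumr).
  have Ej (j : 'I_M) : fejer_weight j * cosn m (j%:R / M%:R) = \sum_(a < N) \sum_(b < N)
      (M * N)%:R^-1 * (r (dist a b) * cosn (dist a b) (j%:R / M%:R)) * cosn m (j%:R / M%:R).
    rewrite /fejer_weight mulr_sumr mulr_suml; apply: eq_bigr => a _; by rewrite mulr_sumr mulr_suml.
  rewrite (eq_bigr _ (fun j _ => Ej j)) exchange_big; apply: eq_bigr => a _; rewrite exchange_big; apply: eq_bigr => b _.
  apply: eq_bigr => j _; rewrite invfM; field.
  exact: lt0r_neq0.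
have E (a b : 'I_N) : \sum_(j < M) 2 * (cosn (dist a b) (j%:R / M%:R) * cosn m (j%:R / M%:R)) =
    M%:R * ((dist a b + m == 0)%N%:R + (dist a b == m)%:R).
  by apply: sum_cosn_pair; have := ltn_ord a; have := ltn_ord b; rewrite /dist; lia.
under eq_bigr do under eq_bigr do rewrite E.
have -> : \sum_(a < N) \sum_(b < N) r (dist a b) * (M%:R * ((dist a b + m == 0)%N%:R + (dist a b == m)%:R)) =
   M%:R * r m * \sum_(a < N) \sum_(b < N) ((dist a b + m == 0)%N%:R + (dist a b == m)%:R).
  rewrite mulr_sumr; apply: eq_bigr => a _; rewrite mulr_sumr; apply: eq_bigr => b _.
  case: eqP => [e|_]; case: eqP => [e2|ne]; rewrite ?e2 ?addr0 ?mulr0 //; try by ring.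
  by exfalso; apply: ne; lia.
case: m mN E => [|m] mN _.
  have -> : \sum_(a < N) \sum_(b < N) ((dist a b + 0 == 0)%N%:R + (dist a b == 0)%N%:R) = 2 * N%:R :> R.
    have one (a : 'I_N) : \sum_(b < N) ((dist a b + 0 == 0)%N%:R + (dist a b == 0)%N%:R) = 2 :> R.
      rewrite (bigD1 a) //= addn0 /dist subnn eqxx big1 ?addr0 // => b nb.
      have nab : (a - b + (b - a) == 0)%N = false.
        by apply/negbTE; apply: contra nb => /eqP e; apply/eqP/val_inj => /=; lia.
      by rewrite addn0 nab addr0.
    by rewrite (eq_bigr _ (fun a _ => one a)) sumr_const card_ord mulr_natr.
  rewrite subn0 !natrM; field; exact: lt0r_neq0.
have -> : \sum_(a < N) \sum_(b < N) ((dist a b + m.+1 == 0)%N%:R + (dist a b == m.+1)%:R) = 2 * (N - m.+1)%:R :> R.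
  by rewrite -count_dist //; do 2 (apply: eq_bigr => ? _); rewrite addnS add0r.
rewrite !natrM; field; exact: lt0r_neq0.
Qed.

End FejerWeights.

(** * Quantile functions and their limits *)

Section DiscreteQuantile.
Variables (R : realType) (M : nat) (w : nat -> R).
Hypothesis M0 : (0 < M)%N.
Hypothesis w0 : forall j, 0 <= w j.
Hypothesis w1 : \sum_(j < M) w j = 1.

Let W k := \sum_(j < k) w j.
(** The quantile function of the measure with masses [w j] at the points [j / M]. Measures are
    represented in this way because a pointwise limit of monotone functions is monotone, which
    replaces weak compactness of measures. *)
Definition quantile (u : R) : R := M%:R^-1 * \sum_(j < M) (W j.+1 <= u)%R%:R.

Lemma quantile_bound u : 0 <= quantile u <= 1.
Proof.
rewrite mulr_ge0 ?invr_ge0 ?sumr_ge0 //= ler_pdivrMl ?ltr0n // mulr1 -natr_sum ler_nat.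
by rewrite -[leqRHS]card_ord -sum1_card leq_sum // => j _; rewrite leq_b1.
Qed.

Lemma quantile_homo u v : u <= v -> quantile u <= quantile v.
Proof.
move=> uv; rewrite ler_wpM2l ?invr_ge0 // ler_sum // => j _; rewrite ler_nat.
by case: (leP (W j.+1) u) => // h; rewrite (le_trans h uv).
Qed.

Lemma count_ge L (y : R) : 0 <= y -> y <= L%:R ->
  L%:R - y - 1 <= \sum_(i < L) (y <= i%:R)%R%:R <= L%:R - y.
Proof.
move=> y0 yL.
have up k : \sum_(i < k) (y <= i%:R)%R%:R <= Num.max 0 (k%:R - y).
  elim: k => [|k IH]; first by rewrite big_ord0 le_max lexx.
  rewrite big_ord_recr /= -natr1; case: (leP y k%:R) IH => h IH /=.
    rewrite le_max; apply/orP; right; move: IH; rewrite le_max => /orP[]; lra.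
  rewrite addr0; move: IH; rewrite !le_max => /orP[->//|]; lra.
have lo k : k%:R - y - 1 <= \sum_(i < k) (y <= i%:R)%R%:R.
  elim: k => [|k IH]; first by rewrite big_ord0; lra.
  rewrite big_ord_recr /= -natr1; case: (leP y k%:R) => h /=; first lra.
  have : 0 <= \sum_(i < k) (y <= i%:R)%R%:R :> R by rewrite sumr_ge0.
  lra.
by rewrite lo (le_trans (up L)) // ge_max subr_ge0 yL lexx.
Qed.

(** Both sums are written through the [M] increments of [g] along the grid, each at most [Lam / M],
    and the mesh misplaces each jump by at most [1 / L]. The bound is free of [M], so it survives
    the limit. *)
Lemma quantile_riemann (g : R -> R) (Lam : R) L : (0 < L)%N ->
  (forall x y, `|g x - g y| <= Lam * `|x - y|) ->
  `|L%:R^-1 * \sum_(i < L) g (quantile (i%:R / L%:R)) - \sum_(j < M) w j * g (j%:R / M%:R)| <= Lam / L%:R.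
Proof.
move=> L0 hg; have L0R : 0 < L%:R :> R by rewrite ltr0n.
have M0R : 0 < M%:R :> R by rewrite ltr0n.
pose h (j : nat) := g (j%:R / M%:R).
have Wmono k l : (k <= l)%N -> W k <= W l.
  move=> kl; rewrite /W (big_ord_widen _ w kl) big_mkcond /= ler_sum // => j _; by case: ifP.
have hQ u : g (quantile u) = h 0%N + \sum_(j < M) (h j.+1 - h j) * (W j.+1 <= u)%R%:R.
  have key m : h (\sum_(j < m) (W j.+1 <= u)%R)%N = h 0%N + \sum_(j < m) (h j.+1 - h j) * (W j.+1 <= u)%R%:R.
    elim: m => [|m IH]; first by rewrite !big_ord0 addr0.
    rewrite !big_ord_recr /= addrA -IH; case: (leP (W m.+1) u) => hm; last by rewrite mulr0 addr0 addn0.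
    have -> : (\sum_(j < m) (W j.+1 <= u)%R)%N = m.
      rewrite -[RHS]card_ord -sum1_card; apply: eq_bigr => j _.
      by rewrite (le_trans _ hm) // Wmono // ltnS ltnW.
    by rewrite addn1 mulr1 addrC subrK.
  by rewrite -key /h /quantile -natr_sum mulrC.
have abel : \sum_(j < M) w j * h j = h 0%N + \sum_(j < M) (h j.+1 - h j) * (1 - W j.+1).
  have key m : \sum_(j < m) w j * h j = W m * h m - \sum_(j < m) (h j.+1 - h j) * W j.+1.
    elim: m => [|m IH]; first by rewrite /W !big_ord0 mul0r subrr.
    rewrite !big_ord_recr /= IH; have -> : W m.+1 = W m + w m by rewrite /W big_ord_recr.
    ring.
  rewrite key; have -> : W M = 1 by [].
  under [in RHS]eq_bigr do rewrite mulrBr mulr1; rewrite sumrB.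
  have -> : \sum_(j < M) (h j.+1 - h j) = h M - h 0%N.
    by rewrite -(big_mkord xpredT (fun j => h j.+1 - h j)) telescope_sumr.
  ring.
rewrite -/(h _); have -> : L%:R^-1 * \sum_(i < L) g (quantile (i%:R / L%:R)) - \sum_(j < M) w j * h j =
   \sum_(j < M) (h j.+1 - h j) * (L%:R^-1 * \sum_(i < L) (W j.+1 <= i%:R / L%:R)%R%:R - (1 - W j.+1)).
  rewrite abel; under eq_bigr do rewrite hQ; rewrite big_split /= sumr_const card_ord mulrDr.
  rewrite -[h 0%N *+ L]mulr_natl mulKf ?gt_eqF // exchange_big /= opprD addrACA subrr add0r.
  rewrite mulr_sumr -sumrB; apply: eq_bigr => j _; rewrite -mulr_sumr; ring.
apply: le_trans (ler_norm_sum _ _ _) _.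
apply: (@le_trans _ _ (\sum_(j < M) Lam / M%:R * L%:R^-1)); last first.
  rewrite sumr_const card_ord -mulr_natr; rewrite le_eqVlt; apply/orP; left; apply/eqP; field.
  by rewrite !gt_eqF.
apply: ler_sum => j _; rewrite normrM ler_pM //.
  apply: le_trans (hg _ _) _; rewrite -mulrBl -natrB // subSnn div1r ger0_norm ?invr_ge0 //.
have W01 : 0 <= W j.+1 <= 1 by rewrite sumr_ge0 //= -w1 Wmono.
have /andP[a1 a2] := W01.
have /andP[b1 b2] := @count_ge L (L%:R * W j.+1) (mulr_ge0 (ltW L0R) a1) (ler_piMr (ltW L0R) a2).
have e : \sum_(i < L) (W j.+1 <= i%:R / L%:R)%R%:R = \sum_(i < L) (L%:R * W j.+1 <= i%:R)%R%:R :> R.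
  by apply: eq_bigr => i _; rewrite ler_pdivlMr // mulrC.
rewrite e; move: b1 b2; set c := \sum_(i < L) _ => b1 b2.
have -> : L%:R^-1 * c - (1 - W j.+1) = L%:R^-1 * (c - L%:R * (1 - W j.+1)) by field; rewrite gt_eqF.
by rewrite normrM ger0_norm ?invr_ge0 // ler_piMr ?invr_ge0 // ler_norml; apply/andP; split; lra.
Qed.

End DiscreteQuantile.

Section CosineLipschitz.
Variable R : realType.
Local Notation cosn := (@cosn R).

Lemma cos_lipschitz (x y : R) : `|cos x - cos y| <= `|x - y|.
Proof.
wlog xy : x y / y <= x.
  move=> H; have [/H//|/ltW/H] := leP y x; by rewrite distrC [`|y - x|]distrC.
have [|z _ ->] := @MVT_segment R (@cos R) (fun x => - sin x) y x xy.
- by apply: continuous_subspaceT => z; exact: continuous_cos.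
by rewrite normrM ler_piMl // normrN sin_max.
Qed.

Lemma cosn_lipschitz n x y : `|cosn n x - cosn n y| <= (2 * pi * n%:R) * `|x - y|.
Proof.
apply: le_trans (cos_lipschitz _ _) _; rewrite -mulrBr normrM ger0_norm //.
by rewrite !mulr_ge0 // pi_ge0.
Qed.

Lemma continuous_cosn n : continuous (cosn n).
Proof.
move=> x; apply: (@continuous_comp _ _ _ (fun t => 2 * pi * n%:R * t) (@cos R)); last exact: continuous_cos.
by apply: cvgM; [exact: cvg_cst|exact: cvg_id].
Qed.

End CosineLipschitz.

Lemma fmap_ultra (T S : Type) (f : T -> S) (U : set_system T) : UltraFilter U -> UltraFilter (fmap f U).
Proof.
move=> UU; have PU := @ultra_proper _ _ UU.
apply: Build_UltraFilter => G PG sub; apply/seteqP; split => // A GA.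
have [//|nA] := in_ultra_setVsetC (f @^-1` A) UU.
have GC : G (~` A) by exact: sub.
have : G (A `&` ~` A) by exact: filterI.
by rewrite setICr => /filter_not_empty.
Qed.

Lemma cvg_big_sum (R : realType) (U : set_system nat) (PU : ProperFilter U) (I : Type) (s : seq I)
  (F : I -> nat -> R) (l : I -> R) : (forall i, F i n @[n --> U] --> l i) ->
  \sum_(i <- s) F i n @[n --> U] --> \sum_(i <- s) l i.
Proof.
move=> h; elim: s => [|i s IH].
  by rewrite big_nil; under eq_fun do rewrite big_nil; exact: cvg_cst.
by rewrite big_cons; under eq_fun do rewrite big_cons; apply: cvgD.
Qed.

Section QuantileLimit.
Variables (R : realType) (r : nat -> R).
Hypothesis r_pos : forall N (c : nat -> R), 0 <= \sum_(a < N) \sum_(b < N) c a * c b * r (dist a b).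
Hypothesis r01 : r 0%N = 1.
Local Notation cosn := (@cosn R).

Let QN n := quantile (2 * n.+1) (fejer_weight r n.+1).

(** Helly's selection theorem, carried out pointwise along an ultrafilter. Only finite Riemann sums
    pass to the limit, so no exchange of limit and integral is required. *)
Lemma limit_quantile : exists Q : R -> R, [/\ {homo Q : u v / u <= v}, forall u, 0 <= Q u <= 1 &
  forall m L, (0 < L)%N ->
    `|L%:R^-1 * \sum_(i < L) cosn m (Q (i%:R / L%:R)) - r m| <= 2 * pi * m%:R / L%:R].
Proof.
have [U [UU subU]] := ultraFilterLemma (@eventually_filter : ProperFilter (\oo : set_system nat)).
have PU : ProperFilter U := @ultra_proper _ _ UU.
have ex u : exists q : R, (0 <= q <= 1) /\ (QN n u @[n --> U] --> q).
  have := @segment_compact R 0 1; rewrite compact_ultra => /(_ (fmap (fun n => QN n u) U)).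
  have UI : UltraFilter (fmap (fun n => QN n u) U) by exact: fmap_ultra.
  case=> //.
    rewrite /fmap /=; apply: filterS (filterT : U setT) => n _ /=.
    by rewrite in_itv /=; apply: quantile_bound.
  by move=> q [q01 cq]; exists q; split => //; move: q01; rewrite /= in_itv.
have [Q hQ] := boolp.choice ex; exists Q; split.
- move=> u v uv; apply: (ler_cvg_to (hQ u).2 (hQ v).2).
  by apply: nearW => n; apply: quantile_homo.
- by move=> u; exact: (hQ u).1.
move=> m L L0; pose a n := L%:R^-1 * \sum_(i < L) cosn m (QN n (i%:R / L%:R)).
pose b n := (n.+1 - m)%:R / n.+1%:R * r m.
have ca : a n @[n --> U] --> L%:R^-1 * \sum_(i < L) cosn m (Q (i%:R / L%:R)).
  apply: cvgM; first exact: cvg_cst.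
  apply: cvg_big_sum => i; apply: (@cvg_comp _ _ _ (fun n => QN n (i%:R / L%:R)) (cosn m)).
    exact: (hQ _).2.
  exact: continuous_cosn.
have cb : b n @[n --> U] --> r m.
  suff : b n @[n --> \oo] --> r m by apply: cvg_trans; exact: cvg_app.
  have -> : r m = (1 - m%:R * 0) * r m by rewrite mulr0 subr0 mul1r.
  apply: cvgM; last exact: cvg_cst.
  have : 1 - m%:R * n.+1%:R^-1 @[n --> \oo] --> (1 - m%:R * 0 : R).
    by apply: cvgB; [exact: cvg_cst|apply: cvgM; [exact: cvg_cst|exact: cvg_harmonic]].
  apply: cvg_trans; apply: near_eq_cvg; near=> n.
  have mn : (m <= n.+1)%N by near: n; exists m => // k /= mk; rewrite leqW.
  by rewrite natrB // mulrBl divff ?pnatr_eq0.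
have close : \forall n \near U, `|a n - b n| <= 2 * pi * m%:R / L%:R.
  apply: subU; exists m => // n /= mn; rewrite /a /b -(fejer_weight_cosn r (ltn0Sn n) (leqW mn)).
  apply: quantile_riemann => //.
  - by move=> j; apply: fejer_weight_ge0.
  - have := fejer_weight_cosn r (ltn0Sn n) (leq0n n.+1).
    rewrite subn0 divff ?mul1r ?r01 ?pnatr_eq0 // => <-; apply: eq_bigr => j _.
    by rewrite /cosn mulr0 mul0r cos0 mulr1.
  - exact: cosn_lipschitz.
exact: (ler_cvg_to (cvg_norm (cvgB ca cb)) (cvg_cst (2 * pi * m%:R / L%:R)) close).
Unshelve. all: by end_near.
Qed.

End QuantileLimit.

Section UniformPushforward.
Variable R : realType.

Lemma measurable_uniform_id : @measurable_fun _ _ (measurableTypeR R) R setT (fun x => x).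
Proof. by move=> _ A mA; rewrite setTI. Qed.

(** The push-forward by the identity only transports the uniform law from the alias
    [measurableTypeR R] to [R] itself. *)
Definition uniform01 : {measure set R -> \bar R} := pushm (uniform_prob (@ltr01 R)) measurable_uniform_id.
Local Notation P := uniform01.

Lemma uniform_itv (a b : R) : 0 <= a -> a <= b -> b <= 1 -> P `[a, b[%classic = (b - a)%:E.
Proof.
move=> a0 ab b1; rewrite /P /= /pushforward /= /uniform_prob.
rewrite (eq_integral (fun=> 1%:E)); last first.
  move=> x; rewrite inE /= in_itv /= => /andP[ax xb]; rewrite /uniform_pdf.
  by rewrite (le_trans a0 ax) (le_trans (ltW xb) b1) subr0 invr1.
rewrite (_ : _ @^-1` _ = `[a, b[%classic) // integral_cst //= mul1e lebesgue_measure_itv /= lte_fin.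
by case: ltP => [_|ba]; rewrite -?EFinB //; have -> : a = b; rewrite ?subrr //; apply/le_anti; rewrite ab.
Qed.

Lemma riemann_homo (h Q : R -> R) (Lam B : R) L : (0 < L)%N -> 0 <= Lam ->
  measurable_fun setT h -> (forall u, `|h u| <= B) ->
  {homo Q : u v / u <= v} -> (forall u, 0 <= Q u <= 1) ->
  (forall u v, u <= v -> `|h u - h v| <= Lam * (Q v - Q u)) ->
  `|\int[P]_u h u - L%:R^-1 * \sum_(i < L) h (i%:R / L%:R)| <= Lam / L%:R.
Proof.
move=> L0 Lam0 mh hB Qm Q01 hQ; have L0R : 0 < L%:R :> R by rewrite ltr0n.
have P1 : (P setT < +oo)%E by rewrite /P /= /pushforward preimage_setT probability_setT ltry.
have ih D : measurable D -> P.-integrable D (EFin \o h).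
  by move=> mD; apply: (integrableS measurableT) => //; exact: bounded_integrable P1 mh hB.
pose I (k : nat) := \int[P]_(u in `[0, k%:R / L%:R[) h u.
have step k : (k <= L)%N -> `|I k - L%:R^-1 * \sum_(i < k) h (i%:R / L%:R)| <=
    Lam / L%:R * (Q (k%:R / L%:R) - Q 0).
  elim: k => [|k IH] kL.
    rewrite /I mul0r set_itvco0 // Rintegral_set0 big_ord0 mulr0 subrr normr0 subrr mulr0 //.
  have kL' : k%:R / L%:R <= k.+1%:R / L%:R :> R by rewrite ler_wpM2r ?invr_ge0 // ler_nat.
  have k0 : 0 <= k%:R / L%:R :> R by rewrite divr_ge0.
  have k1 : k.+1%:R / L%:R <= 1 :> R by rewrite ler_pdivrMr // mul1r ler_nat.
  pose J : set R := `[k%:R / L%:R, k.+1%:R / L%:R[%classic.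
  have PJ : fine (P J) = L%:R^-1.
    by rewrite uniform_itv //= -mulrBl -natrB // subSnn mul1r.
  have -> : I k.+1 = I k + \int[P]_(u in J) h u.
    pose A : set R := `[0, k%:R / L%:R[%classic.
    have mA : measurable A by exact: measurable_itv.
    have mJ : measurable J by exact: measurable_itv.
    have dis : [disjoint A & J].
      apply/disj_setPS => u []; rewrite /A /J /= !in_itv /= => /andP[_ u1] /andP[u2 _].
      by have := lt_le_trans u1 u2; rewrite ltxx.
    rewrite -[RHS](Rintegral_setU mA mJ (ih _ (measurableU _ _ mA mJ)) dis) /I; congr (Rintegral _ _ _).
    by rewrite -(@itv_bndbnd_setU _ _ _ (BLeft (k%:R / L%:R))) // bnd_simp.
  rewrite big_ord_recr /= mulrDr opprD addrACA.
  apply: le_trans (ler_normD _ _) _.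
  have -> : Q (k.+1%:R / L%:R) - Q 0 = (Q (k%:R / L%:R) - Q 0) + (Q (k.+1%:R / L%:R) - Q (k%:R / L%:R)) by ring.
  rewrite mulrDr lerD //; first exact: IH (ltnW kL).
  have -> : L%:R^-1 * h (k%:R / L%:R) = \int[P]_(u in J) h (k%:R / L%:R).
    transitivity (h (k%:R / L%:R) * fine (P J)); first by rewrite PJ mulrC.
    by rewrite Rintegral_cst //; exact: measurable_itv.
  have mJ : measurable J by exact: measurable_itv.
  have ic : P.-integrable J (EFin \o (fun=> h (k%:R / L%:R))).
    by apply: (integrableS measurableT) => //; exact: (@bounded_integrable _ _ _ `|h (k%:R / L%:R)|).
  have idf : P.-integrable J (EFin \o (fun t => h t - h (k%:R / L%:R))).
    apply: (integrableS measurableT) => //; apply: (@bounded_integrable _ _ _ (B + B)) => //.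
      by apply: measurable_funB => //; exact: measurable_cst.
    by move=> u; apply: le_trans (ler_normB _ _) _; rewrite lerD.
  rewrite -RintegralB //; last exact: ih.
  apply: le_trans (le_normr_Rintegral _ _) _ => //.
  apply: (@le_trans _ _ (\int[P]_(u in J) (Lam * (Q (k.+1%:R / L%:R) - Q (k%:R / L%:R))))).
    apply: le_Rintegral => //.
    - exact: integrable_norm.
    - by apply: (integrableS measurableT) => //; exact: (@bounded_integrable _ _ _ `|Lam * (Q (k.+1%:R / L%:R) - Q (k%:R / L%:R))|).
    - move=> u; rewrite /J /= in_itv /= => /andP[u1 u2].
      rewrite distrC; apply: le_trans (hQ _ _ u1) _; rewrite ler_wpM2l // lerD2r; exact: Qm (ltW u2).
  have -> : Lam / L%:R * (Q (k.+1%:R / L%:R) - Q (k%:R / L%:R)) = Lam * (Q (k.+1%:R / L%:R) - Q (k%:R / L%:R)) * fine (P J).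
    by rewrite PJ mulrAC.
  by rewrite Rintegral_cst.
have -> : \int[P]_u h u = I L.
  rewrite /I divff ?gt_eqF // /Rintegral (@negligible_integral _ _ _ P setT (~` `[0, 1[)) //.
  - by rewrite setTD setCK.
  - exact: measurableC.
  - exact: ih.
  - have Pt : P setT = 1%E by rewrite /P /= /pushforward preimage_setT probability_setT.
    have mA : measurable (`[0, 1[%classic : set R) by exact: measurable_itv.
    rewrite -setTD measureD ?setTI ?Pt ?ltry //.
    have Pu : P `[0, 1[%classic = 1%E by rewrite uniform_itv // subr0.
    by apply: (eq_trans (congr2 (fun a b => a - b)%E Pt Pu)); rewrite subee.
apply: le_trans (step L (leqnn L)) _; rewrite divff ?gt_eqF //.
rewrite ler_piMr ?divr_ge0 //; have := Q01 1; have := Q01 0; lra.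
Qed.

End UniformPushforward.

Section Herglotz.
Variable R : realType.
Local Notation cosn := (@cosn R).
Definition sinn (n : nat) (t : R) : R := sin (2 * pi * n%:R * t).

Lemma measurable_sinn n : measurable_fun setT (sinn n).
Proof.
apply: continuous_measurable_fun => x.
apply: (@continuous_comp _ _ _ (fun t => 2 * pi * n%:R * t) (@sin R)); last exact: continuous_sin.
by apply: cvgM; [exact: cvg_cst|exact: cvg_id].
Qed.

Lemma integrable_sinn sigma n : on_circle sigma -> sigma.-integrable setT (EFin \o sinn n).
Proof.
by case=> fin _; apply: (@bounded_integrable _ _ _ 1) => //; [exact: measurable_sinn|move=> x; exact: sin_max].
Qed.

(** A quantile may take the value [1], which on the circle [[0, 1[] is the point [0]. *)
Definition fold1 (t : R) : R := if t < 1 then t else 0.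
Definition refl1 (t : R) : R := if t == 0 then 0 else 1 - t.

Lemma measurable_fold1 : measurable_fun setT fold1.
Proof.
apply: measurable_fun_if => //; exact: measurable_fun_ltr.
Qed.

Lemma measurable_refl1 : measurable_fun setT refl1.
Proof.
apply: measurable_fun_if => //; first exact: measurable_fun_eqr.
by apply: measurable_funTS; apply: measurable_funB.
Qed.

Lemma refl1K t : circle t -> refl1 (refl1 t) = t.
Proof.
rewrite /circle /= in_itv /= /refl1 => /andP[t0 t1]; case: (eqVneq t 0) => [->|tn]; first by rewrite eqxx.
by rewrite subr_eq0 eq_sym lt_eqF // subKr.
Qed.

Lemma refl1_circle t : circle t -> circle (refl1 t).
Proof.
rewrite /circle /= !in_itv /= /refl1 => /andP[t0 t1]; case: (eqVneq t 0) => [_|tn]; first by rewrite lexx ltr01.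
have {}t0 : 0 < t by rewrite lt_neqAle eq_sym tn.
by apply/andP; split; lra.
Qed.

Lemma cosn_refl1 n t : cosn n (refl1 t) = cosn n t.
Proof.
rewrite /refl1; case: eqP => [->//|_]; rewrite /cosn.
have -> : 2 * pi * n%:R * (1 - t) = - (2 * pi * n%:R * t) + 2 * pi * n%:R by ring.
have -> : - (2 * pi * n%:R * t) + 2 * pi * n%:R = - (2 * pi * n%:R * t) + pi *+ 2 *+ n.
  by rewrite -[pi *+ 2 *+ n]mulr_natr -[pi *+ 2]mulr_natl.
by rewrite (periodicn (@cosD2pi R)) cosN.
Qed.

Lemma sinn_refl1 n t : sinn n (refl1 t) = - sinn n t.
Proof.
rewrite /refl1; case: eqP => [->|_]; first by rewrite /sinn mulr0 sin0 oppr0.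
rewrite /sinn; have -> : 2 * pi * n%:R * (1 - t) = - (2 * pi * n%:R * t) + 2 * pi * n%:R by ring.
by rewrite sin2piD_nat sinN.
Qed.

Lemma cosn_fold1 n t : t <= 1 -> cosn n (fold1 t) = cosn n t.
Proof.
rewrite /fold1 le_eqVlt => /orP[/eqP ->|->//]; rewrite ltxx.
rewrite /cosn mulr0 mulr1.
have e : 2 * pi * n%:R = 0 + pi *+ 2 *+ n :> R.
  by rewrite add0r -[pi *+ 2 *+ n]mulr_natr -[pi *+ 2]mulr_natl.
by rewrite e (periodicn (@cosD2pi R)).
Qed.

Lemma integral_mscale_bounded (k : {nonneg R}) (m : {measure set R -> \bar R}) (f : R -> R) (M : R) :
  (m setT < +oo)%E -> measurable_fun setT f -> (forall x, `|f x| <= M) ->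
  (\int[mscale k m]_x (f x)%:E = k%:num%:E * \int[m]_x (f x)%:E)%E.
Proof.
move=> fin mf fM; have iF := bounded_integrable fin mf fM.
have mF : measurable_fun setT (EFin \o f) by exact/measurable_EFinP.
rewrite integralE [in RHS]integralE !ge0_integral_mscale //; try by [exact: measurable_funepos|exact: measurable_funeneg].
rewrite [RHS]muleBr //.
by apply: fin_num_adde_defl; rewrite fin_numN; exact: (integrable_neg_fin_num measurableT iF).
Qed.

Definition positive_definite (r : nat -> R) :=
  forall N (c : nat -> R), 0 <= \sum_(a < N) \sum_(b < N) c a * c b * r (dist a b).

Lemma positive_definite_bound r n : positive_definite r -> `|r n| <= r 0%N.
Proof.
move=> hr; case: n => [|n].
  by rewrite ger0_norm //; have := hr 1%N (fun=> 1); rewrite !big_ord1 !mul1r.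
have key (e : R) : e ^+ 2 = 1 -> 0 <= 2 * r 0%N + 2 * e * r n.+1.
  move=> e2; have := hr n.+2 (fun i => if i == 0%N then 1 else if i == n.+1 then e else 0).
  have z (F : nat -> R) : \sum_(a < n.+2) (if a == 0%N :> nat then 1 else if a == n.+1 :> nat then e else 0) * F a = F 0%N + e * F n.+1.
    rewrite big_ord_recr big_ord_recl /= eqxx mul1r big1 ?addr0 // => i _.
    by rewrite /bump /= add1n eqSS ltn_eqF ?mul0r // ltnS; case: i.
  pose c (a : nat) : R := if a == 0%N then 1 else if a == n.+1 then e else 0.
  have E (a : 'I_n.+2) : \sum_(b < n.+2) c a * c b * r (dist a b) = c a * (r (dist a 0) + e * r (dist a n.+1)).
    under eq_bigr do rewrite -mulrA; rewrite -mulr_sumr; congr (_ * _); exact: (z (fun b => r (dist a b))).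
  rewrite -/c (eq_bigr _ (fun a _ => E a)) (z (fun a => r (dist a 0) + e * r (dist a n.+1))) /dist !subn0 !sub0n !subnn !addn0 ?add0n; rewrite expr2 in e2 => h.
  by apply: le_trans h _; rewrite le_eqVlt; apply/orP; left; apply/eqP; rewrite mulrDr !mulrA e2; ring.
have h1 := key 1 (expr1n _ _); have h2 := key (-1) (etrans (sqrrN 1) (expr1n _ _)).
by rewrite ler_norml; apply/andP; split; lra.
Qed.

End Herglotz.

Section HerglotzTheorem.
Variable R : realType.
Local Notation cosn := (@cosn R).
Local Notation sinn := (@sinn R).

Lemma riemann_limit (a l c : R) (s : nat -> R) : 0 <= c ->
  (forall L, (0 < L)%N -> `|a - s L| <= c / L%:R) -> (forall L, (0 < L)%N -> `|s L - l| <= c / L%:R) -> a = l.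
Proof.
move=> c0 h1 h2; apply/eqP; rewrite -subr_eq0 -normr_le0 leNgt; apply/negP => d0.
set d := `|a - l| in d0.
have L0 : (0 < (Num.trunc (2 * c / d)).+1)%N by [].
have := h1 _ L0; have := h2 _ L0; have := truncnS_gt (2 * c / d : R).
rewrite ltr_pdivrMr //; set L := (Num.trunc _).+1; set x := L%:R => dx e2 e1.
have x0 : 0 < x by rewrite ltr0n.
have : d <= c / x + c / x.
  rewrite /d -(subrK (s L) a) -addrA; apply: le_trans (ler_normD _ _) _; exact: lerD.
have -> : c / x + c / x = 2 * c / x by field; rewrite gt_eqF.
by rewrite leNgt ltr_pdivrMr // [d * x]mulrC dx.
Qed.

(** The measure is the law of the limit quantile function under the uniform distribution. Its
    coefficient and [r n] are both within [O(1 / L)] of the same Riemann sum, for every [L]. *)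
Lemma herglotz_unit (r : nat -> R) : positive_definite r -> r 0%N = 1 ->
  exists2 sigma : {measure set R -> \bar R}, on_circle sigma &
    forall n, (\int[sigma]_t (cosn n t)%:E)%E = (r n)%:E.
Proof.
move=> hr r1; have [Q [Qm Q01 hQ]] := limit_quantile hr r1.
have mQ : measurable_fun setT Q.
  by apply: nondecreasing_measurable => // u v; exact: Qm.
have mg : measurable_fun setT ((@fold1 R) \o Q).
  by apply: measurableT_comp => //; exact: measurable_fold1.
pose P := uniform01 R.
have Pt : P setT = 1%E by rewrite /P /uniform01 /= /pushforward preimage_setT probability_setT.
exists (pushm P mg).
  split; first by rewrite /pushm /= /pushforward preimage_setT Pt ltry.
  rewrite /pushm /= /pushforward; have -> : ((@fold1 R) \o Q) @^-1` (~` (@circle R)) = set0; last exact: measure0.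
  rewrite -subset0 => u /= []; rewrite /circle /= in_itv /= /fold1; have /andP[q0 q1] := Q01 u.
  by case: ltP => [q|_]; rewrite ?q0 ?lexx ?ltr01.
move=> n; have mc := @measurable_cosn R n.
have Pfin : (P setT < +oo)%E by rewrite Pt ltry.
have mcQ : measurable_fun setT (cosn n \o ((@fold1 R) \o Q)) by exact: measurableT_comp.
have iQ : P.-integrable setT (EFin \o (cosn n \o ((@fold1 R) \o Q))).
  by apply: (@bounded_integrable _ _ _ 1) => // u; exact: cos_max.
rewrite (@integral_pushforward _ _ _ _ _ _ mg P setT (EFin \o cosn n)) //; last exact/measurable_EFinP.
rewrite preimage_setT; have -> : (\int[P]_u ((EFin \o cosn n) \o ((@fold1 R) \o Q)) u)%E =
   (\int[P]_u cosn n (fold1 (Q u)))%:E.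
  by rewrite /Rintegral fineK //; exact: (integrable_fin_num measurableT iQ).
congr (_%:E); apply: (@riemann_limit _ _ (2 * pi * n%:R) (fun L => L%:R^-1 * \sum_(i < L) cosn n (fold1 (Q (i%:R / L%:R))))).
- by rewrite !mulr_ge0 // pi_ge0.
- move=> L L0; apply: (@riemann_homo R (fun u => cosn n (fold1 (Q u))) Q _ 1) => //.
  + by rewrite !mulr_ge0 // pi_ge0.
  + by move=> u; exact: cos_max.
  + move=> u v uv; rewrite !cosn_fold1 //; [|by have /andP[] := Q01 v|by have /andP[] := Q01 u].
    by apply: le_trans (cosn_lipschitz _ _ _) _; rewrite distrC ger0_norm // subr_ge0 Qm.
- move=> L L0; apply: le_trans (hQ n L L0); rewrite le_eqVlt; apply/orP; left; apply/eqP.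
  congr (`|_ * _ - _|); apply: eq_bigr => i _; rewrite cosn_fold1 //; by have /andP[] := Q01 (i%:R / L%:R).
Qed.

Lemma integral_refl1 (sigma : {measure set R -> \bar R}) (f : R -> R) : (sigma setT < +oo)%E ->
  measurable_fun setT f -> (forall x, `|f x| <= 1) ->
  (\int[pushm sigma (@measurable_refl1 R)]_t (f t)%:E = \int[sigma]_t (f (refl1 t))%:E)%E.
Proof.
move=> fin mf f1; rewrite (@integral_pushforward _ _ _ _ _ _ (@measurable_refl1 R) sigma setT (EFin \o f)) //.
- exact/measurable_EFinP.
- rewrite preimage_setT; apply: (@bounded_integrable _ _ (f \o (@refl1 R)) 1) => //.
    by apply: measurableT_comp => //; exact: measurable_refl1.
  by move=> x; exact: f1.
Qed.

Definition refl_invariant (sigma : {measure set R -> \bar R}) :=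
  forall A, measurable A -> sigma ((@refl1 R) @^-1` A) = sigma A.

(** Normalising reduces to [r 0 = 1]; averaging with the mirror image then kills the sine
    coefficients and gives the invariance under reflection. *)
Theorem herglotz (r : nat -> R) : positive_definite r ->
  exists sigma : {measure set R -> \bar R}, [/\ on_circle sigma,
    forall n, (\int[sigma]_t (cosn n t)%:E)%E = (r n)%:E,
    forall n, (\int[sigma]_t (sinn n t)%:E)%E = 0%E & refl_invariant sigma].
Proof.
move=> hr; have r0 : 0 <= r 0%N by apply: le_trans (positive_definite_bound 0 hr).
(* If [r 0 = 0] then [r] vanishes identically; the coefficients of Lebesgue measure are then used
   and multiplied by [0] at the end. *)
pose r' n := if r 0%N == 0 then (n == 0%N)%:R else r n / r 0%N.
have hr' : positive_definite r'.
  move=> N c; rewrite /r'; case: eqP => [_|/eqP rn0].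
    apply: sumr_ge0 => a _.
    rewrite (bigD1 a) //= /dist subnn eqxx mulr1 big1 ?addr0 ?sqr_ge0 // => b nb.
    case: eqP => [e|_]; last by rewrite mulr0.
    by case/negP: nb; apply/eqP/val_inj => /=; lia.
  have -> : \sum_(a < N) \sum_(b < N) c a * c b * (r (dist a b) / r 0%N) =
     (\sum_(a < N) \sum_(b < N) c a * c b * r (dist a b)) / r 0%N.
    by rewrite mulr_suml; apply: eq_bigr => a _; rewrite mulr_suml; apply: eq_bigr => b _; rewrite mulrA.
  by rewrite divr_ge0.
have r'1 : r' 0%N = 1 by rewrite /r'; case: eqP => [_|/eqP]; rewrite ?eqxx // => ?; rewrite divff.
have rr' n : r 0%N * r' n = r n.
  rewrite /r'; case: eqP => [e|/eqP rn0]; last by rewrite mulrCA mulfV ?mulr1.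
  by have := positive_definite_bound n hr; rewrite e mul0r normr_le0 => /eqP.
have [s0 hs0 s0c] := herglotz_unit hr' r'1.
pose sr := pushm s0 (@measurable_refl1 R).
have hsr : on_circle sr.
  split; first by rewrite /sr /pushm /= /pushforward preimage_setT; exact: hs0.1.
  rewrite /sr /pushm /= /pushforward; apply/eqP; rewrite eq_le measure_ge0 andbT -hs0.2.
  apply: le_measure; rewrite ?inE.
  - by rewrite -[_ @^-1` _]setTI; apply: measurable_refl1 => //; apply: measurableC; exact: measurable_circle.
  - by apply: measurableC; exact: measurable_circle.
  - by move=> t /= nc ct; apply: nc; exact: refl1_circle.
have k0 : 0 <= r 0%N / 2 by rewrite divr_ge0.
pose k : {nonneg R} := NngNum k0.
pose s2 : {measure set R -> \bar R} := measure_add s0 sr.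
have s2E A : s2 A = (s0 A + sr A)%E by exact: measure_addE.
have hs2 : on_circle s2.
  rewrite /on_circle !s2E hs0.2 hsr.2 adde0; split => //.
  by apply: lte_add_pinfty; [exact: hs0.1|exact: hsr.1].
pose s : {measure set R -> \bar R} := mscale k s2.
have intS (f : R -> R) : measurable_fun setT f -> (forall x, `|f x| <= 1) ->
    (\int[s]_t (f t)%:E = (r 0%N / 2)%:E * (\int[s0]_t (f t)%:E + \int[s0]_t (f (refl1 t))%:E))%E.
  move=> mf f1; rewrite /s (@integral_mscale_bounded _ k s2 f 1) //; last exact: hs2.1.
  have i0 := bounded_integrable hs0.1 mf f1; have ir := bounded_integrable hsr.1 mf f1.
  rewrite /s2 integral_measure_add //.
  by rewrite integral_refl1 //; exact: hs0.1.
exists s; split.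
- split; rewrite /s /= /mscale; last by rewrite hs2.2 mule0.
  by apply: lte_mul_pinfty => //; exact: hs2.1.
- move=> n; rewrite intS; [|exact: measurable_cosn|by move=> x; exact: cos_max].
  under [X in (_ + X)%E]eq_integral do rewrite cosn_refl1.
  rewrite s0c -EFinD -EFinM -[r n in RHS]rr'; congr EFin.
  by move: (r 0%N) (r' n) => x y; field.
- move=> n; rewrite intS; [|exact: measurable_sinn|by move=> x; exact: sin_max].
  have iN := integrable_sinn n hs0.
  under [X in (_ + X)%E]eq_integral do rewrite sinn_refl1 EFinN.
  rewrite integralN ?subee ?mule0 //.
    exact: (integrable_fin_num measurableT iN).
  by apply: fin_num_adde_defl; rewrite fin_numN; exact: (integrable_neg_fin_num measurableT iN).
- move=> A mA; have mr (B : set R) : measurable B -> measurable ((@refl1 R) @^-1` B).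
    by move=> mB; rewrite -[_ @^-1` _]setTI; exact: measurable_refl1.
  rewrite /s /= /mscale !s2E; congr (_ * _)%E; rewrite addeC /sr /pushm /= /pushforward; congr (_ + _)%E.
  apply: (etrans (circle_null_setI hs0 (mr _ (mr _ mA)))); apply: esym.
  apply: (etrans (circle_null_setI hs0 mA)); apply: esym.
  congr (s0 _); apply/seteqP; split => t [/= h ct]; split => //; by rewrite /= ?refl1K // in h *.
Qed.

End HerglotzTheorem.

(** * Spectral measures on the tower *)

Section Tower.
Variables (R : realType) (mu : probability XM R) (K : nat).
Hypothesis mu_inv : forall A : set XM, measurable A -> mu (Defs.shift @^-1` A) = mu A.
Hypothesis K0 : (0 < K)%N.
Local Notation T := (Ttil K).
Local Notation tint := (tint mu K).
Implicit Types f g h : Xt -> R.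

Definition sl f (i : nat) : XM -> R := fun x => f (x, i).

Lemma measurable_cyl w m : measurable (cyl w m : set XM).
Proof. by apply: sub_sigma_algebra; exists w, m. Qed.

Definition shiftM : XM -> XM := Defs.shift.

Lemma measurable_shift : measurable_fun setT shiftM.
Proof.
apply: (@measurability _ _ _ XM setT shiftM cyls) => // _ [_ [w [m ->]] <-]; rewrite setTI.
have -> : Defs.shift @^-1` cyl w m = cyl w (m + 1); last exact: measurable_cyl.
by apply/seteqP; split => x /= h j jw; rewrite -h // /Defs.shift; congr (x _); ring.
Qed.

Lemma integral_shift (f : XM -> R) : mu.-integrable setT (EFin \o f) ->
  mu.-integrable setT (EFin \o (f \o shiftM)) /\ \int[mu]_x f (shiftM x) = \int[mu]_x f x.
Proof.
move=> If; have mf : measurable_fun setT f by apply/measurable_EFinP; exact: measurable_int If.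
have mfs : measurable_fun setT (f \o shiftM) by exact: (measurableT_comp mf measurable_shift).
have ne (g : XM -> \bar R) : measurable_fun setT g -> (forall x, 0 <= g x)%E ->
    (\int[mu]_x g (shiftM x) = \int[mu]_x g x)%E.
  move=> mg g0; rewrite [RHS](_ : _ = (\int[pushm mu measurable_shift]_x g x)%E); last first.
    by apply: eq_measure_integral => A mA _; first [exact: mu_inv|exact/esym/mu_inv].
  by rewrite /pushm /= ge0_integral_pushforward ?preimage_setT //; exact: measurable_shift.
have Is : mu.-integrable setT (EFin \o (f \o shiftM)).
  apply/integrableP; split; first exact/measurable_EFinP.
  rewrite (ne (fun x => `|(f x)%:E|)%E); first by case/integrableP: If.
    by apply: measurableT_comp => //; exact/measurable_EFinP.
  by move=> x; exact: abse_ge0.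
split=> //; rewrite /Rintegral; congr fine.
rewrite [RHS](_ : _ = (\int[pushm mu measurable_shift]_x (f x)%:E)%E); last first.
  by apply: eq_measure_integral => A mA _; first [exact: mu_inv|exact/esym/mu_inv].
rewrite /pushm /= (@integral_pushforward _ _ _ _ _ _ measurable_shift mu setT (EFin \o f)) //.
exact/measurable_EFinP.
Qed.

Definition Int f := forall i, (i < K)%N -> mu.-integrable setT (EFin \o sl f i).

Definition L2 f := forall i, (i < K)%N ->
  measurable_fun setT (sl f i) /\ mu.-integrable setT (EFin \o (fun x => sl f i x ^+ 2)).

Lemma IntD f g : Int f -> Int g -> Int (fun y => f y + g y).
Proof. by move=> hf hg i iK; apply: (integrableD measurableT (hf i iK) (hg i iK)). Qed.

Lemma IntZ c f : Int f -> Int (fun y => c * f y).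
Proof. by move=> hf i iK; apply: (integrableZl measurableT c (hf i iK)). Qed.

Lemma tintD f g : Int f -> Int g -> tint (fun y => f y + g y) = tint f + tint g.
Proof.
move=> hf hg; rewrite /tint -mulrDr -big_split /=; congr (_ * _); apply: eq_bigr => i _.
by rewrite -RintegralD //; [exact: hf|exact: hg].
Qed.

Lemma tintZ c f : Int f -> tint (fun y => c * f y) = c * tint f.
Proof.
move=> hf; rewrite /Defs.tint [RHS]mulrCA; congr (_ * _); rewrite mulr_sumr; apply: eq_bigr => i _.
by rewrite -RintegralZl //; exact: hf.
Qed.

Lemma tint_cst c : tint (fun=> c) = c.
Proof.
rewrite /Defs.tint; under eq_bigr do rewrite Rintegral_cst // (_ : fine (mu setT) = 1) ?mulr1 ?probability_setT //.
by rewrite sumr_const card_ord -[c *+ K]mulr_natl mulKf // pnatr_eq0 -lt0n.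
Qed.

Lemma Int_cst c : Int (fun=> c).
Proof. by move=> i _; apply: finite_measure_integrable_cst. Qed.

Lemma Int_sum (I : Type) (s : seq I) (f : I -> Xt -> R) : (forall i, Int (f i)) -> Int (fun y => \sum_(i <- s) f i y).
Proof.
move=> hf; elim: s => [|i s IH].
  have -> : (fun y => \sum_(i <- [::]) f i y) = (fun=> 0) by apply/funext => y; rewrite big_nil.
  exact: Int_cst.
have -> : (fun y => \sum_(j <- i :: s) f j y) = (fun y => f i y + \sum_(j <- s) f j y).
  by apply/funext => y; rewrite big_cons.
exact: IntD.
Qed.

Lemma tint_sum (I : Type) (s : seq I) (f : I -> Xt -> R) : (forall i, Int (f i)) ->
  tint (fun y => \sum_(i <- s) f i y) = \sum_(i <- s) tint (f i).
Proof.
move=> hf; elim: s => [|i s IH].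
  have -> : (fun y => \sum_(i <- [::]) f i y) = (fun=> 0) by apply/funext => y; rewrite big_nil.
  by rewrite tint_cst big_nil.
have -> : (fun y => \sum_(j <- i :: s) f j y) = (fun y => f i y + \sum_(j <- s) f j y).
  by apply/funext => y; rewrite big_cons.
by rewrite tintD ?IH ?big_cons //; exact: Int_sum.
Qed.

Lemma tint_ge0 f : (forall y, 0 <= f y) -> 0 <= tint f.
Proof.
by move=> h; rewrite mulr_ge0 ?invr_ge0 // sumr_ge0 // => i _; apply: Rintegral_ge0.
Qed.

Lemma tint_le f g : Int f -> Int g -> (forall y, f y <= g y) -> tint f <= tint g.
Proof.
move=> hf hg h; rewrite ler_wpM2l ?invr_ge0 // ler_sum // => i _.
by apply: le_Rintegral => //; [exact: hf|exact: hg].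
Qed.

Lemma Int_T f : Int f -> Int (fun y => f (T y)).
Proof.
move=> hf i iK; rewrite /sl /Ttil /=; case: ltnP => h; first exact: hf.
by have [] := integral_shift (hf 0%N K0).
Qed.

Lemma tint_T f : Int f -> tint (fun y => f (T y)) = tint f.
Proof.
move=> hf; rewrite /Defs.tint; congr (_ * _); move: hf; rewrite /Ttil /Int.
case: (K) K0 => // k _ hf; rewrite big_ord_recr [RHS]big_ord_recl /= ltnn addrC; congr (_ + _).
  by have [_] := integral_shift (hf 0%N isT).
by apply: eq_bigr => i _; rewrite /= ltnS ltn_ord.
Qed.

Lemma tint_iter n f : Int f -> Int (fun y => f (iter n T y)) /\ tint (fun y => f (iter n T y)) = tint f.
Proof.
move=> hf; elim: n => [//|n [IH1 IH2]].
have e : (fun y => f (iter n.+1 T y)) = (fun y => (fun z => f (iter n T z)) (T y)).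
  by apply/funext => y; rewrite iterSr.
by rewrite e; split; [exact: (Int_T IH1)|rewrite (tint_T IH1)].
Qed.

Lemma L2D f g : L2 f -> L2 g -> L2 (fun y => f y + g y).
Proof.
move=> hf hg i iK; have [mf If] := hf i iK; have [mg Ig] := hg i iK.
have ms : measurable_fun setT (sl (fun y => f y + g y) i) by exact: measurable_funD.
split=> //; apply: (@le_integrable _ _ _ mu setT measurableT _ (EFin \o (fun x => 2 * sl f i x ^+ 2 + 2 * sl g i x ^+ 2))).
- by apply/measurable_EFinP; exact: measurable_funX.
- move=> x _ /=; rewrite lee_fin /sl; have := sqr_ge0 (f (x, i) - g (x, i)).
  have := sqr_ge0 (f (x, i)); have := sqr_ge0 (g (x, i)); have := sqr_ge0 (f (x, i) + g (x, i)).
  move: (f (x, i)) (g (x, i)) => u v h1 h2 h3 h4; rewrite [`|_ ^+ 2|]ger0_norm // ger0_norm; last by lra.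
  by move: h4; rewrite !expr2; nra.
- have h := integrableD measurableT (integrableZl measurableT 2 If) (integrableZl measurableT 2 Ig).
  by apply: eq_integrable h.
Qed.

Lemma L2Z c f : L2 f -> L2 (fun y => c * f y).
Proof.
move=> hf i iK; have [mf If] := hf i iK; split.
  by apply: measurable_funM => //; exact: measurable_cst.
have -> : EFin \o (fun x => sl (fun y => c * f y) i x ^+ 2) = (fun x => (c ^+ 2)%:E * (sl f i x ^+ 2)%:E)%E.
  by apply/funext => x /=; rewrite -EFinM /sl exprMn.
exact: (integrableZl measurableT _ If).
Qed.

Lemma L2_T f : L2 f -> L2 (fun y => f (T y)).
Proof.
move=> hf i iK; rewrite /sl /Ttil /=; case: ltnP => h; first exact: hf.
have [m0 I0] := hf 0%N K0; split; last by have [] := integral_shift I0.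
by exact: (measurableT_comp m0 measurable_shift).
Qed.

Lemma L2_iter n f : L2 f -> L2 (fun y => f (iter n T y)).
Proof.
move=> hf; elim: n => [//|n IH].
have -> : (fun y => f (iter n.+1 T y)) = (fun y => (fun z => f (iter n T z)) (T y)).
  by apply/funext => y; rewrite iterSr.
exact: (L2_T IH).
Qed.

Lemma L2_bounded (M : R) f : (forall i, (i < K)%N -> measurable_fun setT (sl f i)) -> (forall y, `|f y| <= M) -> L2 f.
Proof.
move=> mf fM i iK; split; first exact: mf.
have muT : (mu setT < +oo)%E by rewrite probability_setT ltry.
apply: measurable_bounded_integrable => //; first by apply: measurable_funX; exact: mf.
exists (M ^+ 2); split; first exact: num_real.
move=> N MN x _ /=; rewrite ger0_norm ?sqr_ge0 // (le_trans _ (ltW MN)) //.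
by rewrite -[_ ^+ 2]real_normK ?num_real // ler_sqr ?nnegrE // (le_trans _ (fM (x, i))).
Qed.

Lemma L2_cst c : L2 (fun=> c).
Proof. by apply: (@L2_bounded `|c|) => [i _|//]; exact: measurable_cst. Qed.

Lemma L2_sum (I : Type) (s : seq I) (f : I -> Xt -> R) : (forall i, L2 (f i)) -> L2 (fun y => \sum_(i <- s) f i y).
Proof.
move=> hf; elim: s => [|i s IH].
  have -> : (fun y => \sum_(i <- [::]) f i y) = (fun=> 0) by apply/funext => y; rewrite big_nil.
  exact: L2_cst.
have -> : (fun y => \sum_(j <- i :: s) f j y) = (fun y => f i y + \sum_(j <- s) f j y).
  by apply/funext => y; rewrite big_cons.
exact: L2D.
Qed.

Lemma L2_Int f g : L2 f -> L2 g -> Int (fun y => f y * g y).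
Proof.
move=> hf hg i iK; have [mf If] := hf i iK; have [mg Ig] := hg i iK.
apply: (@le_integrable _ _ _ mu setT measurableT _ (EFin \o (fun x => sl f i x ^+ 2 + sl g i x ^+ 2))).
- by apply/measurable_EFinP; exact: measurable_funM.
- move=> x _ /=; rewrite lee_fin [leRHS]ger0_norm ?addr_ge0 ?sqr_ge0 // normrM /sl.
  rewrite -[f _ ^+ 2]real_normK ?num_real // -[g _ ^+ 2]real_normK ?num_real //.
  have := sqr_ge0 (`|f (x, i)| - `|g (x, i)|); have := normr_ge0 (f (x, i)); have := normr_ge0 (g (x, i)).
  rewrite !expr2; nra.
- exact: (integrableD measurableT If Ig).
Qed.

Definition ip f g := tint (fun y => f y * g y).

Lemma ipC f g : ip f g = ip g f.
Proof. by congr (Defs.tint _ _ _); apply/funext => y; rewrite mulrC. Qed.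

Lemma ipDl f g h : L2 f -> L2 g -> L2 h -> ip (fun y => f y + g y) h = ip f h + ip g h.
Proof.
move=> hf hg hh; rewrite /ip -tintD; [|exact: L2_Int|exact: L2_Int].
by congr (Defs.tint _ _ _); apply/funext => y; rewrite mulrDl.
Qed.

Lemma ipZl c f h : L2 f -> L2 h -> ip (fun y => c * f y) h = c * ip f h.
Proof.
move=> hf hh; rewrite /ip -tintZ; last exact: L2_Int.
by congr (Defs.tint _ _ _); apply/funext => y; rewrite mulrA.
Qed.

Lemma ip_suml (I : Type) (s : seq I) (f : I -> Xt -> R) h : (forall i, L2 (f i)) -> L2 h ->
  ip (fun y => \sum_(i <- s) f i y) h = \sum_(i <- s) ip (f i) h.
Proof.
move=> hf hh; rewrite /ip -tint_sum; last by move=> i; exact: L2_Int.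
by congr (Defs.tint _ _ _); apply/funext => y; rewrite mulr_suml.
Qed.

Lemma ip_ge0 f : 0 <= ip f f.
Proof. by apply: tint_ge0 => y; rewrite -expr2 sqr_ge0. Qed.

Lemma ip_iter n f g : L2 f -> L2 g -> ip (fun y => f (iter n T y)) (fun y => g (iter n T y)) = ip f g.
Proof. by move=> hf hg; have [_] := tint_iter n (L2_Int hf hg). Qed.

Definition acorr (q : nat) f (n : nat) : R := ip (fun y => f (iter (q * n) T y)) f.

Lemma ip_dist q f a b : L2 f -> ip (fun y => f (iter (q * a) T y)) (fun y => f (iter (q * b) T y)) = acorr q f (dist a b).
Proof.
move=> hf; wlog ab : a b / (b <= a)%N.
  move=> H; have [/H//|/ltnW/H e] := leqP b a.
  by rewrite ipC e; congr acorr; rewrite /dist addnC.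
rewrite /acorr /dist (eqP ab) addn0 -[RHS](ip_iter (q * b)) //; last exact: L2_iter.
by congr ip; apply/funext => y; rewrite -iterD -mulnDr subnK.
Qed.

Lemma ip_comb q f N (c : nat -> R) : L2 f ->
  ip (fun y => \sum_(a < N) c a * f (iter (q * a) T y)) (fun y => \sum_(a < N) c a * f (iter (q * a) T y)) =
  \sum_(a < N) \sum_(b < N) c a * c b * acorr q f (dist a b).
Proof.
move=> hf; have hL (i : 'I_N) : L2 (fun y => c i * f (iter (q * i) T y)) by apply: L2Z; exact: L2_iter.
rewrite ip_suml //; last exact: L2_sum.
apply: eq_bigr => a _; rewrite ipC ip_suml //; apply: eq_bigr => b _.
rewrite (ipZl _ (L2_iter _ hf) (hL a)) ipC (ipZl _ (L2_iter _ hf) (L2_iter _ hf)) (ip_dist q a b hf).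
by rewrite mulrA [c b * _]mulrC.
Qed.

Lemma acorr_positive_definite q f : L2 f -> positive_definite (acorr q f).
Proof. by move=> hf N c; rewrite -ip_comb // ip_ge0. Qed.

End Tower.

Section SpectralMeasures.
Variables (R : realType) (mu : probability XM R) (K : nat).
Hypothesis mu_inv : forall A : set XM, measurable A -> mu (Defs.shift @^-1` A) = mu A.
Hypothesis K0 : (0 < K)%N.
Variable q : nat.
Local Notation T := (Ttil K).
Local Notation tint := (tint mu K).
Local Notation L2 := (L2 mu K).
Local Notation ip := (ip mu K).
Local Notation acorr := (acorr mu K q).
Local Notation cosn := (@cosn R).
Implicit Types f g h : Xt -> R.

(** A real function has real autocorrelations, so its spectral measure for the [q]-th power can be
    required to be invariant under reflection, with vanishing sine coefficients. *)
Definition represents (sigma : {measure set R -> \bar R}) f := [/\ on_circle sigma,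
    forall n, (\int[sigma]_t (cosn n t)%:E)%E = (acorr f n)%:E,
    forall n, (\int[sigma]_t (sinn n t)%:E)%E = 0%E & refl_invariant sigma].

Lemma exists_spectral : exists sigma : (Xt -> R) -> {measure set R -> \bar R},
  forall f, L2 f -> represents (sigma f) f.
Proof.
have h f : exists s : {measure set R -> \bar R}, L2 f -> represents s f.
  case: (pselect (L2 f)) => Lf; last by exists mzero.
  by have [s hs] := herglotz (acorr_positive_definite mu_inv K0 q Lf); exists s.
by have [s hs] := boolp.choice h; exists s => f; exact: hs.
Qed.

Variable sigma : (Xt -> R) -> {measure set R -> \bar R}.
Hypothesis sigmaP : forall f, L2 f -> represents (sigma f) f.

Definition mass f (S : set R) : R := fine (sigma f S).

Lemma sigma_le f S : L2 f -> measurable S -> (sigma f S <= (ip f f)%:E)%E.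
Proof.
move=> Lf mS; have [hs hc _ _] := sigmaP Lf.
have <- : (\int[sigma f]_t (cosn 0 t)%:E)%E = (ip f f)%:E.
  by rewrite hc /Defs.tint /acorr muln0.
have -> : (\int[sigma f]_t (cosn 0 t)%:E)%E = sigma f setT.
  rewrite (eq_integral (fun=> 1%E)) ?integral_cst ?mul1e // => t _.
  by rewrite /cosn mulr0 mul0r cos0.
by apply: le_measure; rewrite ?inE.
Qed.

Lemma sigma_fin f S : L2 f -> measurable S -> sigma f S \is a fin_num.
Proof. by move=> Lf mS; rewrite ge0_fin_numE // (le_lt_trans (sigma_le Lf mS)) // ltry. Qed.

Lemma massE f S : L2 f -> measurable S -> sigma f S = (mass f S)%:E.
Proof. by move=> Lf mS; rewrite /mass fineK // sigma_fin. Qed.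

Lemma mass_ge0 f S : 0 <= mass f S.
Proof. by rewrite /mass fine_ge0. Qed.

Lemma mass_le f S : L2 f -> measurable S -> mass f S <= ip f f.
Proof. by move=> Lf mS; rewrite -lee_fin -massE // sigma_le. Qed.

Lemma mass_mono f S S' : L2 f -> measurable S -> measurable S' -> S `<=` S' -> mass f S <= mass f S'.
Proof.
by move=> Lf mS mS' SS; rewrite -lee_fin -!massE //; apply: le_measure; rewrite ?inE.
Qed.

Lemma acorrD f g n : L2 f -> L2 g ->
  acorr (fun y => f y + g y) n + acorr (fun y => f y + (-1) * g y) n = 2 * acorr f n + 2 * acorr g n.
Proof.
move=> Lf Lg; have LZ := L2Z (-1) Lg.
have Lfn := L2_iter mu_inv K0 (q * n) Lf; have Lgn := L2_iter mu_inv K0 (q * n) Lg.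
have LZn := L2Z (-1) Lgn; have LD := L2D Lf Lg; have LB := L2D Lf LZ.
rewrite /acorr (ipDl Lfn Lgn LD) (ipDl Lfn LZn LB) ![ip _ (fun y => f y + _)]ipC.
rewrite (ipDl Lf Lg Lfn) (ipDl Lf Lg Lgn) (ipDl Lf LZ Lfn) (ipDl Lf LZ LZn).
rewrite (ipZl _ Lg Lfn) (ipZl _ Lg LZn) ![ip _ (fun y => -1 * _)]ipC !(ipZl _ Lgn) //.
rewrite ![ip f (fun y => _)]ipC ![ip g (fun y => _)]ipC; ring.
Qed.

Lemma acorrZ c f n : L2 f -> acorr (fun y => c * f y) n = c ^+ 2 * acorr f n.
Proof.
move=> Lf; have Lfn := L2_iter mu_inv K0 (q * n) Lf.
rewrite /acorr (ipZl _ Lfn (L2Z c Lf)) ipC (ipZl _ Lf Lfn) ipC; ring.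
Qed.

Lemma integral_madd (s1 s2 : {measure set R -> \bar R}) n : on_circle s1 -> on_circle s2 ->
  (\int[measure_add s1 s2]_t (cosn n t)%:E = \int[s1]_t (cosn n t)%:E + \int[s2]_t (cosn n t)%:E)%E.
Proof.
move=> h1 h2; rewrite integral_measure_add //; try exact: integrable_cosn.
Qed.

Lemma on_circle_add (s1 s2 : {measure set R -> \bar R}) : on_circle s1 -> on_circle s2 ->
  on_circle (measure_add s1 s2).
Proof.
move=> h1 h2; have E A : (measure_add s1 s2 : {measure set R -> \bar R}) A = (s1 A + s2 A)%E by exact: measure_addE.
rewrite /on_circle !E h1.2 h2.2 adde0; split => //.
by apply: lte_add_pinfty; [exact: h1.1|exact: h2.1].
Qed.

(** The parallelogram identity holds for the autocorrelations; uniqueness on symmetric sets carries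
    it over to the measures. *)
Lemma mass_parallelogram f g S : L2 f -> L2 g -> measurable S -> symmetric S ->
  mass (fun y => f y + g y) S + mass (fun y => f y + (-1) * g y) S = 2 * mass f S + 2 * mass g S.
Proof.
move=> Lf Lg mS sS; have LZ := L2Z (-1) Lg; have LD := L2D Lf Lg; have LB := L2D Lf LZ.
have [w1 c1 _ _] := sigmaP LD; have [w2 c2 _ _] := sigmaP LB.
have [w3 c3 _ _] := sigmaP Lf; have [w4 c4 _ _] := sigmaP Lg.
pose m1 : {measure set R -> \bar R} := measure_add (sigma (fun y => f y + g y)) (sigma (fun y => f y + (-1) * g y)).
pose mf : {measure set R -> \bar R} := measure_add (sigma f) (sigma f).
pose mg : {measure set R -> \bar R} := measure_add (sigma g) (sigma g).
pose m2 : {measure set R -> \bar R} := measure_add mf mg.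
have of_ : on_circle mf := on_circle_add w3 w3; have og : on_circle mg := on_circle_add w4 w4.
have e : m1 S = m2 S.
  apply: circle_measure_unique => //; [exact: on_circle_add|exact: on_circle_add|move=> n].
  rewrite integral_madd // c1 c2 /m2 integral_madd // /mf /mg !integral_madd // c3 c4 -!EFinD acorrD //.
  by congr EFin; ring.
have E1 : m1 S = _ := measure_addE _ _ S; have E2 : m2 S = _ := measure_addE _ _ S.
have Ef : mf S = _ := measure_addE _ _ S; have Eg : mg S = _ := measure_addE _ _ S.
move: e; rewrite E1 E2 Ef Eg !massE // -!EFinD => -[->]; ring.
Qed.

(** Takes the place of the triangle inequality for the spectral projection attached to [S]. *)
Lemma massD f g S : L2 f -> L2 g -> measurable S -> symmetric S ->
  mass (fun y => f y + g y) S <= 2 * mass f S + 2 * mass g S.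
Proof. by move=> Lf Lg mS sS; rewrite -mass_parallelogram // lerDl mass_ge0. Qed.

Lemma massZ c f S : L2 f -> measurable S -> symmetric S -> mass (fun y => c * f y) S = c ^+ 2 * mass f S.
Proof.
move=> Lf mS sS; have Lc := L2Z c Lf; have [w1 c1 _ _] := sigmaP Lc; have [w2 c2 _ _] := sigmaP Lf.
have c0 : 0 <= c ^+ 2 by exact: sqr_ge0.
pose k : {nonneg R} := NngNum c0.
pose m : {measure set R -> \bar R} := mscale k (sigma f).
have om : on_circle m.
  split; rewrite /m /= /mscale; last by rewrite w2.2 mule0.
  by apply: lte_mul_pinfty => //; exact: w2.1.
have e : sigma (fun y => c * f y) S = m S.
  apply: circle_measure_unique => // n.
  rewrite c1 (@integral_mscale_bounded _ k (sigma f) (cosn n) 1) ?c2; first by rewrite acorrZ // EFinM.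
  - exact: w2.1.
  - exact: measurable_cosn.
  - by move=> x; exact: cos_max.
by rewrite /mass e /m /= /mscale massE // -EFinM.
Qed.

Lemma mass_set0 f : mass f set0 = 0.
Proof. by rewrite /mass measure0. Qed.

(** The cosine coefficients of the spectral measure of [a + i b] are the sums of those of [a] and
    [b]; the cross terms sit in the sine coefficients, which symmetric sets do not see. *)
Lemma complex_spectral_mass (a b : Xt -> R) (nu : {measure set R -> \bar R}) S : L2 a -> L2 b ->
  is_spectral_measure mu K q a b nu -> measurable S -> symmetric S ->
  nu S = (mass a S + mass b S)%:E.
Proof.
move=> La Lb [fin [null ints]] mS sS; have on : on_circle nu by [].
have [w1 c1 _ _] := sigmaP La; have [w2 c2 _ _] := sigmaP Lb.
pose m : {measure set R -> \bar R} := measure_add (sigma a) (sigma b).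
have -> : nu S = m S.
  apply: circle_measure_unique => //; first exact: on_circle_add.
  move=> n; rewrite integral_madd // c1 c2 -EFinD -integral_circle //; last exact: integrable_cosn.
  have [+ _] := ints n; rewrite -[X in _ = X -> _]/(_) => ->; congr EFin.
  rewrite /inner_re /acorr -tintD //; apply: L2_Int => //; exact: L2_iter.
have E : m S = _ := measure_addE _ _ S.
by rewrite E !massE // -EFinD.
Qed.

Lemma mass_spectral f : L2 f -> is_spectral_measure mu K q f (fun=> 0) (sigma f).
Proof.
move=> Lf; have [w c s _] := sigmaP Lf; split; [exact: w.1|split; [exact: w.2|move=> n; split]].
- have := c n; rewrite -integral_circle //; last exact: integrable_cosn.
  move=> e; apply: (etrans e); congr EFin; rewrite /inner_re /acorr; congr (Defs.tint _ _ _).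
  by apply/funext => y; rewrite mulr0 addr0.
- have := s n; rewrite -integral_circle //; last exact: integrable_sinn.
  move=> e; apply: (etrans e); congr EFin; rewrite /inner_im -[LHS](tint_cst mu K0 0); congr (Defs.tint _ _ _).
  by apply/funext => y; rewrite mul0r mulr0 subrr.
Qed.

End SpectralMeasures.

(** * Maximal spectral types *)

Section MaximalSpectralType.
Variables (R : realType) (mu : probability XM R) (K : nat).
Hypothesis mu_inv : forall A : set XM, measurable A -> mu (Defs.shift @^-1` A) = mu A.
Hypothesis K0 : (0 < K)%N.
Variable q : nat.
Variable sigma : (Xt -> R) -> {measure set R -> \bar R}.
Hypothesis sigmaP : forall f, L2 mu K f -> represents mu K q (sigma f) f.
Variable F : nat -> Xt -> R.
Hypothesis F_meas : forall n i, (i < K)%N -> measurable_fun setT (sl (F n) i).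
Hypothesis F_le1 : forall n y, `|F n y| <= 1.
Hypothesis F_mean : forall n, tint mu K (F n) = 0.
Local Notation L2 := (L2 mu K).
Local Notation ip := (ip mu K).
Local Notation mass := (mass sigma).
Implicit Types f g h : Xt -> R.

Let L2F n : L2 (F n).
Proof. by apply: (@L2_bounded _ _ _ 1) => //; exact: F_meas. Qed.

Lemma ip_bounded f (M : R) : L2 f -> (forall y, `|f y| <= M) -> ip f f <= M ^+ 2.
Proof.
move=> Lf fM; rewrite -(tint_cst mu K0 (M ^+ 2)); apply: tint_le => [||y].
- exact: L2_Int.
- exact: Int_cst.
- have := fM y; rewrite -expr2 -[f y ^+ 2]real_normK ?num_real // => h.
  by rewrite ler_sqr ?nnegrE // (le_trans _ h).
Qed.

Lemma mass_setU f (A B : set R) : L2 f -> measurable A -> measurable B ->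
  mass f (A `|` B) = mass f A + mass f B - mass f (A `&` B).
Proof.
move=> Lf mA mB; have mBA : measurable (B `\` A) by exact: measurableD.
have mBI : measurable (A `&` B) by exact: measurableI.
have mU : measurable (A `|` B) by exact: measurableU.
have e1 : mass f B = mass f (A `&` B) + mass f (B `\` A).
  apply: EFin_inj; rewrite EFinD -!(massE sigmaP Lf) //.
  rewrite -measureU //; first by rewrite setIC setUIDK.
  by apply/seteqP; split => // t [[? _] [_ ?]].
have e2 : mass f (A `|` B) = mass f A + mass f (B `\` A).
  apply: EFin_inj; rewrite EFinD -!(massE sigmaP Lf) //.
  rewrite -measureU //; first by congr (sigma f _); apply/seteqP; split => t /=; [case=> [|h]; [left|have [|] := pselect (A t); [left|right]]|case=> [|[]]; [left|right]].
  by apply/seteqP; split => // t [? [_ ?]].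
rewrite e2 e1; ring.
Qed.

Lemma symmetricI (A B : set R) : symmetric A -> symmetric B -> symmetric (A `&` B).
Proof. by move=> hA hB t t0 t1 [a b]; split; [exact: hA|exact: hB]. Qed.

(* If every [c_j] were bad, the sets witnessing this would be [J] nearly disjoint sets of mass at least [eps]
   for the spectral measure of [F k], which has total mass at most [1]. *)
Lemma generic_step g k (tau eps : R) : L2 g -> 0 < tau -> 0 < eps ->
  exists c r, [/\ 0 <= c, c <= tau, 0 < r & forall S, measurable S -> symmetric S ->
    mass (fun y => g y + c * F k y) S < r -> mass (F k) S < eps].
Proof.
move=> Lg t0 e0; pose J := (Num.trunc (2 / eps)).+1.
have J0 : 0 < J%:R :> R by rewrite ltr0n.
have Je : 2 < J%:R * eps by rewrite -ltr_pdivrMr //; exact: truncnS_gt.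
(* Two bad coefficients differ by at least [tau / J], so on the intersection of their sets [F k] has
   mass at most [4 * r / (tau / J) ^ 2 = eps / (2 * J)]. The union of the [J] sets then has mass at
   least [J * eps / 2 > 1]. *)
pose r : R := eps * tau ^+ 2 / (8 * J%:R ^+ 3).
have r0 : 0 < r by rewrite divr_gt0 ?mulr_gt0 ?exprn_gt0.
pose c (j : nat) : R := tau * j.+1%:R / J%:R.
apply: contrapT => no.
have bad (j : nat) : exists S, (j < J)%N -> [/\ measurable S, symmetric S,
    mass (fun y => g y + c j * F k y) S < r & eps <= mass (F k) S].
  have [jJ|] := boolP (j < J)%N; last by exists set0.
  apply: contrapT => noS; apply: no; exists (c j), r; split => //.
  - by rewrite /c divr_ge0 // mulr_ge0 // ltW.
  - by rewrite /c ler_pdivrMr // ler_wpM2l ?ler_nat // ltW.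
  - move=> S mS sS mr; rewrite ltNge; apply/negP => me; apply: noS.
    by exists S.
have [S hS] := boolp.choice bad.
have inter i j : (i < j)%N -> (j < J)%N -> mass (F k) (S i `&` S j) <= eps / (2 * J%:R).
  move=> ij jJ; have [mi si ai _] := hS i (ltn_trans ij jJ); have [mj sj aj _] := hS j jJ.
  have mI : measurable (S i `&` S j) by exact: measurableI.
  have sI := symmetricI si sj.
  have Li : L2 (fun y => g y + c i * F k y) by apply: L2D => //; exact: L2Z.
  have Lj : L2 (fun y => g y + c j * F k y) by apply: L2D => //; exact: L2Z.
  have E : (fun y => (c j - c i) * F k y) = (fun y => (g y + c j * F k y) + (-1) * (g y + c i * F k y)).
    by apply/funext => y; ring.
  have := massD mu_inv K0 sigmaP Lj (L2Z (-1) Li) mI sI; rewrite -E.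
  rewrite (massZ mu_inv K0 sigmaP _ (L2F k) mI sI) (massZ mu_inv K0 sigmaP _ Li mI sI).
  have b1 : mass (fun y => g y + c i * F k y) (S i `&` S j) < r.
    by apply: le_lt_trans ai; apply: (mass_mono sigmaP) => //; move=> t [].
  have b2 : mass (fun y => g y + c j * F k y) (S i `&` S j) < r.
    by apply: le_lt_trans aj; apply: (mass_mono sigmaP) => //; move=> t [].
  have m0 : 0 <= mass (F k) (S i `&` S j) by exact: mass_ge0.
  rewrite sqrrN expr1n mul1r => h.
  have cd : tau / J%:R <= c j - c i.
    rewrite /c -mulrBl -mulrBr ler_wpM2r ?invr_ge0 // -[leLHS]mulr1; apply: ler_wpM2l; first exact: ltW.
    by rewrite -natrB ?ler1n ?subn_gt0 // ltnS ltnW.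
  have cd2 : (tau / J%:R) ^+ 2 <= (c j - c i) ^+ 2.
    have t1 : 0 <= tau / J%:R by rewrite divr_ge0 // ltW.
    by rewrite ler_sqr ?nnegrE // (le_trans t1 cd).
  have h2 : (tau / J%:R) ^+ 2 * mass (F k) (S i `&` S j) <= 4 * r.
    apply: (@le_trans _ _ ((c j - c i) ^+ 2 * mass (F k) (S i `&` S j))); first by rewrite ler_wpM2r.
    lra.
  have -> : eps / (2 * J%:R) = 4 * r / (tau / J%:R) ^+ 2.
    by rewrite /r; field; rewrite !gt_eqF.
  by rewrite ler_pdivlMr ?exprn_gt0 ?divr_gt0 // mulrC.
pose U := fix U n := if n is m.+1 then U m `|` S m else set0 : set R.
have mU n : (n <= J)%N -> measurable (U n).
  elim: n => [_|n IH nJ]; first exact: measurable0.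
  by apply: measurableU; [exact: IH (ltnW nJ)|have [] := hS n nJ].
have UI m n : (m <= n)%N -> (n < J)%N -> mass (F k) (U m `&` S n) <= m%:R * (eps / (2 * J%:R)).
  elim: m => [_ _|m IH mn nJ]; first by rewrite set0I mass_set0 mul0r.
  have [mn' _ _ _] := hS n nJ; have [mm' _ _ _] := hS m (ltn_trans mn nJ).
  have mUm := mU m (ltnW (ltn_trans mn nJ)).
  rewrite /= setIUl mass_setU //; [|exact: measurableI|exact: measurableI].
  have := IH (ltnW mn) nJ; have := inter m n mn nJ; have := mass_ge0 sigma (F k) (U m `&` S n `&` (S m `&` S n)).
  rewrite -natr1 mulrDl mul1r; lra.
have Ubig n : (n <= J)%N -> n%:R * (eps / 2) <= mass (F k) (U n).
  elim: n => [_|n IH nJ]; first by rewrite mass_set0 mul0r.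
  have [mn' _ _ me] := hS n nJ; have mUn := mU n (ltnW nJ).
  rewrite /= mass_setU //; have := UI n n (leqnn n) nJ; have := IH (ltnW nJ).
  have : n%:R * (eps / (2 * J%:R)) <= eps / 2.
    have -> : n%:R * (eps / (2 * J%:R)) = eps / 2 * (n%:R / J%:R) by field; rewrite gt_eqF.
    rewrite -[leRHS]mulr1; apply: ler_wpM2l; first by apply: divr_ge0; [exact: ltW|].
    by rewrite ler_pdivrMr // mul1r ler_nat ltnW.
  rewrite -[n.+1%:R]natr1 [(n%:R + 1) * _]mulrDl mul1r; move: (n%:R * (eps / (2 * _))) (n%:R * (eps / 2)) => u v; lra.
have := Ubig J (leqnn J); have := mass_le sigmaP (L2F k) (mU J (leqnn J)).
have := ip_bounded (L2F k) (F_le1 k); rewrite expr1n; lra.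
Qed.

(** Step [j] treats one pair [(k, m)]: the function [F k] at precision [1 / (m + 1)]. Every pair is
    treated, at the step that codes it. *)
Let dec (j : nat) : nat * nat := odflt (0%N, 0%N) (unpickle j).
(** The coefficients are geometric and proportional to the tolerance reached so far, so that
    everything added from step [j] on has sup norm at most [rho j / 2 * 2 ^- j] and cannot undo
    earlier steps. *)
Let tau (j : nat) (rho : R) : R := 2 ^- j.+1 * rho / 2.

Let good j g (rho : R) (p : R * R) := [/\ 0 <= p.1, p.1 <= tau j rho, 0 < p.2 &
  forall S, measurable S -> symmetric S -> mass (fun y => g y + p.1 * F (dec j).1 y) S < p.2 ->
    mass (F (dec j).1) S < (dec j).2.+1%:R^-1].

Lemma maximal_sequence : exists (g : nat -> Xt -> R) (rho : nat -> R) (c : nat -> R),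
  [/\ forall y, g 0%N y = 0, rho 0%N = 1,
      forall j y, g j.+1 y = g j y + c j * F (dec j).1 y,
      forall j, 0 < rho j.+1 <= rho j /\ 0 <= c j <= tau j (rho j) &
      forall j S, measurable S -> symmetric S -> mass (g j.+1) S < rho j.+1 ->
        mass (F (dec j).1) S < (dec j).2.+1%:R^-1].
Proof.
have st (a : nat * (Xt -> R) * R) : exists p, L2 a.1.2 -> 0 < a.2 -> good a.1.1 a.1.2 a.2 p.
  case: (pselect (L2 a.1.2 /\ 0 < a.2)) => [[La r0]|no]; last by exists (0, 0) => h1 h2; case: no.
  have t0 : 0 < tau a.1.1 a.2 by rewrite /tau divr_gt0 // mulr_gt0 // invr_gt0 exprn_gt0.
  have e0 : 0 < (dec a.1.1).2.+1%:R^-1 :> R by rewrite invr_gt0.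
  by have [c [r hcr]] := generic_step (dec a.1.1).1 La t0 e0; exists (c, r).
have [p hp] := boolp.choice st.
pose nxt j (s : (Xt -> R) * R) : (Xt -> R) * R :=
  ((fun y => s.1 y + (p (j, s.1, s.2)).1 * F (dec j).1 y), Num.min s.2 (p (j, s.1, s.2)).2).
pose S := fix S j := if j is i.+1 then nxt i (S i) else ((fun=> 0), 1) : (Xt -> R) * R.
have inv j : L2 (S j).1 /\ 0 < (S j).2.
  elim: j => [|j [IH1 IH2]]; first by split => //; exact: L2_cst.
  have [/= h1 h2 h3 h4] := hp (j, (S j).1, (S j).2) IH1 IH2.
  by split; [apply: L2D => //; exact: L2Z|rewrite /= lt_min IH2].
exists (fun j => (S j).1), (fun j => (S j).2), (fun j => (p (j, (S j).1, (S j).2)).1); split => // j.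
- have [IH1 IH2] := inv j; have [/= h1 h2 h3 h4] := hp (j, (S j).1, (S j).2) IH1 IH2.
  by rewrite lt_min IH2 h3 ge_min lexx h1 h2.
- have [IH1 IH2] := inv j; have [/= h1 h2 h3 h4] := hp (j, (S j).1, (S j).2) IH1 IH2.
  by move=> A mA sA; rewrite lt_min => /andP[_]; exact: h4.
Qed.

(** If [f] has no mass on [S], then [g j.+1] differs from [f] by at most [rho j.+1 / 2] and has mass
    at most [rho j.+1 ^ 2 / 2] there. This is below the tolerance of step [j], so [F k] has mass
    below every [1 / (m + 1)]. *)
Theorem maximal_function : exists f, [/\ L2 f, tint mu K f = 0 &
  forall S, measurable S -> symmetric S -> mass f S = 0 -> forall k, mass (F k) S = 0].
Proof.
have [g [rho [c [g0 r0 gS rc hg]]]] := maximal_sequence.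
have rpos j : 0 < rho j.
  by case: j => [|j]; [rewrite r0|have [/andP[]] := rc j].
have rmono i j : (i <= j)%N -> rho j <= rho i.
  move=> /subnK <-; elim: (j - i)%N => [|k IH]; first by rewrite add0n.
  by rewrite addSn; apply: le_trans IH; have [/andP[]] := rc (k + i)%N.
have inc j y : `|g j.+1 y - g j y| <= tau j (rho j).
  have [_ /andP[c0 ct]] := rc j; rewrite gS addrC addKr normrM ger0_norm //.
  by apply: le_trans ct; rewrite -[leRHS]mulr1 ler_wpM2l.
have gb j n y : (j <= n)%N -> `|g n y - g j y| <= rho j / 2 * (2 ^- j - 2 ^- n).
  move=> /subnK <-; elim: (n - j)%N => [|k IH]; first by rewrite add0n !subrr mulr0 normr0.
  rewrite -(subrK (g (k + j)%N y) (g _ y)) addSn -addrA; apply: le_trans (ler_normD _ _) _.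
  have h1 := inc (k + j)%N y; have h2 : tau (k + j)%N (rho (k + j)%N) <= rho j / 2 * 2 ^- (k + j).+1.
    have -> : tau (k + j)%N (rho (k + j)%N) = rho (k + j)%N / 2 * 2 ^- (k + j).+1.
      rewrite /tau; ring.
    apply: ler_wpM2r; first by rewrite invr_ge0 exprn_ge0.
    by apply: ler_wpM2r; [rewrite invr_ge0|apply: rmono; exact: leq_addl].
  have e : 2 ^- (k + j) = 2 ^- (k + j).+1 + 2 ^- (k + j).+1 :> R.
    by rewrite exprS invfM; field; rewrite expf_neq0.
  rewrite e in IH; set x := 2 ^- (k + j).+1 in h1 h2 IH *; have := le_trans h1 h2; nra.
have gb' j n y : (j <= n)%N -> `|g n y - g j y| <= rho j / 2 * 2 ^- j.
  move=> jn; apply: le_trans (gb j n y jn) _; apply: ler_wpM2l; first by apply: divr_ge0; [exact: ltW|].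
  by rewrite gerBl invr_ge0 exprn_ge0.
have cv y : cvgn (fun n => g n y).
  have -> : (fun n => g n y) = series (fun i => g i.+1 y - g i y).
    by apply/funext => n; rewrite /series /= telescope_sumr // g0 subr0.
  apply: normed_cvg; apply: (@series_le_cvg _ _ (geometric 2^-1 2^-1)) => [i|i|i|] /=.
  - exact: normr_ge0.
  - by rewrite mulr_ge0 ?exprn_ge0 // invr_ge0.
  - apply: le_trans (inc i y) _; rewrite /tau exprVn exprS invfM -[leRHS]mulr1 -mulrA ler_wpM2l ?mulr_ge0 ?invr_ge0 ?exprn_ge0 //.
    have := rmono 0%N i (leq0n i); rewrite r0; have := rpos i; lra.
  - by apply: is_cvg_geometric_series; rewrite ger0_norm ?invr_ge0 // invf_lt1 // ltr1n.
pose f (y : Xt) : R := limn (fun n => g n y).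
have cf y : g n y @[n --> \oo] --> f y by exact: cv.
have fb j y : `|f y - g j y| <= rho j / 2 * 2 ^- j.
  apply: (ler_cvg_to (cvg_norm (cvgB (cf y) (cvg_cst (g j y)))) (cvg_cst (rho j / 2 * 2 ^- j))).
  by exists j => // n /= jn; exact: gb'.
have mg n i : (i < K)%N -> measurable_fun setT (sl (g n) i).
  move=> iK; elim: n => [|n IH].
    have -> : sl (g 0%N) i = cst 0 by apply/funext => x; rewrite /sl g0.
    exact: measurable_cst.
  have -> : sl (g n.+1) i = (fun x => sl (g n) i x + c n * sl (F (dec n).1) i x).
    by apply/funext => x; rewrite /sl gS.
  apply: measurable_funD => //; apply: measurable_funM; [exact: measurable_cst|exact: F_meas].
have mf i : (i < K)%N -> measurable_fun setT (sl f i).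
  move=> iK; apply: (@measurable_fun_cvg _ _ _ _ (fun n => sl (g n) i)) => [n|x _].
    exact: mg.
  exact: cf.
have f1 y : `|f y| <= 1.
  have := fb 0%N y; rewrite g0 subr0 r0 expr0 invr1; lra.
have Lf : L2 f by apply: (@L2_bounded _ mu K 1).
have Lg n : L2 (g n).
  have gn y : `|g n y| <= 1.
    have := gb' 0%N n y (leq0n n); rewrite g0 subr0 r0 expr0 invr1; lra.
  by apply: (@L2_bounded _ mu K 1) => // i; exact: mg.
have LI h : L2 h -> Int mu K h.
  move=> Lh; have -> : h = (fun y => h y * 1) by apply/funext => y; rewrite mulr1.
  by apply: L2_Int => //; exact: L2_cst.
have gm n : tint mu K (g n) = 0.
  elim: n => [|n IH].
    by have -> : g 0%N = (fun=> 0) by [apply/funext|]; rewrite tint_cst.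
  have -> : g n.+1 = (fun y => g n y + c n * F (dec n).1 y) by apply/funext.
  rewrite tintD ?IH ?tintZ ?F_mean ?mulr0 ?addr0 //; [exact: LI|exact: LI|].
  by apply: IntZ; exact: LI.
exists f; split => // [|S mS sS fS k].
  apply/eqP; rewrite -normr_le0 leNgt; apply/negP => t0.
  have key j : `|tint mu K f| <= 2 ^- j.
    have Lfg : L2 (fun y => f y + (-1) * g j y) by apply: L2D => //; exact: L2Z.
    have e : tint mu K (fun y => f y + (-1) * g j y) = tint mu K f.
      rewrite tintD ?tintZ ?gm ?mulr0 ?addr0 //; [exact: LI|exact: LI|].
      by apply: IntZ; exact: LI.
    have b y : `|f y + (-1) * g j y| <= 2 ^- j.
      rewrite mulN1r; apply: le_trans (fb j y) _; rewrite -[leRHS]mul1r ler_wpM2r ?invr_ge0 ?exprn_ge0 //.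
      have := rmono 0%N j (leq0n j); rewrite r0; have := rpos j; lra.
    rewrite -e ler_norml -[X in X <= _](tint_cst mu K0) -[X in _ && (_ <= X)](tint_cst mu K0).
    apply/andP; split; apply: tint_le; rewrite ?Int_cst //; try by [exact: Int_cst|exact: LI].
      by move=> y; have := b y; rewrite ler_norml => /andP[].
    by move=> y; have := b y; rewrite ler_norml => /andP[].
  have := cvg_geometric (1 : R) (z := 2^-1); rewrite ger0_norm ?invr_ge0 // invf_lt1 // ltr1n => /(_ isT).
  move=> /cvgrPdist_lt /(_ _ t0) [N _ /(_ N (leqnn N))] /=.
  rewrite mul1r sub0r normrN exprVn ger0_norm ?invr_ge0 ?exprn_ge0 // => h.
  by have := lt_le_trans h (key N); rewrite ltxx.
have small m : mass (F k) S < m.+1%:R^-1.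
  pose j := pickle (k, m); have dj : dec j = (k, m) by rewrite /dec pickleK.
  have := hg j S mS sS; rewrite dj /=; apply.
  have L1 : L2 (fun y => g j.+1 y + (-1) * f y) by apply: L2D => //; exact: L2Z.
  have E : g j.+1 = (fun y => f y + (g j.+1 y + (-1) * f y)) by apply/funext => y; ring.
  have := massD mu_inv K0 sigmaP Lf L1 mS sS; rewrite -E fS mulr0 add0r => h1.
  have h2 := mass_le sigmaP L1 mS.
  have b y : `|g j.+1 y + (-1) * f y| <= rho j.+1 / 2.
    rewrite mulN1r distrC; apply: le_trans (fb j.+1 y) _; rewrite -[leRHS]mulr1 ler_wpM2l ?divr_ge0 ?ltW //.
    by rewrite invf_lt1 ?exprn_gt0 // exprn_egt1 // ltr1n.
  have h3 := ip_bounded L1 b.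
  have r1 : rho j.+1 <= 1 by rewrite -r0; apply: rmono.
  have rp := rpos j.+1; move: h3; rewrite expr2 => h3; nra.
apply/eqP; rewrite eq_le mass_ge0 andbT leNgt; apply/negP => m0.
have := small (Num.trunc (mass (F k) S)^-1); have := truncnS_gt (mass (F k) S)^-1.
set n := (Num.trunc _).+1 => h1 h2.
have := lt_trans h2 (_ : n%:R^-1 < mass (F k) S); rewrite ltxx => /(_ _) ff; apply: notF; apply: ff.
by rewrite invf_plt ?posrE ?ltr0n.
Qed.

End MaximalSpectralType.

(** * Density of finite combinations of coordinate sets *)

Section SquareIntegrable.
Context {d : measure_display} {T : measurableType d} {R : realType}.
Variable mu : {measure set T -> \bar R}.
Variable V : set (T -> R).
Hypothesis V_meas : forall f, V f -> measurable_fun setT f.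
Hypothesis V_add : forall f g, V f -> V g -> V (fun x => f x + g x).
Hypothesis V_scale : forall c f, V f -> V (fun x => c * f x).
Hypothesis V1 : V (fun=> 1).
Hypothesis indic_V : forall A, measurable A -> approximable mu V (\1_A).

Import HBNNSimple.

Lemma approximable_ge0 (f : T -> R) : measurable_fun setT f -> (forall x, 0 <= f x) ->
  mu.-integrable setT (EFin \o (fun x => f x ^+ 2)) -> approximable mu V f.
Proof.
move=> mf f0 If; apply: (approximable_close V_meas) => // e e0.
have mEf : measurable_fun setT (EFin \o f) by exact/measurable_EFinP.
pose g := nnsfun_approx measurableT mEf.
have cg x : g n x @[n --> \oo] --> f x.
  have h := @cvg_nnsfun_approx _ _ _ _ measurableT _ mEf _ x I.
  by have /fine_cvgP[_] := h (fun t _ => f0 t).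
have gle n x : 0 <= g n x <= f x.
  rewrite fun_ge0 /=; apply: (ler_cvg_to (cvg_cst (g n x)) (cg x)); exists n => // m /= nm.
  by have /lefP := nd_nnsfun_approx measurableT mEf nm; exact.
have [n hn] : exists n, (sqd mu f (g n) <= e%:E)%E.
  apply: (@sqd_dominated _ _ _ mu (fun n => g n : T -> R) f (fun x => f x ^+ 2)) => // n x.
  have /andP[h1 h2] := gle n x; have := f0 x => h3.
  by rewrite ler_sqr ?nnegrE ?subr_ge0 // lerBlDr lerDl.
exists (g n); split => //.
have E : (g n : T -> R) = _ := funext (fimfunEord (g n)).
rewrite E; apply: (approximable_sum V_meas) => // i.
  by apply: measurable_funM; [exact: measurable_cst|exact: measurable_indic].
by apply: (approximableZ V_meas) => //; exact: indic_V.
Qed.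

Lemma approximable_L2 (f : T -> R) : measurable_fun setT f ->
  mu.-integrable setT (EFin \o (fun x => f x ^+ 2)) -> approximable mu V f.
Proof.
move=> mf If.
have mn : measurable_fun setT (fun x => `|f x|) by exact: (measurableT_comp (@normr_measurable R setT) mf).
have half (c : R) : c ^+ 2 = 1 -> measurable_fun setT (fun x => 2^-1 * (`|f x| + c * f x)) /\
    approximable mu V (fun x => 2^-1 * (`|f x| + c * f x)).
  move=> c1; have mh : measurable_fun setT (fun x => 2^-1 * (`|f x| + c * f x)).
    apply: measurable_funM; first exact: measurable_cst.
    by apply: measurable_funD => //; apply: measurable_funM => //; exact: measurable_cst.
  have cf x : `|c * f x| = `|f x|.
    by move/eqP: c1; rewrite sqrf_eq1 => /orP[/eqP ->|/eqP ->]; rewrite ?mul1r ?mulN1r ?normrN.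
  have c0 x : 0 <= `|f x| + c * f x.
    by have := ler_norm (- (c * f x)); rewrite normrN cf; lra.
  split=> //; apply: approximable_ge0 => // [x|].
    by rewrite mulr_ge0 ?invr_ge0.
  apply: (@le_integrable _ _ _ mu setT measurableT _ _ _ _ If) => [|x _ /=].
    by apply/measurable_EFinP; exact: measurable_funX.
  rewrite lee_fin [leLHS]ger0_norm ?sqr_ge0 // [leRHS]ger0_norm ?sqr_ge0 // -[leRHS]real_normK ?num_real //.
  rewrite ler_sqr ?nnegrE ?mulr_ge0 ?invr_ge0 //.
  have := ler_norm (c * f x); rewrite cf; lra.
have [m1 a1] := half 1 (expr1n _ _); have [m2 a2] := half (-1) (etrans (sqrrN 1) (expr1n _ _)).
have -> : f = (fun x => 2^-1 * (`|f x| + 1 * f x) + (-1) * (2^-1 * (`|f x| + (-1) * f x))).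
  by apply/funext => x; field.
apply: (approximableD V_meas) => //.
  by apply: measurable_funM => //; exact: measurable_cst.
exact: (approximableZ V_meas).
Qed.

End SquareIntegrable.

Section Boxes.

(** Constraints at arbitrary coordinates, possibly contradictory: unlike the cylinders over an
    interval, these sets are closed under intersection. *)
Definition box (L : seq (int * bool)) : set X := [set x | all (fun ib => x ib.1 == ib.2) L].

Lemma measurable_box L : measurable (box L : set XM).
Proof.
elim: L => [|[i b] L IH].
  by have -> : box [::] = setT by apply/seteqP.
have -> : box ((i, b) :: L) = cyl [:: b] i `&` box L.
  apply/seteqP; split => x /= [].
    by move=> /andP[/eqP h1 h2]; split => // -[|//] _; rewrite addr0.
  by move=> h1 h2; have := h1 0%N isT; rewrite addr0 /box /= h2 => ->; rewrite eqxx.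
by apply: measurableI => //; exact: measurable_cyl.
Qed.

Lemma cyl_box w m : cyl w m = box [seq (m + j%:Z, nth false w j) | j <- iota 0 (size w)].
Proof.
apply/seteqP; split => x /=; rewrite /box /=.
  by move=> h; apply/allP => _ /mapP[j + ->] /=; rewrite mem_iota /= => jw; apply/eqP/h.
move=> /allP h j jw; apply/eqP.
by apply: (h (m + j%:Z, nth false w j)); apply/mapP; exists j => //; rewrite mem_iota.
Qed.

Lemma measurable_boxE : @measurable _ XM = <<s range box >>.
Proof.
apply/seteqP; split.
  apply: smallest_sub; first exact: smallest_sigma_algebra.
  move=> _ [w [m ->]]; apply: sub_sigma_algebra; rewrite cyl_box; eexists => //.
apply: smallest_sub; first exact: sigma_algebra_measurable.
by move=> _ [L _ <-]; exact: measurable_box.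
Qed.

Lemma box_setI_closed : setI_closed (range box).
Proof.
move=> _ _ [L1 _ <-] [L2 _ <-]; exists (L1 ++ L2) => //.
by apply/seteqP; split => x /=; rewrite /box /= all_cat => /andP.
Qed.

End Boxes.

Section Density.
Variables (R : realType) (mu : probability XM R) (K : nat).
Hypothesis mu_inv : forall A : set XM, measurable A -> mu (Defs.shift @^-1` A) = mu A.
Hypothesis K0 : (0 < K)%N.
Local Notation L2 := (L2 mu K).
Local Notation ip := (ip mu K).

Definition boxfun (L : seq (int * bool)) (j : nat) (y : Xt) : R := \1_(box L) y.1 * (y.2 == j)%:R.

Lemma boxfun_bound L j y : 0 <= boxfun L j y <= 1.
Proof.
rewrite /boxfun indicE; case: (_ \in _); case: (_ == _); rewrite ?mulr1 ?mulr0 ?lexx ?ler01 //.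
Qed.

Lemma measurable_boxfun L j i : measurable_fun setT (sl (boxfun L j) i).
Proof.
apply: measurable_funM; last exact: measurable_cst.
by apply: measurable_indic; exact: measurable_box.
Qed.

Lemma L2_boxfun L j : L2 (boxfun L j).
Proof.
apply: (@L2_bounded _ mu K 1) => [i _|y]; first exact: measurable_boxfun.
by have /andP[h1 h2] := boxfun_bound L j y; rewrite ger0_norm.
Qed.

Lemma Int_L2 f : L2 f -> Int mu K f.
Proof.
move=> Lh; have -> : f = (fun y => f y * 1) by apply/funext => y; rewrite mulr1.
by apply: L2_Int => //; exact: L2_cst.
Qed.

Lemma tint_boxfun L j : (j < K)%N -> tint mu K (boxfun L j) = fine (mu (box L)) / K%:R.
Proof.
move=> jK; rewrite /tint mulrC; congr (_ * _).
have mB := measurable_box L.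
rewrite (bigD1 (Ordinal jK)) //= big1 ?addr0 => [|i ij].
  rewrite /Rintegral; congr fine; rewrite -[box L in RHS]setIT -integral_indic //.
    by apply: eq_integral => x _; rewrite /boxfun /= eqxx mulr1.
have ji : (nat_of_ord i == j) = false.
  by apply/negP => /eqP e; move/eqP: ij; apply; apply/val_inj.
transitivity (\int[mu]_(x in setT) (0 : R)); last by rewrite Rintegral_cst // mul0r.
by congr fine; apply: eq_integral => x _; rewrite /boxfun ji mulr0.
Qed.

(** An enumeration of the indicators of boxes at one level, centred over the whole tower. Reducing
    the level modulo [K] and the default for undecodable indices give every [n] a bounded function
    of mean zero. *)
Definition family (n : nat) (y : Xt) : R :=
  let u := odflt ([::], 0%N) (unpickle n : option (seq (int * bool) * nat)) in
  boxfun u.1 (u.2 %% K) y - fine (mu (box u.1)) / K%:R.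

Lemma family_pickle L j y : (j < K)%N ->
  family (pickle (L, j)) y = boxfun L j y - fine (mu (box L)) / K%:R.
Proof. by move=> jK; rewrite /family pickleK /= modn_small. Qed.

Lemma measurable_family n i : measurable_fun setT (sl (family n) i).
Proof.
by apply: measurable_funB; [exact: measurable_boxfun|exact: measurable_cst].
Qed.

Lemma family_le1 n y : `|family n y| <= 1.
Proof.
rewrite /family; set u := odflt _ _; have /andP[h1 h2] := boxfun_bound u.1 (u.2 %% K) y.
have m0 : 0 <= fine (mu (box u.1)) by rewrite fine_ge0.
have m1 : fine (mu (box u.1)) <= 1.
  by rewrite -lee_fin fineK ?fin_num_measure ?probability_le1 //; exact: measurable_box.
have a0 : 0 <= fine (mu (box u.1)) / K%:R by rewrite divr_ge0.
have a1 : fine (mu (box u.1)) / K%:R <= 1.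
  by rewrite ler_pdivrMr ?ltr0n // mul1r (le_trans m1) // ler1n.
rewrite ler_norml; lra.
Qed.

Lemma family_mean n : tint mu K (family n) = 0.
Proof.
rewrite /family; set u := odflt _ _.
rewrite tintD; [|exact: Int_L2 (L2_boxfun _ _)|exact: Int_cst].
by rewrite tint_boxfun ?ltn_mod // tint_cst // subrr.
Qed.

Lemma L2_family n : L2 (family n).
Proof. by apply: (@L2_bounded _ mu K 1) => [i _|]; [exact: measurable_family|exact: family_le1]. Qed.

Definition comb (s : seq (R * seq (int * bool))) : XM -> R := fun x => \sum_(u <- s) u.1 * \1_(box u.2) x.

Lemma slice_approximation f i (e : R) : (i < K)%N -> L2 f -> 0 < e ->
  exists s : seq (R * seq (int * bool)), (sqd mu (sl f i) (comb s) <= e%:E)%E.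
Proof.
move=> iK Lf e0; have [mf If] := Lf i iK.
pose V := [set h : XM -> R | exists s, h = comb s].
have V_meas h : V h -> measurable_fun setT h.
  move=> [s ->]; apply: measurable_sum => u; apply: measurable_funM; first exact: measurable_cst.
  by apply: measurable_indic; exact: measurable_box.
have V_add f1 f2 : V f1 -> V f2 -> V (fun x => f1 x + f2 x).
  by move=> [s1 ->] [s2 ->]; exists (s1 ++ s2); apply/funext => x; rewrite /comb big_cat.
have V_scale c h : V h -> V (fun x => c * h x).
  move=> [s ->]; exists [seq (c * u.1, u.2) | u <- s]; apply/funext => x.
  by rewrite /comb big_map mulr_sumr; apply: eq_bigr => u _; rewrite mulrA.
have V_box L : V (\1_(box L)).
  by exists [:: (1, L)]; apply/funext => x; rewrite /comb big_seq1 mul1r.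
have V1 : V (fun=> 1).
  have -> : (fun=> 1) = \1_(box [::]) :> (XM -> R); last exact: V_box.
  by apply/funext => x; rewrite indicE mem_set.
have muT : (mu setT < +oo)%E by rewrite probability_setT ltry.
have ap : approximable mu V (sl f i).
  apply: (approximable_L2 V_meas V_add V_scale V1) => // A mA.
  apply: (@approximable_indic _ XM R mu V V_meas V_add V_scale V1 muT (range box)) => //.
  - exact: measurable_boxE.
  - exact: box_setI_closed.
  - by move=> _ [L _ <-]; apply: approximable_V => //; exact: V_box.
by have [h [s ->] hs] := ap e e0; exists s.
Qed.

Lemma ip_shift_mean f : L2 f ->
  ip (fun y => f y + (- tint mu K f)) (fun y => f y + (- tint mu K f)) <= ip f f.
Proof.
move=> Lf; have Lc := @L2_cst _ mu K (- tint mu K f); have LD := L2D Lf Lc.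
have ipc (c : R) : ip (fun=> c) f = c * tint mu K f.
  by rewrite /ip tintZ //; exact: Int_L2.
rewrite ipDl // ![ip _ (fun y => f y + _)]ipC !ipDl // ![ip f (fun=> - tint mu K f)]ipC !ipc.
have -> : ip (fun=> - tint mu K f) (fun=> - tint mu K f) = tint mu K f ^+ 2.
  by rewrite /ip tint_cst // mulrNN expr2.
have := sqr_ge0 (tint mu K f); rewrite expr2; lra.
Qed.

Lemma family_dense f (e : R) : L2 f -> tint mu K f = 0 -> 0 < e ->
  exists s : seq (R * nat), let h y := f y + (-1) * (\sum_(u <- s) u.1 * family u.2 y) in ip h h <= e.
Proof.
move=> Lf f0 e0.
have ex i : exists s : seq (R * seq (int * bool)), (i < K)%N ->
    (sqd mu (sl f i) (comb s) <= e%:E)%E.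
  have [iK|_] := boolP (i < K)%N; last by exists [::].
  by have [s hs] := slice_approximation iK Lf e0; exists s.
have [s hs] := boolp.choice ex.
pose g y := \sum_(i <- iota 0 K) \sum_(u <- s i) u.1 * boxfun u.2 i y.
have Lg : L2 g.
  by apply: L2_sum => // i; apply: L2_sum => // u; apply: L2Z; exact: L2_boxfun.
have gsl i x : (i < K)%N -> g (x, i) = comb (s i) x.
  move=> iK; rewrite /g (bigD1_seq i) ?iota_uniq ?mem_iota //= [X in _ + X]big1 ?addr0 => [|j ji].
    by apply: eq_bigr => u _; rewrite /boxfun /= eqxx mulr1.
  by apply: big1 => u _; rewrite /boxfun /= eq_sym (negPf ji) !mulr0.
pose t := flatten [seq [seq (u.1, pickle (u.2, i)) | u <- s i] | i <- iota 0 K].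
have tE y : \sum_(u <- t) u.1 * family u.2 y = g y - tint mu K g.
  rewrite big_flatten big_map /g (tint_sum K0); last first.
    by move=> i; apply: Int_L2; apply: L2_sum => // u; apply: L2Z; exact: L2_boxfun.
  rewrite -sumrB; apply: eq_big_seq => i; rewrite mem_iota /= add0n => iK.
  rewrite big_map (tint_sum K0); last by move=> u; apply: Int_L2; apply: L2Z; exact: L2_boxfun.
  rewrite -sumrB; apply: eq_bigr => u _; rewrite tintZ; last by apply: Int_L2; exact: L2_boxfun.
  by rewrite family_pickle // tint_boxfun // mulrBr.
have LB : L2 (fun y => f y + (-1) * g y) by apply: L2D => //; exact: L2Z.
have mB : tint mu K (fun y => f y + (-1) * g y) = - tint mu K g.
  by rewrite tintD ?tintZ ?f0 ?add0r ?mulN1r //; try (by apply: Int_L2); apply: IntZ; exact: Int_L2.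
exists t => /=.
(* As [f] has mean zero, centring the approximation [g] amounts to centring [f - g], and this can
   only decrease the norm. *)
have -> : (fun y => f y + -1 * (\sum_(u <- t) u.1 * family u.2 y)) =
    (fun y => (f y + -1 * g y) + (- tint mu K (fun y => f y + (-1) * g y))).
  by apply/funext => y; rewrite tE mB; ring.
apply: le_trans (ip_shift_mean LB) _.
rewrite /ip /tint -(tint_cst mu K0 e) /tint ler_wpM2l ?invr_ge0 // ler_sum // => i _.
have h := hs i (ltn_ord i); rewrite Rintegral_cst // (_ : fine (mu setT) = 1) ?mulr1 ?probability_setT //.
have -> : \int[mu]_x ((f (x, i : nat) + -1 * g (x, i : nat)) * (f (x, i : nat) + -1 * g (x, i : nat))) =
    fine (sqd mu (sl f i) (comb (s i))).
  by congr fine; apply: eq_integral => x _; rewrite /sl gsl // mulN1r expr2.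
by rewrite -lee_fin fineK // ge0_fin_numE ?sqd_ge0 // (le_lt_trans h) // ltry.
Qed.

End Density.

(** A null set of the measure of [f] stays null after adding its mirror image, by invariance under
    reflection. On the resulting symmetric set, masses pass from the dense family to all functions
    of mean zero, and from real to complex ones. *)
Theorem exists_max_spectral_type (R : realType) (mu : probability XM R) (K q : nat) :
  (forall A : set XM, measurable A -> mu (Defs.shift @^-1` A) = mu A) -> (0 < K)%N ->
  exists nu, is_max_spectral_type mu K q nu.
Proof.
move=> mu_inv K0; have [sigma sigmaP] := exists_spectral mu_inv K0 q.
have [f [Lf f0 fmax]] := maximal_function mu_inv K0 sigmaP (fun n i _ => @measurable_family R mu K n i)
  (family_le1 mu K0) (family_mean mu K0).
exists (sigma f); split.
  exists f, (fun=> 0); split; last exact: mass_spectral.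
  split; last by rewrite tint_cst.
  move=> i iK; have [mf If] := Lf i iK; split => //; split; first exact: measurable_cst.
  split=> //; have [_] := @L2_cst _ mu K 0 i iK; exact.
move=> a b nu [ab [a0 b0]] nuP A mA fA.
have La : L2 mu K a by move=> i iK; have [h1 [h2 [h3 h4]]] := ab i iK; split.
have Lb : L2 mu K b by move=> i iK; have [h1 [h2 [h3 h4]]] := ab i iK; split.
have [w _ _ ri] := sigmaP f Lf.
pose S := A `|` (@refl1 R) @^-1` A.
have mrA : measurable ((@refl1 R) @^-1` A : set R).
  by rewrite -[X in measurable X]setTI; exact: measurable_refl1.
have mS : measurable S by exact: measurableU.
have sS : symmetric S.
  move=> t t0 t1; rewrite /S /=.
  have -> : refl1 t = 1 - t by rewrite /refl1 gt_eqF.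
  have -> : refl1 (1 - t) = t by rewrite /refl1 gt_eqF ?subr_gt0 // subKr.
  by case; [right|left].
have fS : sigma f S = 0%E.
  have le : (sigma f S <= sigma f A + sigma f ((@refl1 R) @^-1` A))%E by exact: measureU2.
  by move: le; rewrite ri // fA adde0 => le; apply/eqP; rewrite eq_le le measure_ge0.
have z g : L2 mu K g -> tint mu K g = 0 -> mass sigma g S = 0.
  move=> Lg g0; apply/eqP; rewrite eq_le mass_ge0 andbT leNgt; apply/negP => p0.
  have e0 : 0 < mass sigma g S / 4 by rewrite divr_gt0.
  have [s /= hs] := family_dense K0 Lg g0 e0.
  pose h (s : seq (R * nat)) y := \sum_(u <- s) u.1 * family mu K u.2 y.
  have Lh r : L2 mu K (h r) by apply: L2_sum => // u; apply: L2Z; exact: L2_family.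
  have hz r : mass sigma (h r) S = 0.
    elim: r => [|u r IH].
      have -> : h [::] = (fun y => 0 * 0) by apply/funext => y; rewrite /h big_nil mul0r.
      by rewrite (massZ mu_inv K0 sigmaP) // ?expr0n ?mul0r //; exact: L2_cst.
    have -> : h (u :: r) = (fun y => u.1 * family mu K u.2 y + h r y).
      by apply/funext => y; rewrite /h big_cons.
    apply/eqP; rewrite eq_le mass_ge0 andbT.
    have LF := L2Z u.1 (L2_family mu K0 u.2).
    apply: le_trans (massD mu_inv K0 sigmaP LF (Lh r) mS sS) _.
    rewrite IH (massZ mu_inv K0 sigmaP) //; last exact: L2_family.
    by rewrite fmax ?mulr0 ?addr0 // /mass fS.
  have LB : L2 mu K (fun y => g y + (-1) * h s y) by apply: L2D => //; exact: L2Z.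
  have := massD mu_inv K0 sigmaP (Lh s) LB mS sS.
  have -> : (fun y => h s y + (g y + (-1) * h s y)) = g by apply/funext => y; ring.
  rewrite hz mulr0 add0r => h1; have h2 := le_trans (mass_le sigmaP LB mS) hs.
  lra.
apply/eqP; rewrite eq_le measure_ge0 andbT.
have : (nu S <= 0)%E.
  by rewrite (complex_spectral_mass mu_inv K0 sigmaP La Lb nuP mS sS) !z // addr0.
by apply: le_trans; apply: le_measure; rewrite ?inE //; exact: subsetUl.
Qed.

(** * Decorrelation of prime powers *)

Section Atoms.
Variable R : realType.
Implicit Types nu sigma : {measure set R -> \bar R}.

Lemma countable_atoms nu : (nu setT < +oo)%E -> countable (atoms nu).
Proof.
move=> fin; have fn A : measurable A -> nu A \is a fin_num.
  by move=> mA; rewrite ge0_fin_numE // (le_lt_trans _ fin) // le_measure ?inE.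
pose w r : R := fine (nu [set r]).
rewrite [X in countable X](_ : _ = \bigcup_n [set r | n.+1%:R^-1 < w r]); last first.
  apply/seteqP; split=> [r /= h|r [k _ /= h]].
    have : 0 < w r by rewrite -lte_fin /w fineK // fn.
    by move=> /ltr_add_invr[k /[!add0r] kXr]; exists k.
  by rewrite /atoms /= -[nu _]fineK ?fn // lte_fin (lt_trans _ h).
apply: bigcup_countable => // n _; apply: finite_set_countable.
apply: contrapT => /infiniteP/pcard_leP/injfunPex[/= g g_fun g_inj].
have mU : measurable (\bigcup_k [set g k]) by exact: bigcup_measurable.
pose m := (Num.trunc (fine (nu setT) * n.+1%:R)).+1.
have : (nu (\bigcup_k [set g k]) <= nu setT)%E by apply: le_measure; rewrite ?inE.
rewrite measure_bigcup //=; last first.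
  by apply/trivIsetP => i j _ _ ij; apply/seteqP; split => // t [/= -> /g_inj e]; move: ij; rewrite e ?inE ?eqxx.
move=> h; have : (\sum_(0 <= k < m) nu [set g k] <= nu setT)%E.
  apply: le_trans h; rewrite [leRHS](_ : _ = \sum_(0 <= k <oo) nu [set g k])%E.
    exact: nneseries_lim_ge.
  by apply: eq_eseriesl => i; rewrite in_setT.
rewrite -EFin_sum_fine; last by move=> i _; rewrite fn.
rewrite -[nu setT]fineK ?fn // lee_fin => h2.
have : m%:R * n.+1%:R^-1 <= \sum_(0 <= k < m) fine (nu [set g k]) :> R.
  have -> : m%:R / n.+1%:R = \sum_(0 <= k < m) n.+1%:R^-1 :> R by rewrite sumr_const_nat subn0 mulr_natl.
  by apply: ler_sum => k _; rewrite ltW //; exact: g_fun.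
move=> /le_trans /(_ h2); rewrite ler_pdivrMr ?ltr0n // leNgt => /negP; apply.
exact: truncnS_gt.
Qed.

Lemma countable_null sigma (A : set R) : (forall t, sigma [set t] = 0%E) -> countable A -> sigma A = 0%E.
Proof.
move=> s0 /countable_injP [f injf].
rewrite -(injpinv_image (fun=> 0) injf).
rewrite [X in sigma X](_ : _ = \bigcup_(x in f @` A) [set 'pinv_(fun=> 0) A f x]); last first.
  rewrite eqEsubset; split => [r [n]|r [n]].
    by move=> [t At ftn] Afnr; exists n => //=; exists t.
  by move=> [t At ftn] /= rAfn; exists n => //=; exists t.
rewrite measure_bigcup/=; last 2 first.
  by move=> ? _; exact: measurable_set1.
  move=> i j [r Ar <-] [s As <-].
  by rewrite !pinvKV ?inE// => -[x [/= <- <-]].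
by apply: eseries0 => i _ _; rewrite s0.
Qed.

Lemma sum_indicator_le1 (P : nat -> bool) N : (forall a b, P a -> P b -> a = b) ->
  \sum_(b < N) (P b)%:R <= 1 :> R.
Proof.
move=> inj; case: (pickP (fun b : 'I_N => P b)) => [b Pb|no].
  rewrite (bigD1 b) //= Pb big1 ?addr0 // => c cb.
  by have [Pc|//] := boolP (P c); rewrite (val_inj (inj _ _ Pc Pb)) eqxx in cb.
by rewrite big1 // => b _; rewrite no.
Qed.

(** Here [h b n] says that the term [b] on the left may be charged to the term [n] on the right; the
    second hypothesis forbids charging a term twice. *)
Lemma sum_reindex_le (I J : nat) (h : nat -> nat -> bool) (g : nat -> R) (G : nat -> R) :
  (forall n, 0 <= g n) -> (forall n a b, h a n -> h b n -> a = b) ->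
  (forall b, (b < I)%N -> G b <= \sum_(n < J) (h b n)%:R * g n) ->
  \sum_(b < I) G b <= \sum_(n < J) g n.
Proof.
move=> g0 inj hG; apply: (@le_trans _ _ (\sum_(b < I) \sum_(n < J) (h b n)%:R * g n)).
  by apply: ler_sum => b _; exact: hG.
rewrite exchange_big /=; apply: ler_sum => n _; rewrite -mulr_suml -[leRHS]mul1r ler_wpM2r //.
by apply: (@sum_indicator_le1 (h^~ n)) => a b; exact: inj.
Qed.

Lemma sum_pick_le (J : nat) (g : nat -> R) (P : nat -> bool) n : (forall n, 0 <= g n) -> (n < J)%N -> P n ->
  g n <= \sum_(n < J) (P n)%:R * g n.
Proof.
move=> g0 nJ Pn; rewrite (bigD1 (Ordinal nJ)) //= Pn mul1r lerDl sumr_ge0 // => i _.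
by rewrite mulr_ge0.
Qed.

Lemma sum_dist_le (g : nat -> R) N a : (forall n, 0 <= g n) -> (a < N)%N ->
  \sum_(b < N) g (dist a b) <= 2 * \sum_(n < N) g n.
Proof.
move=> g0 aN; have -> : 2 = 1 + 1 :> R by []; rewrite mulrDl mul1r.
have -> : \sum_(b < N) g (dist a b) =
    \sum_(b < N) ((b <= a)%N%:R * g (dist a b)) + \sum_(b < N) ((a < b)%N%:R * g (dist a b)).
  by rewrite -big_split /=; apply: eq_bigr => b _; case: leqP; rewrite ?mul1r ?mul0r ?addr0 ?add0r.
apply: lerD.
  apply: (@sum_reindex_le N N (fun b n => a == b + n)%N g (fun b => (b <= a)%N%:R * g (dist a b))) => // [n b c /eqP -> /eqP /addIn //|b bN].
  have [ba|_] := leqP b a; last by rewrite mul0r sumr_ge0 // => n _; rewrite mulr_ge0.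
  have -> : dist a b = (a - b)%N by rewrite /dist; lia.
  rewrite mul1r; apply: (@sum_pick_le N g (fun n => a == b + n)%N) => //; first by lia.
  by rewrite subnKC.
apply: (@sum_reindex_le N N (fun b n => b == a + n)%N g (fun b => (a < b)%N%:R * g (dist a b))) => // [n b c /eqP -> /eqP //|b bN].
have [_|ba] := leqP b a; first by rewrite mul0r sumr_ge0 // => n _; rewrite mulr_ge0.
have -> : dist a b = (b - a)%N by rewrite /dist; lia.
rewrite mul1r; apply: (@sum_pick_le N g (fun n => b == a + n)%N) => //; first by lia.
by rewrite subnKC // ltnW.
Qed.

(* The kernel below is [(K(t - t0) + K(t + t0))/2], where [K] is the square of the modulus of the Dirichlet kernel. *)
Lemma double_kernel N (t t0 : R) :
  let c a := cosn a t in let s a := sinn a t in let c0 a := cosn a t0 in let s0 a := sinn a t0 in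
  \sum_(a < N) \sum_(b < N) cosn (dist a b) t * cosn (dist a b) t0 =
  (\sum_(a < N) c a * c0 a) ^+ 2 + (\sum_(a < N) c a * s0 a) ^+ 2 +
  (\sum_(a < N) s a * c0 a) ^+ 2 + (\sum_(a < N) s a * s0 a) ^+ 2.
Proof.
move=> c s c0 s0; rewrite !expr2 !mulr_suml -!big_split /=; apply: eq_bigr => a _.
rewrite !mulr_sumr -!big_split /=; apply: eq_bigr => b _.
rewrite !cosn_dist -/(sinn a t) -/(sinn b t) -/(sinn a t0) -/(sinn b t0) /c /s /c0 /s0; ring.
Qed.

(** One direction of Wiener's lemma. The kernel is nonnegative, and at [t0] it is at least
    [N ^ 2 / 2] because two of its squares have bases adding up to [N]; its integral is at most
    [2 * N] times the sum of the [|r n|]. *)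
Lemma no_atom sigma (r : nat -> R) : on_circle sigma ->
  (forall n, (\int[sigma]_t (cosn n t)%:E)%E = (r n)%:E) ->
  (fun N : nat => N%:R^-1 * \sum_(n < N) `|r n|) @ \oo --> (0 : R) ->
  forall t, sigma [set t] = 0%E.
Proof.
move=> hs hr cr t0; have fin : sigma [set t0] \is a fin_num.
  by rewrite ge0_fin_numE // (le_lt_trans _ hs.1) // le_measure ?inE.
pose x := fine (sigma [set t0]); have x0 : 0 <= x by rewrite fine_ge0.
rewrite -[LHS]fineK //; congr EFin; apply/eqP; rewrite eq_le x0 andbT leNgt; apply/negP => xp.
have key N : N%:R ^+ 2 / 2 * x <= 2 * N%:R * \sum_(n < N) `|r n|.
  pose Phi t := \sum_(a < N) \sum_(b < N) cosn (dist a b) t * cosn (dist a b) t0.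
  have Phi0 t : 0 <= Phi t by rewrite /Phi double_kernel; do !apply: addr_ge0; exact: sqr_ge0.
  have mPhi : measurable_fun setT Phi.
    apply: measurable_sum => a; apply: measurable_sum => b.
    by apply: measurable_funM; [exact: measurable_cosn|exact: measurable_cst].
  have low t : N%:R ^+ 2 / 2 * \1_[set t0] t <= Phi t.
    rewrite indicE; have [|_] := boolP (t \in [set t0]); last by rewrite mulr0.
    rewrite inE => /= ->; rewrite mulr1 /Phi double_kernel.
    have e : \sum_(a < N) cosn a t0 * cosn a t0 + \sum_(a < N) sinn a t0 * sinn a t0 = N%:R.
      rewrite -big_split /= (eq_bigr (fun=> 1)) ?sumr_const ?card_ord // => a _.
      by rewrite -!expr2 /cosn /sinn cos2Dsin2.
    rewrite -e; set u := \sum_(a < N) _ * _; set v := \sum_(a < N) _ * _.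
    set y := \sum_(a < N) _ * _; set z := \sum_(a < N) _ * _.
    have := sqr_ge0 y; have := sqr_ge0 z; have := sqr_ge0 (u - v); rewrite !expr2; nra.
  have up : (\int[sigma]_t (Phi t)%:E <= (2 * N%:R * \sum_(n < N) `|r n|)%:E)%E.
    have -> : (\int[sigma]_t (Phi t)%:E = (\sum_(a < N) \sum_(b < N) cosn (dist a b) t0 * r (dist a b))%:E)%E.
      rewrite (eq_integral (fun t => \sum_(a < N) \sum_(b < N) ((cosn (dist a b) t0)%:E * (cosn (dist a b) t)%:E))%E); last first.
        move=> t _; rewrite /Phi -sumEFin; apply: eq_bigr => a _; rewrite -sumEFin; apply: eq_bigr => b _.
        by rewrite -EFinM mulrC.
      rewrite integral_sum //; last first.
        move=> a; apply: integrable_sum => // b _; apply: integrableZl => //; exact: integrable_cosn.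
      rewrite -sumEFin; apply: eq_bigr => a _; rewrite integral_sum //; last first.
        move=> b; apply: integrableZl => //; exact: integrable_cosn.
      rewrite -sumEFin; apply: eq_bigr => b _; rewrite integralZl //; last exact: integrable_cosn.
      by rewrite hr -EFinM.
    rewrite lee_fin; apply: (@le_trans _ _ (\sum_(a < N) 2 * \sum_(n < N) `|r n|)).
      apply: ler_sum => a _; apply: le_trans (@sum_dist_le (fun n => `|r n|) N a _ _) => //.
      apply: ler_sum => b _; apply: le_trans (ler_norm _) _.
      by rewrite normrM -[leRHS]mul1r ler_wpM2r //; exact: cos_max.
    by rewrite sumr_const card_ord -[_ *+ N]mulr_natr mulrAC.
  rewrite -lee_fin; apply: le_trans up.
  rewrite EFinM /x fineK // -[X in sigma X]setIT -integral_indic // -ge0_integralZl_EFin //.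
  - apply: ge0_le_integral => //.
    + by apply: measurable_funeM; apply/measurable_EFinP; exact: measurable_indic.
    + exact/measurable_EFinP.
    + by move=> t _; rewrite -EFinM lee_fin.
  - by apply/measurable_EFinP; exact: measurable_indic.
have x4 : 0 < x / 4 by rewrite divr_gt0.
have /cvgrPdist_lt /(_ _ x4) [N _ /(_ N.+1 (leqnSn N))] /= := cr.
rewrite sub0r normrN ger0_norm; last by rewrite mulr_ge0 ?invr_ge0 // sumr_ge0.
rewrite ltr_pdivrMl ?ltr0n // => h; have := key N.+1; set S := \sum_(n < _) _ in h *.
have : 0 < N.+1%:R :> R by rewrite ltr0n.
move: (N.+1%:R : R) h => n h n0 h2.
have : n * S < n * (n * (x / 4)) by rewrite ltr_pM2l.
rewrite expr2 in h2; nra.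
Qed.

End Atoms.

Section Correlation.
Variable R : realType.
Implicit Types a b f al : nat -> R.

Lemma sum_shift f (M : R) n u v : (forall m, `|f m| <= M) ->
  `|\sum_(u <= m < v) f (m + n)%N - \sum_(u <= m < v) f m| <= 2 * n%:R * M.
Proof.
move=> fM; have M0 : 0 <= M := le_trans (normr_ge0 _) (fM 0%N).
have [uv|vu] := leqP u v; last first.
  rewrite !big_geq ?(ltnW vu) // subrr normr0; apply: mulr_ge0 => //; exact: mulr_ge0.
elim: n => [|n IH].
  by under eq_bigr do rewrite addn0; rewrite subrr normr0 mulr0 mul0r.
have -> : \sum_(u <= m < v) f (m + n.+1)%N = \sum_(u <= m < v) f (m + n)%N + (f (v + n)%N - f (u + n)%N).
  have := telescope_sumr (fun m => f (m + n)%N) uv; rewrite sumrB => <-.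
  under eq_bigr do rewrite addnS; rewrite addrC subrK; by apply: eq_bigr.
have h1 := fM (v + n)%N; have h2 := fM (u + n)%N.
rewrite addrAC; apply: le_trans (ler_normD _ _) _.
have := ler_normB (f (v + n)%N) (f (u + n)%N).
rewrite -[n.+1%:R]natr1 mulrDr mulr1 [(_ + 2) * _]mulrDl; lra.
Qed.

(* With [V] the shift of sequences, [symsum al k] is [V^k phi(V)] for [phi(V) = \sum_n al n (V^n + V^-n) / 2]:
   the factor [V^k] makes every iterate a forward one. *)
Definition symsum al k a m := \sum_(n < k) al n / 2 * (a (m + (k + n))%N + a (m + (k - n))%N).

Lemma norm_le_square (d x : R) : 0 < d -> `|x| <= d / 2 + x ^+ 2 / (2 * d).
Proof.
move=> d0; have -> : d / 2 + x ^+ 2 / (2 * d) = `|x| + (`|x| - d) ^+ 2 / (2 * d).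
  by rewrite sqrrB real_normK ?num_real //; field; rewrite gt_eqF.
by rewrite lerDl divr_ge0 ?sqr_ge0 // mulr_ge0 // ltW.
Qed.

Lemma sum_norm_le_square (d : R) a g u v : 0 < d -> (forall m, `|a m| <= 1) ->
  `|\sum_(u <= m < v) a m * g m| <= d / 2 * (v - u)%:R + (\sum_(u <= m < v) g m ^+ 2) / (2 * d).
Proof.
move=> d0 a1; apply: le_trans (ler_norm_sum _ _ _) _.
have -> : d / 2 * (v - u)%:R + (\sum_(u <= m < v) g m ^+ 2) / (2 * d) =
    \sum_(u <= m < v) (d / 2 + g m ^+ 2 / (2 * d)).
  by rewrite big_split /= sumr_const_nat mulr_natr mulr_suml.
apply: ler_sum => m _; rewrite normrM; apply: le_trans (norm_le_square (g m) d0).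
by rewrite -[leRHS]mul1r ler_wpM2r.
Qed.

(* Write [b = phi(V) b + (1 - phi(V)) b]: up to boundary terms [phi(V)] is self-adjoint and can be moved to [a]. *)
Lemma correlation_bound a b al k (d : R) u v : 0 < d -> (0 < k)%N -> (forall m, `|a m| <= 1) -> (forall m, `|b m| <= 1) ->
  `|\sum_(u <= m < v) a m * b m| <= d * (v - u)%:R +
    (\sum_(u <= m < v) symsum al k a m ^+ 2 +
     \sum_(u <= m < v) symsum (fun n => (n == 0)%N%:R - al n) k b m ^+ 2) / (2 * d) +
    2 * k%:R * (1 + \sum_(n < k) `|al n|).
Proof.
move=> d0 k0 a1 b1; set g2 := symsum (fun n => _) k b.
have g2E m : b (m + k)%N = g2 m + symsum al k b m.
  rewrite /g2 /symsum -big_split /=.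
  under eq_bigr do rewrite -mulrDl -mulrDl subrK.
  rewrite (bigD1 (Ordinal k0)) //= addn0 subn0 big1 ?addr0 => [|i].
    by field.
  rewrite -val_eqE /= => /negPf ->; by rewrite !mul0r.
have ab1 c e m : `|a (m + c)%N * b (m + e)%N| <= 1 by rewrite normrM mulr_ile1.
have s0 : `|\sum_(u <= m < v) a m * b m - \sum_(u <= m < v) a (m + k)%N * b (m + k)%N| <= 2 * k%:R.
  rewrite distrC -[leRHS]mulr1; apply: (@sum_shift (fun m => a m * b m) 1) => m.
  by have := ab1 0%N 0%N m; rewrite !addn0.
have e1 : \sum_(u <= m < v) a (m + k)%N * b (m + k)%N =
    \sum_(u <= m < v) a (m + k)%N * g2 m + \sum_(u <= m < v) a (m + k)%N * symsum al k b m.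
  by rewrite -big_split /=; apply: eq_bigr => m _; rewrite g2E mulrDr.
have swap : `|\sum_(u <= m < v) a (m + k)%N * symsum al k b m - \sum_(u <= m < v) symsum al k a m * b (m + k)%N| <=
    2 * k%:R * \sum_(n < k) `|al n|.
  have ex (f1 f2 : nat -> nat -> R) : \sum_(u <= m < v) \sum_(n < k) al n / 2 * (f1 m n + f2 m n) =
      \sum_(n < k) al n / 2 * (\sum_(u <= m < v) f1 m n + \sum_(u <= m < v) f2 m n).
    rewrite exchange_big /=; apply: eq_bigr => n _; rewrite -big_split /= mulr_sumr //.
  have -> : \sum_(u <= m < v) a (m + k)%N * symsum al k b m = \sum_(n < k) al n / 2 *
      (\sum_(u <= m < v) a (m + k)%N * b (m + (k + n))%N + \sum_(u <= m < v) a (m + k)%N * b (m + (k - n))%N).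
    rewrite -(ex (fun m n => a (m + k)%N * b (m + (k + n))%N) (fun m n => a (m + k)%N * b (m + (k - n))%N)).
    apply: eq_bigr => m _; rewrite /symsum mulr_sumr; apply: eq_bigr => n _; ring.
  have -> : \sum_(u <= m < v) symsum al k a m * b (m + k)%N = \sum_(n < k) al n / 2 *
      (\sum_(u <= m < v) a (m + (k - n))%N * b (m + k)%N + \sum_(u <= m < v) a (m + (k + n))%N * b (m + k)%N).
    rewrite -(ex (fun m n => a (m + (k - n))%N * b (m + k)%N) (fun m n => a (m + (k + n))%N * b (m + k)%N)).
    apply: eq_bigr => m _; rewrite /symsum mulr_suml; apply: eq_bigr => n _; ring.
  rewrite -sumrB mulr_sumr; apply: le_trans (ler_norm_sum _ _ _) _; apply: ler_sum => n _.
  have nk := ltnW (ltn_ord n).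
  have t1 := @sum_shift (fun m => a (m + (k - n))%N * b (m + k)%N) 1 n u v (ab1 _ _).
  have t2 := @sum_shift (fun m => a (m + k)%N * b (m + (k - n))%N) 1 n u v (ab1 _ _).
  have r1 : \sum_(u <= m < v) a (m + n + (k - n))%N * b (m + n + k)%N = \sum_(u <= m < v) a (m + k)%N * b (m + (k + n))%N.
    by apply: eq_bigr => m _; congr (a _ * b _); lia.
  have r2 : \sum_(u <= m < v) a (m + n + k)%N * b (m + n + (k - n))%N = \sum_(u <= m < v) a (m + (k + n))%N * b (m + k)%N.
    by apply: eq_bigr => m _; congr (a _ * b _); lia.
  rewrite r1 in t1; rewrite r2 in t2; rewrite -mulrBr normrM normrM [`|2^-1|]ger0_norm ?invr_ge0 //.
  have nkR : n%:R <= k%:R :> R by rewrite ler_nat.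
  set A1 := \sum_(u <= m < v) _ in t1 t2 *; set A2 := \sum_(u <= m < v) a (m + k)%N * b (m + (k - n))%N in t2 *.
  set A3 := \sum_(u <= m < v) a (m + (k - n))%N * b (m + k)%N in t1 *; set A4 := \sum_(u <= m < v) _ in t2 *.
  have t : `|A1 + A2 - (A3 + A4)| <= 4 * k%:R.
    have -> : A1 + A2 - (A3 + A4) = (A1 - A3) - (A4 - A2) by ring.
    apply: le_trans (ler_normB _ _) _; lra.
  have n0 := normr_ge0 (al n); rewrite -mulrA mulrC -[leRHS]mulrC.
  have -> : `|al n| * (2 * k%:R) = 2^-1 * (4 * k%:R) * `|al n| by field.
  by apply: ler_wpM2r => //; apply: ler_wpM2l; rewrite ?invr_ge0.
have q1 := @sum_norm_le_square d (fun m => a (m + k)%N) g2 u v d0 (fun m => a1 _).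
have q2 := @sum_norm_le_square d (fun m => b (m + k)%N) (symsum al k a) u v d0 (fun m => b1 _).
have q2' : \sum_(u <= m < v) b (m + k)%N * symsum al k a m = \sum_(u <= m < v) symsum al k a m * b (m + k)%N.
  by apply: eq_bigr => m _; rewrite mulrC.
rewrite q2' in q2; move: q1 q2 s0 swap; rewrite e1 [(_ + \sum_(u <= m < v) g2 _ ^+ 2) / _]mulrDl.
set X0 := \sum_(u <= m < v) a m * b m; set X1 := \sum_(u <= m < v) a (m + k)%N * g2 m.
set X2 := \sum_(u <= m < v) a (m + k)%N * symsum al k b m; set X3 := \sum_(u <= m < v) _ * b (m + k)%N.
set Y1 := _ / (2 * d); set Y2 := _ / (2 * d); set Z := \sum_(n < k) _; set V := (v - u)%:R.
rewrite !ler_norml mulrDr mulr1; have -> : d * V = d / 2 * V + d / 2 * V by field.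
set V' := d / 2 * V; set Z' := 2 * k%:R * Z; lra.
Qed.

End Correlation.

Section SliceFunctions.
Variables (R : realType) (mu : probability XM R) (K : nat).
Hypothesis mu_inv : forall A : set XM, measurable A -> mu (Defs.shift @^-1` A) = mu A.
Hypothesis K0 : (0 < K)%N.
Local Notation T := (Ttil K).

Lemma iter_Ttil n x i : (i < K)%N -> iter n T (x, i) = (iter ((n + i) %/ K) Defs.shift x, ((n + i) %% K)%N).
Proof.
move=> iK; elim: n => [|n IH]; first by rewrite add0n divn_small // modn_small.
rewrite iterS IH /Ttil /=; have := divn_eq (n + i) K; have := ltn_pmod (n + i) K0.
move: ((n + i) %/ K)%N ((n + i) %% K)%N => d r rK e.
have -> : (n.+1 + i = d * K + r.+1)%N by lia.
move: rK; rewrite leq_eqVlt => /orP[/eqP rK|rK].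
  by rewrite rK ltnn -mulSnr mulnK // modnMl.
by rewrite rK divnMDl // divn_small // addn0 modnMDl modn_small.
Qed.

Variable C : set XM.
Hypothesis mC : measurable C.
Let c : R := fine (mu C).

(** Centred on the level [j] itself instead of by a constant on the tower: its integral over every
    level is zero, which makes it orthogonal to the eigenfunctions coming from the rotation of the
    levels. *)
Definition slicefun (j : nat) (y : Xt) : R := (\1_C y.1 - c) * (y.2 == j)%:R.

Definition mixing_defect (l : nat) : R := fine (mu ((iter l Defs.shift @^-1` C) `&` C)) - c * c.

Let c01 : 0 <= c <= 1.
Proof. by rewrite /c fine_ge0 //= -lee_fin fineK ?fin_num_measure // probability_le1. Qed.

Lemma slicefun_le1 j y : `|slicefun j y| <= 1.
Proof.
have /andP[h0 h1] := c01; rewrite /slicefun indicE ler_norml.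
by case: (_ \in _); case: (_ == _); rewrite ?mulr1 ?mulr0 /=; lra.
Qed.

Lemma L2_slicefun j : L2 mu K (slicefun j).
Proof.
apply: (@L2_bounded _ mu K 1) => [i _|y]; last exact: slicefun_le1.
apply: measurable_funM; last exact: measurable_cst.
by apply: measurable_funB; [exact: measurable_indic|exact: measurable_cst].
Qed.

Let Rint_indic (A : set XM) : measurable A -> mu.-integrable setT (EFin \o \1_A) /\
  \int[mu]_x (\1_A x : R) = fine (mu A).
Proof.
move=> mA; split; first by apply: integrable_indic.
by rewrite /Rintegral; congr fine; rewrite integral_indic // setIT.
Qed.

Lemma tint_slice (g : Xt -> R) j : (j < K)%N -> (forall x i, i != j -> g (x, i) = 0) ->
  tint mu K g = K%:R^-1 * \int[mu]_x g (x, j).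
Proof.
move=> jK h; rewrite /tint (bigD1 (Ordinal jK)) //= big1 ?addr0 // => i ij.
transitivity (\int[mu]_(x in setT) (0 : R)); last by rewrite Rintegral_cst // mul0r.
congr fine; apply: eq_integral => x _; congr EFin; apply: h.
by apply/negP => /eqP e; move/eqP: ij; apply; apply/val_inj.
Qed.

Lemma tint_slicefun j : (j < K)%N -> tint mu K (slicefun j) = 0.
Proof.
move=> jK; rewrite (tint_slice jK); last by move=> x i /negPf ij; rewrite /slicefun ij mulr0.
have [I1 e1] := Rint_indic mC.
have -> : \int[mu]_x slicefun j (x, j) = \int[mu]_x (\1_C x + (- c)).
  by congr fine; apply: eq_integral => x _; rewrite /slicefun /= eqxx mulr1.
have I2 : mu.-integrable setT (EFin \o (fun=> - c)) by apply: finite_measure_integrable_cst.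
rewrite (RintegralD measurableT I1 I2) e1 Rintegral_cst // (_ : fine (mu setT) = 1) ?mulr1 ?subrr ?mulr0 //.
by rewrite probability_setT.
Qed.

Lemma measurable_iter_shift (A : set XM) l : measurable A -> measurable (iter l Defs.shift @^-1` A : set XM) /\
  mu (iter l Defs.shift @^-1` A) = mu A.
Proof.
move=> mA; elim: l => [//|l [IH1 IH2]].
have -> : iter l.+1 Defs.shift @^-1` A = Defs.shift @^-1` (iter l Defs.shift @^-1` A).
  by apply/seteqP; split => x /=; rewrite -iterSr.
split; last by rewrite mu_inv.
by rewrite -[X in measurable X]setTI; exact: (measurable_shift measurableT IH1).
Qed.

(** The orbit returns to level [j] only at multiples of [K], and after [l * K] steps the base point
    has been shifted [l] times. *)
Lemma acorr_slicefun q n j : (j < K)%N ->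
  acorr mu K q (slicefun j) n = (K %| q * n)%N%:R * (K%:R^-1 * mixing_defect (q * n %/ K)).
Proof.
move=> jK; rewrite /acorr /ip (tint_slice jK); last first.
  by move=> x i /negPf ij; rewrite {2}/slicefun ij !mulr0.
have [/dvdnP[l e]|nd] := boolP (K %| q * n)%N; last first.
  rewrite mul0r; apply/eqP; rewrite mulf_eq0; apply/orP; right; apply/eqP.
  transitivity (\int[mu]_(x in setT) (0 : R)); last by rewrite Rintegral_cst // mul0r.
  congr fine; apply: eq_integral => x _; congr EFin; rewrite iter_Ttil // /slicefun /=.
  suff -> : ((q * n + j) %% K == j)%N = false by rewrite mulr0 mul0r.
  apply/negP => /eqP h; move/negP: nd; apply.
  have : (q * n + j == j %[mod K])%N by rewrite h modn_small.
  by rewrite eqn_mod_dvd ?leq_addl // addnK.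
rewrite e mulnK // mul1r; congr (_ * _).
have [mD muD] := measurable_iter_shift l mC.
pose C' : set XM := iter l Defs.shift @^-1` C.
have mI : measurable (C' `&` C) by exact: measurableI.
have [I1 e1] := Rint_indic mI; have [I2 e2] := Rint_indic mD; have [I3 e3] := Rint_indic mC.
have I4 : mu.-integrable setT (EFin \o (fun=> c * c)) by apply: finite_measure_integrable_cst.
have J2 := integrableZl measurableT (- c) I2; have J3 := integrableZl measurableT (- c) I3.
have J34 := integrableD measurableT J3 I4; have J24 := integrableD measurableT J2 J34.
have -> : \int[mu]_x (slicefun j (iter (l * K) T (x, j)) * slicefun j (x, j)) =
    \int[mu]_x (\1_(C' `&` C) x + ((- c) * \1_C' x + ((- c) * \1_C x + c * c))).
  congr fine; apply: eq_integral => x _; congr EFin; rewrite iter_Ttil //.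
  rewrite divnMDl // divn_small // addn0 modnMDl modn_small // /slicefun /= eqxx !mulr1 indicI /=.
  have -> : \1_C (iter l Defs.shift x) = \1_C' x :> R by rewrite !indicE.
  ring.
rewrite (RintegralD measurableT I1 J24) (RintegralD measurableT J2 J34) (RintegralD measurableT J3 I4).
transitivity (fine (mu (C' `&` C)) + (- c * c + (- c * c + c * c))); last by rewrite /mixing_defect -/C'; ring.
congr (_ + (_ + (_ + _))); first exact: e1.
- by apply: (etrans (RintegralZl _ measurableT I2)); congr (_ * _); apply: (etrans e2); rewrite muD.
- by apply: (etrans (RintegralZl _ measurableT I3)); congr (_ * _).
- by rewrite Rintegral_cst // (_ : fine (mu setT) = 1) ?mulr1 // probability_setT.
Qed.

Hypothesis mixing : weakly_mixing mu.

(** The nonzero terms, at times [q * b = n * K], are charged to the mixing defects at distinct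
    [n < q * N]. Their average is therefore at most [q] times that of the defects, which tends to
    zero by weak mixing. *)
Lemma acorr_slicefun_average q j : (0 < q)%N -> (j < K)%N ->
  (fun N : nat => N%:R^-1 * \sum_(n < N) `|acorr mu K q (slicefun j) n|) @ \oo --> (0 : R).
Proof.
move=> q0 jK; have mx := mixing mC mC.
have q0R : 0 < q%:R :> R by rewrite ltr0n.
apply/cvgrPdist_lt => e e0; have /cvgrPdist_lt /(_ _ (divr_gt0 e0 q0R)) [N0 _ hN] := mx.
exists N0 => // N /= NN; rewrite sub0r normrN ger0_norm; last by rewrite mulr_ge0 ?invr_ge0 ?sumr_ge0.
have := hN (q * N)%N (leq_trans NN (leq_pmull _ q0)) => /=.
rewrite sub0r normrN ger0_norm; last by rewrite mulr_ge0 ?invr_ge0 ?sumr_ge0.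
rewrite big_mkord ltr_pdivlMr // => h; apply: le_lt_trans h.
rewrite natrM invfM [q%:R^-1 * _]mulrC -mulrA -[leRHS]mulrA ler_wpM2l ?invr_ge0 //.
rewrite mulrCA mulVf ?gt_eqF // mulr1.
apply: (@sum_reindex_le R N (q * N) (fun b n => n * K == q * b)%N (fun n => `|mixing_defect n|) (fun n => `|acorr mu K q (slicefun j) n|)) => //.
  by move=> n a b /eqP -> /eqP /eqP; rewrite eqn_pmul2l // => /eqP.
move=> b bN; rewrite acorr_slicefun //.
have [/dvdnP[l qbE]|_] := boolP (K %| q * b)%N; last first.
  by rewrite mul0r normr0 sumr_ge0 // => n _; rewrite mulr_ge0.
rewrite qbE mulnK // mul1r; apply: le_trans (@sum_pick_le R _ (fun n => `|mixing_defect n|) (fun n => n * K == l * K)%N l _ _ _) => //.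
  rewrite normrM ger0_norm ?invr_ge0 // -[leRHS]mul1r ler_wpM2r // invf_le1 ?ltr0n // ler1n //.
apply: leq_ltn_trans (_ : (q * b < q * N)%N); last by rewrite ltn_pmul2l.
by rewrite qbE leq_pmulr.
Qed.

End SliceFunctions.

Section SpectralCombinations.
Variables (R : realType) (mu : probability XM R) (K : nat).
Hypothesis mu_inv : forall A : set XM, measurable A -> mu (Defs.shift @^-1` A) = mu A.
Hypothesis K0 : (0 < K)%N.
Variable q : nat.
Variable sigma : {measure set R -> \bar R}.
Variable f : Xt -> R.
Hypothesis Lf : L2 mu K f.
Hypothesis sigmaP : represents mu K q sigma f.
Local Notation T := (Ttil K).
Local Notation ip := (ip mu K).

Definition symcomb (al : nat -> R) k (y : Xt) : R :=
  symsum al k (fun m => f (iter (q * m) T y)) 0.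

Let Lpair al (k n : nat) : L2 mu K (fun y => al n / 2 * (f (iter (q * (k + n)) T y) + f (iter (q * (k - n)) T y))).
Proof. by apply: L2Z; apply: L2D; exact: L2_iter. Qed.

Lemma symcombE al k : symcomb al k = (fun y => \sum_(n < k) al n / 2 * (f (iter (q * (k + n)) T y) + f (iter (q * (k - n)) T y))).
Proof. by apply/funext => y; rewrite /symcomb /symsum; apply: eq_bigr => n _; rewrite !add0n. Qed.

Lemma L2_symcomb al k : L2 mu K (symcomb al k).
Proof. by rewrite symcombE; apply: (@L2_sum _ mu K _ _ (fun n : 'I_k => _)) => n; exact: Lpair. Qed.

(** The spectral isometry, for cosine polynomials. The extra power of the Koopman operator in
    [symcomb] preserves the norm, and both sides expand by the product formula for cosines. *)
Lemma ip_symcomb (al : nat -> R) k :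
  sqd sigma (fun t => \sum_(n < k) al n * cosn n t) (fun=> 0) = (ip (symcomb al k) (symcomb al k))%:E.
Proof.
have [on ci _ _] := sigmaP.
have -> : ip (symcomb al k) (symcomb al k) =
    \sum_(n < k) \sum_(m < k) al n * al m / 2 * (acorr mu K q f (n + m) + acorr mu K q f (dist n m)).
  have L (n : 'I_k) := Lpair al k n; have LS := L2_symcomb al k.
  rewrite {1}symcombE ip_suml //; apply: eq_bigr => n _; rewrite ipC symcombE ip_suml //.
  apply: eq_bigr => m _.
  have L1 := L2_iter mu_inv K0 (q * (k + m)) Lf; have L2' := L2_iter mu_inv K0 (q * (k - m)) Lf.
  have L3 := L2_iter mu_inv K0 (q * (k + n)) Lf; have L4 := L2_iter mu_inv K0 (q * (k - n)) Lf.
  have L12 := L2D L1 L2'; have L34 := L2D L3 L4.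
  rewrite (ipZl _ L12 (L n)) ipC (ipZl _ L34 L12) ipDl // ![ip (fun y => f _) (fun y => _ + _)]ipC !ipDl //.
  rewrite !(ip_dist mu_inv K0 q _ _ Lf).
  have nk := ltnW (ltn_ord n); have mk := ltnW (ltn_ord m).
  have -> : dist (k + m) (k + n) = dist n m by rewrite /dist; lia.
  have -> : dist (k - m) (k - n) = dist n m by rewrite /dist; lia.
  have -> : dist (k - m) (k + n) = (n + m)%N by rewrite /dist; lia.
  have -> : dist (k + m) (k - n) = (n + m)%N by rewrite /dist; lia.
  by field.
rewrite /sqd (eq_integral (fun t => \sum_(n < k) \sum_(m < k)
    ((al n * al m / 2)%:E * (cosn (n + m) t)%:E + (al n * al m / 2)%:E * (cosn (dist n m) t)%:E))%E); last first.
  move=> t _; rewrite subr0 expr2 mulr_suml -sumEFin; apply: eq_bigr => n _.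
  rewrite mulr_sumr -sumEFin; apply: eq_bigr => m _; rewrite -!EFinM -EFinD; congr EFin.
  have := cosnD n m t; rewrite -distE => e.
  have -> : al n * cosn n t * (al m * cosn m t) = al n * al m / 2 * (2 * (cosn n t * cosn m t)) by field.
  by rewrite e mulrDr.
have I (c : R) n : sigma.-integrable setT (fun t => c%:E * (cosn n t)%:E)%E.
  by apply: integrableZl => //; exact: integrable_cosn.
have I2 (c1 c2 : R) n m : sigma.-integrable setT (fun t => c1%:E * (cosn n t)%:E + c2%:E * (cosn m t)%:E)%E.
  exact: (integrableD measurableT (I c1 n) (I c2 m)).
rewrite integral_sum //; last by move=> n; apply: integrable_sum => // m _; exact: I2.
rewrite -sumEFin; apply: eq_bigr => n _; rewrite integral_sum //.
rewrite -sumEFin; apply: eq_bigr => m _; rewrite integralD //.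
by rewrite !integralZl //; try exact: integrable_cosn; rewrite !ci -!EFinM -EFinD mulrDr.
Qed.

End SpectralCombinations.

Section Decorrelation.
Variables (R : realType) (mu : probability XM R) (K : nat).
Hypothesis mu_inv : forall A : set XM, measurable A -> mu (Defs.shift @^-1` A) = mu A.
Hypothesis K0 : (0 < K)%N.
Local Notation T := (Ttil K).
Local Notation ip := (ip mu K).

Lemma max_type_dominates q nu (sigma : (Xt -> R) -> {measure set R -> \bar R}) F :
  is_max_spectral_type mu K q nu -> (forall f, L2 mu K f -> represents mu K q (sigma f) f) ->
  L2 mu K F -> tint mu K F = 0 -> forall A, measurable A -> nu A = 0%E -> sigma F A = 0%E.
Proof.
move=> [_ dom] sP LF F0; apply: (dom F (fun=> 0)); last exact: mass_spectral.
split; last by rewrite tint_cst.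
move=> i iK; have [mf If] := LF i iK; split => //; split; first exact: measurable_cst.
split=> //; have [_] := @L2_cst _ mu K 0 i iK; exact.
Qed.

(** The hypothesis says nothing about the atoms of the maximal types, but they are countable and the
    measures of [F] do not charge countable sets. Adding the mirror image to [A] keeps it null for
    the first measure and only shrinks the complement. *)
Lemma singular_set p q nu1 nu2 (s1 s2 : (Xt -> R) -> {measure set R -> \bar R}) F :
  is_max_spectral_type mu K p nu1 -> is_max_spectral_type mu K q nu2 -> cont_parts_singular nu1 nu2 ->
  (forall f, L2 mu K f -> represents mu K p (s1 f) f) -> (forall f, L2 mu K f -> represents mu K q (s2 f) f) ->
  L2 mu K F -> tint mu K F = 0 -> (forall t, s1 F [set t] = 0%E) -> (forall t, s2 F [set t] = 0%E) ->
  exists S, [/\ measurable S, symmetric S, s1 F S = 0%E & s2 F (~` S) = 0%E].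
Proof.
move=> max1 max2 [A [mA [A1 A2]]] sP1 sP2 LF F0 at1 at2.
have part q' nu (s : (Xt -> R) -> {measure set R -> \bar R}) B : is_max_spectral_type mu K q' nu ->
    (forall f, L2 mu K f -> represents mu K q' (s f) f) -> (forall t, s F [set t] = 0%E) ->
    measurable B -> nu (B `\` atoms nu) = 0%E -> s F B = 0%E.
  move=> maxn sP at0 mB B0.
  have fin : (nu setT < +oo)%E by case: (maxn) => -[a [b [_ []]]].
  have ca := countable_atoms fin; have ma : measurable (atoms nu).
    by apply: countable_measurable => // t; exact: measurable_set1.
  have mBa : measurable (B `\` atoms nu) by exact: measurableD.
  have h1 := max_type_dominates maxn sP LF F0 mBa B0.
  have h2 := countable_null at0 ca.
  have le : (s F B <= s F (B `\` atoms nu) + s F (atoms nu))%E.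
    apply: le_trans (measureU2 _ mBa ma); apply: le_measure; rewrite ?inE //; first exact: measurableU.
    by move=> t Bt; have [|] := pselect (atoms nu t); [right|left].
  by move: le; rewrite h1 h2 adde0 => le; apply/eqP; rewrite eq_le le measure_ge0.
have s1A := part _ _ _ A max1 sP1 at1 mA A1.
have s2A := part _ _ _ (~` A) max2 sP2 at2 (measurableC mA) A2.
have mrA : measurable ((@refl1 R) @^-1` A : set R).
  by rewrite -[X in measurable X]setTI; exact: measurable_refl1.
exists (A `|` (@refl1 R) @^-1` A); split.
- exact: measurableU.
- move=> t t0 t1 /=; have -> : refl1 t = 1 - t by rewrite /refl1 gt_eqF.
  have -> : refl1 (1 - t) = t by rewrite /refl1 gt_eqF ?subr_gt0 // subKr.
  by case; [right|left].
- have [_ _ _ ri] := sP1 F LF.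
  have le : (s1 F (A `|` (@refl1 R) @^-1` A) <= s1 F A + s1 F ((@refl1 R) @^-1` A))%E by exact: measureU2.
  by move: le; rewrite ri // s1A adde0 => le; apply/eqP; rewrite eq_le le measure_ge0.
- apply/eqP; rewrite eq_le measure_ge0 andbT -s2A; apply: le_measure; rewrite ?inE //.
  + by apply: measurableC; exact: measurableU.
  + exact: measurableC.
  + by apply: subsetC; exact: subsetUl.
Qed.

Lemma sqd_indic0 (s : {measure set R -> \bar R}) (S : set R) : measurable S -> sqd s \1_S (fun=> 0) = s S.
Proof.
move=> mS; rewrite -[in RHS](setIT S) -integral_indic //; apply: eq_integral => t _.
by rewrite subr0 indicE; case: (_ \in _); rewrite ?expr1n ?expr0n.
Qed.

Lemma sqd_1_indic (s : {measure set R -> \bar R}) (S : set R) : measurable S -> sqd s (fun=> 1) \1_S = s (~` S).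
Proof.
move=> mS; rewrite -sqd_indic0; last exact: measurableC.
apply: eq_integral => t _; rewrite subr0 indicC indicE; congr (_ ^+ 2)%:E.
by case: (_ \in _); rewrite ?subrr ?subr0.
Qed.

Theorem small_combinations p q F (e : R) :
  (forall nu1 nu2, is_max_spectral_type mu K p nu1 -> is_max_spectral_type mu K q nu2 -> cont_parts_singular nu1 nu2) ->
  L2 mu K F -> tint mu K F = 0 ->
  (fun N : nat => N%:R^-1 * \sum_(n < N) `|acorr mu K p F n|) @ \oo --> (0 : R) ->
  (fun N : nat => N%:R^-1 * \sum_(n < N) `|acorr mu K q F n|) @ \oo --> (0 : R) ->
  0 < e -> exists k (al : nat -> R), let be n := (n == 0)%N%:R - al n in
    [/\ (0 < k)%N, ip (symcomb K p F al k) (symcomb K p F al k) <= e &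
        ip (symcomb K q F be k) (symcomb K q F be k) <= e].
Proof.
move=> sing LF F0 av1 av2 e0.
have [nu1 max1] := exists_max_spectral_type p mu_inv K0.
have [nu2 max2] := exists_max_spectral_type q mu_inv K0.
have [s1 sP1] := exists_spectral mu_inv K0 p; have [s2 sP2] := exists_spectral mu_inv K0 q.
have [on1 c1 _ _] := sP1 F LF; have [on2 c2 _ _] := sP2 F LF.
have at1 := no_atom on1 c1 av1; have at2 := no_atom on2 c2 av2.
have [S [mS sS S1 S2]] := singular_set max1 max2 (sing _ _ max1 max2) sP1 sP2 LF F0 at1 at2.
have e2 : 0 < e / 2 by rewrite divr_gt0.
have [k [al0 /= [ap1 ap2]]] := circle_approximation2 on1 on2 mS sS e2.
(* The coefficients are padded by zero and the length becomes [k.+1], so that the constant term of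
   [1 - phi] has a place even when [k = 0]. *)
pose al n := if (n < k)%N then al0 n else 0.
have ex (t : R) : \sum_(n < k.+1) al n * cosn n t = \sum_(n < k) al0 n * cosn n t.
  rewrite big_ord_recr /= {2}/al ltnn mul0r addr0; apply: eq_bigr => i _.
  by rewrite /al ltn_ord.
have mphi (b : nat -> R) m : measurable_fun setT (fun t : R => \sum_(n < m) b n * cosn n t).
  apply: measurable_sum => n; apply: measurable_funM; [exact: measurable_cst|exact: measurable_cosn].
have mI : measurable_fun setT (\1_S : R -> R) by exact: measurable_indic.
have dbl : e = 2 * (e / 2) by field.
pose be (n : nat) : R := (n == 0%N)%:R - al n.
exists k.+1, al; split=> //.
- rewrite -lee_fin -(ip_symcomb mu_inv K0 LF (sP1 F LF)).
  have -> : (fun t : R => \sum_(n < k.+1) al n * cosn n t) = (fun t : R => \sum_(n < k) al0 n * cosn n t).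
    by apply/funext => t; exact: ex.
  apply: le_trans (sqd_triangle _ (mphi _ _) mI (measurable_cst _)) _.
  by rewrite sqd_indic0 // S1 mule0 adde0 sqdC dbl EFinM lee_wpmul2l // lee_fin.
- change (ip (symcomb K q F be k.+1) (symcomb K q F be k.+1) <= e).
  rewrite -lee_fin -(ip_symcomb mu_inv K0 LF (sP2 F LF)).
  have -> : sqd (s2 F) (fun t : R => \sum_(n < k.+1) be n * cosn n t) (fun=> 0) =
      sqd (s2 F) (fun=> 1) (fun t : R => \sum_(n < k) al0 n * cosn n t).
    apply: eq_integral => t _; rewrite subr0 -ex; congr (_ ^+ 2)%:E.
    rewrite /be; under eq_bigr do rewrite mulrBl; rewrite sumrB; congr (_ - _).
    by rewrite big_ord_recl /= big1 ?addr0 => [|i _]; rewrite ?mul0r // mul1r /cosn mulr0 mul0r cos0.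
  apply: le_trans (sqd_triangle _ (measurable_cst _) mI (mphi _ _)) _.
  by rewrite sqd_1_indic // S2 mule0 add0e dbl EFinM lee_wpmul2l // lee_fin.
Qed.

End Decorrelation.

(** * Statistics of rank-one words *)

Section Blocks.
Variable R : realType.
Implicit Types (u v w B : seq bool) (L : seq nat).

Definition blocks B L : seq bool := flatten [seq B ++ nseq s true | s <- L].

Lemma blocks_cons B s L : blocks B (s :: L) = (B ++ nseq s true) ++ blocks B L.
Proof. by []. Qed.

Lemma BwordS p s k : Bword p s k.+1 = blocks (Bword p s k) [seq s k.+1 i | i <- iota 0 (p k.+1)].
Proof. by rewrite /blocks -map_comp. Qed.

Lemma size_BwordS p s m : (forall n, (1 <= n)%N -> (2 <= p n)%N) ->
  (2 * size (Bword p s m) <= size (Bword p s m.+1))%N.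
Proof.
move=> p2; rewrite BwordS; have := p2 m.+1 (ltn0Sn m); case: (p m.+1) => [//|[//|q _]].
by rewrite /= !blocks_cons !size_cat; lia.
Qed.

Lemma size_Bword_mono p s m n : (forall n, (1 <= n)%N -> (2 <= p n)%N) -> (m <= n)%N ->
  (size (Bword p s m) <= size (Bword p s n))%N.
Proof.
move=> p2 /subnK <-; elim: (n - m)%N => [//|j IH]; rewrite addSn.
by apply: leq_trans IH _; apply: leq_trans (size_BwordS s _ p2); rewrite leq_pmull.
Qed.

Lemma size_Bword_gt p s m : (forall n, (1 <= n)%N -> (2 <= p n)%N) -> (m < size (Bword p s m))%N.
Proof. by move=> p2; elim: m => [//|m IH]; have := size_BwordS s m p2; lia. Qed.

Lemma cat_split (a b u v : seq bool) : a ++ b = u ++ v ->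
  (exists w, u = a ++ w /\ b = w ++ v) \/ (exists w, a = u ++ w /\ v = w ++ b).
Proof.
elim: a u => [|x a IH] [|y u] //=; rewrite ?cat0s.
- by move=> ->; left; exists [::].
- by move=> ->; left; exists (y :: u).
- by move=> <-; right; exists (x :: a).
- by move=> [-> /IH [[w [-> ->]]|[w [-> ->]]]]; [left|right]; exists w.
Qed.

Lemma cat_nseq (n : nat) u v : nseq n true = u ++ v -> exists a b, [/\ u = nseq a true, v = nseq b true & (a + b = n)%N].
Proof.
elim: n u => [|n IH] [|y u] //=.
- by case: v => // _; exists 0%N, 0%N.
- by move=> <-; exists 0%N, n.+1.
- by move=> [<- /IH [a [b [-> -> <-]]]]; exists a.+1, b; rewrite addSn.
Qed.

(** An abstract discrepancy, later [disc]: subadditive up to the boundary cost [c] and at most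
    proportional to the length. *)
Variable d : seq bool -> R.
Variables c C0 : R.
Hypothesis C0_ge0 : 0 <= C0.
Hypothesis d_cat : forall u v, d (u ++ v) <= d u + d v + c.
Hypothesis d_size : forall u, d u <= C0 * (size u)%:R.

Lemma d_nil : d [::] <= 0.
Proof. by have := d_size [::]; rewrite mulr0. Qed.

Section Level.
Variables (B : seq bool) (eps H : R).
Hypothesis eps0 : 0 <= eps.
Hypothesis c_small : c <= eps * (size B)%:R.
Hypothesis dB : d B <= eps * (size B)%:R.
Local Notation h := ((size B)%:R : R).
Local Notation E1 := ((C0 + 3) * eps).
Local Notation E2 := ((4 * C0 + 6) * eps).

Definition short L := all (fun s => (s%:R : R) <= eps * h) L.

Hypothesis H0 : 0 <= H.

Let eh0 : 0 <= eps * h. Proof. exact: mulr_ge0. Qed.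

Lemma d_block s : (s%:R : R) <= eps * h -> d (B ++ nseq s true) + c <= E1 * h.
Proof.
move=> sh; have h1 := d_cat B (nseq s true); have h2 := d_size (nseq s true); rewrite size_nseq in h2.
have : C0 * s%:R <= C0 * (eps * h) by exact: ler_wpM2l.
move: h1 h2 c_small dB; set x := eps * h; have -> : E1 * h = C0 * x + 3 * x by rewrite /x; ring.
lra.
Qed.

Lemma size_block s : h <= (size (B ++ nseq s true))%:R.
Proof. by rewrite ler_nat size_cat leq_addr. Qed.

Lemma E1_ge0 : 0 <= E1. Proof. by rewrite mulr_ge0 // addr_ge0. Qed.

Lemma d_blocks L : short L -> d (blocks B L) <= E1 * (size (blocks B L))%:R.
Proof.
elim: L => [_|s L IH /= /andP[sh /IH {}IH]]; first by rewrite mulr0 d_nil.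
rewrite blocks_cons; apply: le_trans (d_cat _ _) _; rewrite size_cat natrD mulrDr.
have := d_block sh; have := ler_wpM2l E1_ge0 (size_block s); lra.
Qed.

Lemma size_blocks L : L != [::] -> h <= (size (blocks B L))%:R.
Proof. by case: L => // s L _; rewrite blocks_cons; apply: le_trans (size_block s) _; rewrite ler_nat [leqRHS]size_cat leq_addr. Qed.

(** A prefix consists of whole blocks followed by a piece of one block. Only that last piece costs
    [H], so the additive constant does not grow with the level. *)
Lemma d_prefix_blocks L P Q : short L ->
  (forall P Q, B = P ++ Q -> d P <= E1 * (size P)%:R + H) ->
  blocks B L = P ++ Q -> d P <= E1 * (size P)%:R + H.
Proof.
move=> sL hB; elim: L P sL => [|s L IH] P /=.
  case: P => // _ _; rewrite mulr0 add0r; exact: le_trans d_nil _.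
move=> /andP[sh sL]; rewrite blocks_cons => /cat_split [[w [-> /(IH _ sL) hw]]|[w [e _]]].
  apply: le_trans (d_cat _ _) _; rewrite size_cat natrD mulrDr.
  have := d_block sh; have := ler_wpM2l E1_ge0 (size_block s); lra.
have [[z [-> /cat_nseq [a [b [-> _ ab]]]]]|[z [/hB //]]] := cat_split e.
have ah : (a%:R : R) <= eps * h by apply: le_trans sh; rewrite ler_nat -ab leq_addr.
have h1 := d_cat B (nseq a true); have h2 := d_size (nseq a true); rewrite size_nseq in h2.
have h3 : C0 * a%:R <= C0 * (eps * h) by exact: ler_wpM2l.
have h4 := ler_wpM2l E1_ge0 (size_block a).
move: h1 h2 h3 h4 c_small dB eh0 H0; set x := eps * h; have -> : E1 * h = C0 * x + 3 * x by rewrite /x; ring.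
lra.
Qed.

(** A suffix may be shorter than the spacers that end it, and then its statistics are bad; the final
    run is therefore split off, with a bound on its length. *)
Definition tail_decomposition (tau : R) S :=
  exists A t, [/\ S = A ++ nseq t true, (t%:R : R) <= tau & d A <= E2 * (size S)%:R + H].

(** If a whole block follows, its length dominates the run of spacers, which is absorbed into the
    density; otherwise the run is merely lengthened by the spacers of the last block. *)
Lemma suffix_blocks L P S : short L ->
  (forall P S, B = P ++ S -> tail_decomposition (2 * eps * h) S) ->
  blocks B L = P ++ S -> tail_decomposition (3 * eps * h) S.
Proof.
have E20 : 0 <= E2 by rewrite mulr_ge0 // addr_ge0 // mulr_ge0.
move=> sL hB; elim: L P sL => [|s L IH] P /=.
  case: P => //; case: S => // _ _; exists [::], 0%N; split => //; first by rewrite mulr_ge0 ?mulr_ge0.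
  by rewrite mulr0 add0r (le_trans d_nil).
move=> /andP[sh sL]; rewrite blocks_cons => /cat_split [[w [_ /(IH _ sL)]] //|[w [e ->]]].
have app (A0 S0 : seq bool) t : (t%:R : R) <= 3 * eps * h -> S0 = A0 ++ nseq t true -> d A0 <= E2 * (size S0)%:R + H ->
    tail_decomposition (3 * eps * h) (S0 ++ blocks B L).
  move=> th S0E dA; have [->|Ln] := eqVneq L [::]; first by exists A0, t; rewrite cats0.
  exists (S0 ++ blocks B L), 0%N; split; rewrite ?cats0 //; first by rewrite mulr_ge0 ?mulr_ge0.
  have h1 := d_cat S0 (blocks B L); have h2 := d_blocks sL.
  have h3 := d_cat A0 (nseq t true); rewrite -S0E in h3.
  have h4 := d_size (nseq t true); rewrite size_nseq in h4.
  have h5 : C0 * t%:R <= C0 * (3 * eps * h) by exact: ler_wpM2l.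
  have h6 := ler_wpM2l eps0 (size_blocks Ln).
  rewrite size_cat natrD mulrDr; set z := (size (blocks B L))%:R in h2 h6 *; set y := E2 * _ in dA *.
  move: h5 h6; have -> : C0 * (3 * eps * h) = 3 * (C0 * (eps * h)) by ring.
  have -> : E2 * z = E1 * z + 3 * (C0 * (eps * z)) + 3 * (eps * z) by ring.
  move=> h5 h6; have h7 := ler_wpM2l C0_ge0 h6; move: h1 h2 h3 h4 h5 h6 h7 c_small dA.
  move: eh0; set x := eps * h; set x' := eps * z; lra.
have [[z [_ /cat_nseq [a [b [_ -> ab]]]]]|[z [/hB [A0 [t0 [-> t0h dA]]] ->]]] := cat_split e.
  apply: (app [::] _ b) => //.
    apply: le_trans (_ : (s%:R : R) <= _); first by rewrite ler_nat -ab leq_addl.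
    by apply: le_trans sh _; rewrite -mulrA; move: eh0; lra.
  by apply: le_trans d_nil _; rewrite addr_ge0 // mulr_ge0.
apply: (app A0 _ (t0 + s)%N) => //.
- by rewrite natrD; move: t0h sh; rewrite -!mulrA; lra.
- by rewrite -catA nseqD.
- apply: le_trans dA _; rewrite lerD2r; apply: ler_wpM2l => //; by rewrite ler_nat [leqRHS]size_cat leq_addr.
Qed.

(* Only a run of spacers in the middle of a word can spoil its statistics. *)
Definition decomposition (K1 : R) u :=
  exists A t D, u = A ++ nseq t true ++ D /\ d A + d D <= E2 * (size u)%:R + K1.

(** A subword starting in one block and reaching the next ones is a suffix followed by a prefix, and
    the run ending the suffix becomes the middle run. Otherwise it lies in one block, up to its
    spacers. *)
Lemma infix_blocks L P u Q : short L ->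
  (forall P Q, B = P ++ Q -> d P <= E1 * (size P)%:R + H) ->
  (forall P S, B = P ++ S -> tail_decomposition (2 * eps * h) S) ->
  (forall P u Q, B = P ++ u ++ Q -> decomposition (2 * H) u) ->
  blocks B L = P ++ u ++ Q -> decomposition (2 * H) u.
Proof.
have E20 : 0 <= E2 by rewrite mulr_ge0 // addr_ge0 // mulr_ge0.
have E12 : E1 <= E2.
  by apply: ler_wpM2r => //; move: C0_ge0; lra.
move=> sL hP hS hI; elim: L P sL => [|s L IH] P /=.
  case: P => //; case: u => // _ _; exists [::], 0%N, [::]; split => //.
  by rewrite mulr0 add0r (le_trans (lerD d_nil d_nil)) // add0r mulr_ge0.
move=> /andP[sh sL]; rewrite blocks_cons => /cat_split [[w [_ /(IH _ sL)]] //|[w [e ew]]].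
have fin (A0 S0 D : seq bool) t : S0 = A0 ++ nseq t true -> d A0 <= E2 * (size S0)%:R + H ->
    d D <= E1 * (size D)%:R + H -> decomposition (2 * H) (S0 ++ D).
  move=> -> dA dD; exists A0, t, D; split; first by rewrite catA.
  rewrite [size (_ ++ D)]size_cat natrD mulrDr; have := ler_wpM2r (ler0n R (size D)) E12; lra.
have suf (s' : nat) (S0 D : seq bool) : (exists P, B ++ nseq s' true = P ++ S0) -> d D <= E1 * (size D)%:R + H ->
    decomposition (2 * H) (S0 ++ D).
  move=> [P' /cat_split [[z [_ /cat_nseq [a [b [_ -> ab]]]]]|[z [/hS [A0 [t0 [-> t0h dA]]] ->]]]] dD.
    apply: (fin [::] _ _ b) => //.
    by apply: le_trans d_nil _; rewrite addr_ge0 // mulr_ge0.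
  apply: (fin A0 _ _ (t0 + s')%N) => //; first by rewrite -catA nseqD.
  by apply: le_trans dA _; rewrite lerD2r; apply: ler_wpM2l => //; rewrite ler_nat [leqRHS]size_cat leq_addr.
have [[z [uE /(d_prefix_blocks sL hP) dz]]|[z [wE _]]] := cat_split (esym ew).
  by rewrite uE; apply: (suf s) => //; exists P.
move: e; rewrite wE catA => /cat_split [[y [Pu /cat_nseq [a [b [ya _ _]]]]]|[y [e2 _]]]; last first.
  by apply: (hI P _ y); rewrite e2 catA.
rewrite -[u]cats0; apply: (suf a); first by exists P; rewrite Pu ya.
by rewrite mulr0 add0r (le_trans d_nil).
Qed.

End Level.

Variables (p : nat -> nat) (s : nat -> nat -> nat) (k : nat) (eps : R).
Local Notation B := (Bword p s).
Hypothesis p2 : forall n, (1 <= n)%N -> (2 <= p n)%N.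
Hypothesis eps0 : 0 <= eps.
Hypothesis c_small : c <= eps * (size (B k))%:R.
Hypothesis d_Bword : forall m, (k <= m)%N -> d (B m) <= eps * (size (B m))%:R.
Hypothesis s_small : forall m i, (k <= m)%N -> (i < p m.+1)%N -> ((s m.+1 i)%:R : R) <= eps * (size (B m))%:R.

Lemma short_spacers m : (k <= m)%N -> short (B m) eps [seq s m.+1 i | i <- iota 0 (p m.+1)].
Proof.
move=> km; apply/allP => _ /mapP[i + ->]; rewrite mem_iota /= add0n => ip; exact: s_small.
Qed.

Local Notation H := (C0 * (size (B k))%:R).
Local Notation E1 := ((C0 + 3) * eps).
Local Notation E2 := ((4 * C0 + 6) * eps).

Let H0 : 0 <= H. Proof. exact: mulr_ge0. Qed.

Let c_small_m m : (k <= m)%N -> c <= eps * (size (B m))%:R.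
Proof. by move=> km; apply: le_trans c_small _; rewrite ler_wpM2l // ler_nat (size_Bword_mono s p2). Qed.

Let E1_0 : 0 <= E1. Proof. by rewrite mulr_ge0 // addr_ge0. Qed.
Let E2_0 : 0 <= E2. Proof. by rewrite mulr_ge0 // addr_ge0 // mulr_ge0. Qed.

Let d_short u : (size u <= size (B k))%N -> d u <= H.
Proof. by move=> h; apply: le_trans (d_size u) _; rewrite ler_wpM2l // ler_nat. Qed.

Lemma d_prefix m : (k <= m)%N -> forall P Q, B m = P ++ Q -> d P <= E1 * (size P)%:R + H.
Proof.
move=> /subnK <-; elim: (m - k)%N => [|j IH] P Q.
  rewrite add0n => e; apply: le_trans (d_short (u := P) _) _; first by rewrite e size_cat leq_addr.
  by rewrite lerDr mulr_ge0.
have kj : (k <= j + k)%N by exact: leq_addl.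
rewrite addSn BwordS; apply: d_prefix_blocks => //; [exact: c_small_m|exact: d_Bword|exact: short_spacers].
Qed.

(** One more run of spacers takes the tail from [2 * eps * h] to [3 * eps * h]; as the heights at
    least double, this is again below [2 * eps] times the next height. *)
Lemma d_suffix m : (k <= m)%N -> forall P S, B m = P ++ S -> tail_decomposition eps H (2 * eps * (size (B m))%:R) S.
Proof.
move=> /subnK <-; elim: (m - k)%N => [|j IH] P S.
  rewrite add0n => e; exists S, 0%N; split; rewrite ?cats0 //; first by rewrite mulr_ge0 ?mulr_ge0.
  apply: le_trans (d_short (u := S) _) _; first by rewrite e size_cat leq_addl.
  by rewrite lerDr mulr_ge0.
have kj : (k <= j + k)%N by exact: leq_addl.
rewrite addSn => e; have [||||||A [t [SE th dA]]] := @suffix_blocks (B (j + k)) eps H eps0 _ _ _ [seq s (j + k).+1 i | i <- iota 0 (p (j + k).+1)] P S.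
- exact: c_small_m.
- exact: d_Bword.
- exact: H0.
- exact: short_spacers.
- exact: IH.
- by rewrite -BwordS.
exists A, t; split => //; apply: le_trans th _.
have := size_BwordS s (j + k) p2; rewrite -(ler_nat R) natrM => h.
have := ler_wpM2l eps0 h; have : 0 <= eps * (size (B (j + k)))%:R by exact: mulr_ge0.
lra.
Qed.

Theorem infix_decomposition m P u Q : B m = P ++ u ++ Q -> decomposition eps (2 * H) u.
Proof.
have sm (v : seq bool) : (size v <= size (B k))%N -> decomposition eps (2 * H) v.
  move=> h; exists v, 0%N, [::]; split; first by rewrite /= cats0.
  have := d_short h; have := d_nil; have : 0 <= E2 * (size v)%:R by exact: mulr_ge0.
  have := H0; lra.
have [km|/ltnW mk] := leqP k m; last first.
  move=> e; apply: sm; apply: leq_trans (size_Bword_mono s p2 mk).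
  by rewrite e !size_cat; lia.
move: km P u Q => /subnK <-; elim: (m - k)%N => [|j IH] P u Q.
  by rewrite add0n => e; apply: sm; rewrite e !size_cat; lia.
have kj : (k <= j + k)%N by exact: leq_addl.
rewrite addSn BwordS; apply: infix_blocks => //.
- exact: c_small_m.
- exact: d_Bword.
- exact: short_spacers.
- exact: d_prefix.
- exact: d_suffix.
Qed.

End Blocks.

(** * Occurrence counts and windows with good statistics *)

Section Occurrences.
Variable R : realType.
Implicit Types (u v w : seq bool).

Definition occurs_at w u i : bool := take (size w) (drop i u) == w.

Lemma occurs_at_size w u i : (0 < size w)%N -> (size u < i + size w)%N -> occurs_at w u i = false.
Proof.
move=> w0 h; have hh : (size u - i < size w)%N by lia.
apply/negP => /eqP e; have : (size (take (size w) (drop i u)) <= size u - i)%N by rewrite size_take_min size_drop geq_minr.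
by rewrite e leqNgt hh.
Qed.

Lemma occE w u : (0 < size w)%N -> (occ w u)%:R = \sum_(0 <= i < size u) (occurs_at w u i)%:R :> R.
Proof.
move=> w0; rewrite /occ; set n := ((size u).+1 - size w)%N.
have nu : (n <= size u)%N by rewrite /n; lia.
rewrite (@big_cat_nat _ _ _ n) //= [X in _ + X]big_nat [X in _ + X]big1 ?addr0; last first.
  by move=> i /andP[ni _]; rewrite occurs_at_size //; rewrite /n in ni; lia.
rewrite /index_iota subn0 -natr_sum; congr _%:R.
by elim: (iota 0 n) => [|i t IH]; rewrite ?big_nil // big_cons -IH.
Qed.

Lemma sum_tail_le n r : \sum_(0 <= i < n) ((n < i + r)%N%:R : R) <= r%:R.
Proof.
rewrite (@big_cat_nat _ _ _ (n - r)) ?leq_subr //= [X in X + _]big_nat [X in X + _]big1 ?add0r; last first.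
  by move=> i /andP[_ h]; have -> : (n < i + r)%N = false by lia.
apply: le_trans (_ : \sum_(n - r <= i < n) 1 <= _).
  by apply: ler_sum => i _; rewrite lern1 leq_b1.
rewrite sumr_const_nat ler_nat; lia.
Qed.

Lemma occ_cat w u v : (0 < size w)%N ->
  `|(occ w (u ++ v))%:R - ((occ w u)%:R + (occ w v)%:R)| <= (size w)%:R :> R.
Proof.
move=> w0; rewrite !occE // size_cat (@big_cat_nat _ _ _ (size u)) ?leq_addr //=.
have -> : \sum_(size u <= i < size u + size v) ((occurs_at w (u ++ v) i)%:R : R) = \sum_(0 <= i < size v) (occurs_at w v i)%:R.
  rewrite -{1}[size u]add0n big_addn addKn; apply: eq_bigr => i _.
  by rewrite /occurs_at drop_cat ltnNge leq_addl /= addnK.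
set X := \sum_(0 <= i < size v) _; have -> (a b : R) : a + X - (b + X) = a - b by ring.
rewrite -sumrB; apply: le_trans (ler_norm_sum _ _ _) _; apply: le_trans (sum_tail_le (size u) (size w)).
rewrite big_nat [leRHS]big_nat; apply: ler_sum => i /andP[_ iu].
case: ltnP => h; last first.
  rewrite /occurs_at drop_cat iu take_cat size_drop; case: ltnP => h2; first by rewrite subrr normr0.
  have -> : (size w - (size u - i) = 0)%N by lia.
  by rewrite take0 cats0 take_oversize ?size_drop // subrr normr0.
by case: (occurs_at _ _ _); case: (occurs_at _ _ _); rewrite ?subrr ?subr0 ?sub0r ?normrN ?normr0 ?normr1.
Qed.

Variable mu : probability XM R.
Variable r : nat.
Hypothesis r0 : (0 < r)%N.

Definition word_freq (w : r.-tuple bool) : R := fine (mu (cyl w 0)).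

Lemma word_freq01 (w : r.-tuple bool) : 0 <= word_freq w <= 1.
Proof.
rewrite /word_freq fine_ge0 //= -lee_fin fineK ?probability_le1 //; first by apply: measurable_cyl.
by apply: fin_num_measure; exact: measurable_cyl.
Qed.

Definition disc u : R := \sum_(w : r.-tuple bool) `|(occ w u)%:R - word_freq w * (size u)%:R|.

Definition nwords : R := #|{: r.-tuple bool}|%:R.

Lemma disc_cat u v : disc (u ++ v) <= disc u + disc v + nwords * r%:R.
Proof.
rewrite /disc /nwords mulr_natl -sumr_const -!big_split /=; apply: ler_sum => w _.
have := @occ_cat w u v; rewrite size_tuple => /(_ r0); rewrite size_cat natrD.
move: (occ w (u ++ v))%:R (occ w u)%:R (occ w v)%:R (word_freq w) => a b c f h.
have -> : a - f * ((size u)%:R + (size v)%:R) = (b - f * (size u)%:R) + (c - f * (size v)%:R) + (a - (b + c)) by ring.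
apply: le_trans (ler_normD _ _) _; apply: lerD => //; exact: ler_normD.
Qed.

Lemma disc_size u : disc u <= nwords * (size u)%:R.
Proof.
rewrite /disc /nwords mulr_natl -sumr_const; apply: ler_sum => w _.
have : (occ w u)%:R <= (size u)%:R :> R.
  rewrite occE ?size_tuple //; apply: le_trans (_ : \sum_(0 <= i < size u) 1 <= _).
    by apply: ler_sum => i _; rewrite lern1 leq_b1.
  by rewrite sumr_const_nat subn0.
have : 0 <= (occ w u)%:R :> R by exact: ler0n.
have /andP[f0 f1] := word_freq01 w; have := ler_wpM2r (ler0n R (size u)) f1; rewrite mul1r.
have := mulr_ge0 f0 (ler0n R (size u)); move: (word_freq w * _) => x.
rewrite ler_norml; lra.
Qed.

Lemma disc_ge0 u : 0 <= disc u. Proof. exact: sumr_ge0. Qed.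

Lemma nwords_ge0 : 0 <= nwords. Proof. exact: ler0n. Qed.

Variables (p : nat -> nat) (s : nat -> nat -> nat).
Hypothesis mu_rank_one : is_rank_one_measure p s mu.
Local Notation B := (Bword p s).

Lemma disc_Bword (e : R) : 0 < e -> (forall n, (1 <= n)%N -> (2 <= p n)%N) ->
  exists k, forall m, (k <= m)%N -> disc (B m) <= e * (size (B m))%:R.
Proof.
move=> e0 p2; have N0 : 0 < nwords + 1 by rewrite ltr_wpDl ?nwords_ge0.
have ex (w : r.-tuple bool) : exists k, forall m, (k <= m)%N -> `|freq R w (B m) - word_freq w| <= e / (nwords + 1).
  have [_ [_ /(_ w) cv]] := mu_rank_one.
  have fin : mu (cyl w 0) \is a fin_num by apply: fin_num_measure; exact: measurable_cyl.
  rewrite -(fineK fin) in cv; have /fine_cvgP[_ /cvgrPdist_le /(_ _ (divr_gt0 e0 N0)) [k _ hk]] := cv.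
  by exists k => m km; rewrite distrC; exact: hk.
have [k hk] := boolp.choice ex; exists (\max_(w : r.-tuple bool) k w) => m km.
have Bm : 0 < (size (B m))%:R :> R by rewrite ltr0n (leq_ltn_trans _ (size_Bword_gt s m p2)).
apply: le_trans (_ : \sum_(w : r.-tuple bool) e / (nwords + 1) * (size (B m))%:R <= _).
  apply: ler_sum => w _; rewrite -ler_pdivrMr // -[X in _ / X](ger0_norm (ltW Bm)) -normfV -normrM.
  rewrite mulrBl mulfK ?gt_eqF //; apply: hk; apply: leq_trans km; exact: leq_bigmax.
rewrite sumr_const -[_ *+ _]mulr_natl -/nwords mulrA ler_wpM2r // mulrCA -[leRHS]mulr1 ler_wpM2l ?ltW //.
by rewrite ltr_pdivrMr // mul1r ltrDl.
Qed.

Lemma size_subword x a n : size (subword x a n) = n.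
Proof. by rewrite size_map size_iota. Qed.

Lemma nth_subword x a n i : (i < n)%N -> nth false (subword x a n) i = x (a + i%:Z).
Proof. by move=> h; rewrite (nth_map 0%N) ?size_iota // nth_iota. Qed.

Lemma subwordD x a m n : subword x a (m + n) = subword x a m ++ subword x (a + m%:Z) n.
Proof.
rewrite /subword iotaD map_cat; congr (_ ++ _); rewrite add0n -[m in iota m n]addn0 iotaDl -map_comp.
by apply: eq_map => i /=; rewrite PoszD addrA.
Qed.

(** The constant [H] is a multiple of the length of one fixed word [B k], hence uniform in the
    point, the position and the length of the window. *)
Theorem good_windows (e : R) : 0 < e -> reasonable_rank_one R p s ->
  exists H, forall x, Omega p s x -> forall a L, exists t1 t2, [/\ (t1 <= t2)%N, (t2 <= L)%N,
    forall l, (t1 <= l)%N -> (l < t2)%N -> x (a + l%:Z) = true,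
    disc (subword x a t1) <= e * L%:R + H & disc (subword x (a + t2%:Z) (L - t2)) <= e * L%:R + H].
Proof.
move=> e0 [p2 [_ short]]; have n0 := nwords_ge0.
have C1 : 0 < 4 * nwords + 6 by rewrite ltr_wpDl // mulr_ge0.
(* The loss factor in [infix_decomposition] is [4 * C0 + 6], with [C0 = nwords] for [disc]. Below,
   [k] is also taken so large that the boundary cost [nwords * r] is at most [eps] times the length
   of [B k]. *)
pose eps := e / (4 * nwords + 6); have eps0 : 0 < eps by rewrite divr_gt0.
have [k1 hk1] := disc_Bword eps0 p2; have [k2 hk2] := short eps eps0.
pose k := maxn (maxn k1 k2) (Num.trunc (nwords * r%:R / eps)).+1.
have k1k : (k1 <= k)%N by rewrite /k; lia.
have k2k : (k2 <= k)%N by rewrite /k; lia.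
exists (2 * (nwords * (size (B k))%:R)) => x Ox a L; have [m /infixP[P [Q e1]]] := Ox a L.
have c_small : nwords * r%:R <= eps * (size (B k))%:R.
  rewrite -ler_pdivrMl // mulrC ltW //; apply: lt_le_trans (truncnS_gt _) _.
  rewrite ler_nat; apply: leq_trans (ltnW (size_Bword_gt s k p2)); exact: leq_maxr.
have sm j i : (k <= j)%N -> (i < p j.+1)%N -> (s j.+1 i)%:R <= eps * (size (B j))%:R.
  move=> kj ip; apply: le_trans (hk2 j.+1 _ _) => //; last by lia.
  by rewrite ler_nat (leq_bigmax (Ordinal ip)).
have [A [t [D [uE dd]]]] := infix_decomposition n0 disc_cat disc_size p2 (ltW eps0) c_small
  (fun j kj => hk1 j (leq_trans k1k kj)) sm e1.
rewrite size_subword /eps mulrCA divff ?gt_eqF // mulr1 in dd.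
have sz := congr1 size uE; rewrite size_subword !size_cat size_nseq in sz.
have LE : L = (size A + (t + size D))%N by lia.
move: uE; rewrite LE subwordD subwordD => /eqP; rewrite eqseq_cat ?size_subword // => /andP[/eqP uA].
rewrite eqseq_cat ?size_subword ?size_nseq // => /andP[/eqP ut /eqP uD].
rewrite -LE; exists (size A), (size A + t)%N; split; [exact: leq_addr|lia| | |].
- move=> l l1 l2; have := nth_subword x (a + (size A)%:Z) (i := l - size A) (n := t).
  rewrite ut nth_nseq => h; have lt : (l - size A < t)%N by lia.
  have := h lt; rewrite lt => ->; congr x; lia.
- by rewrite uA; have := disc_ge0 D; lra.
- have -> : (L - (size A + t) = size D)%N by lia.
  have -> : a + (size A + t)%N%:Z = a + (size A)%:Z + t%:Z by rewrite PoszD addrA.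
  by rewrite uD; have := disc_ge0 A; lra.
Qed.

Definition cyl_at x w (a : int) : R := \1_(cyl w a) x.

Lemma occ_subword x a n (w : r.-tuple bool) :
  `|(occ w (subword x a n))%:R - \sum_(0 <= i < n) cyl_at x w (a + i%:Z)| <= r%:R.
Proof.
rewrite occE ?size_tuple //.
rewrite -sumrB; apply: le_trans (ler_norm_sum _ _ _) _.
apply: le_trans (sum_tail_le n r); rewrite big_nat [leRHS]big_nat; apply: ler_sum => i /andP[_ iu].
rewrite /cyl_at indicE; case: ltnP => h; last first.
  suff -> : occurs_at w (subword x a n) i = (x \in cyl w (a + i%:Z)) by rewrite subrr normr0.
  rewrite /occurs_at; apply/eqP/idP; rewrite ?inE => hw.
    move=> j jw; rewrite -[in RHS]hw size_tuple nth_take -?(size_tuple w) // nth_drop nth_subword.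
      by congr x; lia.
    by rewrite size_tuple in jw; lia.
  apply: (@eq_from_nth _ false); first by rewrite size_take size_drop size_subword size_tuple; case: ltnP; lia.
  move=> j; rewrite size_take size_drop size_subword size_tuple => jr.
  have {}jr : (j < r)%N by move: jr; case: (ltnP r (n - i)) => h1 h2 //; exact: leq_trans h2 h1.
  rewrite nth_take // nth_drop nth_subword ?(leq_trans _ h) ?ltn_add2l //.
  by rewrite -hw ?size_tuple //; congr x; lia.
by case: (occurs_at _ _ _); case: (_ \in _); rewrite ?subrr ?subr0 ?sub0r ?normrN ?normr0 ?normr1.
Qed.

Lemma cyl_count x a n (w : r.-tuple bool) :
  `|\sum_(0 <= i < n) cyl_at x w (a + i%:Z) - word_freq w * n%:R| <= disc (subword x a n) + r%:R.
Proof.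
have h1 := occ_subword x a n w.
have h2 : `|(occ w (subword x a n))%:R - word_freq w * n%:R| <= disc (subword x a n).
  rewrite /disc (bigD1 w) //= size_subword lerDl; exact: sumr_ge0.
set S := \sum_(0 <= i < n) _ in h1 *; set o := (occ w _)%:R in h1 h2.
have -> : S - word_freq w * n%:R = - (o - S) + (o - word_freq w * n%:R) by ring.
by apply: le_trans (ler_normD _ _) _; rewrite normrN addrC; exact: lerD.
Qed.

End Occurrences.

(** * Averages along orbits *)

Lemma iter_shiftE (x : X) l (j : int) : iter l Defs.shift x j = x (j + l%:Z).
Proof.
elim: l j => [|l IH] j; first by rewrite addr0.
by rewrite iterS /Defs.shift IH; congr x; lia.
Qed.

Section LocalFunctions.
Variables (R : realType) (mu : probability XM R) (K : nat).
Hypothesis mu_inv : forall A : set XM, measurable A -> mu (Defs.shift @^-1` A) = mu A.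
Hypothesis K0 : (0 < K)%N.
Local Notation T := (Ttil K).
Implicit Types (G : Xt -> R) (x : X).

Definition local (r : nat) G := forall i x x', (forall j : int, `|j| <= r%:Z -> x j = x' j) -> G (x, i) = G (x', i).

Lemma local_mono r r' G : (r <= r')%N -> local r G -> local r' G.
Proof. by move=> rr h i x x' e; apply: h => j jr; apply: e; apply: le_trans jr _. Qed.

Lemma local_T r G : local r G -> local r.+1 (fun y => G (T y)).
Proof.
move=> h i x x' e; rewrite /Ttil /=; case: ltnP => _; apply: h => j jr; first by apply: e; lia.
by apply: e; lia.
Qed.

Lemma local_iter r n G : local r G -> local (r + n) (fun y => G (iter n T y)).
Proof.
move=> h; elim: n => [|n IH]; first by rewrite addn0.
have -> : (fun y => G (iter n.+1 T y)) = (fun y => (fun z => G (iter n T z)) (T y)).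
  by apply/funext => y; rewrite iterSr.
by rewrite addnS; exact: (local_T IH).
Qed.

Lemma local_symcomb r q F (al : nat -> R) k : local r F -> local (r + q * k.*2) (symcomb K q F al k).
Proof.
move=> h i x x' e; rewrite !symcombE; apply: eq_bigr => n _; congr (_ * _); have nk := ltn_ord n.
have rd a : (a <= k.*2)%N -> F (iter (q * a) T (x, i)) = F (iter (q * a) T (x', i)).
  move=> ak; apply: (local_iter (n := q * a) h) => j jr; apply: e; apply: le_trans jr _.
  by rewrite lez_nat leq_add2l leq_mul2l ak orbT.
by congr (_ + _); apply: rd; rewrite -addnn; lia.
Qed.

Lemma symcomb_bound q F (al : nat -> R) k y : (forall y, `|F y| <= 1) -> `|symcomb K q F al k y| <= \sum_(n < k) `|al n|.
Proof.
move=> F1; rewrite symcombE; apply: le_trans (ler_norm_sum _ _ _) _; apply: ler_sum => n _.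
rewrite normrM normrM [`|2^-1|]ger0_norm ?invr_ge0 // -mulrA -[leRHS]mulr1 ler_wpM2l //.
rewrite ler_pdivrMl // mulr1; apply: le_trans (ler_normD _ _) _.
by have := F1 (iter (q * (k + n)) T y); have := F1 (iter (q * (k - n)) T y); lra.
Qed.

Lemma local_slicefun w m j : local (absz m + size w) (slicefun mu (cyl w m) j).
Proof.
move=> i x x' e; rewrite /slicefun /= !indicE; suff -> : (x \in cyl w m) = (x' \in cyl w m) by [].
by apply/idP/idP; rewrite !inE => h k kw; [rewrite -e|rewrite e]; rewrite ?h //; lia.
Qed.

Section Averages.
Variables (r : nat) (G : Xt -> R) (M : R).
Hypothesis G_local : local r G.
Hypothesis G_le : forall y, `|G y| <= M.
Local Notation r2 := (r.*2.+1).

(** Coordinates outside the window receive arbitrary values, through [absz] and the default of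
    [nth]; a function of radius [r] does not see them. *)
Definition window_value (i : nat) (w : r2.-tuple bool) : R :=
  G ((fun j : int => nth false w (absz (j + r%:Z))), i).

Lemma local_expand i x (l : nat) : G (iter l Defs.shift x, i) =
  \sum_(w : r2.-tuple bool) window_value i w * cyl_at R x w (l%:Z - r%:Z).
Proof.
have sz : size (subword x (l%:Z - r%:Z) r2) == r2 by rewrite size_subword.
pose w0 : r2.-tuple bool := Tuple sz.
rewrite (bigD1 w0) //= big1 ?addr0 => [|w /negP ww0].
  rewrite /cyl_at indicE mem_set ?mulr1 => [|j /=].
    apply: G_local => j jr; rewrite iter_shiftE /= nth_subword; last by rewrite -addnn; lia.
    by congr x; lia.
  by rewrite size_map size_iota => jr; rewrite nth_subword.
rewrite /cyl_at indicE memNset ?mulr0 // => h; apply: ww0; apply/eqP/val_inj => /=.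
apply: (@eq_from_nth _ false); rewrite size_tuple ?size_subword // => j jr.
by rewrite nth_subword // -(h j) ?size_tuple.
Qed.

Lemma mu_cyl w (r' : nat) : mu (cyl w (- r'%:Z)) = mu (cyl w 0).
Proof.
have [_ <-] := measurable_iter_shift mu_inv r' (measurable_cyl w (- r'%:Z)); congr (mu _).
apply/seteqP; split => x /= h j jw; have := h j jw; rewrite iter_shiftE => <-; congr x; lia.
Qed.

Lemma integral_local i : \int[mu]_x G (x, i) = \sum_(w : r2.-tuple bool) window_value i w * word_freq mu w.
Proof.
have indI (w : r2.-tuple bool) : mu.-integrable setT (EFin \o (\1_(cyl w (- r%:Z)) : XM -> R)).
  by apply: integrable_indic => //; exact: measurable_cyl.
have I (w : r2.-tuple bool) : mu.-integrable setT (EFin \o (fun x : XM => window_value i w * \1_(cyl w (- r%:Z)) x)).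
  have h := indI w; by apply: (integrableZl measurableT (window_value i w) h).
rewrite /Rintegral (eq_integral (fun x : XM => \sum_(w : r2.-tuple bool) (window_value i w * \1_(cyl w (- r%:Z)%R) x)%R%:E)%E); last first.
  move=> x _; rewrite sumEFin; congr EFin; rewrite -[x in LHS]/(iter 0 Defs.shift x) local_expand.
  by apply: eq_bigr => w _; rewrite sub0r.
rewrite integral_sum //.
transitivity (fine (\sum_(w : r2.-tuple bool) (window_value i w * word_freq mu w)%R%:E)%E); last by rewrite sumEFin.
congr fine; apply: eq_bigr => w _; rewrite -[LHS]fineK; last exact: (integrable_fin_num measurableT (I w)).
congr EFin; have := RintegralZl (window_value i w) measurableT (indI w).
rewrite /Rintegral => ->; congr (_ * _); rewrite integral_indic // ?setIT; last exact: measurable_cyl.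
by rewrite /word_freq; congr fine; exact: mu_cyl.
Qed.

Lemma local_average i x (t n : nat) :
  `|\sum_(0 <= l < n) G (iter (t + l) Defs.shift x, i) - n%:R * \int[mu]_x G (x, i)| <=
  M * nwords R r2 * (disc mu r2 (subword x (t%:Z - r%:Z) n) + r2%:R).
Proof.
have -> : \sum_(0 <= l < n) G (iter (t + l) Defs.shift x, i) =
    \sum_(w : r2.-tuple bool) window_value i w * \sum_(0 <= l < n) cyl_at R x w (t%:Z - r%:Z + l%:Z).
  under eq_bigr do rewrite local_expand; rewrite exchange_big /=; apply: eq_bigr => w _.
  rewrite mulr_sumr; apply: eq_bigr => l _; congr (_ * cyl_at _ _ _ _); lia.
rewrite integral_local mulr_sumr -sumrB; apply: le_trans (ler_norm_sum _ _ _) _.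
rewrite -mulrA mulrCA /nwords mulr_natl -sumr_const; apply: ler_sum => w _.
rewrite mulrCA -mulrBr normrM [n%:R * _]mulrC; apply: ler_pM => //; first exact: G_le.
exact: cyl_count.
Qed.

End Averages.

Lemma sum_tower_blocks (F : nat -> R) t1 t2 : (t1 <= t2)%N ->
  \sum_(K * t1 <= n < K * t2) F n = \sum_(i < K) \sum_(t1 <= l < t2) F (l * K + i)%N.
Proof.
move=> /subnKC <-; elim: (t2 - t1)%N => [|d IH].
  by rewrite addn0 big_geq // big1 // => i _; rewrite big_geq.
rewrite addnS (@big_cat_nat _ _ _ (K * (t1 + d))) /=; [|by rewrite leq_mul2l leq_addr orbT|by rewrite leq_mul2l leqnSn orbT].
rewrite IH; under [RHS]eq_bigr do rewrite big_nat_recr ?leq_addr //=.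
rewrite big_split /=; congr (_ + _); rewrite -{1}[(K * (t1 + d))%N]add0n big_addn mulnS addnK big_mkord.
by apply: eq_bigr => i _; congr F; lia.
Qed.

(** The times at which the base point of the orbit starting at level [i0] has been shifted at least
    [t1] and fewer than [t2] times; truncated subtraction is harmless for [n >= 0]. *)
Definition zone (i0 t1 t2 n : nat) : bool := (K * t1 - i0 <= n < K * t2 - i0)%N.

(** Extended to complete passages through the tower, the sum splits by levels. On each level it is
    an orbital average of the local function [G ^ 2], whose distance to the integral is controlled
    by the discrepancy. *)
Lemma zone_square_sum r G (M : R) x i0 t1 t2 : local r G -> (forall y, `|G y| <= M) -> L2 mu K G ->
  (i0 < K)%N -> (t1 <= t2)%N ->
  \sum_(K * t1 - i0 <= n < K * t2 - i0) G (iter n T (x, i0)) ^+ 2 <=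
  (K * (t2 - t1))%:R * ip mu K G G +
  K%:R * (M ^+ 2 * nwords R r.*2.+1 * (disc mu r.*2.+1 (subword x (t1%:Z - r%:Z) (t2 - t1)) + r.*2.+1%:R)).
Proof.
move=> Gl GM LG iK t12; pose G2 y := G y * G y.
have G2l : local r G2 by move=> i x1 x2 e; rewrite /G2 (Gl i x1 x2 e).
have G2M y : `|G2 y| <= M ^+ 2 by rewrite normrM expr2; apply: ler_pM.
pose F n := G2 (iter (n %/ K) Defs.shift x, (n %% K)%N).
have F0 n : 0 <= F n by rewrite /F /G2 -expr2 sqr_ge0.
apply: (@le_trans _ _ (\sum_(K * t1 <= n < K * t2) F n)).
  have -> : \sum_(K * t1 - i0 <= n < K * t2 - i0) G (iter n T (x, i0)) ^+ 2 = \sum_(K * t1 - i0 <= n < K * t2 - i0) F (n + i0)%N.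
    by apply: eq_bigr => n _; rewrite iter_Ttil // /F /G2 expr2.
  have [h|h] := leqP i0 (K * t2); last by rewrite [leLHS]big_geq ?sumr_ge0 // (eqP (ltnW h)).
  have -> : \sum_(K * t1 - i0 <= n < K * t2 - i0) F (n + i0)%N = \sum_(K * t1 - i0 + i0 <= n < K * t2) F n.
    by rewrite big_addn; congr bigop; rewrite addnK.
  have h2 : (K * t1 <= K * t1 - i0 + i0)%N by lia.
  have [h3|/ltnW h3] := leqP (K * t1 - i0 + i0) (K * t2); last by rewrite [leLHS]big_geq ?sumr_ge0.
  rewrite [leRHS](@big_cat_nat _ _ _ (K * t1 - i0 + i0)) //= lerDr; exact: sumr_ge0.
rewrite sum_tower_blocks // /ip /tint.
have -> : (K * (t2 - t1))%:R * (K%:R^-1 * \sum_(i < K) \int[mu]_x (G (x, i : nat) * G (x, i : nat))) =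
    \sum_(i < K) (t2 - t1)%:R * \int[mu]_x G2 (x, i : nat).
  by rewrite natrM -mulr_sumr [RHS]/=; field; rewrite pnatr_eq0 -lt0n.
have -> (c : R) : K%:R * c = \sum_(i < K) c by rewrite sumr_const card_ord mulr_natl.
rewrite -big_split /=; apply: ler_sum => i _.
have -> : \sum_(t1 <= l < t2) F (l * K + i)%N = \sum_(0 <= l < t2 - t1) G2 (iter (t1 + l) Defs.shift x, i : nat).
  rewrite -{1}[t1]add0n big_addn; apply: eq_bigr => l _.
  by rewrite /F divnMDl // divn_small // addn0 modnMDl modn_small // addnC.
by have := local_average G2l G2M i x t1 (t2 - t1); rewrite ler_norml; lra.
Qed.

End LocalFunctions.

(** * Cancellation along a zone with good statistics *)

Section ZoneCancellation.
Variables (R : realType) (mu : probability XM R) (K : nat).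
Hypothesis mu_inv : forall A : set XM, measurable A -> mu (Defs.shift @^-1` A) = mu A.
Hypothesis K0 : (0 < K)%N.
Local Notation T := (Ttil K).
Implicit Types f g : nat -> R.

Definition ceil_div (d n : nat) : nat := if n is n'.+1 then (n' %/ d).+1 else 0.

Lemma ceil_divP d n m : (0 < d)%N -> (n <= d * m)%N = (ceil_div d n <= m)%N.
Proof. by case: n => [|n] d0 //=; rewrite ltn_divLR // mulnC. Qed.

Lemma sum_sparse_le g d u v n0 n1 : (0 < d)%N -> (forall n, 0 <= g n) ->
  (forall m, (u <= m < v)%N -> (n0 <= d * m < n1)%N) ->
  \sum_(u <= m < v) g (d * m)%N <= \sum_(n0 <= n < n1) g n.
Proof.
move=> d0 g0 h; rewrite !big_geq_mkord big_mkcond [leRHS]big_mkcond /=.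
have if0 (b : bool) n : 0 <= (if b then g n else 0) by case: b.
apply: (@sum_reindex_le R v n1 (fun b n => n == d * b)%N (fun n => if (n0 <= n)%N then g n else 0)
  (fun b => if (u <= b)%N then g (d * b)%N else 0)) => //.
  by move=> n a b /eqP -> /eqP /eqP; rewrite eqn_pmul2l // => /eqP.
move=> b bv; case: ifP => [ub|_]; last by rewrite sumr_ge0 // => n _; rewrite mulr_ge0.
have /andP[h0 h1] := h b (introT andP (conj ub bv)).
by have := @sum_pick_le R n1 (fun n => if (n0 <= n)%N then g n else 0) (fun n => n == d * b)%N _ (fun n => if0 _ n) h1 (eqxx _); rewrite h0.
Qed.

Lemma symsum_orbit q F (al : nat -> R) k y m :
  symsum al k (fun m => F (iter (q * m) T y)) m = symcomb K q F al k (iter (q * m) T y).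
Proof.
rewrite symcombE /symsum; apply: eq_bigr => n _.
by rewrite -!iterD -!mulnDr ![(m + _)%N]addnC.
Qed.

(** The requirements that [p * m] and [q * m] lie in the zone define a single interval of [m], on
    which the correlation is an unrestricted sum. *)
Lemma sum_zone_product f p q n0 n1 M : (0 < p)%N -> (0 < q)%N ->
  let z n := f n * (n0 <= n < n1)%N%:R in
  exists u v, (forall m, (u <= m < v)%N -> (n0 <= p * m < n1)%N /\ (n0 <= q * m < n1)%N) /\ (v - u <= M)%N /\
  \sum_(1 <= m < M.+1) z (p * m)%N * z (q * m)%N = \sum_(u <= m < v) f (p * m)%N * f (q * m)%N.
Proof.
move=> p0 q0 z; pose u := maxn 1 (maxn (ceil_div p n0) (ceil_div q n0)).
pose v := minn M.+1 (minn (ceil_div p n1) (ceil_div q n1)).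
have cond m : (n0 <= p * m < n1)%N && (n0 <= q * m < n1)%N =
    (maxn (ceil_div p n0) (ceil_div q n0) <= m < minn (ceil_div p n1) (ceil_div q n1))%N.
  rewrite geq_max leq_min !ltnNge !ceil_divP //.
  by case: (ceil_div p n0 <= m)%N; case: (ceil_div q n0 <= m)%N; case: (ceil_div p n1 <= m)%N; case: (ceil_div q n1 <= m)%N.
exists u, v; split; last split; [|by rewrite /u /v; lia|].
  move=> m muv; apply/andP; rewrite cond; move: muv; rewrite /u /v; lia.
rewrite [RHS](big_nat_widenl _ 1) ?leq_maxl // [RHS](big_nat_widen _ _ M.+1) ?geq_minl // [RHS]big_mkcond /=.
apply: eq_big_nat => m /andP[m1 mM].
have -> : (u <= m)%N && (m < v)%N = (n0 <= p * m < n1)%N && (n0 <= q * m < n1)%N.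
  by rewrite cond /u /v geq_max leq_min m1 mM.
rewrite /z; case: (n0 <= p * m < n1)%N; case: (n0 <= q * m < n1)%N; rewrite ?mulr1 ?mulr0 ?mul0r //.
Qed.

(** Squares are nonnegative, so their sum along the multiples of [p] is at most the sum over all
    times of the zone; no statistics along progressions are needed. *)
Lemma pair_correlation (F : Xt -> R) y p q n0 n1 M (al : nat -> R) k (d Q : R) : (0 < p)%N -> (0 < q)%N -> 0 < d -> (0 < k)%N ->
  (forall y, `|F y| <= 1) ->
  let be n := (n == 0)%N%:R - al n in let z n := F (iter n T y) * (n0 <= n < n1)%N%:R in
  \sum_(n0 <= n < n1) symcomb K p F al k (iter n T y) ^+ 2 <= Q ->
  \sum_(n0 <= n < n1) symcomb K q F be k (iter n T y) ^+ 2 <= Q ->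
  `|\sum_(1 <= m < M.+1) z (p * m)%N * z (q * m)%N| <= d * M%:R + Q / d + 2 * k%:R * (1 + \sum_(n < k) `|al n|).
Proof.
move=> p0 q0 d0 k0 F1 be z Q1 Q2.
have [u [v [huv [uvM ->]]]] := sum_zone_product (fun n => F (iter n T y)) n0 n1 M p0 q0.
have := @correlation_bound R (fun m => F (iter (p * m) T y)) (fun m => F (iter (q * m) T y)) al k d u v d0 k0
  (fun m => F1 _) (fun m => F1 _).
move=> /le_trans; apply; rewrite lerD2r; apply: lerD; first by apply: ler_wpM2l; [exact: ltW|rewrite ler_nat].
have -> : Q / d = (Q + Q) / (2 * d) by field; rewrite gt_eqF.
apply: ler_wpM2r; first by rewrite invr_ge0 mulr_ge0 // ltW.
apply: lerD.
  apply: le_trans Q1; under eq_bigr do rewrite symsum_orbit.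
  by apply: (@sum_sparse_le (fun n => symcomb K p F al k (iter n T y) ^+ 2)) => // [n|m /huv []//]; exact: sqr_ge0.
apply: le_trans Q2; under eq_bigr do rewrite symsum_orbit.
by apply: (@sum_sparse_le (fun n => symcomb K q F be k (iter n T y) ^+ 2)) => // [n|m /huv []//]; exact: sqr_ge0.
Qed.

Lemma nat_pair_bound (h : nat -> nat -> nat) Y : exists r, forall p q, (p <= Y)%N -> (q <= Y)%N -> (h p q <= r)%N.
Proof.
exists (\sum_(p < Y.+1) \sum_(q < Y.+1) h p q)%N => p q pY qY.
rewrite (bigD1 (Ordinal (pY : (p < Y.+1)%N))) //= (bigD1 (Ordinal (qY : (q < Y.+1)%N))) //=.
by rewrite -addnA leq_addr.
Qed.

Lemma real_pair_bound (h : nat -> nat -> R) Y : exists2 r : R, 0 <= r & forall p q, (p <= Y)%N -> (q <= Y)%N -> h p q <= r.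
Proof.
have [r hr] := nat_pair_bound (fun p q => (Num.trunc `|h p q|).+1) Y; exists r%:R => // p q pY qY.
apply: le_trans (ler_norm _) _; apply: ltW; apply: lt_le_trans (truncnS_gt _) _.
by rewrite ler_nat; exact: hr.
Qed.

Hypothesis mixing : weakly_mixing mu.
Hypothesis singular : forall q1 q2 : nat, prime q1 -> prime q2 -> q1 != q2 ->
  forall nu1 nu2 : {measure set R -> \bar R},
  is_max_spectral_type mu K q1 nu1 -> is_max_spectral_type mu K q2 nu2 -> cont_parts_singular nu1 nu2.
Variables (w : seq bool) (m0 : int) (j : nat).
Hypothesis jK : (j < K)%N.
Local Notation F := (slicefun mu (cyl w m0) j).

(** The order of the quantifiers matters: [r] and [e] depend only on the finitely many pairs of
    primes up to [y], whereas [H] is produced by [good_windows] for these [r] and [e], and affects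
    only the threshold [N0]. *)
Theorem zone_cancellation (eps : R) : 0 < eps -> exists (r : nat) (e : R), [/\ 0 < e, (`|m0|%N + size w <= r)%N &
  forall H : R, exists N0 : nat, forall N x i0 t1 t2, (N0 <= N)%N -> (i0 < K)%N -> (t1 <= t2)%N ->
  (t2 <= ((N + i0) %/ K).+1)%N ->
  disc mu r.*2.+1 (subword x (t1%:Z - r%:Z) (t2 - t1)) <= e * ((N + i0) %/ K).+1%:R + H ->
  `|\sum_(1 <= n < N.+1) F (iter n T (x, i0)) * (zone K i0 t1 t2 n)%:R * (mobius n)%:~R| <= eps * N%:R].
Proof.
move=> eps0; have [y [dl [N1 [dl0 kbsz]]]] := katai_bourgain_sarnak_ziegler eps0.
have mC := measurable_cyl w m0; have F1 := slicefun_le1 mu mC j.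
have LF := @L2_slicefun R mu K (cyl w m0) mC j.
pose d := dl / 4; have d0 : 0 < d by rewrite divr_gt0.
pose e1 := d * dl / 8; have e10 : 0 < e1 by rewrite divr_gt0 // mulr_gt0.
pose be (al : nat -> R) n : R := (n == 0%N)%:R - al n.
have ex (pq : nat * nat) : exists ka : nat * (nat -> R), prime pq.1 -> prime pq.2 -> pq.1 != pq.2 ->
    [/\ (0 < ka.1)%N, ip mu K (symcomb K pq.1 F ka.2 ka.1) (symcomb K pq.1 F ka.2 ka.1) <= e1 &
      ip mu K (symcomb K pq.2 F (be ka.2) ka.1) (symcomb K pq.2 F (be ka.2) ka.1) <= e1].
  case: (pselect [/\ prime pq.1, prime pq.2 & pq.1 != pq.2]) => [[pp pr pqn]|no]; last first.
    by exists (0%N, fun=> 0) => h1 h2 h3; case: no.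
  have [k [al [/= h1 h2 h3]]] := small_combinations mu_inv K0 (singular pp pr pqn) LF (tint_slicefun mu mC jK)
    (acorr_slicefun_average mu_inv K0 mC mixing (prime_gt0 pp) jK)
    (acorr_slicefun_average mu_inv K0 mC mixing (prime_gt0 pr) jK) e10.
  by exists (k, al).
have [ka hka] := boolp.choice ex.
pose kk p q := (ka (p, q)).1; pose al p q := (ka (p, q)).2.
have [ra hra] := nat_pair_bound (fun p q => (p + q) * (kk p q).*2)%N y.
have [M M0 hM] := real_pair_bound (fun p q => 1 + \sum_(n < kk p q) `|al p q n|) y.
have [C0 C00 hC] := real_pair_bound (fun p q => 2 * (kk p q)%:R * (1 + \sum_(n < kk p q) `|al p q n|)) y.
(* Large enough for the cylinder and for all the combinations of its iterates attached to primes up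
   to [y]. *)
pose r := (`|m0|%N + size w + ra)%N.
pose W : R := K%:R * (M ^+ 2 * nwords R r.*2.+1).
have W0 : 0 <= W by rewrite mulr_ge0 // mulr_ge0 ?sqr_ge0 ?nwords_ge0.
have W1 : 0 < 8 * (W + 1) by rewrite mulr_gt0 // ltr_wpDl.
exists r, (d * dl / (8 * (W + 1))); split; [by rewrite divr_gt0 // mulr_gt0|exact: leq_addr|].
(* Collects everything that does not grow with [N]; the growing terms use only half of [dl * N]. *)
move=> H; pose cst := K%:R * dl / 4 + dl / 8 + W * (H + r.*2.+1%:R) / d + C0.
exists (maxn N1 (Num.trunc (2 * cst / dl)).+1) => N x i0 t1 t2 NN iK t12 t2L hd.
have N1N : (N1 <= N)%N by apply: leq_trans NN; exact: leq_maxl.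
have cN : cst <= dl / 2 * N%:R.
  have : 2 * cst / dl <= N%:R.
    by apply: ltW; apply: lt_le_trans (truncnS_gt _) _; rewrite ler_nat; apply: leq_trans NN; exact: leq_maxr.
  by rewrite ler_pdivrMr //; lra.
set L := ((N + i0) %/ K).+1 in t2L hd.
have KL : (K * L)%:R <= N%:R + 2 * K%:R :> R.
  rewrite -natrM -natrD ler_nat /L mulnS mulnC.
  apply: leq_trans (leq_add (leqnn K) (leq_trunc_div _ _)) _.
  by rewrite addnCA leq_add2l mul2n -addnn leq_add2l ltnW.
have LN : L%:R <= N%:R + 1 :> R.
  rewrite natr1 ler_nat /L ltnS -ltnS ltn_divLR // mulSn [(N + i0)%N]addnC -addSn.
  by rewrite leq_add // leq_pmulr.
pose Q := (K * L)%:R * e1 + W * (d * dl / (8 * (W + 1)) * L%:R + H + r.*2.+1%:R).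
have sq q b k : local r (symcomb K q F b k) -> (forall y, `|symcomb K q F b k y| <= M) ->
    ip mu K (symcomb K q F b k) (symcomb K q F b k) <= e1 ->
    \sum_(K * t1 - i0 <= n < K * t2 - i0) symcomb K q F b k (iter n T (x, i0)) ^+ 2 <= Q.
  move=> lg bg ig; have LG := L2_symcomb mu_inv K0 q LF b k.
  apply: le_trans (zone_square_sum mu_inv K0 x lg bg LG iK t12) _.
  apply: lerD.
    apply: ler_pM => //; first exact: ip_ge0.
    by rewrite ler_nat leq_mul2l (leq_trans (leq_subr _ _) t2L) orbT.
  by rewrite mulrA; apply: ler_wpM2l => //; rewrite lerD2r.
have Qd : Q / d <= dl / 4 * N%:R + K%:R * dl / 4 + dl / 8 + W * (H + r.*2.+1%:R) / d.
  rewrite ler_pdivrMr //.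
  have -> : (dl / 4 * N%:R + K%:R * dl / 4 + dl / 8 + W * (H + r.*2.+1%:R) / d) * d =
      (N%:R + 2 * K%:R) * e1 + (d * dl / 8) * (N%:R + 1) + W * (H + r.*2.+1%:R).
    by rewrite /e1; field; rewrite gt_eqF.
  have q1 : (K * L)%:R * e1 <= (N%:R + 2 * K%:R) * e1 by rewrite ler_wpM2r // ltW.
  have q2 : W * (d * dl / (8 * (W + 1)) * L%:R) <= (d * dl / 8) * (N%:R + 1).
    have -> : W * (d * dl / (8 * (W + 1)) * L%:R) = (W / (W + 1) * (d * dl / 8)) * L%:R.
      by field; rewrite gt_eqF // ltr_wpDl.
    have ddl : 0 <= d * dl / 8 by rewrite divr_ge0 // mulr_ge0 // ltW.
    apply: ler_pM => //; first by rewrite mulr_ge0 // divr_ge0 // addr_ge0.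
    by rewrite -[leRHS]mul1r ler_wpM2r // ler_pdivrMr ?ltr_wpDl // mul1r lerDl.
  rewrite /Q; move: q1 q2; set A1 := (K * L)%:R * e1; set A2 := d * dl / (8 * (W + 1)) * L%:R.
  have -> : W * (A2 + H + r.*2.+1%:R) = W * A2 + W * (H + r.*2.+1%:R) by ring.
  lra.
apply: (kbsz N (fun n => F (iter n T (x, i0)) * (zone K i0 t1 t2 n)%:R)) => // [n|p q pp pr py qy pq].
  rewrite normrM [`|_%:R|]ger0_norm //; have := F1 (iter n T (x, i0)).
  by case: (zone _ _ _ _ _); rewrite ?mulr1 ?mulr0.
have [/= k0 i1 i2] := hka (p, q) pp pr pq.
have pqr : ((p + q) * (kk p q).*2 <= ra)%N by exact: hra.
have lF := @local_slicefun R mu K K0 w m0 j.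
have lp b q' : (q' <= p + q)%N -> local r (symcomb K q' F b (kk p q)).
  move=> qp; apply: local_mono (local_symcomb K0 b lF); rewrite /r leq_add2l.
  by apply: leq_trans pqr; rewrite leq_mul2r qp orbT.
have sal : \sum_(n < kk p q) `|al p q n| <= M by have := hM p q py qy; lra.
have sbe : \sum_(n < kk p q) `|be (al p q) n| <= M.
  apply: le_trans (hM p q py qy); apply: (@le_trans _ _ (\sum_(n < kk p q) ((n == 0 :> nat)%N%:R + `|al p q n|))).
    by apply: ler_sum => n _; rewrite /be; apply: le_trans (ler_normB _ _) _; rewrite [`|_%:R|]ger0_norm.
  rewrite big_split /= lerD2r; apply: (@sum_indicator_le1 R (fun n => n == 0%N)) => a b /eqP -> /eqP -> //.
have s1 := sq p (al p q) (kk p q) (lp _ _ (leq_addr _ _)) (fun y => le_trans (symcomb_bound K p _ _ y F1) sal) i1.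
have s2 := sq q (be (al p q)) (kk p q) (lp _ _ (leq_addl _ _)) (fun y => le_trans (symcomb_bound K q _ _ y F1) sbe) i2.
have := @pair_correlation F (x, i0) p q (K * t1 - i0) (K * t2 - i0) (N %/ maxn p q) (al p q) (kk p q) d Q
  (prime_gt0 pp) (prime_gt0 pr) d0 k0 F1 s1 s2.
move=> /le_trans; apply.
have c := hC p q py qy.
have dn : d * (N %/ maxn p q)%:R <= dl / 4 * N%:R by apply: ler_wpM2l; [exact: ltW|rewrite ler_nat leq_div].
move: cN; rewrite /cst; lra.
Qed.

End ZoneCancellation.

Section MobiusSums.
Variable R : realType.
Local Notation mob n := ((mobius n)%:~R : R).

Lemma norm_mobius n : `|mob n| <= 1.
Proof. exact: (@norm_mu R). Qed.

Lemma sum_norm_le_count (f : nat -> R) a b : (forall n, `|f n| <= 1) -> `|\sum_(a <= n < b) f n| <= (b - a)%:R.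
Proof.
move=> f1; apply: le_trans (ler_norm_sum _ _ _) _; apply: le_trans (_ : \sum_(a <= n < b) 1 <= _).
  by apply: ler_sum.
by rewrite sumr_const_nat.
Qed.

(** Uniform in the cut-off [b]: prefixes of length up to [N0] are bounded trivially, which accounts
    for the additive constant. *)
Lemma mobius_prefix K a (eps : R) : (1 < K)%N -> 0 < eps -> exists N0 : nat, forall N b,
  `|\sum_(1 <= n < N.+1) ((n < b)%N && (n == a %[mod K]))%:R * mob n| <= eps * N%:R + N0%:R.
Proof.
move=> K1 e0; have [N0 h] := mobius_progression a K1 e0; exists N0 => N b.
have conv B : \sum_(1 <= n < B) (n == a %[mod K])%:R * mob n = \sum_(1 <= n < B | n == a %[mod K]) mob n.
  by rewrite big_mkcond [RHS]big_mkcond; apply: eq_bigr => n _; case: (_ == _); rewrite ?mul1r ?mul0r.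
have -> : \sum_(1 <= n < N.+1) ((n < b)%N && (n == a %[mod K]))%:R * mob n =
    \sum_(1 <= n < minn N.+1 b) (n == a %[mod K])%:R * mob n.
  rewrite [RHS](big_nat_widen _ _ N.+1) ?geq_minl // [RHS]big_mkcond; apply: eq_big_nat => n /andP[_ nN].
  by rewrite leq_min nN /=; case: (n < b)%N; rewrite ?mul0r.
have eN : 0 <= eps * N%:R by rewrite mulr_ge0 // ltW.
case: (leqP (minn N.+1 b) N0) => [BN|NB].
  apply: le_trans (sum_norm_le_count _ _ _) _ => [n|].
    by rewrite normrM normr_nat; apply: mulr_ile1 => //; [rewrite lern1 leq_b1|exact: norm_mobius].
  by rewrite ler_wpDl // ler_nat (leq_trans (leq_subr _ _) BN).
have [B BE] : exists B, minn N.+1 b = B.+1 by case: (minn _ _) NB => // B _; exists B.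
rewrite BE conv; apply: le_trans (h B _) _; first by rewrite -ltnS -BE.
by rewrite -[leLHS]addr0 lerD // ler_wpM2l ?(ltW e0) // ler_nat -ltnS -BE geq_minl.
Qed.

End MobiusSums.

Lemma ones_window (x : X) r t1 t2 l (k : int) : (forall i, (t1 <= i)%N -> (i < t2)%N -> x (- r%:Z + i%:Z) = true) ->
  (t1 <= l)%N -> (l < t2 - r.*2)%N -> `|k| <= r%:Z -> x (k + l%:Z) = true.
Proof.
move=> ones l1 l2 kr; have -> : k + l%:Z = - r%:Z + (absz (k + l%:Z + r%:Z))%:Z by lia.
by apply: ones; rewrite -addnn in l2; lia.
Qed.

(** * Moebius sums of cylinder indicators along any orbit *)

Section CylinderSums.
Variables (R : realType) (p : nat -> nat) (s : nat -> nat -> nat) (mu : probability XM R) (K : nat).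
Hypothesis reasonable : reasonable_rank_one R p s.
Hypothesis rank_one : is_rank_one_measure p s mu.
Hypothesis mixing : weakly_mixing mu.
Hypothesis K2 : (2 <= K)%N.
Hypothesis singular : forall q1 q2 : nat, prime q1 -> prime q2 -> q1 != q2 ->
  forall nu1 nu2 : {measure set R -> \bar R},
  is_max_spectral_type mu K q1 nu1 -> is_max_spectral_type mu K q2 nu2 -> cont_parts_singular nu1 nu2.
Local Notation T := (Ttil K).
Local Notation mob n := ((mobius n)%:~R : R).

Let K0 : (0 < K)%N. Proof. exact: ltnW. Qed.

Lemma zone_card i0 t1 t2 (f : nat -> R) N : (forall n, `|f n| <= 1) ->
  `|\sum_(1 <= n < N.+1) f n * (zone K i0 t1 t2 n)%:R| <= (K * (t2 - t1))%:R.
Proof.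
move=> f1; set n1 := (K * t1 - i0)%N; set n2 := (K * t2 - i0)%N.
have -> : \sum_(1 <= n < N.+1) f n * (zone K i0 t1 t2 n)%:R = \sum_(maxn 1 n1 <= n < minn N.+1 n2) f n.
  rewrite [RHS](big_nat_widenl _ 1) ?leq_maxl // [RHS](big_nat_widen _ _ N.+1) ?geq_minl // [RHS]big_mkcond.
  apply: eq_big_nat => n /andP[n0 nN]; rewrite /zone geq_max leq_min n0 nN /= -/n1 -/n2.
  by case: (n1 <= n)%N; case: (n < n2)%N; rewrite ?mulr1 ?mulr0.
apply: le_trans (sum_norm_le_count _ _ f1) _; rewrite ler_nat.
have : (n2 - n1 <= K * (t2 - t1))%N by rewrite /n1 /n2 mulnBr; lia.
by apply: leq_trans; rewrite leq_sub // ?geq_minr // leq_maxr.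
Qed.

Lemma zone_split i0 t1 t2 t3 n : (t1 <= t2)%N -> (t2 <= t3)%N ->
  (zone K i0 t1 t3 n)%:R = (zone K i0 t1 t2 n)%:R + (zone K i0 t2 t3 n)%:R :> R.
Proof.
move=> h1 h2; have a : (K * t1 - i0 <= K * t2 - i0)%N by rewrite leq_sub2r // leq_mul2l h1 orbT.
have b : (K * t2 - i0 <= K * t3 - i0)%N by rewrite leq_sub2r // leq_mul2l h2 orbT.
rewrite /zone; have [h|h] := ltnP n (K * t2 - i0).
  by rewrite (leq_trans h b) addr0.
by rewrite (leq_trans a h) andbF add0r.
Qed.

Lemma zone_level i0 t1 t2 n : zone K i0 t1 t2 n -> (t1 <= (n + i0) %/ K < t2)%N.
Proof.
rewrite /zone => /andP[h1 h2]; rewrite leq_divRL // ltn_divLR // ![(_ * K)%N]mulnC; lia.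
Qed.

(* On the run of spacers between two windows with good statistics the orbit is periodic, and the means are periodic
   too: there cancellation comes from arithmetic progressions instead of orthogonality. *)
Theorem cylinder_sum w m0 j x i0 (eps : R) : (j < K)%N -> Omega p s x -> (i0 < K)%N -> 0 < eps ->
  exists N0 : nat, forall N, (N0 <= N)%N ->
  `|\sum_(1 <= n < N.+1) \1_(cyl w m0) (iter n T (x, i0)).1 * ((iter n T (x, i0)).2 == j)%:R * mob n| <= eps * N%:R.
Proof.
move=> jK Ox iK e0; have mu_inv := rank_one.2.1.
have mC := measurable_cyl w m0; pose F := slicefun mu (cyl w m0) j; pose c := fine (mu (cyl w m0)).
have F1 : forall y, `|F y| <= 1 := slicefun_le1 mu mC j.
have lF := @local_slicefun R mu K K0 w m0 j.
have e8 : 0 < eps / 8 by rewrite divr_gt0.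
have [r [e [ee hr canc]]] := zone_cancellation mu_inv K0 mixing singular w m0 jK e8.
have [H hH] := good_windows (ltn0Sn r.*2) rank_one ee reasonable.
have [N1 {}canc] := canc H.
(* The orbit is at level [j] exactly at the times congruent to [a] modulo [K]; adding [K] keeps the
   truncated subtraction exact. *)
pose a := (j + K - i0)%N; have [N2 pre] := mobius_prefix a K2 e8.
have per n : ((n + i0) %% K == j)%N = (n == a %[mod K])%N.
  rewrite -[in LHS](modn_small jK) -(eqn_modDr i0 n a) /a subnK; last by rewrite (leq_trans (ltnW iK)) // leq_addl.
  by rewrite modnDr.
pose cst : R := 3 * N2%:R + (K * r.*2)%:R.
exists (maxn N1 (Num.trunc (8 * cst / eps)).+1) => N NN.
have N1N : (N1 <= N)%N by apply: leq_trans NN; exact: leq_maxl.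
have cN : cst <= eps / 8 * N%:R.
  have : 8 * cst / eps <= N%:R.
    by apply: ltW; apply: lt_le_trans (truncnS_gt _) _; rewrite ler_nat; apply: leq_trans NN; exact: leq_maxr.
  by rewrite ler_pdivrMr //; lra.
(* The base point is shifted fewer than [L] times up to time [N]. The window starts at [- r] because
   the averages of functions of radius [r] from time [t1] on are read off the word starting at
   [t1 - r]. *)
set L := ((N + i0) %/ K).+1; have [t1 [t2 [t12 t2L ones dA dD]]] := hH x Ox (- r%:Z) L.
pose z t t' := \sum_(1 <= n < N.+1) F (iter n T (x, i0)) * (zone K i0 t t' n)%:R * mob n.
have zA : `|z 0%N t1| <= eps / 8 * N%:R.
  by apply: canc => //; [exact: leq_trans t2L|rewrite sub0r subn0].
have zD : `|z t2 L| <= eps / 8 * N%:R.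
  by apply: canc => //; rewrite addrC in dD.
(* Before [t3] all coordinates within distance [r] are spacers. The remaining [2 * r] shifts, or the
   whole run if it is shorter, are estimated trivially. *)
pose t3 := maxn t1 (t2 - r.*2); have t13 : (t1 <= t3)%N by exact: leq_maxl.
have t32 : (t3 <= t2)%N by rewrite /t3 geq_max t12 leq_subr.
have zB : `|z t3 t2| <= (K * r.*2)%:R.
  have -> : z t3 t2 = \sum_(1 <= n < N.+1) (F (iter n T (x, i0)) * mob n) * (zone K i0 t3 t2 n)%:R.
    by apply: eq_bigr => n _; rewrite mulrAC.
  apply: le_trans (zone_card _ _ _ _ _) _ => [n|].
    by rewrite normrM mulr_ile1 // norm_mobius.
  by rewrite ler_nat leq_mul2l; apply/orP; right; rewrite /t3; lia.
(* On the run of spacers [F] takes the same values as along the constant sequence of spacers: [c']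
   at level [j] and zero at the other levels. *)
pose one : X := fun=> true; pose c' : R := \1_(cyl w m0) one - c.
have c'1 : `|c'| <= 1.
  by have := F1 (one, j); rewrite /F /slicefun /= eqxx mulr1.
have prefix b : `|\sum_(1 <= n < N.+1) ((n < b)%N && (n == a %[mod K]))%:R * mob n| <= eps / 8 * N%:R + N2%:R := pre N b.
have zM : `|z t1 t3| <= 2 * (eps / 8 * N%:R + N2%:R).
  have -> : z t1 t3 = c' * (\sum_(1 <= n < N.+1) ((n < K * t3 - i0)%N && (n == a %[mod K]))%:R * mob n -
      \sum_(1 <= n < N.+1) ((n < K * t1 - i0)%N && (n == a %[mod K]))%:R * mob n).
    rewrite -sumrB mulr_sumr; apply: eq_bigr => n _; rewrite -mulrBl mulrA; congr (_ * _).
    have mono : (K * t1 - i0 <= K * t3 - i0)%N by rewrite leq_sub2r // leq_mul2l t13 orbT.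
    have [zn|] := boolP (zone K i0 t1 t3 n); last first.
      rewrite mulr0 /zone negb_and -ltnNge -leqNgt => /orP[h|h].
        by rewrite h (leq_trans h mono) subrr mulr0.
      by rewrite ltnNge h ltnNge (leq_trans mono h) /= subrr mulr0.
    move/andP: (zn) => [h1 h2]; rewrite h2 ltnNge h1 /= subr0 mulr1 -per iter_Ttil //.
    have /andP[l1 l2] := zone_level zn.
    set l := ((n + i0) %/ K)%N in l1 l2 *; set i := ((n + i0) %% K)%N.
    have -> : F (iter l Defs.shift x, i) = F (one, i).
      apply: lF => k kr; rewrite iter_shiftE /one.
      have kr' : `|k| <= r%:Z by apply: le_trans kr _; rewrite lez_nat.
      by apply: (ones_window ones l1) kr'; move: l2; rewrite leq_max ltnNge l1.
    by rewrite /F /slicefun /c' /=.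
  rewrite normrM -[leRHS]mul1r; apply: ler_pM => //.
  by apply: le_trans (ler_normB _ _) _; have := prefix (K * t3 - i0)%N; have := prefix (K * t1 - i0)%N; lra.
have mean : `|c * \sum_(1 <= n < N.+1) ((n < N.+1)%N && (n == a %[mod K]))%:R * mob n| <= eps / 8 * N%:R + N2%:R.
  rewrite normrM -[leRHS]mul1r; apply: ler_pM => //.
  rewrite ger0_norm ?fine_ge0 // -lee_fin fineK ?fin_num_measure // probability_le1 //.
(* The indicator is [F] plus [c] times the indicator of level [j]; the zones cover all times up to
   [N], and the level is a progression modulo [K]. *)
have -> : \sum_(1 <= n < N.+1) \1_(cyl w m0) (iter n T (x, i0)).1 * ((iter n T (x, i0)).2 == j)%:R * mob n =
    z 0%N t1 + (z t1 t3 + z t3 t2) + z t2 L + c * \sum_(1 <= n < N.+1) ((n < N.+1)%N && (n == a %[mod K]))%:R * mob n.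
  rewrite /z -!big_split mulr_sumr -big_split; apply: eq_big_nat => n /andP[_ nN] /=.
  rewrite -!mulrDl -!mulrDr -!zone_split // mulrA -mulrDl; congr (_ * _).
  have -> : zone K i0 0 L n.
    rewrite /zone muln0 sub0n /= ltn_subRL addnC; apply: leq_ltn_trans (_ : (N + i0 < _)%N); first by rewrite leq_add2r -ltnS.
    by rewrite mulnC -ltn_divLR.
  by rewrite mulr1 nN /= -per iter_Ttil // /F /slicefun /= -/c; ring.
apply: le_trans (ler_normD _ _) _; apply: le_trans (lerD (ler_normD _ _) mean) _.
have h1 := ler_normD (z 0%N t1) (z t1 t3 + z t3 t2); have h2 := ler_normD (z t1 t3) (z t3 t2).
move: (normr_ge0 (z 0%N t1)) cN zA zD zB zM h1 h2; rewrite /cst; set X := eps / 8 * N%:R.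
have -> : eps * N%:R = 8 * X by rewrite /X; field.
lra.
Qed.

End CylinderSums.

(** * From cylinders to continuous functions *)

Lemma complexD (R : realType) (a b : R) : ((a + b)%:C = a%:C + b%:C)%C.
Proof. exact: (rmorphD (real_complex R)). Qed.

Lemma complexM (R : realType) (a b : R) : ((a * b)%:C = a%:C * b%:C)%C.
Proof. exact: (rmorphM (real_complex R)). Qed.

Section UniformContinuity.
Variables (R : realType) (p : nat -> nat) (s : nat -> nat -> nat) (K : nat).
Local Notation P := (Omega_t p s K).

Lemma Omega_shift x : Omega p s x -> Omega p s (Defs.shift x).
Proof.
move=> Ox a L; have [m hm] := Ox (a + 1) L; exists m.
have -> : subword (Defs.shift x) a L = subword x (a + 1) L; last by [].
by apply: eq_map => j; rewrite /Defs.shift; congr x; lia.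
Qed.

Lemma Omega_t_iter n y : P y -> P (iter n (Ttil K) y).
Proof.
move=> Py; elim: n => [//|n [h1 h2]]; rewrite iterS /Ttil; case: ltnP => h; first by split.
by split; [exact: Omega_shift|exact: leq_ltn_trans h2].
Qed.

(* Compactness: otherwise an ultrafilter limit of the counterexamples is a point of discontinuity. *)
Lemma uniform_continuity (f : Xt -> R[i]) (eps : R) : continuous_on_tower P f -> 0 < eps ->
  exists M : nat, forall y y', P y -> P y' -> y.2 = y'.2 ->
    (forall j : int, `|j| <= M%:Z -> y.1 j = y'.1 j) -> `|f y - f y'| < (eps%:C)%C.
Proof.
move=> cf e0; apply: contrapT => no.
have ex (M : nat) : exists g : Xt * Xt, [/\ P g.1, P g.2, g.1.2 = g.2.2,
    forall j : int, `|j| <= M%:Z -> g.1.1 j = g.2.1 j & ~ (`|f g.1 - f g.2| < (eps%:C)%C)].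
  apply: contrapT => h; apply: no; exists M => y y' Py Py' e ag; apply: contrapT => nlt.
  by apply: h; exists (y, y').
have [g hg] := boolp.choice ex.
have [U [UU subU]] := ultraFilterLemma (@eventually_filter : ProperFilter (\oo : set_system nat)).
have PU : ProperFilter U := @ultra_proper _ _ UU.
have FU : Filter U := @filter_filter _ _ PU.
pose z (j : int) : bool := `[< U [set M | (g M).1.1 j = true] >].
have zj (j : int) : U [set M | (g M).1.1 j = z j].
  rewrite /z; case: asboolP => [//|nU].
  have [//|] := in_ultra_setVsetC [set M | (g M).1.1 j = true] UU.
  by apply: filterS => M /=; case: ((g M).1.1 j).
have zm (m : nat) : U [set M | forall j : int, `|j| <= m%:Z -> (g M).1.1 j = z j].
  elim: m => [|m IH].
    by apply: filterS (zj 0) => M /= h j j0; have -> : j = 0 by lia.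
  apply: filterS (filterI IH (filterI (zj m.+1%:Z) (zj (- m.+1%:Z)))) => M /= [h1 [h2 h3]] j jm.
  have [|jm'] := boolP (`|j| <= m%:Z); first exact: h1.
  have [-> //|->//] : j = m.+1%:Z \/ j = - m.+1%:Z by lia.
have Oz : Omega p s z.
  move=> a L; have [M /= hM] := filter_ex (zm (`|a|%N + L)%N).
  have [[PM1 _] _ _ _ _] := hg M; have [m hm] := PM1 a L; exists m.
  have -> : subword z a L = subword (g M).1.1 a L; last by [].
  apply/eq_in_map => j; rewrite mem_iota /= => jL; rewrite hM //; lia.
have [i [iK Ui]] : exists i, (i < K)%N /\ U [set M | (g M).1.2 = i].
  apply: contrapT => noi.
  have all k : (k <= K)%N -> U [set M | (k <= (g M).1.2)%N].
    elim: k => [_|k IH kK]; first by apply: filterS filterT => M.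
    have nk : U (~` [set M | (g M).1.2 = k]).
      have [Uk|//] := in_ultra_setVsetC [set M | (g M).1.2 = k] UU.
      by case: noi; exists k.
    by apply: filterS (filterI (IH (ltnW kK)) nk) => M /= [h1 h2]; rewrite ltn_neqAle h1 andbT; apply/eqP => e; apply: h2.
  have [M /= hM] := filter_ex (all K (leqnn K)).
  by have [[_ h] _ _ _ _] := hg M; rewrite ltnNge hM in h.
have e2 : 0 < eps / 2 by rewrite divr_gt0.
have [M0 hM0] := cf (z, i) (conj Oz iK) (eps / 2) e2.
have Uge : U [set M | (M0 <= M)%N] by apply: subU; exists M0.
have [M /= [hM [Mi MM]]] := filter_ex (filterI (zm M0) (filterI Ui Uge)).
have [P1 P2 e12 ag nlt] := hg M; apply: nlt.
have -> : f (g M).1 - f (g M).2 = (f (g M).1 - f (z, i)) + (f (z, i) - f (g M).2) by ring.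
apply: le_lt_trans (ler_normD _ _) _.
have -> : (eps%:C = (eps / 2)%:C + (eps / 2)%:C)%C by rewrite -complexD; congr (_%:C)%C; field.
apply: ltrD; first by apply: hM0.
rewrite distrC; apply: hM0 => //; first by rewrite -e12.
by move=> j jM /=; rewrite -(hM j jM) ag // (le_trans jM) // lez_nat.
Qed.

End UniformContinuity.

Theorem mainTheorem5 (R : realType) (p : nat -> nat) (s : nat -> nat -> nat)
    (mu : probability XM R) (K : nat) :
  reasonable_rank_one R p s ->
  is_rank_one_measure p s mu ->
  weakly_mixing mu ->
  (2 <= K)%N ->
  (forall q1 q2 : nat, prime q1 -> prime q2 -> q1 != q2 ->
     forall nu1 nu2 : {measure set R -> \bar R},
       is_max_spectral_type mu K q1 nu1 -> is_max_spectral_type mu K q2 nu2 ->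
       cont_parts_singular nu1 nu2) ->
  forall f : Xt -> R[i], continuous_on_tower (Omega_t p s K) f ->
  forall x : Xt, Omega_t p s K x ->
  forall eps : R, 0 < eps -> exists N0 : nat, forall N : nat, (N0 <= N)%N ->
    `| N%:R^-1 * \sum_(1 <= n < N.+1) (f (iter n (Ttil K) x) * (mobius n)%:~R) | < (eps%:C)%C.
Proof.
move=> reas rank mixing K2 sing f cf [x0 i0] [/= Ox iK] eps e0.
have K0 : (0 < K)%N by exact: ltnW.
have e4 : 0 < eps / 4 by rewrite divr_gt0.
have [M hM] := uniform_continuity cf e4.
pose r2 := M.*2.+1.
(* On each cell given by a central word and a level, [f] is nearly constant; [v] is its value at
   some point of the cell, or [0] if the cell misses the tower. *)
have exv (wi : r2.-tuple bool * 'I_K) : exists v : R[i], forall y, Omega_t p s K y -> y.2 = wi.2 -> cyl wi.1 (- M%:Z) y.1 ->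
    `|f y - v| <= ((eps / 4)%:C)%C.
  case: (pselect (exists y, [/\ Omega_t p s K y, y.2 = wi.2 & cyl wi.1 (- M%:Z) y.1])) => [[y [Py yi cy]]|no]; last first.
    by exists 0 => y Py yi cy; case: no; exists y.
  exists (f y) => y' Py' yi' cy'; apply: ltW; apply: hM => //; first by rewrite yi yi'.
  move=> j jM; have jr : (absz (j + M%:Z)%R < size wi.1)%N by rewrite size_tuple /r2 -addnn; lia.
  have je : j = - M%:Z + (absz (j + M%:Z))%:Z by lia.
  by rewrite je (cy' _ jr) (cy _ jr).
have [v hv] := boolp.choice exv.
(* The sum of the norms is a real element of [R[i]]; its real part lets each cylinder sum be
   estimated in [R] with tolerance [eps / 4 / (B + 1)]. *)
pose B : R := complex.Re (\sum_wi `|v wi|).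
have BE : (B%:C)%C = \sum_wi `|v wi| by rewrite /B RRe_real // ger0_real // sumr_ge0.
have B0 : 0 <= B by rewrite -ler0c BE sumr_ge0.
have B1 : 0 < B + 1 by rewrite ltr_wpDl.
have eB : 0 < eps / 4 / (B + 1) by rewrite divr_gt0.
pose S (wi : r2.-tuple bool * 'I_K) N : R := \sum_(1 <= n < N.+1)
  \1_(cyl wi.1 (- M%:Z)) (iter n (Ttil K) (x0, i0)).1 * ((iter n (Ttil K) (x0, i0)).2 == wi.2)%:R * (mobius n)%:~R.
have exN (wi : r2.-tuple bool * 'I_K) : exists N0 : nat, forall N, (N0 <= N)%N -> `|S wi N| <= eps / 4 / (B + 1) * N%:R.
  exact: (cylinder_sum reas rank mixing K2 sing wi.1 (- M%:Z) (ltn_ord wi.2) Ox iK eB).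
have [N0 hN0] := boolp.choice exN.
exists (\max_wi N0 wi).+1 => N NN.
have NR : 0 < N%:R :> R by rewrite ltr0n (leq_trans _ NN).
have NRC : (N%:R : R[i]) = ((N%:R : R)%:C)%C by rewrite (rmorph_nat (real_complex R)).
pose app y : R[i] := \sum_wi v wi * ((\1_(cyl wi.1 (- M%:Z)) y.1 * (y.2 == nat_of_ord wi.2)%:R : R)%:C)%C.
have appE y : Omega_t p s K y -> `|f y - app y| <= ((eps / 4)%:C)%C.
  move=> Py; have sz : size (subword y.1 (- M%:Z) r2) == r2 by rewrite size_subword.
  pose wi0 : r2.-tuple bool * 'I_K := (Tuple sz, Ordinal Py.2).
  have cy : cyl wi0.1 (- M%:Z) y.1.
    by move=> j /=; rewrite size_map size_iota => jr; rewrite nth_subword.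
  rewrite /app (bigD1 wi0) //= [\sum_(_ | _ != wi0) _]big1 ?addr0 => [|[w i] ne].
    rewrite indicE mem_set // eqxx mulr1 /= mulr1; exact: hv.
  rewrite /= indicE; have [/=|_] := boolP (y.1 \in cyl w (- M%:Z)); last by rewrite mul0r mulr0.
  rewrite inE => h; have [/= yi|_] := eqVneq y.2 i; last by rewrite mulr0 mulr0.
  move/negP: ne; case; apply/eqP; congr (_, _); last by apply/val_inj.
  apply/val_inj => /=; apply: (@eq_from_nth _ false); rewrite size_tuple ?size_subword // => j jr.
  by rewrite nth_subword // -(h j) ?size_tuple.
have mobC n : ((mobius n)%:~R : R[i]) = (((mobius n)%:~R : R)%:C)%C by rewrite (rmorph_int (real_complex R)).
have mob1 n : `|((mobius n)%:~R : R[i])| <= 1.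
  by rewrite -intr_norm lerz1; have := @norm_mobius R n; rewrite -intr_norm lerz1.
have part1 : `|\sum_(1 <= n < N.+1) (f (iter n (Ttil K) (x0, i0)) - app (iter n (Ttil K) (x0, i0))) * (mobius n)%:~R| <=
    ((eps / 4 * N%:R)%:C)%C.
  apply: le_trans (ler_norm_sum _ _ _) _.
  apply: (@le_trans _ _ (\sum_(1 <= n < N.+1) ((eps / 4)%:C)%C)).
    apply: ler_sum => n _; rewrite normrM -[leRHS]mulr1; apply: ler_pM => //.
    by apply: appE; apply: Omega_t_iter.
  by rewrite sumr_const_nat subn1 /= (complexM (eps / 4)) -NRC mulr_natr.
have part2 : `|\sum_(1 <= n < N.+1) app (iter n (Ttil K) (x0, i0)) * (mobius n)%:~R| <= ((eps / 4 * N%:R)%:C)%C.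
  have -> : \sum_(1 <= n < N.+1) app (iter n (Ttil K) (x0, i0)) * (mobius n)%:~R = \sum_wi v wi * ((S wi N)%:C)%C.
    under eq_bigr do rewrite /app mulr_suml.
    rewrite exchange_big /=; apply: eq_bigr => wi _; rewrite /S (rmorph_sum (real_complex R)) mulr_sumr.
    by apply: eq_bigr => n _; rewrite mobC -mulrA -complexM.
  apply: le_trans (ler_norm_sum _ _ _) _.
  apply: (@le_trans _ _ (\sum_wi `|v wi| * ((eps / 4 / (B + 1) * N%:R)%:C)%C)).
    apply: ler_sum => wi _; rewrite normrM; apply: ler_wpM2l => //.
    have -> : `|((S wi N)%:C)%C| = (`|S wi N|%:C)%C by rewrite normc_def /= expr0n addr0 sqrtr_sqr.
    by rewrite lecR; apply: hN0; apply: leq_trans (ltnW NN); exact: leq_bigmax.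
  rewrite -mulr_suml -BE -complexM lecR mulrA; apply: ler_wpM2r => //.
  by rewrite mulrCA -[leRHS]mulr1 ler_wpM2l ?(ltW e4) // ler_pdivrMr // mul1r lerDl.
have -> : \sum_(1 <= n < N.+1) f (iter n (Ttil K) (x0, i0)) * (mobius n)%:~R =
    \sum_(1 <= n < N.+1) (f (iter n (Ttil K) (x0, i0)) - app (iter n (Ttil K) (x0, i0))) * (mobius n)%:~R +
    \sum_(1 <= n < N.+1) app (iter n (Ttil K) (x0, i0)) * (mobius n)%:~R.
  by rewrite -big_split /=; apply: eq_bigr => n _; rewrite -mulrDl subrK.
have NC0 : 0 < (N%:R : R[i]) by rewrite ltr0n (leq_trans _ NN).
rewrite normrM normfV [`|N%:R|]ger0_norm ?ler0n // ltr_pdivrMl //.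
apply: le_lt_trans (ler_normD _ _) _; apply: le_lt_trans (lerD part1 part2) _.
rewrite -complexD NRC -complexM ltcR; have : 0 < eps * N%:R by rewrite mulr_gt0.
by move: (N%:R : R) => t; nra.
Qed.
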